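(* Let $n\in\mathbb{N}$ and let $Y$ be a Banach ideal space with $L^\infty(\mathbb{T})\subseteq Y\subseteq L^1(\mathbb{T})$ whose norm is rotation invariant. Let $\alpha\in\mathbb{T}$ be not a root of unity and let $w\in W^{n,L^\infty(\mathbb{T})}_A(\mathbb{U})$. Let $$(Tx)(z)=w(z)x(\alpha z),\quad x\in W^{n,Y}_A(\mathbb{U}),\ z\in\mathbb{U},$$ and $$(\tilde Tx)(z)=w(z)x(\alpha z),\quad x\in Y\cap H^1(\mathbb{U}),\ z\in\mathbb{U}.$$ Then the operators $T$ and $\tilde T$ are bounded in $W^{n,Y}_A(\mathbb{U})$ and $Y\cap H^1(\mathbb{U})$, respectively, and $$\sigma(T)=\sigma(\tilde T),\qquad\sigma_i(T)=\sigma_i(\tilde T),\ i=1,\dots,5.$$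
   Context: $\mathbb{T}$ is the unit circle (with normalized Lebesgue measure), $\mathbb{U}$ the open unit disc, $\mathcal{H}(\mathbb{U})$ the space of analytic functions in $\mathbb{U}$, $x^{(j)}$ the $j$-th derivative of $x$ ($x^{(0)}=x$). A Banach ideal space here is an order ideal in the lattice of classes of measurable functions on $\mathbb{T}$ which is a Banach space under a lattice norm ($|x|\le|y|$ implies $\|x\|\le\|y\|$). The Hardy space $H^1(\mathbb{U})$ is identified with a closed subspace of $L^1(\mathbb{T})$ via boundary values; $Y\cap H^1(\mathbb{U})$ carries the norm of $Y$. For such $Y$, $$W^{n,Y}_A(\mathbb{U})=\{x\in\mathcal{H}(\mathbb{U}):x^{(n)}\in Y\cap H^1(\mathbb{U})\},\qquad\|x\|=\sum_{j=0}^{n-1}|x^{(j)}(0)|+\|x^{(n)}\|_Y .$$ An operator $S$ is semi-Fredholm ($S\in\Phi$) if its range is closed and either $\dim\ker S<\infty$ or $\mathrm{codim}\,R(S)<\infty$; $\Phi_+$ (resp. $\Phi_-$) consists of $S\in\Phi$ with $\dim\ker S<\infty$ (resp. $\mathrm{codim}\,R(S)<\infty$); Fredholm means in $\Phi_+\cap\Phi_-$; Weyl means Fredholm of index $0$. $\sigma_1,\sigma_2,\sigma_3,\sigma_4$ of $T$ are the sets of $\lambda$ for which $\lambda I-T$ is not semi-Fredholm, not in $\Phi_+$, not Fredholm, not Weyl, respectively; $\sigma_5(T)=\sigma(T)\setminus\{\zeta\in\mathbb{C}:$ there is a component $C$ of $\mathbb{C}\setminus\sigma_1(T)$ with $\zeta\in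 C$ and $C$ meeting the resolvent set of $T\}$. *)

(* Defs.v *)
From HB Require Import structures.
From mathcomp Require Import all_boot all_order all_algebra.
From mathcomp Require Import all_classical all_reals all_analysis.
From mathcomp Require Import complex.

Set Implicit Arguments.
Unset Strict Implicit.
Unset Printing Implicit Defensive.

Import Order.TTheory GRing.Theory Num.Theory.
Import numFieldNormedType.Exports.

Local Open Scope classical_set_scope.
Local Open Scope ring_scope.
Local Open Scope complex_scope.

(* The norm topology of [R[i]], which the library attaches to the alias
   [R[i]^o] only. *)
HB.instance Definition _ (R : realType) := NormedModule.copy R[i] R[i]^o.

(** * Operators on a normed space of vectors of an ambient module

  The spaces of the theorem are subspaces of the space of all complex functions
  on the disc.  Such a space is given by its carrier and by a function that is
  only meaningful on the carrier; that it is a complete norm there is a theorem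
  about each space and is not part of the data. An operator is a map of the
  ambient module, only its values on the carrier being relevant. *)

Record normedSubspace (R : realType) (V : lmodType R[i]) := NormedSubspace {
  ns_carrier :> V -> Prop;
  ns_norm : V -> R }.

Section Spectra.
Context {R : realType} {V : lmodType R[i]}.
Implicit Types (X : normedSubspace V) (S T : V -> V) (A : set V).

Definition bounded_operator X T :=
  [/\ forall x, X x -> X (T x),
      forall (a : R[i]) x y, X x -> X y -> T (a *: x + y) = a *: T x + T y &
      exists M : R, forall x, X x -> ns_norm X (T x) <= M * ns_norm X x].

Definition norm_closed X A :=
  forall x, X x ->
    (forall e : R, 0 < e -> exists2 y, A y & ns_norm X (x - y) < e) -> A x.

Definition kernel_of X S : set V := [set x | X x /\ S x = 0].

Definition range_of X S : set V := S @` X.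

(* [has_dim A k]: the linear subspace [A] has a basis of [k] vectors. *)
Definition has_dim A (k : nat) :=
  exists e : 'I_k -> V,
    [/\ forall i, A (e i),
        forall x, A x -> exists c : 'I_k -> R[i], x = \sum_(i < k) c i *: e i &
        forall c : 'I_k -> R[i],
          \sum_(i < k) c i *: e i = 0 -> forall i, c i = 0].

(* [has_codim X A k]: the quotient of [X] by its linear subspace [A] has a
   basis of [k] classes. *)
Definition has_codim X A (k : nat) :=
  exists e : 'I_k -> V,
    [/\ forall i, X (e i),
        forall x, X x ->
          exists c : 'I_k -> R[i], A (x - \sum_(i < k) c i *: e i) &
        forall c : 'I_k -> R[i],
          A (\sum_(i < k) c i *: e i) -> forall i, c i = 0].

Definition fin_dim_kernel X S := exists k, has_dim (kernel_of X S) k.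

Definition fin_codim_range X S := exists k, has_codim X (range_of X S) k.

Definition semi_fredholm X S :=
  norm_closed X (range_of X S) /\ (fin_dim_kernel X S \/ fin_codim_range X S).

Definition Phi_plus X S := semi_fredholm X S /\ fin_dim_kernel X S.

Definition Phi_minus X S := semi_fredholm X S /\ fin_codim_range X S.

Definition fredholm X S := Phi_plus X S /\ Phi_minus X S.

Definition has_index X S (m : int) :=
  exists p q : nat, [/\ has_dim (kernel_of X S) p,
    has_codim X (range_of X S) q & m = p%:Z - q%:Z].

Definition weyl X S := fredholm X S /\ has_index X S 0.

Definition lambdaI_sub (l : R[i]) T : V -> V := fun x => l *: x - T x.

Definition resolvent_set X T : set R[i] := [set l |
  exists2 S, bounded_operator X S &
    forall x, X x -> S (lambdaI_sub l T x) = x /\ lambdaI_sub l T (S x) = x].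

Definition spectrum X T : set R[i] := ~` resolvent_set X T.

Definition sigma1 X T : set R[i] :=
  [set l | ~ semi_fredholm X (lambdaI_sub l T)].

Definition sigma2 X T : set R[i] := [set l | ~ Phi_plus X (lambdaI_sub l T)].

Definition sigma3 X T : set R[i] := [set l | ~ fredholm X (lambdaI_sub l T)].

Definition sigma4 X T : set R[i] := [set l | ~ weyl X (lambdaI_sub l T)].

Definition is_component_of (A C : set R[i]) :=
  exists2 x, A x & C = connected_component A x.

Definition sigma5 X T : set R[i] :=
  spectrum X T `\` [set z | exists C,
    [/\ is_component_of (~` sigma1 X T) C, C z &
        C `&` resolvent_set X T !=set0]].

End Spectra.

(** * The unit circle with its normalized Lebesgue measure *)

Definition circle (R : realType) : Type := {z : R[i] | `|z| == 1}.

HB.instance Definition _ (R : realType) :=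
  Choice.copy (circle R) {z : R[i] | `|z| == 1}.

Section Circle.
Variable R : realType.

Lemma norm_cis (t : R) : `|cos t +i* sin t| == 1.
Proof. by rewrite normc_def /= cos2Dsin2 sqrtr1. Qed.

Definition cis (t : R) : circle R :=
  exist (fun z : R[i] => `|z| == 1) _ (norm_cis t).

HB.instance Definition _ := isPointed.Build (circle R) (cis 0).

(* The Borel sets of the circle are the sets whose inverse image under
   t |-> e^(it) is a Borel set of the line. *)
Definition circle_measurable : set (set (circle R)) :=
  [set A | measurable (cis @^-1` A)].

Lemma circle_measurable0 : circle_measurable set0.
Proof. by rewrite /circle_measurable /= preimage_set0. Qed.

Lemma circle_measurableC (A : set (circle R)) :
  circle_measurable A -> circle_measurable (~` A).
Proof. by rewrite /circle_measurable /= preimage_setC => /measurableC. Qed.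

Lemma circle_measurable_bigcup (F : (set (circle R))^nat) :
  (forall i, circle_measurable (F i)) -> circle_measurable (\bigcup_i F i).
Proof.
move=> mF; rewrite /circle_measurable /= preimage_bigcup.
by apply: bigcup_measurable => i _; exact: mF.
Qed.

HB.instance Definition _ := @isMeasurable.Build default_measure_display
  (circle R) circle_measurable circle_measurable0 circle_measurableC
  circle_measurable_bigcup.

Lemma measurable_cis : measurable_fun [set: R] cis.
Proof. by move=> _ A mA; rewrite setTI. Qed.

Lemma inv_2pi_ge0 : 0 <= (2 * pi)^-1 :> R.
Proof. by rewrite invr_ge0 mulr_ge0 // pi_ge0. Qed.

Definition circle_measure : set (circle R) -> \bar R :=
  pushforward (mscale (NngNum inv_2pi_ge0)
    (mrestr lebesgue_measure (measurable_itv `[0 : R, 2 * pi[))) cis.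

Lemma circle_measure0 : circle_measure set0 = 0%E.
Proof. by rewrite /circle_measure /pushforward preimage_set0 measure0. Qed.

Lemma circle_measure_ge0 A : (0 <= circle_measure A)%E.
Proof. by rewrite /circle_measure /pushforward measure_ge0. Qed.

Lemma circle_measure_sigma_additive : semi_sigma_additive circle_measure.
Proof.
move=> F mF tF mUF; rewrite /circle_measure /pushforward preimage_bigcup.
apply: measure_semi_sigma_additive.
- by move=> i; exact: mF.
- apply/trivIsetP => /= i j _ _ ij; rewrite -preimage_setI.
  by move/trivIsetP : tF => /(_ _ _ _ _ ij) ->//; rewrite preimage_set0.
- by rewrite -preimage_bigcup; exact: mUF.
Qed.

HB.instance Definition _ := isMeasure.Build _ _ _ circle_measure
  circle_measure0 circle_measure_ge0 circle_measure_sigma_additive.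

Lemma circle_measureT : circle_measure [set: circle R] = 1%E.
Proof.
rewrite /circle_measure /pushforward preimage_setT /mscale /= /mrestr setTI.
rewrite lebesgue_measure_itv /= lte_fin mulr_gt0 ?pi_gt0 // oppr0 adde0.
by rewrite -EFinM mulVf // gt_eqF // mulr_gt0 ?pi_gt0.
Qed.

HB.instance Definition _ :=
  Measure_isProbability.Build _ _ _ circle_measure circle_measureT.

Lemma norm_rotate (a z : circle R) : `|val a * val z| == 1.
Proof. by rewrite normrM (eqP (valP a)) (eqP (valP z)) mulr1. Qed.

Definition rotate_circle (a z : circle R) : circle R :=
  exist (fun z : R[i] => `|z| == 1) _ (norm_rotate a z).

Definition complex_measurable : set (circle R -> R[i]) :=
  [set f : circle R -> R[i] |
  measurable_fun setT (fun z => complex.Re (f z)) /\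
  measurable_fun setT (fun z => complex.Im (f z))].

(* [Lp 1] and [Lp +oo] are L^1 and L^oo of the circle; a function stands for
   its class modulo equality almost everywhere. *)
Definition Lp (p : \bar R) : set (circle R -> R[i]) :=
  [set f : circle R -> R[i] |
  complex_measurable f /\
  (fun z => Normc.normc (f z)) \in Lfun circle_measure p].

End Circle.

(* Elements are represented by functions; by [bis_ideal], the carrier and the
   norm are invariant under equality almost everywhere, and by [bis_norm_eq0]
   the norm separates classes. *)
Record banachIdealSpace (R : realType) := BanachIdealSpace {
  bis_carrier :> set (circle R -> R[i]);
  bis_norm : (circle R -> R[i]) -> R;
  bis_measurable : bis_carrier `<=` @complex_measurable R;
  bis_zero : bis_carrier 0;
  bis_add : forall f g, bis_carrier f -> bis_carrier g -> bis_carrier (f + g);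
  bis_scale : forall (c : R[i]) f, bis_carrier f -> bis_carrier (c *: f);
  bis_ideal : forall f g, complex_measurable f -> bis_carrier g ->
    {ae @circle_measure R, forall z, `|f z| <= `|g z|} ->
    bis_carrier f /\ bis_norm f <= bis_norm g;
  bis_norm_triangle : forall f g, bis_carrier f -> bis_carrier g ->
    bis_norm (f + g) <= bis_norm f + bis_norm g;
  bis_norm_scale : forall (c : R[i]) f, bis_carrier f ->
    bis_norm (c *: f) = Normc.normc c * bis_norm f;
  bis_norm_eq0 : forall f, bis_carrier f -> bis_norm f = 0 ->
    {ae @circle_measure R, forall z, f z = 0};
  bis_complete : forall u : nat -> circle R -> R[i],
    (forall k, bis_carrier (u k)) ->
    (forall e : R, 0 < e -> exists N : nat, forall k m : nat,
      (N <= k)%N -> (N <= m)%N -> bis_norm (u k - u m) < e) ->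
    exists2 f, bis_carrier f & bis_norm (u k - f) @[k --> \oo] --> (0 : R) }.

Definition rotation_invariant (R : realType) (Y : banachIdealSpace R) :=
  forall (a : circle R) f, bis_carrier Y f ->
    bis_carrier Y (f \o rotate_circle a) /\
    bis_norm Y (f \o rotate_circle a) = bis_norm Y f.

(** * Analytic functions in the unit disc *)

Definition disc (R : realType) : Type := {z : R[i] | `|z| < 1}.

Section Disc.
Variable R : realType.
Implicit Types (x : disc R -> R[i]) (E : set (circle R -> R[i])).

Lemma norm_rotate_disc (a : circle R) (z : disc R) : `|val a * val z| < 1.
Proof. by rewrite normrM (eqP (valP a)) mul1r (valP z). Qed.

Definition rotate_disc (a : circle R) (z : disc R) : disc R :=
  exist (fun z : R[i] => `|z| < 1) _ (norm_rotate_disc a z).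

(* Extension by 0; it is only used at points of the open disc and through local
   notions, so the value chosen outside plays no role. *)
Definition ext x (z : R[i]) : R[i] := if insub z is Some u then x u else 0.

Definition analytic x := forall z0 : disc R, exists a : nat -> R[i],
  \forall z \near val z0, series (fun k => a k * (z - val z0) ^+ k) @ \oo -->
    ext x z.

Definition dderive (j : nat) x : disc R -> R[i] :=
  fun z => derive1n j (ext x) (val z).

Lemma norm0_lt1 : `|0 : R[i]| < 1. Proof. by rewrite normr0. Qed.

Definition disc0 : disc R := exist (fun z : R[i] => `|z| < 1) 0 norm0_lt1.

(* z |-> x (r z) on the circle, for 0 <= r < 1 *)
Definition dilate x (r : R) : circle R -> R[i] :=
  fun z => ext x (r%:C * val z).

Definition hardy1 : set (disc R -> R[i]) := [set x | analytic x /\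
  exists M : R, forall r : R, 0 <= r < 1 ->
    (\int[@circle_measure R]_z (Normc.normc (dilate x r z))%:E <= M%:E)%E].

Definition boundary_values x : set (circle R -> R[i]) :=
  [set f : circle R -> R[i] |
  {ae @circle_measure R, forall z, dilate x r z @[r --> 1^'-] --> f z}].

(* The intersection of [E] with the Hardy space, for a set [E] of functions on
   the circle stable under equality almost everywhere. *)
Definition hardy_cap E : set (disc R -> R[i]) := [set x | hardy1 x /\
  E `&` boundary_values x !=set0].

(* Boundary values are unique up to equality almost everywhere, so the choice
   made by [xget] does not matter. *)
Definition hardy_norm (Y : banachIdealSpace R) x : R :=
  bis_norm Y (xget 0 (Y `&` boundary_values x)).

Definition hardySpace (Y : banachIdealSpace R) : normedSubspace _ :=
  NormedSubspace (hardy_cap Y) (hardy_norm Y).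

Definition sobolev (n : nat) E : set (disc R -> R[i]) :=
  [set x | analytic x /\ hardy_cap E (dderive n x)].

Definition sobolev_norm (n : nat) (Y : banachIdealSpace R) x : R :=
  \sum_(j < n) Normc.normc (dderive j x disc0) + hardy_norm Y (dderive n x).

Definition sobolevSpace (n : nat) (Y : banachIdealSpace R) :
    normedSubspace _ :=
  NormedSubspace (sobolev n Y) (sobolev_norm n Y).

Definition weighted_rotation (w : disc R -> R[i]) (a : circle R) x :
    disc R -> R[i] :=
  fun z => w z * x (rotate_disc a z).

End Disc.

(* Main.v *)
Require Import Defs.
From HB Require Import structures.
From mathcomp Require Import all_boot all_order all_algebra.
From mathcomp Require Import all_classical all_reals all_analysis.
From mathcomp Require Import complex ring lra measurable_realfun ess_sup_inf.
(** Both operators act on Taylor coefficients: if a and omega are the coefficients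
    of x and w, then w(z) x(alpha z) has the coefficients omega * (alpha^k a_k), a
    Cauchy product. The intersection of Y and H^1 becomes the Banach space H of the sequences
    of Fourier coefficients of the functions of Y without negative frequencies, and
    the Sobolev space the Banach space W of the sequences whose n-th derivative is
    in H. Let t be the weighted rotation on H, t' and t'' the rotations weighted by
    the derivatives of w, J the integration from 0 and D the derivation.

    The map J^n embeds H into W with codimension n and the left inverse D^n, so that
    up to a finite dimensional block the operator on W is A = D^n t J^n
    ([sobolev_derw]). By Leibniz' rule A is alpha^n t + n alpha^(n-1) t' J plus terms
    that contain two consecutive factors J ([derw_approx]).

    There is no reason for J to be compact on H, but J g J is a norm limit of finite
    rank operators for each bounded g ([icoef_mult_icoef_ap]): J maps H into the
    bounded functions, because the sums of sin (k t) / k are bounded; so g J x has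
    square summable coefficients, and the series of J (g J x) has a uniformly small
    tail. Hence the terms with two consecutive factors J are negligible. The term
    with t' J is not, but integration by parts, alpha J t = t J - J t' J, shows that
    for u = l - alpha^n t and v = l - alpha^(n-1) t the operators J u and v J are
    equal up to a negligible error. In this situation l - A, which is u + m J with m
    a multiple of t' up to a negligible error, has the lower bounds, the parametrices
    and the index zero that u and v have in common ([LF_perturb], [FP_perturb],
    [IF_perturb]). Finally multiplication by z, whose range has codimension one,
    intertwines t and alpha t, so that u and v have the properties of l - t. The
    converse implication is obtained in the same way with A and A / alpha in place
    of alpha^n t and alpha^(n-1) t ([rotw_of_derw]).

    On coefficients l - t is triangular with the diagonal entries l - w(0) alpha^k.
    As alpha is not a root of unity, the kernel has dimension at most one unless
    l = 0 and w = 0, in which case both operators are zero and none of the classes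
    contains them. So the semi-Fredholm operators of the theorem have finite
    dimensional kernels, a closed range amounts to a lower bound modulo finitely
    many functionals by the open mapping theorem, and the index zero amounts to
    being invertible plus finite rank ([dims_IF]). Moreover l is in the resolvent
    set when l - t has index zero and l is none of the w(0) alpha^k ([rotw_isom]),
    which gives the equality of the spectra and, with that of sigma_1, the equality
    of sigma_5.

    The description of H rests on classical facts about the disc: a function that
    is locally the sum of power series is the sum of one power series
    ([analytic_pseries]); a function of H^1 is the product of two functions of H^2,
    hence converges in mean to its boundary values, which determine its Taylor
    coefficients ([hardy_factor], [hardy_fourier]); an integrable function without
    negative frequencies is the boundary function of its Poisson integral
    ([hardy_boundary]). The inclusion of Y in L^1 is automatically bounded
    ([bis_L1_bounded]). *)

Import Order.TTheory GRing.Theory Num.Theory.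
Import numFieldNormedType.Exports.
Local Open Scope classical_set_scope.
Local Open Scope ring_scope.
Local Open Scope complex_scope.
Set Implicit Arguments.
Unset Strict Implicit.
Unset Printing Implicit Defensive.

(** * Linear identities *)

Section LinearReflection.
Context {K : comNzRingType} {V : lmodType K}.

Inductive lexp :=
| LAtom of nat | LZero | LAdd of lexp & lexp | LOpp of lexp | LScale of K & lexp.

Fixpoint leval (env : seq V) (e : lexp) : V :=
  match e with
  | LAtom i => nth 0 env i
  | LZero => 0
  | LAdd a b => leval env a + leval env b
  | LOpp a => - leval env a
  | LScale c a => c *: leval env a
  end.

Fixpoint lcoef (e : lexp) (i : nat) : K :=
  match e with
  | LAtom j => if eqn j i then 1 else 0
  | LZero => 0
  | LAdd a b => lcoef a i + lcoef b i
  | LOpp a => - lcoef a i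
  | LScale c a => c * lcoef a i
  end.

Fixpoint same_coefs (a b : lexp) (n : nat) : Prop :=
  if n is k.+1 then lcoef a k = lcoef b k /\ same_coefs a b k else True.

Lemma levalE env e : leval env e = \sum_(i < size env) lcoef e i *: env`_i.
Proof.
elim: e => [j||a IHa b IHb|a IHa|c a IHa] /=; rewrite ?IHa ?IHb.
- have [jn|nj] := ltnP j (size env); last first.
    rewrite nth_default // big1 // => i _.
    by rewrite eqnE (gtn_eqF (leq_trans (ltn_ord i) nj)) scale0r.
  rewrite (bigD1 (Ordinal jn)) //= eqnE eqxx scale1r big1 ?addr0 // => i ij.
  have -> : (j == i :> nat) = false by apply/negbTE; rewrite eq_sym.
  by rewrite scale0r.
- by rewrite big1 // => i _; rewrite scale0r.
- by rewrite -big_split; apply: eq_bigr => i _; rewrite scalerDl.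
- by rewrite -sumrN; apply: eq_bigr => i _; rewrite scaleNr.
- by rewrite scaler_sumr; apply: eq_bigr => i _; rewrite scalerA.
Qed.

(** By this lemma an identity between linear combinations of vectors is reduced to
    polynomial identities between the scalars, one for each vector. *)
Lemma leval_eq env a b :
  same_coefs a b (size env) -> leval env a = leval env b.
Proof.
move=> h; rewrite !levalE; apply: eq_bigr => i _; congr (_ *: _).
move: (size env) (nat_of_ord i) h (ltn_ord i); elim=> [//|n IH] k /= [hn h].
by rewrite ltnS leq_eqVlt => /orP[/eqP ->|/(IH _ h)].
Qed.

End LinearReflection.

(* Atoms are compared up to conversion: the same sum may be presented with
   different but convertible algebraic structures. *)
Ltac lmod_in x l :=
  match l with
  | nil => constr:(false)
  | ?y :: ?l' =>
      match goal with
      | _ => let _ := match goal with _ => unify x y end in constr:(true)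
      | _ => lmod_in x l'
      end
  end.
Ltac lmod_idx x l :=
  match l with
  | ?y :: ?l' =>
      match goal with
      | _ => let _ := match goal with _ => unify x y end in constr:(0%N)
      | _ => let n := lmod_idx x l' in constr:(S n)
      end
  end.
Ltac lmod_atoms t l :=
  match t with
  | GRing.add ?a ?b => let l1 := lmod_atoms a l in lmod_atoms b l1
  | GRing.opp ?a => lmod_atoms a l
  | GRing.scale ?c ?a => lmod_atoms a l
  | GRing.zero => l
  | _ => match lmod_in t l with
         | true => l
         | false => constr:(t :: l)
         end
  end.
Ltac lmod_reify K t l :=
  match t with
  | GRing.add ?a ?b =>
      let x := lmod_reify K a l in let y := lmod_reify K b l in
      constr:(@LAdd K x y)
  | GRing.opp ?a => let x := lmod_reify K a l in constr:(@LOpp K x)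
  | GRing.scale ?c ?a => let x := lmod_reify K a l in constr:(@LScale K c x)
  | GRing.zero => constr:(@LZero K)
  | _ => let n := lmod_idx t l in constr:(@LAtom K n)
  end.
Ltac lmod_with K V :=
  match goal with
  | |- ?a = ?b =>
    let l0 := constr:(@nil V) in
    let l1 := lmod_atoms a l0 in
    let l := lmod_atoms b l1 in
    let x := lmod_reify K a l in
    let y := lmod_reify K b l in
    refine (@leval_eq K V l x y _);
    cbn [size same_coefs lcoef eqn]; do ?[split]; try ring
  end.
(** * The complex modulus *)

Notation nm := Normc.normc.

Section ComplexModulus.
Context {R : realType}.
Implicit Types (x y z : R[i]) (r : R).

Lemma normE z : `|z| = (nm z)%:C. Proof. by case: z. Qed.

Lemma nm_ge0 z : 0 <= nm z.
Proof. by case: z => a b /=; exact: sqrtr_ge0. Qed.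

Lemma nm0 : nm (0 : R[i]) = 0. Proof. exact: Normc.normc0. Qed.
Lemma nm1 : nm (1 : R[i]) = 1. Proof. exact: Normc.normc1. Qed.
Lemma nmM x y : nm (x * y) = nm x * nm y. Proof. exact: Normc.normcM. Qed.
Lemma nmV x : nm x^-1 = (nm x)^-1. Proof. exact: Normc.normcV. Qed.
Lemma nmN x : nm (- x) = nm x. Proof. exact: normcN. Qed.
Lemma nmD x y : nm (x + y) <= nm x + nm y. Proof. exact: le_normcD. Qed.
Lemma nmB x y : nm (x - y) <= nm x + nm y.
Proof. by rewrite -(nmN y); exact: nmD. Qed.
Lemma nmC x y : nm (x - y) = nm (y - x).
Proof. by rewrite -nmN opprB. Qed.
Lemma nm_tri z x y : nm (x - y) <= nm (x - z) + nm (z - y).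
Proof. by have := nmD (x - z) (z - y); rewrite addrA subrK. Qed.
Lemma nm_eq0 x : (nm x == 0) = (x == 0).
Proof. by apply/eqP/eqP => [/Normc.eq0_normc //|->]; rewrite nm0. Qed.
Lemma nm_gt0 x : (0 < nm x) = (x != 0).
Proof. by rewrite lt_neqAle nm_ge0 andbT eq_sym nm_eq0. Qed.
Lemma nmX x n : nm (x ^+ n) = nm x ^+ n.
Proof. by elim: n => [|n IH]; rewrite ?expr0 ?nm1 // !exprS nmM IH. Qed.
Lemma nmR r : nm r%:C = `|r|.
Proof. by rewrite /= expr0n /= addr0 sqrtr_sqr. Qed.
Lemma nmR_ge0 r : 0 <= r -> nm r%:C = r.
Proof. by move=> r0; rewrite nmR ger0_norm. Qed.
Lemma nm_nat n : nm (n%:R : R[i]) = n%:R.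
Proof.
have -> : (n%:R : R[i]) = (n%:R : R)%:C by rewrite rmorph_nat.
by rewrite nmR_ge0.
Qed.
Lemma nm_sum (I : Type) (s : seq I) (P : pred I) (F : I -> R[i]) :
  nm (\sum_(i <- s | P i) F i) <= \sum_(i <- s | P i) nm (F i).
Proof.
elim/big_ind2: _ => [|x a y b ha hb|i _]; rewrite ?nm0 ?lexx //.
by rewrite (le_trans (nmD _ _)) // lerD.
Qed.
Lemma nm_conj z : nm (z^*%C) = nm z.
Proof. by case: z => a b /=; rewrite sqrrN. Qed.

Lemma Re_nm z : `|complex.Re z| <= nm z.
Proof.
case: z => a b /=; rewrite -sqrtr_sqr ler_sqrt ?addr_ge0 ?sqr_ge0 //.
by rewrite lerDl sqr_ge0.
Qed.
Lemma Im_nm z : `|complex.Im z| <= nm z.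
Proof.
case: z => a b /=; rewrite -sqrtr_sqr ler_sqrt ?addr_ge0 ?sqr_ge0 //.
by rewrite lerDr sqr_ge0.
Qed.
Lemma nm_ReIm z : nm z <= `|complex.Re z| + `|complex.Im z|.
Proof.
rewrite [X in nm X]complexE (le_trans (nmD _ _)) // nmM nmR.
rewrite (_ : nm 'i%C = 1) ?mul1r ?nmR //=.
by rewrite expr0n /= expr1n add0r sqrtr1.
Qed.
Lemma nm_sqr z : nm z ^+ 2 = complex.Re z ^+ 2 + complex.Im z ^+ 2.
Proof. by case: z => a b /=; rewrite sqr_sqrtr // addr_ge0 ?sqr_ge0. Qed.

Lemma ReD x y : complex.Re (x + y) = complex.Re x + complex.Re y.
Proof. by case: x y => a b []. Qed.
Lemma ImD x y : complex.Im (x + y) = complex.Im x + complex.Im y.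
Proof. by case: x y => a b []. Qed.
Lemma ReN x : complex.Re (- x) = - complex.Re x. Proof. by case: x. Qed.
Lemma ImN x : complex.Im (- x) = - complex.Im x. Proof. by case: x. Qed.
Lemma Re_sum (I : Type) (s : seq I) (P : pred I) (F : I -> R[i]) :
  complex.Re (\sum_(i <- s | P i) F i) = \sum_(i <- s | P i) complex.Re (F i).
Proof. exact: (big_morph _ ReD). Qed.
Lemma exists_half_lt (B e : R) : 0 < e -> exists n, B * 2^-1 ^+ n < e.
Proof.
move=> e0; have [n hn] : exists n : nat, `|B| / e < n%:R.
  by eexists; apply: archi_boundP; rewrite divr_ge0 // ltW.
exists n; rewrite (le_lt_trans (ler_wpM2r _ (ler_norm B))) ?exprn_ge0 ?invr_ge0 //.
rewrite exprVn ltr_pdivrMr ?exprn_gt0 // mulrC -ltr_pdivrMr //.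
by rewrite (lt_le_trans hn) // -natrX ler_nat ltnW // ltn_expl.
Qed.

(** Convergence of complex sequences in terms of the real-valued modulus, in
   which all the estimates below are made. *)
Definition tends (u : nat -> R[i]) (l : R[i]) :=
  forall e : R, 0 < e -> exists M : nat, forall k, (M <= k)%N -> nm (u k - l) < e.

Lemma complex_complete (u : nat -> R[i]) :
  (forall e : R, 0 < e -> exists M : nat, forall k m,
    (M <= k)%N -> (M <= m)%N -> nm (u k - u m) < e) -> exists l, tends u l.
Proof.
move=> cu.
have aux (g : R[i] -> R) : (forall x y, `|g x - g y| <= nm (x - y)) ->
    exists l : R, (g \o u) k @[k --> \oo] --> l.
  move=> gn; suff h : cvgn (g \o u) by exists (limn (g \o u)).
  apply: cauchy_cvg; apply: cauchy_exP => e e0.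
  have [M hM] := cu e e0; exists (g (u M)); exists M => //= k Mk.
  by rewrite /ball /= (le_lt_trans (gn _ _)) // hM.
have [a /cvgrPdist_lt ha] : exists l : R, (@complex.Re R \o u) k @[k --> \oo] --> l.
  by apply: aux => x y; rewrite -ReN -ReD Re_nm.
have [b /cvgrPdist_lt hb] : exists l : R, (@complex.Im R \o u) k @[k --> \oo] --> l.
  by apply: aux => x y; rewrite -ImN -ImD Im_nm.
exists (a +i* b) => e e0; have e20 : 0 < e / 2 by rewrite divr_gt0.
have [M1 _ h1] := ha _ e20; have [M2 _ h2] := hb _ e20.
exists (maxn M1 M2) => k; rewrite geq_max => /andP[k1 k2].
rewrite (le_lt_trans (nm_ReIm _)) // ReD ImD ReN ImN /= [e]splitr ltrD //.
  by rewrite distrC; exact: h1.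
by rewrite distrC; exact: h2.
Qed.

End ComplexModulus.
(** * Banach spaces and bounded operators *)

Record banach (R : realType) := Banach {
  bs_sort :> lmodType R[i];
  bn : bs_sort -> R;
  bnD : forall x y, bn (x + y) <= bn x + bn y;
  bnZ : forall (c : R[i]) x, bn (c *: x) = nm c * bn x;
  bn_eq0 : forall x, bn x = 0 -> x = 0;
  bn_complete : forall u : nat -> bs_sort,
    (forall e : R, 0 < e -> exists M : nat, forall k m,
      (M <= k)%N -> (M <= m)%N -> bn (u k - u m) < e) ->
    exists l, forall e : R, 0 < e -> exists M : nat, forall k,
      (M <= k)%N -> bn (u k - l) < e }.

Section BanachBasics.
Context {R : realType} {E : banach R}.
Implicit Types x y : E.

Lemma bn0 : bn (0 : E) = 0.
Proof. by rewrite -(scale0r (0 : E)) bnZ nm0 mul0r. Qed.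
Lemma bnN x : bn (- x) = bn x.
Proof. by rewrite -scaleN1r bnZ nmN nm1 mul1r. Qed.
Lemma bn_ge0 x : 0 <= bn x.
Proof.
have := bnD x (- x); rewrite subrr bn0 bnN -mulr2n -mulr_natl => h.
by rewrite -(pmulr_rge0 _ (ltr0Sn R 1)).
Qed.
Lemma bnB x y : bn (x - y) <= bn x + bn y.
Proof. by rewrite -(bnN y); exact: bnD. Qed.
Lemma bnC x y : bn (x - y) = bn (y - x).
Proof. by rewrite -bnN opprB. Qed.
Lemma bn_tri z x y : bn (x - y) <= bn (x - z) + bn (z - y).
Proof. by have := bnD (x - z) (z - y); rewrite addrA subrK. Qed.
Lemma bn_le_sub x y : bn x <= bn y + bn (x - y).
Proof. by have := bnD y (x - y); rewrite addrC subrK. Qed.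
Lemma bn_le0_eq x : (forall e : R, 0 < e -> bn x <= e) -> x = 0.
Proof.
move=> h; apply/bn_eq0/eqP; rewrite eq_le bn_ge0 andbT.
by apply/ler_addgt0Pr => e e0; rewrite add0r h.
Qed.

Lemma geometric_cvg (u : nat -> E) (M : R) :
  (forall k, bn (u k.+1 - u k) <= M * 2^-1 ^+ k) ->
  exists l, forall k, bn (u k - l) <= 2 * M * 2^-1 ^+ k.
Proof.
move=> hu.
have M0 : 0 <= M by have := le_trans (bn_ge0 _) (hu 0%N); rewrite expr0 mulr1.
have hkm k m : (k <= m)%N ->
    bn (u m - u k) <= 2 * M * 2^-1 ^+ k - 2 * M * 2^-1 ^+ m.
  elim: m => [|m IH]; first by rewrite leqn0 => /eqP ->; rewrite !subrr bn0.
  rewrite leq_eqVlt => /orP[/eqP ->|]; first by rewrite !subrr bn0.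
  rewrite ltnS => /IH h; rewrite (le_trans (bn_tri (u m) _ _)) //.
  rewrite (le_trans (lerD (hu m) h)) // exprS; lra.

have [|l hl] := @bn_complete _ _ u.
  move=> e e0; have [n hn] := exists_half_lt (2 * M) (divr_gt0 e0 (ltr0Sn R 1)).
  exists n => k m nk nm_; rewrite (le_lt_trans (bn_tri (u n) _ _)) //.
  rewrite [e]splitr ltrD //; last rewrite bnC.
    rewrite (le_lt_trans (hkm _ _ nk)) // (le_lt_trans _ hn) // gerBl.
    by rewrite !mulr_ge0 // exprn_ge0 // invr_ge0.
  rewrite (le_lt_trans (hkm _ _ nm_)) // (le_lt_trans _ hn) // gerBl.
  by rewrite !mulr_ge0 // exprn_ge0 // invr_ge0.
exists l => k; apply/ler_addgt0Pr => e e0.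
have [m hm] := hl _ e0; rewrite (le_trans (bn_tri (u (maxn k m)) _ _)) //.
rewrite lerD //; last by rewrite ltW // hm // leq_maxr.
rewrite bnC (le_trans (hkm _ _ (leq_maxl _ _))) // gerBl.
by rewrite !mulr_ge0 // exprn_ge0 // invr_ge0.
Qed.

End BanachBasics.

Lemma nmZ {R : realType} (c x : R[i]^o) : nm (c *: x) = nm c * nm x.
Proof. exact: nmM. Qed.

(** The scalar field as a Banach space, so that functionals are operators. *)
Definition scalars (R : realType) : banach R :=
  @Banach R R[i]^o (fun z : R[i] => nm z) (@nmD R) (@nmZ R)
    (@Normc.eq0_normc R) (@complex_complete R).

Definition bop (R : realType) (E F : banach R) (f : E -> F) :=
  (forall a x y, f (a *: x + y) = a *: f x + f y) /\
  exists2 M : R, 0 <= M & forall x, bn (f x) <= M * bn x.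

Section Operators.
Context {R : realType}.
Implicit Types E F G : banach R.

Lemma bopP E F (f : E -> F) : bop f -> linear f. Proof. by case. Qed.
Lemma bopD E F (f : E -> F) x y : bop f -> f (x + y) = f x + f y.
Proof. by move=> [h _]; have := h 1 x y; rewrite !scale1r. Qed.
Lemma bop_0 E F (f : E -> F) : bop f -> f 0 = 0.
Proof. by move=> [h _]; have := h (-1) 0 0; rewrite !scaleN1r !addNr. Qed.
Lemma bopZ E F (f : E -> F) a x : bop f -> f (a *: x) = a *: f x.
Proof. by move=> hf; have [h _] := hf; have := h a x 0; rewrite !addr0 bop_0 // addr0. Qed.
Lemma bopN E F (f : E -> F) x : bop f -> f (- x) = - f x.
Proof. by move=> hf; rewrite -scaleN1r bopZ // scaleN1r. Qed.
Lemma bopB E F (f : E -> F) x y : bop f -> f (x - y) = f x - f y.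
Proof. by move=> hf; rewrite bopD // bopN. Qed.
Lemma bop_sum E F (f : E -> F) (I : Type) (s : seq I) (P : pred I) (g : I -> E) :
  bop f -> f (\sum_(i <- s | P i) g i) = \sum_(i <- s | P i) f (g i).
Proof.
by move=> hf; apply: (big_morph f); [move=> x y; exact: bopD|exact: bop_0].
Qed.

Lemma bop_id E : bop (fun x : E => x).
Proof. by split=> //; exists 1 => // x; rewrite mul1r. Qed.
Lemma bop_cst0 E F : bop (fun _ : E => 0 : F).
Proof.
by split=> [a x y|]; [rewrite scaler0 addr0|exists 0 => // x; rewrite bn0 mul0r].
Qed.
Lemma bop_add E F (f g : E -> F) : bop f -> bop g -> bop (fun x => f x + g x).
Proof.
move=> [lf [M M0 hM]] [lg [K K0 hK]]; split=> [a x y|].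
  by rewrite lf lg scalerDr addrACA.
exists (M + K); first exact: addr_ge0.
by move=> x; rewrite mulrDl (le_trans (bnD _ _)) // lerD.
Qed.
Lemma bop_scale E F c (f : E -> F) : bop f -> bop (fun x => c *: f x).
Proof.
move=> [lf [M M0 hM]]; split=> [a x y|].
  by rewrite lf scalerDr !scalerA mulrC.
exists (nm c * M); first by rewrite mulr_ge0 ?nm_ge0.
by move=> x; rewrite bnZ -mulrA ler_wpM2l ?nm_ge0.
Qed.
Lemma bop_opp E F (f : E -> F) : bop f -> bop (fun x => - f x).
Proof. by move=> hf; under eq_fun do rewrite -scaleN1r; exact: bop_scale. Qed.
Lemma bop_sub E F (f g : E -> F) : bop f -> bop g -> bop (fun x => f x - g x).
Proof. by move=> hf hg; apply: bop_add => //; exact: bop_opp. Qed.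
Lemma bop_comp E F G (f : F -> G) (g : E -> F) :
  bop f -> bop g -> bop (fun x => f (g x)).
Proof.
move=> [lf [M M0 hM]] [lg [K K0 hK]]; split=> [a x y|]; first by rewrite lg lf.
exists (M * K); first exact: mulr_ge0.
by move=> x; rewrite (le_trans (hM _)) // -mulrA ler_wpM2l.
Qed.
Lemma bop_tensor E F (phi : E -> scalars R) (e : F) :
  bop phi -> bop (fun x => phi x *: e).
Proof.
move=> [lf [M M0 hM]]; split=> [a x y|].
  by rewrite lf scalerDl scalerA.
exists (M * bn e); first by rewrite mulr_ge0 ?bn_ge0.
by move=> x; rewrite bnZ mulrAC ler_wpM2r ?bn_ge0 //; exact: hM.
Qed.

(** ** The open mapping theorem *)

Definition closed_range E F (f : E -> F) :=
  forall y, (forall e : R, 0 < e -> exists x, bn (f x - y) < e) ->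
  exists x, f x = y.

(** The argument of Baire's theorem: if the image of no ball were dense in a ball
    of the range, shrinking balls that avoid the images of the balls of radius
    0, 1, 2, ... would have a common point in the range. *)
Lemma range_ball_dense E F (f : E -> F) : bop f -> closed_range f ->
  exists (K : nat) (x0 : E) (r : R), 0 < r /\ forall x, bn (f x - f x0) < r ->
    forall e : R, 0 < e -> exists2 z, bn z <= K%:R & bn (f x - f z) < e.
Proof.
move=> bf cf; apply: contrapT => hno.
have step (k : nat) (p : E * R) : exists q : E * R, 0 < p.2 ->
    [/\ bn (f q.1 - f p.1) <= p.2 - q.2, 0 < q.2, q.2 <= p.2 / 2 &
     forall z, bn z <= k%:R -> 2 * q.2 <= bn (f q.1 - f z)].
  case: p => x0 r /=; have [r0|r0] := ltP 0 r; last first.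
    by exists (x0, r).
  apply: contrapT => hq; apply: hno; exists k, x0, (r / 2).
  split; first by rewrite divr_gt0.
  move=> x hx e e0; apply: contrapT => hz; apply: hq.
  exists (x, Num.min (r / 2) (e / 2)) => _ /=.
  have mr : Num.min (r / 2) (e / 2) <= r / 2 by rewrite ge_min lexx.
  have me : Num.min (r / 2) (e / 2) <= e / 2 by rewrite ge_min lexx orbT.
  split => //.
  - by rewrite (le_trans (ltW hx)) //; lra.
  - by rewrite lt_min !divr_gt0.
  - move=> z bz; rewrite leNgt; apply/negP => h; apply: hz; exists z => //.
    by rewrite (lt_le_trans h) //; lra.
pose h k p := projT1 (cid (step k p)).
have hP k p := projT2 (cid (step k p)).
pose fix s k := if k is j.+1 then h j (s j) else (0 : E, 1 : R).
have spos k : 0 < (s k).2.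
  by elim: k => [|k IH] //=; have [] := hP k (s k) IH.
have shalf k : (s k).2 <= 2^-1 ^+ k.
  elim: k => [|k IH] //=; have [_ _ h1 _] := hP k (s k) (spos k).
  by rewrite (le_trans h1) // exprSr ler_wpM2r // invr_ge0.
have sinc k : bn (f (s k.+1).1 - f (s k).1) <= (s k).2 - (s k.+1).2.
  by have [] := hP k (s k) (spos k).
have smon k m : bn (f (s (k + m)%N).1 - f (s k).1) <= (s k).2 - (s (k + m)%N).2.
  elim: m => [|m IH]; first by rewrite addn0 !subrr bn0.
  rewrite addnS (le_trans (bn_tri (f (s (k + m)%N).1) _ _)) //.
  rewrite (le_trans (lerD (sinc _) IH)) //; lra.
have [|y hy] := @geometric_cvg _ F (fun k => f (s k).1) 1.
  move=> k; rewrite (le_trans (sinc k)) // mul1r (le_trans _ (shalf k)) //.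
  by rewrite gerBl ltW.
have yle k : bn (f (s k).1 - y) <= (s k).2.
  apply/ler_addgt0Pr => e e0.
  have [m hm] := exists_half_lt (2 * 1) e0.
  rewrite (le_trans (bn_tri (f (s (k + m)%N).1) _ _)) // lerD //.
    by rewrite bnC (le_trans (smon _ _)) // gerBl ltW.
  rewrite (le_trans (hy _)) // (le_trans _ (ltW hm)) // ler_wpM2l //.
  by apply: ler_wiXn2l; rewrite ?invr_ge0 ?invf_le1 ?ler1n ?leq_addl.
have [x xy] : exists x, f x = y.
  apply: cf => e e0; have [n hn] := exists_half_lt 1 e0.
  exists (s n).1; rewrite (le_lt_trans (yle n)) // (le_lt_trans (shalf n)) //.
  by rewrite -[X in X < _]mul1r.
have [k hk] : exists k : nat, bn x < k%:R.
  by eexists; apply: archi_boundP; exact: bn_ge0.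
have [_ q0 _ /(_ x (ltW hk))] := hP k (s k) (spos k).
rewrite xy => /le_trans /(_ (yle k.+1)) /=; rewrite -/(h k (s k)).
by have := spos k.+1; rewrite /=; lra.
Qed.

(** Density gives approximate preimages with an error of one half; the preimages of
    the successive errors form a geometric series. *)
Theorem open_mapping E F (f : E -> F) : bop f -> closed_range f ->
  exists2 C : R, 0 <= C & forall x, exists2 x', f x' = f x & bn x' <= C * bn (f x).
Proof.
move=> bf cf; have [K [x0 [r [r0 hK]]]] := range_ball_dense bf cf.
pose C := 4 * K%:R / r.
have C0 : 0 <= C by rewrite divr_ge0 ?mulr_ge0 // ltW.
have step x : exists z, bn z <= C * bn (f x) /\ bn (f x - f z) <= 2^-1 * bn (f x).
  have [fx0|] := eqVneq (bn (f x)) 0.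
    by exists 0; rewrite fx0 bop_0 // subr0 fx0 !mulr0 bn0.
  move=> fxn; have fx0 : 0 < bn (f x) by rewrite lt_neqAle eq_sym fxn bn_ge0.
  pose t := r / (2 * bn (f x)).
  have t0 : 0 < t by rewrite divr_gt0 // mulr_gt0.
  have e0 : 0 < t * bn (f x) / 4 by rewrite divr_gt0 // mulr_gt0.
  have tE : t * bn (f x) = r / 2 by rewrite /t; field; rewrite fxn.
  have [|z1 z1K hz1] := hK (x0 + t%:C *: x) _ _ e0.
    by rewrite bopD // bopZ // addrC addKr bnZ nmR_ge0 ?(ltW t0) // tE; lra.
  have [|z2 z2K hz2] := hK x0 _ _ e0; first by rewrite subrr bn0.
  exists (t^-1%:C *: (z1 - z2)); split.
    rewrite bnZ nmR_ge0 ?invr_ge0 ?(ltW t0) // mulrC ler_pdivrMr //.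
    rewrite -mulrA [bn _ * t]mulrC tE (le_trans (bnB _ _)) //.
    have -> : C * (r / 2) = K%:R + K%:R by rewrite /C; field; rewrite gt_eqF.
    exact: lerD.
  have -> : f x - f (t^-1%:C *: (z1 - z2)) =
      t^-1%:C *: ((f (x0 + t%:C *: x) - f z1) - (f x0 - f z2)).
    rewrite (bopZ _ _ bf) (bopB _ _ bf) (bopD _ _ bf) (bopZ _ _ bf).
    rewrite [f x0 + _]addrC [_ + f x0 - _]addrAC addrKA opprK -addrA.
    rewrite [in RHS]scalerDr [in RHS]scalerA -rmorphM mulVf ?gt_eqF // rmorph1 scale1r; congr (_ + _).
    by rewrite -scalerN opprB addrC.
  rewrite bnZ nmR_ge0 ?invr_ge0 ?(ltW t0) // mulrC ler_pdivrMr //.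
  by rewrite (le_trans (bnB _ _)) // (le_trans (lerD (ltW hz1) (ltW hz2))) //; lra.
pose h x := projT1 (cid (step x)).
have hh x := projT2 (cid (step x)).
exists (2 * C); first by rewrite mulr_ge0.
move=> x; pose u := fun k => iter k (fun y => y - h y) x.
have fu k : bn (f (u k)) <= 2^-1 ^+ k * bn (f x).
  elim: k => [|k IH]; first by rewrite expr0 mul1r.
  rewrite /u iterS -/(u k) bopB // (le_trans (hh _).2) // exprS -mulrA.
  by rewrite ler_wpM2l // invr_ge0.
have [|l hl] := @geometric_cvg _ E u (C * bn (f x)).
  move=> k; rewrite /u iterS -/(u k) addrAC subrr add0r bnN.
  apply: (le_trans (hh (u k)).1); rewrite -(mulrA C) ler_wpM2l // mulrC.
  exact: fu.
have fl : f l = 0.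
  have [M M0 hM] := bf.2; apply: bn_le0_eq => e e0.
  pose B := M * (2 * (C * bn (f x))) + bn (f x).
  have [n hn] := exists_half_lt B e0.
  rewrite (le_trans (bn_le_sub _ (f (u n)))) // bnC -bopB //.
  rewrite (le_trans (lerD (fu n) (hM _))) //.
  rewrite (le_trans (lerD (lexx _) (ler_wpM2l M0 (hl n)))) //.
  by rewrite mulrA [X in X + _]mulrC -mulrDl addrC ltW.
exists (x - l); first by rewrite bopB // fl subr0.
by have := hl 0%N; rewrite expr0 mulr1 mulrA.
Qed.

End Operators.
(** ** Finite rank and approximable operators *)

Section FiniteRank.
Context {R : realType}.
Implicit Types E F G : banach R.

Inductive frank (E F : banach R) : (E -> F) -> Prop :=
| frank_zero : frank (fun _ => 0)
| frank_cons f (phi : E -> scalars R) e :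
    frank f -> bop phi -> frank (fun x => f x + phi x *: e).

Lemma frank_bop E F (f : E -> F) : frank f -> bop f.
Proof.
elim=> [|{}f phi e _ hf hp]; first exact: bop_cst0.
by apply: bop_add => //; exact: bop_tensor.
Qed.
Lemma frank_ext E F (f g : E -> F) : f =1 g -> frank f -> frank g.
Proof. by move=> /funext ->. Qed.
Lemma frank_tensor E F (phi : E -> scalars R) (e : F) :
  bop phi -> frank (fun x => phi x *: e).
Proof.
move=> hp; apply: (@frank_ext _ _ (fun x => 0 + phi x *: e)).
  by move=> x; rewrite add0r.
by apply: frank_cons => //; exact: frank_zero.
Qed.
Lemma frankD E F (f g : E -> F) :
  frank f -> frank g -> frank (fun x => f x + g x).
Proof.
move=> hf; elim=> [|{}g phi e _ hg hp].
  by apply: (frank_ext _ hf) => x; rewrite addr0.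
apply: (@frank_ext _ _ (fun x => (f x + g x) + phi x *: e)).
  by move=> x; rewrite addrA.
exact: frank_cons.
Qed.
Lemma frank_compl E F G (L : F -> G) (f : E -> F) :
  bop L -> frank f -> frank (fun x => L (f x)).
Proof.
move=> hL; elim=> [|{}f phi e _ hf hp].
  by apply: (frank_ext _ (@frank_zero E G)) => x; rewrite bop_0.
apply: (@frank_ext _ _ (fun x => L (f x) + phi x *: L e)).
  by move=> x; rewrite (bopD _ _ hL) (bopZ _ _ hL).
exact: frank_cons.
Qed.
Lemma frank_compr E F G (f : F -> G) (L : E -> F) :
  bop L -> frank f -> frank (fun x => f (L x)).
Proof.
move=> hL; elim=> [|{}f phi e _ hf hp]; first exact: frank_zero.
apply: (@frank_cons _ _ (fun x => f (L x)) (fun x => phi (L x))) => //.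
exact: bop_comp.
Qed.
Lemma frankN E F (f : E -> F) : frank f -> frank (fun x => - f x).
Proof. by apply: frank_compl; apply: bop_opp; exact: bop_id. Qed.
Lemma frankB E F (f g : E -> F) :
  frank f -> frank g -> frank (fun x => f x - g x).
Proof. by move=> hf /frankN; exact: frankD. Qed.

(** The error terms of the lower bounds satisfied by an operator with closed range
    and finite dimensional kernel. *)
Inductive fsem (E : banach R) : (E -> R) -> Prop :=
| fsem_zero : fsem (fun _ => 0)
| fsem_cons p (phi : E -> scalars R) :
    fsem p -> bop phi -> fsem (fun x => p x + nm (phi x)).

Lemma fsem_ext E (p q : E -> R) : p =1 q -> fsem p -> fsem q.
Proof. by move=> /funext ->. Qed.
Lemma fsemD E (p q : E -> R) : fsem p -> fsem q -> fsem (fun x => p x + q x).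
Proof.
move=> hp; elim=> [|{}q phi _ hq hphi].
  by apply: (fsem_ext _ hp) => x; rewrite addr0.
apply: (@fsem_ext _ (fun x => (p x + q x) + nm (phi x))).
  by move=> x; rewrite addrA.
exact: fsem_cons.
Qed.
Lemma fsem_comp E F (p : F -> R) (L : E -> F) :
  bop L -> fsem p -> fsem (fun x => p (L x)).
Proof.
move=> hL; elim=> [|{}p phi _ hp hphi]; first exact: fsem_zero.
apply: (@fsem_cons _ (fun x => p (L x)) (fun x => phi (L x))) => //.
exact: bop_comp.
Qed.
Lemma fsem_scale E (p : E -> R) (c : R) :
  0 <= c -> fsem p -> fsem (fun x => c * p x).
Proof.
move=> c0; elim=> [|{}p phi _ hp hphi].
  by apply: (fsem_ext _ (@fsem_zero E)) => x; rewrite mulr0.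
apply: (@fsem_ext _ (fun x => c * p x + nm (c%:C *: phi x))).
  by move=> x; rewrite nmZ nmR_ge0 // mulrDr.
by apply: (@fsem_cons _ _ (fun x => c%:C *: phi x)) => //; exact: bop_scale.
Qed.
Lemma frank_fsem E F (f : E -> F) : frank f ->
  exists2 p, fsem p & forall x, bn (f x) <= p x.
Proof.
elim=> [|{}f phi e _ [p hp fp] hphi].
  by exists (fun=> 0); [exact: fsem_zero|move=> x; rewrite bn0].
exists (fun x => p x + bn e * nm (phi x)) => [|x].
  apply: fsemD => //; apply: fsem_scale; first exact: bn_ge0.
  apply: (@fsem_ext _ (fun x => 0 + nm (phi x))) => [x|]; first by rewrite add0r.
  by apply: fsem_cons => //; exact: fsem_zero.
rewrite (le_trans (bnD _ _)) // lerD ?fp // bnZ mulrC //.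
Qed.

(** Norm limits of finite rank operators. They play the part of the compact
    operators: they form a closed ideal, and the finite dimensional corrections
    that they cause are explicit. *)
Definition ap (E F : banach R) (a : E -> F) := bop a /\
  forall e : R, 0 < e ->
    exists2 g : E -> F, frank g & forall x, bn (a x - g x) <= e * bn x.

Lemma ap_ext E F (f g : E -> F) : f =1 g -> ap f -> ap g.
Proof. by move=> /funext ->. Qed.
Lemma frank_ap E F (f : E -> F) : frank f -> ap f.
Proof.
move=> hf; split; first exact: frank_bop.
by move=> e e0; exists f => // x; rewrite subrr bn0 mulr_ge0 ?bn_ge0 // ltW.
Qed.
Lemma apD E F (f g : E -> F) : ap f -> ap g -> ap (fun x => f x + g x).
Proof.
move=> [bf hf] [bg hg]; split; first exact: bop_add.
move=> e e0; have e20 : 0 < e / 2 by rewrite divr_gt0.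
have [f' ff hf'] := hf _ e20; have [g' gg hg'] := hg _ e20.
exists (fun x => f' x + g' x) => [|x]; first exact: frankD.
by rewrite opprD addrACA (le_trans (bnD _ _)) // [e]splitr mulrDl lerD.
Qed.
Lemma ap_compl E F G (L : F -> G) (f : E -> F) :
  bop L -> ap f -> ap (fun x => L (f x)).
Proof.
move=> hL [bf hf]; split; first exact: bop_comp.
move=> e e0; have [M M0 hM] := hL.2.
have M10 : 0 < M + 1 by rewrite ltr_wpDl.
have [g fg hg] := hf (e / (M + 1)) (divr_gt0 e0 M10).
exists (fun x => L (g x)) => [|x]; first exact: frank_compl.
rewrite -bopB // (le_trans (hM _)) // (le_trans (ler_wpM2l M0 (hg x))) //.
rewrite mulrA ler_wpM2r ?bn_ge0 // mulrCA ger_pMr //.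
by rewrite ler_pdivrMr // mul1r lerDl.
Qed.
Lemma ap_compr E F G (f : F -> G) (L : E -> F) :
  bop L -> ap f -> ap (fun x => f (L x)).
Proof.
move=> hL [bf hf]; split; first exact: bop_comp.
move=> e e0; have [M M0 hM] := hL.2.
have M10 : 0 < M + 1 by rewrite ltr_wpDl.
have [g fg hg] := hf (e / (M + 1)) (divr_gt0 e0 M10).
exists (fun x => g (L x)) => [|x]; first exact: frank_compr.
rewrite (le_trans (hg _)) //.
rewrite (le_trans (ler_wpM2l (ltW (divr_gt0 e0 M10)) (hM x))) //.
rewrite mulrA ler_wpM2r ?bn_ge0 // -mulrA ger_pMr //.
by rewrite mulrC ler_pdivrMr // mul1r lerDl.
Qed.
Lemma apZ E F c (f : E -> F) : ap f -> ap (fun x => c *: f x).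
Proof. by apply: ap_compl; apply: bop_scale; exact: bop_id. Qed.
Lemma apN E F (f : E -> F) : ap f -> ap (fun x => - f x).
Proof. by apply: ap_compl; apply: bop_opp; exact: bop_id. Qed.
Lemma apB E F (f g : E -> F) : ap f -> ap g -> ap (fun x => f x - g x).
Proof. by move=> hf /apN; exact: apD. Qed.
Lemma ap_fsem E F (f : E -> F) (e : R) : ap f -> 0 < e ->
  exists2 p, fsem p & forall x, bn (f x) <= e * bn x + p x.
Proof.
move=> [_ hf] e0; have [g /frank_fsem[p fp gp] hg] := hf _ e0.
exists p => // x; rewrite (le_trans (bn_le_sub _ (g x))) // addrC lerD //.
Qed.

(** ** Invertible operators, and invertible plus finite rank *)

Definition isom (E F : banach R) (f : E -> F) := bop f /\
  exists g, [/\ bop g, forall x, g (f x) = x & forall y, f (g y) = y].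

Lemma isom_bijective E F (f : E -> F) (C : R) : bop f -> 0 <= C ->
  (forall y, exists x, f x = y) -> (forall x, bn x <= C * bn (f x)) -> isom f.
Proof.
move=> bf C0 sf lf; split=> //.
pose g y := projT1 (cid (sf y)).
have fg y : f (g y) = y := projT2 (cid (sf y)).
have injf x y : f x = f y -> x = y.
  move=> fxy; apply/eqP; rewrite -subr_eq0; apply/eqP/bn_eq0/eqP.
  rewrite eq_le bn_ge0 andbT (le_trans (lf _)) // bopB // fxy subrr bn0 mulr0 //.
exists g; split=> // [|x]; last by apply: injf; rewrite fg.
split=> [a x y|]; first by apply: injf; rewrite fg (bopP bf) !fg.
by exists C => // y; rewrite (le_trans (lf _)) // fg.
Qed.

Lemma isom_comp E F G (f : F -> G) (g : E -> F) :
  isom f -> isom g -> isom (fun x => f (g x)).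
Proof.
move=> [bf [f' [bf' h1 h2]]] [bg [g' [bg' k1 k2]]]; split; first exact: bop_comp.
exists (fun x => g' (f' x)); split=> [|x|x]; first exact: bop_comp.
- by rewrite h1 k1.
- by rewrite k2 h2.
Qed.

(** The Neumann series. *)
Lemma isom_perturb E (a : E -> E) : bop a ->
  (forall x, bn (a x) <= 2^-1 * bn x) -> isom (fun x => x + a x).
Proof.
move=> ba ha; have bf : bop (fun x => x + a x).
  by apply: bop_add => //; exact: bop_id.
apply: (@isom_bijective _ _ _ 2) => // [y|x]; last first.
  have : bn x <= bn (x + a x) + bn (a x).
    by rewrite (le_trans (bn_le_sub _ (x + a x))) // opprD addNKr bnN.
  by have := ha x; lra.
pose u := fun k => iter k (fun x => y - a x) 0.
have hu k : bn (u k.+1 - u k) <= bn y * 2^-1 ^+ k.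
  elim: k => [|k IH]; first by rewrite /u /= bop_0 // !subr0 expr0 mulr1.
  have -> : u k.+2 - u k.+1 = - a (u k.+1 - u k).
    rewrite (bopB _ _ ba) -[u k.+2]/(y - a (u k.+1)) -[X in _ - X]/(y - a (u k)).
    by lmod_with R[i] E.
  rewrite bnN (le_trans (ha _)) // exprS mulrCA ler_wpM2l // invr_ge0 //.
have [l hl] := geometric_cvg hu; exists l.
have [M M0 hM] := ba.2.
apply/eqP; rewrite -subr_eq0; apply/eqP/bn_le0_eq => e e0.
have [n hn] := exists_half_lt ((1 + M) * (2 * bn y)) e0.
have -> : l + a l - y = (l - u n.+1) + a (l - u n).
  by rewrite (bopB _ _ ba) -[u n.+1]/(y - a (u n)); lmod_with R[i] E.
rewrite (le_trans (bnD _ _)) // (le_trans _ (ltW hn)) //.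
rewrite bnC -mulrA mulrDl mul1r lerD //.
  rewrite (le_trans (hl _)) // exprS mulrCA ler_piMl ?invf_le1 ?ler1n //.
  by rewrite !mulr_ge0 ?bn_ge0 ?exprn_ge0 ?invr_ge0.
by rewrite (le_trans (hM _)) // ler_wpM2l // bnC.
Qed.

(** The Fredholm operators of index zero, described so that finite rank and small
    perturbations are harmless. *)
Definition IF E (f : E -> E) :=
  exists2 V : E -> E, isom V & frank (fun x => f x - V x).

Lemma isom_IF E (V : E -> E) : isom V -> IF V.
Proof.
move=> hV; exists V => //; apply: frank_ext (@frank_zero E E) => x.
by rewrite subrr.
Qed.

(** Up to finite rank the difference is small, and the invertible operators form an
    open set. *)
Lemma IF_ap E (f g : E -> E) : IF f -> ap (fun x => g x - f x) -> IF g.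
Proof.
move=> [V iV fV] ha; have [bV [W [bW WV VW]]] := iV.
have h20 : 0 < 2^-1 :> R by rewrite invr_gt0.
have [_ /(_ _ h20)[r fr hr]] := ap_compl bW ha.
have iS : isom (fun x => x + (W (g x - f x) - r x)).
  apply: isom_perturb => //; apply: bop_sub; last exact: frank_bop.
  by apply: bop_comp => //; case: ha.
exists (fun x => V (x + (W (g x - f x) - r x))); first exact: isom_comp.
apply: (@frank_ext _ _ (fun x => (f x - V x) + V (r x))); last first.
  by apply: frankD => //; exact: frank_compl.
by move=> x; rewrite (bopD _ _ bV) (bopB _ _ bV) VW; lmod_with R[i] E.
Qed.

End FiniteRank.
Ltac vec_eq :=
  match goal with |- @eq ?V _ _ =>
    match V with context [bs_sort ?E] =>
      match type of E with banach ?R => lmod_with R[i] E end end end.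

Section Parametrix.
Context {R : realType}.
Implicit Types E F : banach R.

(** The lower bound that characterizes a closed range with a finite dimensional
    kernel. *)
Definition LF E F (f : E -> F) := exists C : R, exists2 p : E -> R,
  0 <= C /\ fsem p & forall x, bn x <= C * bn (f x) + p x.

(** Atkinson's characterization of the Fredholm operators. *)
Definition FP E (f : E -> E) := exists2 B : E -> E, bop B &
  ap (fun x => f (B x) - x) /\ ap (fun x => B (f x) - x).

Lemma LF_ap E (f g : E -> E) : LF f -> ap (fun x => g x - f x) -> LF g.
Proof.
move=> [C [p [C0 fp] hC]] ha.
have e0 : 0 < (2 * (C + 1))^-1 by rewrite invr_gt0 mulr_gt0 // ltr_wpDl.
have [q fq hq] := ap_fsem ha e0.
exists (2 * C), (fun x => 2 * (C * q x + p x)) => [|x].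
  split; first by rewrite mulr_ge0.
  by apply: fsem_scale => //; apply: fsemD => //; exact: fsem_scale.
have h1 : bn (f x) <= bn (g x) + bn (g x - f x).
  by rewrite (le_trans (bn_le_sub _ (g x))) // bnC.
have h2 : C * bn (g x - f x) <= 2^-1 * bn x + C * q x.
  rewrite (le_trans (ler_wpM2l C0 (hq x))) // mulrDr lerD2r mulrA.
  rewrite ler_wpM2r ?bn_ge0 // invfM mulrCA ger_pMr ?invr_gt0 //.
  by rewrite ler_pdivrMr ?mul1r ?lerDl // ltr_wpDl.
have := hC x; have := ler_wpM2l C0 h1; rewrite mulrDr; lra.
Qed.

Lemma FP_ap E (f g : E -> E) : FP f -> ap (fun x => g x - f x) -> FP g.
Proof.
move=> [B bB [h1 h2]] ha; exists B => //; split.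
  apply: ap_ext (apD h1 (ap_compr bB ha)) => x; vec_eq.
apply: ap_ext (apD h2 (ap_compl bB ha)) => x.
by rewrite (bopB _ _ bB); vec_eq.
Qed.

Lemma FP_LF E (f : E -> E) : FP f -> LF f.
Proof.
move=> [B bB [_ h2]]; have e0 : 0 < 2^-1 :> R by rewrite invr_gt0.
have [q fq hq] := ap_fsem h2 e0; have [M M0 hM] := bB.2.
exists (2 * M), (fun x => 2 * q x) => [|x].
  by split; [rewrite mulr_ge0|exact: fsem_scale].
have := hM (f x); have := hq x; have := bn_le_sub x (B (f x)).
by rewrite bnC; lra.
Qed.

Lemma IF_FP E (f : E -> E) : IF f -> FP f.
Proof.
move=> [V [bV [W [bW WV VW]]] hf]; exists W => //; split.
  by apply: ap_ext (frank_ap (frank_compr bW hf)) => x; rewrite VW.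
apply: ap_ext (frank_ap (frank_compl bW hf)) => x.
by rewrite (bopB _ _ bW) WV.
Qed.

(** ** Perturbation by [m j] when [j m j] is approximable *)

(** When v j is j u up to an approximable operator, and j m j is negligible, the
    perturbation m j does not affect the Fredholm properties that u and v have in
    common, although it need not be small or compact. *)
Section Perturbation.
Variables (E : banach R) (m j u v : E -> E).
Hypotheses (bm : bop m) (bj : bop j) (bu : bop u) (bv : bop v).
Hypothesis juv : ap (fun x => j (u x) - v (j x)).
Hypothesis jmj : ap (fun x => j (m (j x))).

(** With s = u + m j, the vector v (j x) equals j (s x) up to an approximable
    error; so the lower bound of v controls j x, hence u x = s x - m (j x), hence x. *)
Lemma LF_perturb : LF u -> LF v -> LF (fun x => u x + m (j x)).
Proof.
move=> [C1 [p1 [C10 fp1] h1]] [C0 [p0 [C00 fp0] h0]].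
have [M M0 hM] := bm.2; have [K K0 hK] := bj.2.
have ha := apD juv jmj.
pose D := C1 * M * C0.
have D0 : 0 <= D by rewrite !mulr_ge0.
have e0 : 0 < (2 * (D + 1))^-1 by rewrite invr_gt0 mulr_gt0 // ltr_wpDl.
have [q fq hq] := ap_fsem ha e0.
exists (2 * (C1 + D * K)),
  (fun x => 2 * (p1 x + (C1 * M * p0 (j x) + D * q x))) => [|x].
  split; first by rewrite mulr_ge0 // addr_ge0 // mulr_ge0.
  apply: fsem_scale => //; apply: fsemD => //; apply: fsemD.
    by apply: fsem_scale; [exact: mulr_ge0|exact: fsem_comp].
  exact: fsem_scale.
set S := u x + m (j x).
have e1 : bn (u x) <= bn S + M * bn (j x).
  have -> : u x = S - m (j x) by rewrite /S addrK.
  by rewrite (le_trans (bnB _ _)) // lerD2l.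
have e2 : bn (v (j x)) <= K * bn S + bn (j (u x) - v (j x) + j (m (j x))).
  have h : v (j x) = j S - (j (u x) - v (j x) + j (m (j x))).
    by rewrite /S (bopD _ _ bj); vec_eq.
  by rewrite [X in bn X <= _]h (le_trans (bnB _ _)) // lerD2r.
have e3 : bn (j x) <= C0 * (K * bn S + ((2 * (D + 1))^-1 * bn x + q x)) + p0 (j x).
  rewrite (le_trans (h0 _)) // lerD2r ler_wpM2l // (le_trans e2) // lerD2l.
  exact: hq.
have e4 : C1 * M * bn (j x) <= D * K * bn S + 2^-1 * bn x + D * q x + C1 * M * p0 (j x).
  rewrite (le_trans (ler_wpM2l (mulr_ge0 C10 M0) e3)) // mulrDr lerD2r.
  rewrite mulrA -/D !mulrDr mulrA addrA lerD2r lerD2l mulrA.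
  by rewrite ler_wpM2r ?bn_ge0 // ler_pdivrMr; lra.
have := h1 x; have := ler_wpM2l C10 e1; rewrite mulrDr mulrA; lra.
Qed.

(** If b is a parametrix of u, then j b m j is negligible too, and b - b m j b is a
    parametrix of the sum. *)
Lemma FP_perturb : FP u -> FP v -> FP (fun x => u x + m (j x)).
Proof.
move=> [B1 b1 [r1 l1]] [B0 b0 [r0 l0]].
have bmj : bop (fun x => m (j x)) by exact: bop_comp.
have jB : ap (fun x => j (B1 x) - B0 (j x)).
  have bvj := bop_comp bv bj.
  have k1 := ap_compl b0 (ap_compr b1 juv).
  have k2 := ap_compr (bop_comp bj b1) l0.
  have k3 := ap_compl (bop_comp b0 bj) r1.
  apply: ap_ext (apB (apB k3 k1) k2) => x /=.
  rewrite (bopB _ _ (bop_comp b0 bj)) (bopB _ _ b0); vec_eq.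
have small : ap (fun x => j (B1 (m (j x)))).
  apply: ap_ext (apD (ap_compr (bop_comp bm bj) jB) (ap_compl b0 jmj)) => x /=.
  by rewrite subrK.
have small' : ap (fun x => j (B1 (m (j (B1 x))))).
  exact: ap_compr b1 small.
exists (fun x => B1 x - B1 (m (j (B1 x)))).
  apply: bop_sub => //; exact: (bop_comp b1 (bop_comp bmj b1)).
split.
  have k1 := ap_compr (bop_comp bmj b1) r1.
  have k2 := ap_compl bm small'.
  apply: ap_ext (apB (apB r1 k1) k2) => x /=.
  by rewrite (bopB _ _ bu) (bopB _ _ bmj); vec_eq.
have k1 := ap_compl (bop_comp b1 bmj) l1.
have k2 := ap_compl (bop_comp b1 bm) small.
apply: ap_ext (apB (apB l1 k1) k2) => x /=.
rewrite (bopB _ _ (bop_comp b1 bmj)) (bopD _ _ b1).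
by rewrite (bopD _ _ (bop_comp b1 bmj)); vec_eq.
Qed.

(** Modulo approximable operators 1 + c is the 2^p-th power of 1 + c / 2^p, which is
    invertible by a Neumann series when p is large. *)
Lemma isom_one_plus_nilpotent (c : E -> E) : bop c -> ap (fun x => c (c x)) ->
  exists2 G, isom G & ap (fun x => G x - (x + c x)).
Proof.
move=> bc; have [M M0 hM] := bc.2.
have h20 : 0 < 2^-1 :> R by rewrite invr_gt0.
have [p hp] := exists_half_lt M h20.
elim: p M M0 c bc hM hp => [|p IH] M M0 c bc hM hp cc.
  exists (fun x => x + c x).
    apply: isom_perturb => // x; rewrite (le_trans (hM _)) //.
    by rewrite ler_wpM2r ?bn_ge0 // ltW // -[X in X < _]mulr1 -(expr0 2^-1).
  apply: (@ap_ext _ _ _ (fun _ => 0)); last exact/frank_ap/frank_zero.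
  by move=> x; rewrite subrr.
pose d x := (2^-1)%:C *: c x.
have h0 : 0 <= 2^-1 :> R by rewrite invr_ge0.
have bd : bop d by exact: bop_scale.
have [||||G iG aG] := IH (2^-1 * M) _ d bd.
- exact: mulr_ge0.
- by move=> x; rewrite bnZ nmR_ge0 // -mulrA ler_wpM2l.
- by rewrite mulrAC -exprS mulrC.
- apply: ap_ext (apZ ((2^-1)%:C * (2^-1)%:C) cc) => x.
  by rewrite /d (bopZ _ _ bc) scalerA.
have bG := iG.1; exists (fun x => G (G x)); first exact: isom_comp.
have k1 := ap_compl bG aG.
have k2 := ap_compr (bop_add (@bop_id _ E) bd) aG.
have k3 := apZ ((2^-1)%:C * (2^-1)%:C) cc.
apply: ap_ext (apD (apD k1 k2) k3) => x.
have two : (2^-1)%:C + (2^-1)%:C = 1 :> R[i].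
  by rewrite -rmorphD (_ : 2^-1 + 2^-1 = 1) ?rmorph1 //; field.
rewrite (bopB _ _ bG) /d (bopD _ _ bc) (bopZ _ _ bc).
have -> : x + c x = x + ((2^-1)%:C + (2^-1)%:C) *: c x by rewrite two scale1r.
by vec_eq.
Qed.

(** With V the invertible part of u, the sum is V (1 + c) up to approximable
    operators, where c = V^-1 m j has a negligible square. *)
Lemma IF_perturb : IF u -> IF v -> IF (fun x => u x + m (j x)).
Proof.
move=> [V [bV [W [bW WV VW]]] hu] [V0 [bV0 [W0 [bW0 WV0 VW0]]] hv].
have jV : ap (fun x => j (V x) - V0 (j x)).
  have k1 := frank_ap (frank_compl bj hu).
  have k2 := frank_ap (frank_compr bj hv).
  apply: ap_ext (apD (apB juv k1) k2) => x.
  by rewrite (bopB _ _ bj); vec_eq.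
have jW : ap (fun x => j (W x) - W0 (j x)).
  apply: ap_ext (apN (ap_compl bW0 (ap_compr bW jV))) => x.
  by rewrite (bopB _ _ bW0) VW WV0 opprB.
have bc : bop (fun x => W (m (j x))) by apply: bop_comp => //; exact: bop_comp.
have cc : ap (fun x => W (m (j (W (m (j x)))))).
  have bmj := bop_comp bm bj; have bWm := bop_comp bW bm.
  have k1 := ap_compl bWm (ap_compr bmj jW).
  have k2 := ap_compl bWm (ap_compl bW0 jmj).
  apply: ap_ext (apD k1 k2) => x /=; rewrite -(bopD _ _ bWm) subrK //.
have [G iG aG] := isom_one_plus_nilpotent bc cc.
have iV : isom V by split=> //; exists W.
apply: (@IF_ap _ _ (fun x => V (G x))).
  exact/isom_IF/isom_comp.
apply: ap_ext (apB (frank_ap hu) (ap_compl bV aG)) => x.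
by rewrite (bopB _ _ bV) (bopD _ _ bV) VW; vec_eq.
Qed.

End Perturbation.

(** ** Extension by finitely many dimensions *)

(** E is the sum of a copy of E' and a finite dimensional space, and f acts on the
    copy as f'. *)
Section Extension.
Variables (E E' : banach R) (i : E' -> E) (q : E -> E').
Hypotheses (bi : bop i) (bq : bop q) (qi : forall x, q (i x) = x).
Hypothesis fiq : frank (fun x => x - i (q x)).
Variables (f : E -> E) (f' : E' -> E').
Hypotheses (bf : bop f) (bf' : bop f') (fi : forall x, f (i x) = i (f' x)).

Let f'q x : f' (q x) = q (f x) - q (f (x - i (q x))).
Proof. by rewrite (bopB _ _ bf) (bopB _ _ bq) fi qi subKr. Qed.

Lemma LF_extend : LF f <-> LF f'.
Proof.
split=> [|] [C [p [C0 fp] hC]].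
  have [M M0 hM] := bi.2; have [K K0 hK] := bq.2.
  exists (K * (C * M)), (fun x => K * p (i x)) => [|x].
    split; first by rewrite !mulr_ge0.
    by apply: fsem_scale => //; exact: fsem_comp.
  rewrite -{1}[x]qi (le_trans (hK _)) // -[K * _ * _]mulrA -mulrDr ler_wpM2l //.
  by rewrite (le_trans (hC _)) // lerD2r -mulrA ler_wpM2l // fi.
have [M M0 hM] := bi.2; have [K K0 hK] := bq.2.
have [r fr hr] := frank_fsem fiq.
have [s fs hs] := frank_fsem (frank_compl (bop_comp bq bf) fiq).
exists (M * C * K), (fun x => M * C * s x + M * p (q x) + r x) => [|x].
  split; first by rewrite !mulr_ge0.
  apply: fsemD => //; apply: fsemD; first by apply: fsem_scale => //; exact: mulr_ge0.
  by apply: fsem_scale => //; exact: fsem_comp.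
have h1 := bn_le_sub x (i (q x)); have h2 := hM (q x).
have h3 := ler_wpM2l M0 (hC (q x)); have h4 : bn (f' (q x)) <= K * bn (f x) + s x.
  by rewrite f'q (le_trans (bnB _ _)) // lerD.
have h5 := ler_wpM2l (mulr_ge0 M0 C0) h4; have h6 := hr x.
by move: h3 h5; rewrite !mulrDr !mulrA; lra.
Qed.

Lemma FP_extend : FP f <-> FP f'.
Proof.
split=> -[B bB [h1 h2]].
  exists (fun x => q (B (i x))); first exact: (bop_comp bq (bop_comp bB bi)).
  split.
    have k1 := ap_compr bi (ap_compl bq h1).
    have k2 := ap_compl (bop_comp bq bf) (ap_compr (bop_comp bB bi) (frank_ap fiq)).
    apply: ap_ext (apB k1 k2) => x /=.
    by rewrite f'q (bopB _ _ bq) qi; vec_eq.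
  apply: ap_ext (ap_compl bq (ap_compr bi h2)) => x.
  by rewrite (bopB _ _ bq) qi fi.
have biB := bop_comp bi bB.
exists (fun x => i (B (q x))); first exact: bop_comp biB bq.
split.
  have k1 := ap_compl bi (ap_compr bq h1).
  apply: ap_ext (apB k1 (frank_ap fiq)) => x /=.
  by rewrite fi (bopB _ _ bi); vec_eq.
have k1 := ap_compl bi (ap_compr bq h2).
have k2 := ap_compl (bop_comp biB (bop_comp bq bf)) (frank_ap fiq).
apply: ap_ext (apB (apD k1 k2) (frank_ap fiq)) => x /=.
by rewrite f'q !(bopB _ _ bB) !(bopB _ _ bi); vec_eq.
Qed.

Lemma IF_extend : IF f' -> IF f.
Proof.
move=> [V [bV [W [bW WV VW]]] hV].
have biq : bop (fun x => x - i (q x)) by exact: frank_bop.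
have q0 x : q (x - i (q x)) = 0 by rewrite (bopB _ _ bq) qi subrr.
have blk (g : E' -> E') : bop g -> bop (fun x => i (g (q x)) + (x - i (q x))).
  by move=> bg; apply: bop_add => //; exact: (bop_comp bi (bop_comp bg bq)).
have qblk (g : E' -> E') x : q (i (g (q x)) + (x - i (q x))) = g (q x).
  by rewrite (bopD _ _ bq) q0 addr0 qi.
exists (fun x => i (V (q x)) + (x - i (q x))).
  split; first exact: blk.
  exists (fun x => i (W (q x)) + (x - i (q x))); split; first exact: blk.
    by move=> x; rewrite qblk WV; vec_eq.
  by move=> x; rewrite qblk VW; vec_eq.
have k1 := frank_compl bi (frank_compr bq hV).
have k2 := frank_compl bf fiq.
apply: frank_ext (frankB (frankD k1 k2) fiq) => x /=.
by rewrite (bopB _ _ bf) (bopB _ _ bi) fi; vec_eq.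
Qed.

End Extension.

End Parametrix.
(** ** Fredholm properties of operators with a thin kernel *)

Section Thin.
Context {R : realType} {E : banach R}.
Implicit Types (f : E -> E).

(** The kernel has dimension at most one; the functional provides a projection
    onto it. *)
Definition thin f := exists2 phi : E -> scalars R, bop phi &
  forall x, f x = 0 -> phi x = 0 -> x = 0.

Definition kernel_dim f p := exists e : 'I_p -> E,
  [/\ forall i, f (e i) = 0,
      forall x, f x = 0 -> exists c : 'I_p -> R[i], x = \sum_(i < p) c i *: e i &
      forall c : 'I_p -> R[i], \sum_(i < p) c i *: e i = 0 -> forall i, c i = 0].

Definition range_codim f q := exists e : 'I_q -> E,
  (forall y, exists (c : 'I_q -> R[i]) x, y - \sum_(i < q) c i *: e i = f x) /\
  (forall (c : 'I_q -> R[i]) x, \sum_(i < q) c i *: e i = f x -> forall i, c i = 0).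

Lemma thin_proj f : bop f -> thin f ->
  exists (phi : E -> scalars R) e, [/\ bop phi, f e = 0,
    forall x, f x = 0 -> x = phi x *: e & phi e *: e = e].
Proof.
move=> bf [phi bphi hphi].
have [[e fe e0]|nok] := pselect (exists2 e, f e = 0 & e != 0).
  have pe : phi e != 0 by apply: contra_neq e0 => /(hphi _ fe).
  exists phi, ((phi e)^-1 *: e); split=> //.
  - by rewrite (bopZ _ _ bf) fe scaler0.
  - move=> x fx; apply/eqP; rewrite -subr_eq0; apply/eqP/hphi.
      by rewrite (bopB _ _ bf) !(bopZ _ _ bf) fx fe !scaler0 subrr.
    rewrite (bopB _ _ bphi) !(bopZ _ _ bphi).
    by rewrite -[(phi e)^-1 *: phi e]/((phi e)^-1 * phi e) mulVf // [_ *: 1]mulr1 subrr.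
  - rewrite (bopZ _ _ bphi) -[(phi e)^-1 *: phi e]/((phi e)^-1 * phi e).
    by rewrite mulVf // scale1r.
exists phi, 0; split; rewrite ?scaler0 ?(bop_0 bf) // => x fx.
by apply/eqP; rewrite scaler0; apply/negP => /negP x0; apply: nok; exists x.
Qed.

(** The functionals are removed one by one, by passing to the hyperplane where one of
    them vanishes and adding back a line. *)
Lemma lower_bound_reduce f (L : set E) (p : E -> R) : bop f -> fsem p ->
  (forall a x y, L x -> L y -> L (a *: x + y)) ->
  (forall x, (forall e : R, 0 < e -> exists2 y, L y & bn (y - x) < e) -> L x) ->
  (forall x, L x -> f x = 0 -> x = 0) ->
  (exists C : R, 0 <= C /\ forall x, L x -> bn x <= C * bn (f x) + p x) ->
  exists C : R, 0 <= C /\ forall x, L x -> bn x <= C * bn (f x).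
Proof.
move=> bf fp; elim: fp L => [|{}p phi _ IH bphi] L linL clL injL [C [C0 hC]].
  by exists C; split=> // x Lx; rewrite (le_trans (hC x Lx)) // addr0.
have [phi0|] := pselect (forall x, L x -> phi x = 0).
  by apply: IH => //; exists C; split=> // x Lx;
    rewrite (le_trans (hC x Lx)) // phi0 // nm0 addr0.
move=> /existsNP[g0 /not_implyP[Lg0 /eqP pg0]].
have L0 : L 0 by have := linL (-1) _ _ Lg0 Lg0; rewrite scaleN1r addNr.
have LZ a x : L x -> L (a *: x) by move=> Lx; rewrite -[_ *: _]addr0; exact: linL.
pose g := (phi g0)^-1 *: g0; have Lg : L g by exact: LZ.
have pg : phi g = 1.
  rewrite (bopZ _ _ bphi) -[(phi g0)^-1 *: phi g0]/((phi g0)^-1 * phi g0).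
  by rewrite mulVf.
pose L' x := L x /\ phi x = 0.
have [M M0 hM] := bphi.2.
have linL' a x y : L' x -> L' y -> L' (a *: x + y).
  move=> [Lx px] [Ly py]; split; first exact: linL.
  by rewrite (bopP bphi) px py scaler0 addr0.
have clL' x : (forall e : R, 0 < e -> exists2 y, L' y & bn (y - x) < e) -> L' x.
  move=> h; split; first by apply: clL => e /h[y [Ly _] yx]; exists y.
  apply: (@bn_le0_eq _ (scalars R)) => e e0.
  have M10 : 0 < M + 1 by rewrite ltr_wpDl.
  have [y [_ py] yx] := h _ (divr_gt0 e0 M10).
  have -> : phi x = - phi (y - x) by rewrite (bopB _ _ bphi) py sub0r opprK.
  rewrite bnN (le_trans (hM _)) // (le_trans (ler_wpM2l M0 (ltW yx))) //.
  by rewrite mulrCA ger_pMr // ler_pdivrMr // mul1r lerDl.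
have injL' x : L' x -> f x = 0 -> x = 0 by move=> [Lx _]; exact: injL.
have [|K [K0 hK]] := IH L' linL' clL' injL'.
  exists C; split=> // x [Lx px].
  by rewrite (le_trans (hC x Lx)) // px nm0 addr0.
have [d d0 hd] : exists2 d : R, 0 < d & forall x, L' x -> d <= bn (f g - f x).
  apply: contrapT => hno.
  have near (k : nat) : exists2 x, L' x & bn (f g - f x) < 2^-1 ^+ k.
    apply: contrapT => h; apply: hno; exists (2^-1 ^+ k).
      by rewrite exprn_gt0 // invr_gt0.
    by move=> x Lx; rewrite leNgt; apply/negP => hx; apply: h; exists x.
  pose u k := projT1 (cid2 (near k)).
  have uL k : L' (u k) by rewrite /u; case: cid2.
  have ug k : bn (f g - f (u k)) < 2^-1 ^+ k by rewrite /u; case: cid2.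
  have linB x y : L' x -> L' y -> L' (x - y).
    by move=> Lx Ly; rewrite addrC -scaleN1r; exact: linL'.
  have [|l hl] := @geometric_cvg _ E u (2 * K).
    move=> k; rewrite (le_trans (hK _ (linB _ _ (uL _) (uL _)))) //.
    rewrite (bopB _ _ bf) [2 * K]mulrC -mulrA ler_wpM2l //.
    rewrite (le_trans (bn_tri (f g) _ _)) // bnC.
    have := ug k; have := ug k.+1; rewrite exprS.
    have : 0 <= 2^-1 ^+ k :> R by rewrite exprn_ge0 // invr_ge0.
    by move=> *; lra.
  have Ll : L' l.
    apply: clL' => e e0; have [n hn] := exists_half_lt (2 * (2 * K)) e0.
    by exists (u n) => //; exact: le_lt_trans (hl n) hn.
  have fgl : g = l.
    apply/eqP; rewrite -subr_eq0; apply/eqP/injL.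
      by rewrite addrC -scaleN1r; apply: linL => //; case: Ll.
    have [N N0 hN] := bf.2; apply: bn_le0_eq => e e0.
    have [n hn] := exists_half_lt (1 + N * (2 * (2 * K))) e0.
    rewrite (bopB _ _ bf) (le_trans (bn_tri (f (u n)) _ _)) //.
    rewrite (le_trans _ (ltW hn)) // mulrDl mul1r lerD ?(ltW (ug n)) //.
    rewrite -(bopB _ _ bf) (le_trans (hN _)) // -mulrA ler_wpM2l //.
  by have := oner_neq0 R[i]; rewrite -pg fgl; case: Ll => _ ->; rewrite eqxx.
have key x : L x -> nm (phi x) <= d^-1 * bn (f x).
  move=> Lx; have [->|px] := eqVneq (phi x) 0.
    by rewrite nm0 mulr_ge0 ?bn_ge0 // invr_ge0 ltW.
  pose x' := g - (phi x)^-1 *: x.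
  have Lx' : L' x'.
    split; first by rewrite /x' addrC -scaleNr; exact: linL.
    rewrite (bopB _ _ bphi) pg (bopZ _ _ bphi).
    by rewrite -[(phi x)^-1 *: phi x]/((phi x)^-1 * phi x) mulVf // subrr.
  have := hd _ Lx'; rewrite -(bopB _ _ bf) /x' subKr (bopZ _ _ bf) bnZ nmV.
  rewrite mulrC ler_pdivlMr ?nm_gt0 // => h.
  by rewrite mulrC ler_pdivlMr // mulrC.
apply: (IH L) => //; exists (C + d^-1); split.
  by rewrite addr_ge0 // invr_ge0 ltW.
move=> x Lx; have := hC x Lx; have := key x Lx; rewrite mulrDl; lra.
Qed.

(** The previous lemma applied to the complement of the kernel. *)
Lemma LF_proj_bound f (phi : E -> scalars R) e : bop f -> bop phi -> f e = 0 ->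
  (forall x, f x = 0 -> x = phi x *: e) -> phi e *: e = e -> LF f ->
  exists C : R, 0 <= C /\ forall x, bn (x - phi x *: e) <= C * bn (f x).
Proof.
move=> bf bphi fe kf ee [C [p [C0 fp] hC]].
pose P x := phi x *: e.
have bP : bop P by exact: bop_tensor.
pose L x := P x = 0.
have PP x : L (x - P x).
  rewrite /L (bopB _ _ bP) /P (bopZ _ _ bphi).
  by rewrite -[_ *: phi e]/(phi x * phi e) -scalerA ee subrr.
have [||||K [K0 hK]] := @lower_bound_reduce f L p bf fp.
- by move=> a x y Lx Ly; rewrite /L (bopP bP) Lx Ly scaler0 addr0.
- move=> x h; have [M M0 hM] := bP.2; apply: bn_le0_eq => r r0.
  have M10 : 0 < M + 1 by rewrite ltr_wpDl.
  have [y Ly yx] := h _ (divr_gt0 r0 M10).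
  have -> : P x = - P (y - x) by rewrite (bopB _ _ bP) Ly sub0r opprK.
  rewrite bnN (le_trans (hM _)) // (le_trans (ler_wpM2l M0 (ltW yx))) //.
  by rewrite mulrCA ger_pMr // ler_pdivrMr // mul1r lerDl.
- by move=> x Lx /kf ->.
- by exists C; split.
exists K; split=> // x; rewrite (le_trans (hK _ (PP x))) //.
by rewrite (bopB _ _ bf) (bopZ _ _ bf) fe scaler0 subr0.
Qed.

Lemma LF_closed_range f : bop f -> thin f -> LF f -> closed_range f.
Proof.
move=> bf tf hf y hy.
have [phi [e [bphi fe kf ee]]] := thin_proj bf tf.
have [C [C0 hC]] := LF_proj_bound bf bphi fe kf ee hf.
have near (k : nat) : exists x, bn (f x - y) < 2^-1 ^+ k.
  by apply: hy; rewrite exprn_gt0 // invr_gt0.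
pose u k := projT1 (cid (near k)).
have uy k : bn (f (u k) - y) < 2^-1 ^+ k := projT2 (cid (near k)).
pose v k := u k - phi (u k) *: e.
have fv k : f (v k) = f (u k).
  by rewrite (bopB _ _ bf) (bopZ _ _ bf) fe scaler0 subr0.
have bv x z : (x - phi x *: e) - (z - phi z *: e) = (x - z) - phi (x - z) *: e.
  by rewrite (bopB _ _ bphi) scalerBl; vec_eq.
have [|l hl] := @geometric_cvg _ E v (2 * C).
  move=> k; rewrite bv (le_trans (hC _)) // (bopB _ _ bf).
  rewrite [2 * C]mulrC -mulrA ler_wpM2l // (le_trans (bn_tri y _ _)) //.
  rewrite [X in _ + X]bnC; have := uy k; have := uy k.+1; rewrite exprS.
  have : 0 <= 2^-1 ^+ k :> R by rewrite exprn_ge0 // invr_ge0.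
  by move=> *; lra.
exists l; have [N N0 hN] := bf.2.
apply/eqP; rewrite -subr_eq0; apply/eqP/bn_le0_eq => r r0.
have [n hn] := exists_half_lt (N * (2 * (2 * C)) + 1) r0.
rewrite (le_trans (bn_tri (f (v n)) _ _)) // (le_trans _ (ltW hn)) // mulrDl mul1r.
rewrite lerD // ?fv ?(ltW (uy n)) // bnC -fv -(bopB _ _ bf) (le_trans (hN _)) //.
by rewrite -mulrA ler_wpM2l.
Qed.

(** By the open mapping theorem x is bounded by f x modulo the kernel, on which it is
    measured by one functional. *)
Lemma closed_range_LF f : bop f -> thin f -> closed_range f -> LF f.
Proof.
move=> bf tf cf.
have [phi [e [bphi fe kf ee]]] := thin_proj bf tf.
have [C C0 hC] := open_mapping bf cf.
have bP : bop (fun x => x - phi x *: e).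
  by apply: bop_sub; [exact: bop_id|exact: bop_tensor].
have [M M0 hM] := bP.2.
exists (M * C), (fun x => bn e * (0 + nm (phi x))) => [|x].
  split; first exact: mulr_ge0.
  apply: fsem_scale; first exact: bn_ge0.
  by apply: fsem_cons => //; exact: fsem_zero.
have [x' fx' bx'] := hC x.
have h : x - phi x *: e = x' - phi x' *: e.
  have /kf : f (x - x') = 0 by rewrite (bopB _ _ bf) fx' subrr.
  rewrite (bopB _ _ bphi) scalerBl => h.
  by rewrite -[X in X - _](subrK x') h; vec_eq.
rewrite (le_trans (bn_le_sub x (phi x *: e))) // addrC lerD //.
  by rewrite h (le_trans (hM _)) // -mulrA ler_wpM2l.
by rewrite bnZ add0r mulrC.
Qed.

Lemma thin_kernel_dim f : bop f -> thin f -> exists p, kernel_dim f p.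
Proof.
move=> bf tf; have [phi [e [bphi fe kf ee]]] := thin_proj bf tf.
have [e0|e0] := eqVneq e 0.
  exists 0%N, (fun _ => 0); split=> [[]//|x /kf|c _ []//].
  by rewrite e0 scaler0 => ->; exists (fun _ => 0); rewrite big_ord0.
exists 1%N, (fun _ => e); split=> // [x /kf hx|c].
  by exists (fun _ => phi x); rewrite big_ord1.
rewrite big_ord1 => /eqP; rewrite scaler_eq0 (negbTE e0) orbF => /eqP h i.
by rewrite ord1.
Qed.

End Thin.

Section FredholmAlternative.
Context {R : realType} {E : banach R}.
Implicit Types (f : E -> E).

(** The distance from e to M bounds the coordinate along e. *)
Lemma closed_add_line (M : set E) (e : E) :
  (forall a x y, M x -> M y -> M (a *: x + y)) -> M 0 ->
  (forall x, (forall r : R, 0 < r -> exists2 y, M y & bn (y - x) < r) -> M x) ->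
  ~ M e ->
  exists2 d : R, 0 < d & forall x c, M (x - c *: e) -> nm c * d <= bn x.
Proof.
move=> linM M0 clM Me.
have [d d0 hd] : exists2 d : R, 0 < d & forall y, M y -> d <= bn (y - e).
  apply: contrapT => h; apply: Me; apply: clM => r r0.
  apply: contrapT => h'; apply: h; exists r => // y My.
  by rewrite leNgt; apply/negP => lt; apply: h'; exists y.
exists d => // x c Mx; have [->|c0] := eqVneq c 0; first by rewrite nm0 mul0r bn_ge0.
have My : M (- c^-1 *: (x - c *: e)) by rewrite -[_ *: _]addr0; exact: linM.
have := hd _ My.
have -> : - c^-1 *: (x - c *: e) - e = - c^-1 *: x.
  rewrite scalerBr scalerA mulNr mulVf // scaleN1r opprK addrK //.
by rewrite bnZ nmN nmV mulrC ler_pdivlMr ?nm_gt0 // mulrC.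
Qed.

(** Along a convergent sequence of M + C e the coordinates on e form a Cauchy
    sequence, by the bound above. *)
Lemma closed_add_lineP (M : set E) (e : E) :
  (forall a x y, M x -> M y -> M (a *: x + y)) -> M 0 ->
  (forall x, (forall r : R, 0 < r -> exists2 y, M y & bn (y - x) < r) -> M x) ->
  forall x, (forall r : R, 0 < r -> exists2 y, (exists c, M (y - c *: e)) &
    bn (y - x) < r) -> exists c, M (x - c *: e).
Proof.
move=> linM M0 clM x hx; have [Me|nMe] := pselect (M e).
  exists 0; rewrite scale0r subr0; apply: clM => r /hx[y [c hc] yx]; exists y => //.
  by rewrite -[y](subrK (c *: e)) addrC; exact: linM.
have [d d0 hd] := closed_add_line linM M0 clM nMe.
have linL a y z : (exists c, M (y - c *: e)) -> (exists c, M (z - c *: e)) ->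
    exists c, M (a *: y + z - c *: e).
  move=> [c1 h1] [c2 h2]; exists (a * c1 + c2).
  by have := linM a _ _ h1 h2; congr M; vec_eq.
have near (k : nat) : exists p : E * R[i], M (p.1 - p.2 *: e) /\
    bn (p.1 - x) < 2^-1 ^+ k.
  have [|y [c hc] yx] := hx (2^-1 ^+ k); first by rewrite exprn_gt0 // invr_gt0.
  by exists (y, c).
pose u k := (projT1 (cid (near k))).1; pose c k := (projT1 (cid (near k))).2.
have [uc ux] : (forall k, M (u k - c k *: e)) /\ (forall k, bn (u k - x) < 2^-1 ^+ k).
  by split=> k; have [] := projT2 (cid (near k)).
have cdiff k m : nm (c k - c m) * d <= bn (u k - u m).
  apply: hd; have := linM (-1) _ _ (uc m) (uc k); congr M; vec_eq.
have [|l hl] := @geometric_cvg _ (scalars R) c (2 / d).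
  move=> k; rewrite mulrAC ler_pdivlMr // (le_trans (cdiff _ _)) //.
  rewrite (le_trans (bn_tri x _ _)) // [X in _ + X]bnC.
  have := ux k; have := ux k.+1; rewrite exprS.
  have : 0 <= 2^-1 ^+ k :> R by rewrite exprn_ge0 // invr_ge0.
  by move=> *; lra.
exists l; apply: clM => r r0.
have [n hn] := exists_half_lt (1 + 2 * (2 / d) * bn e) r0.
exists (u n - c n *: e) => //.
have -> : u n - c n *: e - (x - l *: e) = (u n - x) - (c n - l) *: e by vec_eq.
rewrite (le_lt_trans (bnB _ _)) // (le_lt_trans _ hn) // mulrDl mul1r lerD //.
  exact: ltW.
by rewrite bnZ mulrAC ler_wpM2r ?bn_ge0 //; exact: hl.
Qed.

(** The span of M and of all the e j with j different from i is closed, so that its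
    distance to e i is positive. *)
Lemma codim_coordinates_bounded (M : set E) q (e : 'I_q -> E) (i : 'I_q) :
  (forall a x y, M x -> M y -> M (a *: x + y)) -> M 0 ->
  (forall x, (forall r : R, 0 < r -> exists2 y, M y & bn (y - x) < r) -> M x) ->
  (forall c : 'I_q -> R[i], M (\sum_(i < q) c i *: e i) -> forall i, c i = 0) ->
  exists C : R, 0 <= C /\ forall x (c : 'I_q -> R[i]),
    M (x - \sum_(i < q) c i *: e i) -> nm (c i) <= C * bn x.
Proof.
move=> linM M0 clM indM.
pose L (s : seq 'I_q) (x : E) := exists2 c : 'I_q -> R[i],
  (forall j, j \notin s -> c j = 0) & M (x - \sum_(j < q) c j *: e j).
have LL s : [/\ forall a x y, L s x -> L s y -> L s (a *: x + y), L s 0 &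
    forall x, (forall r : R, 0 < r -> exists2 y, L s y & bn (y - x) < r) -> L s x].
  have lin t : forall a x y, L t x -> L t y -> L t (a *: x + y).
    move=> a x y [c1 k1 h1] [c2 k2 h2]; exists (fun j => a * c1 j + c2 j).
      by move=> j js; rewrite k1 // k2 // mulr0 addr0.
    have := linM a _ _ h1 h2; congr M.
    under [in RHS]eq_bigr do rewrite scalerDl -scalerA.
    by rewrite big_split /= -scaler_sumr; vec_eq.
  have L0 t : L t 0.
    by exists (fun _ => 0) => //; rewrite big1 ?subr0 // => j _; rewrite scale0r.
  elim: s => [|k s [_ _ IH]]; (split; [exact: lin|exact: L0|]).
    move=> x hx; exists (fun _ => 0) => //; rewrite big1 ?subr0 //; last first.
      by move=> j _; rewrite scale0r.
    apply: clM => r /hx[y [c hc h] yx]; exists y => //.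
    move: h; rewrite big1 ?subr0 // => j _.
    by rewrite hc ?in_nil // scale0r.
  move=> x hx; have [|c [c' hc' h]] := @closed_add_lineP _ (e k) (lin s) (L0 s) IH x.
    move=> r /hx[y [c hc h] yx]; exists y => //; exists (c k).
    exists (fun j => if j == k then 0 else c j).
      move=> j js; case: eqP => // /eqP jk; apply: hc.
      by rewrite inE negb_or jk.
    move: h; congr M; rewrite (bigD1 k) //= [in RHS](bigD1 k) //= eqxx scale0r add0r.
    rewrite opprD addrA; congr (_ - _ - _); apply: eq_bigr => j /negbTE -> //.
  exists (fun j => if j == k then c + c' k else c' j).
    move=> j; rewrite inE negb_or => /andP[/negbTE -> js]; exact: hc'.
  move: h; congr M; rewrite (bigD1 k) //= [in RHS](bigD1 k) //= eqxx scalerDl.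
  have -> : \sum_(j < q | j != k) (if j == k then c + c' k else c' j) *: e j =
      \sum_(j < q | j != k) c' j *: e j by apply: eq_bigr => j /negbTE ->.
  by vec_eq.
have [lin L0 cl] := LL [seq j <- enum 'I_q | j != i].
have notin : ~ L [seq j <- enum 'I_q | j != i] (e i).
  move=> [c hc h].
  have := indM (fun j => (j == i)%:R - c j).
  have -> : \sum_(j < q) ((j == i)%:R - c j) *: e j = e i - \sum_(j < q) c j *: e j.
    under eq_bigr do rewrite scalerBl.
    rewrite sumrB; congr (_ - _); rewrite (bigD1 i) //= eqxx scale1r big1 ?addr0 //.
    by move=> j /negbTE ->; rewrite scale0r.
  move=> /(_ h i); rewrite eqxx hc ?subr0 => [/eqP|].
    by rewrite oner_eq0.
  by rewrite mem_filter eqxx.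
have [d d0 hd] := closed_add_line lin L0 cl notin.
exists d^-1; split; first by rewrite invr_ge0 ltW.
move=> x c Mx; rewrite mulrC ler_pdivlMr //; apply: hd.
exists (fun j => if j == i then 0 else c j).
  by move=> j; rewrite mem_filter mem_enum andbT negbK => ->.
move: Mx; congr M; rewrite (bigD1 i) //= [in RHS](bigD1 i) //= eqxx scale0r add0r.
rewrite opprD addrA; congr (_ - _ - _); apply: eq_bigr => j /negbTE -> //.
Qed.

(** The parametrix sends y to the preimage, in the complement of the kernel, of the
    component of y in the range; it is bounded because the operator is bounded
    below there and the coordinates in the cokernel are bounded. *)
Lemma fredholm_FP f q : bop f -> thin f -> closed_range f -> range_codim f q ->
  FP f.
Proof.
move=> bf tf cf [e' [sp ind]].
have hLF := closed_range_LF bf tf cf.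
have [phi [e [bphi fe kf ee]]] := thin_proj bf tf.
have [C [C0 hC]] := LF_proj_bound bf bphi fe kf ee hLF.
pose P x := x - phi x *: e.
have bP : bop P by apply: bop_sub; [exact: bop_id|exact: bop_tensor].
have fP x : f (P x) = f x by rewrite /P (bopB _ _ bf) (bopZ _ _ bf) fe scaler0 subr0.
have P0 x : f x = 0 -> P x = 0 by move=> /kf h; rewrite /P -h subrr.
have Pe : P e = 0 by exact: P0.
have PP x : P (P x) = P x by rewrite {2}/P (bopB _ _ bP) (bopZ _ _ bP) Pe scaler0 subr0.
pose M y := exists x, f x = y.
have linM a x y : M x -> M y -> M (a *: x + y).
  by move=> [x1 <-] [y1 <-]; exists (a *: x1 + y1); rewrite (bopP bf).
have M0 : M 0 by exists 0; rewrite (bop_0 bf).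
have clM x : (forall r : R, 0 < r -> exists2 y, M y & bn (y - x) < r) -> M x.
  by move=> h; apply: cf => r /h[_ [y <-] yx]; exists y.
have indM (c : 'I_q -> R[i]) : M (\sum_(i < q) c i *: e' i) -> forall i, c i = 0.
  by move=> [x /esym]; exact: ind.
have dec y : exists p : ('I_q -> R[i]) * E, y - \sum_(i < q) p.1 i *: e' i = f p.2
    /\ P p.2 = p.2.
  by have [c [x h]] := sp y; exists (c, P x); rewrite fP PP.
pose g i y := (projT1 (cid (dec y))).1 i : scalars R.
pose B y := (projT1 (cid (dec y))).2.
have [gB PB] : (forall y, y - \sum_(i < q) g i y *: e' i = f (B y)) /\
    (forall y, P (B y) = B y).
  by split=> y; have [] := projT2 (cid (dec y)).
have guniq y (c : 'I_q -> R[i]) x i : y - \sum_(i < q) c i *: e' i = f x -> g i y = c i.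
  move=> h; apply/eqP; rewrite -subr_eq0; apply/eqP.
  apply: (ind (fun i => g i y - c i) (x - B y)).
  under eq_bigr do rewrite scalerBl.
  rewrite big_split /= sumrN (bopB _ _ bf) -h -gB; vec_eq.
have Buniq y x : y - \sum_(i < q) g i y *: e' i = f x -> B y = P x.
  move=> h; apply/eqP; rewrite -subr_eq0 -PB -(bopB _ _ bP); apply/eqP/P0.
  by rewrite (bopB _ _ bf) -gB -h subrr.
have bg i : bop (g i).
  split=> [a x y|].
    apply: (guniq _ (fun i => a *: g i x + g i y) (a *: B x + B y)).
    rewrite (bopP bf) -!gB; under eq_bigr do rewrite scalerDl -scalerA.
    by rewrite big_split -scaler_sumr /=; vec_eq.
  have [K [K0 hK]] := codim_coordinates_bounded i linM M0 clM indM.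
  by exists K => // y; apply: (hK _ (fun i => g i y)); exists (B y).
have hF : frank (fun y => \sum_(i < q) g i y *: e' i).
  have aux (s : seq 'I_q) : frank (fun y => \sum_(i <- s) g i y *: e' i).
    elim: s => [|i s IH].
      by apply: frank_ext (@frank_zero R E E) => y; rewrite big_nil.
    apply: frank_ext (frank_cons (e' i) IH (bg i)) => y.
    by rewrite big_cons addrC.
  exact: aux.
have bB : bop B.
  split=> [a x y|].
    rewrite (Buniq (a *: x + y) (a *: B x + B y)); first by rewrite (bopP bP) !PB.
    by rewrite (bopP bf) -!gB (bopP (frank_bop hF)); vec_eq.
  have bI : bop (fun y => y - \sum_(i < q) g i y *: e' i).
    by apply: bop_sub; [exact: bop_id|exact: frank_bop].
  have [K K0 hK] := bI.2; exists (C * K); first exact: mulr_ge0.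
  move=> y; rewrite -PB (le_trans (hC _)) // -mulrA ler_wpM2l //.
  by rewrite -gB.
exists B => //; split.
  apply: ap_ext (apN (frank_ap hF)) => y; rewrite -gB; vec_eq.
apply: ap_ext (apN (frank_ap (frank_tensor e bphi))) => x.
rewrite (Buniq (f x) x); first by rewrite /P; vec_eq.
have -> : \sum_(i < q) g i (f x) *: e' i = 0; last by rewrite subr0.
apply: big1 => i _; rewrite (guniq _ (fun _ => 0) x) ?scale0r // big1 ?subr0 //.
by move=> j _; rewrite scale0r.
Qed.

Lemma frank_sum f : frank f -> exists k (phi : 'I_k -> E -> scalars R) (e : 'I_k -> E),
  (forall i, bop (phi i)) /\ forall x, f x = \sum_(i < k) phi i x *: e i.
Proof.
elim=> [|g psi e0 _ [k [phi [e [bphi ge]]]] bpsi].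
  exists 0%N, (fun _ _ => 0), (fun _ => 0); split=> [[]//|x].
  by rewrite big_ord0.
exists k.+1, (fun i => if unlift ord0 i is Some j then phi j else psi),
  (fun i => if unlift ord0 i is Some j then e j else e0); split.
  by move=> i; case: unliftP => [j _|_].
move=> x; rewrite ge big_ord_recl unlift_none addrC; congr (_ + _).
by apply: eq_bigr => i _; rewrite liftK.
Qed.

(** The right parametrix writes every vector as an element of the range plus one of
    a finite dimensional space; a spanning family of least size is a basis. *)
Lemma FP_codim f : bop f -> FP f -> exists q, range_codim f q.
Proof.
move=> bf [B bB [h1 _]].
have h20 : 0 < 2^-1 :> R by rewrite invr_gt0.
have [r fr hr] := h1.2 _ h20.
have [bV [W [bW WV VW]]] : isom (fun x => x + (f (B x) - x - r x)).
  by apply: isom_perturb => //; apply: bop_sub; [exact: h1.1|exact: frank_bop].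
have sp : exists k, `[< exists e : 'I_k -> E,
    forall y, exists (c : 'I_k -> R[i]) x, y - \sum_(i < k) c i *: e i = f x >].
  have [k [phi [e [_ he]]]] := frank_sum (frank_compr bW (frankN fr)).
  exists k; apply/asboolP; exists e => y; exists (fun i => phi i y), (B (W y)).
  by rewrite -he -{1}(VW y); vec_eq.
have [q /asboolP[e he] qmin] := ex_minnP sp; exists q, e; split=> // c x hcx i.
apply: contrapT => /eqP ci.
case: q e he qmin c hcx i ci => [|q] e he qmin c hcx i ci; first by case: i ci.
suff /qmin : `[< exists e' : 'I_q -> E, forall y, exists (c' : 'I_q -> R[i]) x',
    y - \sum_(j < q) c' j *: e' j = f x' >] by rewrite ltnn.
apply/asboolP; exists (fun j => e (lift i j)) => y.
have [d [z hz]] := he y.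
exists (fun j => d (lift i j) - d i / c i * c (lift i j)), (z + (d i / c i) *: x).
rewrite (bopD _ _ bf) (bopZ _ _ bf) -hz -hcx (bigD1_ord i) //=.
rewrite [in RHS](bigD1_ord i) //=; under eq_bigr do rewrite scalerBl -scalerA.
rewrite sumrB -scaler_sumr scalerDr scalerA divfK //; vec_eq.
Qed.

End FredholmAlternative.

Section Weyl.
Context {R : realType} {E : banach R}.
Implicit Types (f : E -> E).

(** For 1 + s u with u : E -> C^k and s : C^k -> E, the kernel and the cokernel
    are those of the matrix 1 + u s, whose dimensions agree. *)
Lemma IF_dims f : IF f -> exists p, kernel_dim f p /\ range_codim f p.
Proof.
move=> [V [bV [W [bW WV VW]]] hF].
have [k [phi [e [bphi he]]]] := frank_sum (frank_compl bW hF).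
pose u x : 'rV[R[i]]_k := \row_i phi i x.
pose s (c : 'rV[R[i]]_k) : E := \sum_(i < k) c 0 i *: e i.
have uP a x y : u (a *: x + y) = a *: u x + u y.
  by apply/rowP => i; rewrite !mxE (bopP (bphi i)).
have uB x y : u (x - y) = u x - u y.
  by rewrite addrC -scaleN1r uP scaleN1r addrC.
have uD x y : u (x + y) = u x + u y by have := uP 1 x y; rewrite !scale1r.
have u0 : u 0 = 0 by rewrite -(subrr (0 : E)) uB subrr.
have sP a c d : s (a *: c + d) = a *: s c + s d.
  rewrite /s scaler_sumr -big_split; apply: eq_bigr => i _.
  by rewrite !mxE scalerDl scalerA.
have s0 : s 0 = 0 by rewrite /s big1 // => i _; rewrite mxE scale0r.
have sN c : s (- c) = - s c by have := sP (-1) c 0; rewrite s0 !scaleN1r !addr0.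
have sZ a c : s (a *: c) = a *: s c by have := sP a c 0; rewrite s0 !addr0.
have ssum p (A : 'M[R[i]]_(p, k)) (d : 'I_p -> R[i]) :
    s (\row_i d i *m A) = \sum_(i < p) d i *: s (row i A).
  rewrite mulmx_sum_row (big_morph s (id1 := 0) (op1 := +%R)) //; last first.
    by move=> x y; have := sP 1 x y; rewrite !scale1r.
  by apply: eq_bigr => i _; rewrite sZ mxE.
pose Phi : 'M[R[i]]_k := \matrix_(i, j) phi j (e i).
have us c : u (s c) = c *m Phi.
  apply/rowP => i; rewrite !mxE (bop_sum _ _ _ (bphi i)); apply: eq_bigr => j _.
  by rewrite (bopZ _ _ (bphi i)) !mxE.
pose M : 'M[R[i]]_k := 1%:M + Phi.
have mM c : c *m M = c + c *m Phi by rewrite mulmxDr mulmx1.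
have fE x : f x = V (x + s (u x)).
  have -> : s (u x) = W (f x - V x).
    by rewrite he; apply: eq_bigr => i _; rewrite mxE.
  by rewrite (bopD _ _ bV) VW addrCA subrr addr0.
have f0 x : f x = 0 -> x + s (u x) = 0.
  by rewrite fE => h; rewrite -(WV (x + _)) h (bop_0 bW).
have fran y : (u (W y) <= M)%MS -> exists x, y = f x.
  move=> /submxP[c hc]; exists (W y - s c).
  have ux : u (W y - s c) = c by rewrite uB us hc mM addrK.
  by rewrite fE ux subrK VW.
have franM x : (u (W (f x)) <= M)%MS.
  by rewrite fE WV uD us -mM submxMl.
have rk : \rank (kermx M) = \rank (M^C)%MS by rewrite mxrank_ker mxrank_compl.
exists (\rank (kermx M)); split.
  pose K := row_base (kermx M).
  have KM : K *m M = 0.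
    by apply/eqP; rewrite -sub_kermx eq_row_base.
  have KPhi (d : 'rV_ _) : d *m K *m Phi = - (d *m K).
    apply/eqP; rewrite -addr_eq0 addrC -mM -mulmxA KM mulmx0 //.
  have Ks (d : 'I_ _ -> R[i]) :
      \sum_i d i *: (- s (row i K)) = - s (\row_i d i *m K).
    by rewrite ssum -sumrN; apply: eq_bigr => i _; rewrite scalerN.
  exists (fun i => - s (row i K)); split=> [i|x /f0 hx|d].
  - have -> : - s (row i K) = - s (delta_mx 0 i *m K) by rewrite -rowE.
    rewrite fE -sN us mulNmx KPhi opprK sN addNr (bop_0 bV) //.
  - have /submxP[d hd] : (u x <= K)%MS.
      by rewrite eq_row_base sub_kermx mM -us -uD hx u0.
    exists (fun i => d 0 i); rewrite Ks.
    have -> : \row_i d 0 i = d by apply/rowP => i; rewrite mxE.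
    by rewrite -hd; apply/eqP; rewrite -addr_eq0 hx.
  - rewrite Ks => /eqP; rewrite oppr_eq0 => /eqP h i.
    have := us (\row_i d i *m K); rewrite h u0 KPhi => /esym/eqP.
    rewrite oppr_eq0 => /eqP h0.
    have /(row_free_inj (row_base_free (kermx M))) : \row_i d i *m K = 0 *m K.
      by rewrite mul0mx.
    by move=> /rowP/(_ i); rewrite !mxE.
rewrite rk; pose K := row_base (M^C)%MS.
have Ks (d : 'I_ _ -> R[i]) :
    \sum_i d i *: V (- s (row i K)) = V (- s (\row_i d i *m K)).
  rewrite ssum -sumrN (bop_sum _ _ _ bV); apply: eq_bigr => i _.
  by rewrite -scalerN (bopZ _ _ bV).
exists (fun i => V (- s (row i K))); split=> [y|d x].
  have : (u (W y) <= M + M^C)%MS by rewrite submx_full // addsmx_compl_full.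
  move=> /sub_addsmxP[[a b] /= hab].
  have /submxP[d hd] : (b *m M^C <= K)%MS by rewrite eq_row_base submxMl.
  exists (fun i => d 0 i); apply: fran; rewrite Ks (bopB _ _ bW) WV opprK.
  have -> : \row_i d 0 i = d by apply/rowP => i; rewrite mxE.
  by rewrite uD us hab hd -addrA -mM addmx_sub ?submxMl.
rewrite Ks => h.
have h1 : (\row_i d i *m K *m Phi <= M)%MS.
  by have := franM x; rewrite -h WV -sN us mulNmx eqmx_opp.
have h2 : (\row_i d i *m K <= M)%MS.
  rewrite -[\row_i d i *m K](addrK (\row_i d i *m K *m Phi)) -mM.
  by rewrite addmx_sub ?submxMl // eqmx_opp.
have h3 : (\row_i d i *m K <= M :&: M^C)%MS.
  by rewrite sub_capmx h2 /= (submx_trans (submxMl _ _)) // eq_row_base.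
have /(row_free_inj (row_base_free (M^C)%MS)) : \row_i d i *m K = 0 *m K.
  by apply/eqP; rewrite mul0mx -submx0 -(capmx_compl M).
by move=> /rowP hd i; have := hd i; rewrite !mxE.
Qed.

Lemma bijective_isom f : bop f -> (forall x, f x = 0 -> x = 0) ->
  (forall y, exists x, f x = y) -> isom f.
Proof.
move=> bf injf sf.
have [C C0 hC] : exists2 C : R, 0 <= C & forall x, exists2 x', f x' = f x &
    bn x' <= C * bn (f x).
  by apply: open_mapping => // y _; exact: sf.
apply: (isom_bijective bf C0) => // x; have [x' fx' h] := hC x.
suff xx : x = x' by rewrite {1}xx.
by apply/eqP; rewrite -subr_eq0; apply/eqP/injf; rewrite (bopB _ _ bf) fx' subrr.
Qed.

(** A thin kernel has dimension 0 or 1. In the second case adding the rank one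
    operator that maps the kernel onto a complement of the range makes the
    operator bijective. *)
Lemma dims_IF f p : bop f -> thin f -> kernel_dim f p -> range_codim f p -> IF f.
Proof.
move=> bf [phi bphi hphi] [e [fe kf ie]] [e' [sp ind]].
case: p e fe kf ie e' sp ind => [|[|p]] e fe kf ie e' sp ind.
- apply: isom_IF; apply: bijective_isom => // [x /kf[c ->]|y]; first by rewrite big_ord0.
  by have [c [x]] := sp y; rewrite big_ord0 subr0 => ->; exists x.
- have e0 : e 0 != 0.
    apply/eqP => e0; have := ie (fun _ => 1); rewrite big_ord1 e0 scaler0.
    by move=> /(_ erefl 0)/eqP; rewrite oner_eq0.
  have pe : phi (e 0) != 0 by apply: contra_neq e0 => /(hphi _ (fe 0)).
  have hfr : frank (fun x => phi x *: e' 0) by exact: frank_tensor.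
  exists (fun x => f x + phi x *: e' 0); last first.
    by apply: frank_ext (frankN hfr) => x; vec_eq.
  apply: bijective_isom => [|x h|y].
  + by apply: bop_add => //; exact: frank_bop.
  + have px : phi x = 0.
      apply: (ind (fun _ => phi x) (- x)) 0; rewrite big_ord1 (bopN _ bf).
      by apply/eqP; rewrite -addr_eq0 addrC h.
    by apply: hphi => //; move: h; rewrite px scale0r addr0.
  + have [c [x]] := sp y; rewrite big_ord1 => hx.
    exists (x + ((c 0 - phi x) / phi (e 0)) *: e 0).
    rewrite (bopD _ _ bf) (bopZ _ _ bf) fe scaler0 addr0 -hx.
    rewrite (bopD _ _ bphi) (bopZ _ _ bphi).
    rewrite -[_ *: phi (e 0)]/(_ / _ * _) divfK // addrCA subrr addr0.
    by rewrite subrK.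
have i01 : lift ord0 (ord0 : 'I_p.+1) != ord0 :> 'I_p.+2 by [].
pose x := phi (e (lift ord0 ord0)) *: e ord0 - phi (e ord0) *: e (lift ord0 ord0).
have x0 : x = 0.
  apply: hphi; first by rewrite /x (bopB _ _ bf) !(bopZ _ _ bf) !fe !scaler0 subrr.
  rewrite (bopB _ _ bphi) !(bopZ _ _ bphi).
  by rewrite -[_ *: phi (e ord0)]/(_ * _) -[phi (e ord0) *: _]/(_ * _) mulrC subrr.
have pe i : phi (e i) = 0 -> False.
  move=> /(hphi _ (fe i)) ei; have := ie (fun j => (j == i)%:R).
  rewrite (bigD1 i) //= eqxx scale1r ei add0r big1; last first.
    by move=> j /negbTE ->; rewrite scale0r.
  by move=> /(_ erefl i)/eqP; rewrite eqxx oner_eq0.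
exfalso; apply: (pe (lift ord0 ord0)).
have := ie (fun j => if j == ord0 then phi (e (lift ord0 ord0))
  else if j == lift ord0 ord0 then - phi (e ord0) else 0).
rewrite (bigD1 ord0) //= (bigD1 (lift ord0 ord0)) //= big1; last first.
  by move=> j /andP[/negbTE -> /negbTE ->]; rewrite scale0r.
by rewrite addr0 scaleNr; move=> /(_ x0 ord0).
Qed.

End Weyl.
(** * Integration on the circle *)

Section CircleBasics.
Context {R : realType}.
Local Notation C := R[i].
Local Notation T := (circle R).
Local Notation mu := (@circle_measure R).

(** A named projection, which simplification does not unfold. *)
Definition pt (z : T) : C := val z.

Lemma nm_circle (z : T) : nm (pt z) = 1.
Proof. by apply: complexI; rewrite -normE; exact/eqP/(valP z). Qed.

Lemma pt_rot (a z : T) : pt (rotate_circle a z) = pt a * pt z.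
Proof. by []. Qed.

Lemma cisD (s t : R) : pt (cis (s + t)) = pt (cis s) * pt (cis t).
Proof. by rewrite /pt /= cosD sinD; apply/eqP; rewrite eq_complex /= eqxx addrC mulrC [sin t * _]mulrC eqxx. Qed.

Lemma cisX (t : R) n : pt (cis t) ^+ n = pt (cis (n%:R * t)).
Proof.
elim: n => [|n IH]; first by rewrite mul0r /pt /= cos0 sin0.
by rewrite exprS IH -cisD; congr (pt (cis _)); rewrite -natr1; ring.
Qed.

Lemma cis2pi (t : R) : cis (t + 2 * pi) = cis t.
Proof.
apply: val_inj => /=; rewrite [2 * pi]mulr_natl.
by rewrite (cosD2pi t) (sinD2pi t).
Qed.

Lemma cis_pi : pt (cis (pi : R)) = -1 :> C.
Proof. by rewrite /pt /= cospi sinpi; apply/eqP; rewrite eq_complex /= oppr0 !eqxx. Qed.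

Lemma cis_surj (z : T) : exists2 t : R, 0 <= t < 2 * pi & cis t = z.
Proof.
case: z => [[a b] hz]; have ab : a ^+ 2 + b ^+ 2 = 1.
  move: (hz); rewrite normE => /eqP/complexI /= h.
  by rewrite -[LHS]sqr_sqrtr ?addr_ge0 ?sqr_ge0 // h expr1n.
have a1 : -1 <= a <= 1.
  rewrite -ler_norml -(@ler_pXn2r _ 2) ?nnegrE // expr1n -ab real_normK ?num_real //.
  by rewrite lerDl sqr_ge0.
have pi0 := pi_gt0 R.
have ca : cos (acos a) = a by apply: acosK; rewrite in_itv.
have sa : sin (acos a) = `|b|.
  rewrite sin_acos // -sqrtr_sqr; congr Num.sqrt; rewrite -ab; ring.
have ac0 := acos_ge0 a1; have acpi := acos_lepi a1.
have [b0|b0] := leP 0 b.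
  exists (acos a); first by rewrite ac0 /=; lra.
  by apply: val_inj; rewrite /= ca sa ger0_norm.
exists (2 * pi - acos a); last first.
  apply: val_inj => /=; rewrite addrC -[cos _]/(complex.Re (pt (cis _))).
  rewrite -[sin _]/(complex.Im (pt (cis (- acos a + 2 * pi)))) cis2pi /=.
  by rewrite cosN sinN ca sa ltr0_norm // opprK.
rewrite subr_ge0 gtrBl; apply/andP; split; first by lra.
rewrite lt_neqAle ac0 andbT; apply/eqP => h.
by move: sa; rewrite -h sin0 ltr0_norm // => /eqP; rewrite eq_sym oppr_eq0 lt_eqF.
Qed.

Lemma circle_measurable_fun d' (U : measurableType d') (g : T -> U) :
  measurable_fun [set: R] (g \o @cis R) -> measurable_fun setT g.
Proof.
move=> mg _ A mA; rewrite setTI; have := mg measurableT A mA; rewrite setTI.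
by rewrite comp_preimage.
Qed.

Definition cmeas (f : T -> C) := complex_measurable f.

Lemma cmeas_ext (f g : T -> C) : f =1 g -> cmeas f -> cmeas g.
Proof. by move=> /funext ->. Qed.
Lemma cmeas_cst (c : C) : cmeas (fun _ => c).
Proof. by split; exact: measurable_cst. Qed.
Lemma cmeasD (f g : T -> C) : cmeas f -> cmeas g -> cmeas (fun z => f z + g z).
Proof.
move=> [f1 f2] [g1 g2]; split.
  by under eq_fun do rewrite ReD; exact: measurable_funD.
by under eq_fun do rewrite ImD; exact: measurable_funD.
Qed.
Lemma cmeasM (f g : T -> C) : cmeas f -> cmeas g -> cmeas (fun z => f z * g z).
Proof.
move=> [f1 f2] [g1 g2].
have E z : f z * g z =
  (complex.Re (f z) * complex.Re (g z) - complex.Im (f z) * complex.Im (g z)) +i*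
  (complex.Re (f z) * complex.Im (g z) + complex.Im (f z) * complex.Re (g z)).
  by case: (f z) (g z) => a b [].
split; under eq_fun do rewrite E /=.
  by apply: measurable_funB; exact: measurable_funM.
by apply: measurable_funD; exact: measurable_funM.
Qed.
Lemma cmeas_conj (f : T -> C) : cmeas f -> cmeas (fun z => (f z)^*%C).
Proof.
move=> [f1 f2]; split.
  by rewrite (_ : (fun z => _) = (fun z => complex.Re (f z))) //;
    apply/funext => z; case: (f z).
rewrite (_ : (fun z => _) = (fun z => - complex.Im (f z))).
  exact: measurableT_comp.
by apply/funext => z; case: (f z).
Qed.
Lemma cmeasN (f : T -> C) : cmeas f -> cmeas (fun z => - f z).
Proof.
move=> hf; apply: cmeas_ext (cmeasM (cmeas_cst (-1)) hf) => z.
by rewrite mulN1r.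
Qed.
Lemma cmeasB (f g : T -> C) : cmeas f -> cmeas g -> cmeas (fun z => f z - g z).
Proof. by move=> hf /cmeasN; exact: cmeasD. Qed.
Lemma cmeas_id : cmeas pt.
Proof.
split; apply: circle_measurable_fun.
  apply: continuous_measurable_fun; exact: continuous_cos.
apply: continuous_measurable_fun; exact: continuous_sin.
Qed.
Lemma cmeasX (f : T -> C) n : cmeas f -> cmeas (fun z => f z ^+ n).
Proof.
move=> hf; elim: n => [|n IH]; first exact: cmeas_cst.
by apply: cmeas_ext (cmeasM hf IH) => z; rewrite exprS.
Qed.
Lemma cmeas_sum (I : Type) (s : seq I) (F : I -> T -> C) :
  (forall i, cmeas (F i)) -> cmeas (fun z => \sum_(i <- s) F i z).
Proof.
move=> hF; elim: s => [|i s IH].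
  by apply: cmeas_ext (cmeas_cst 0) => z; rewrite big_nil.
by apply: cmeas_ext (cmeasD (hF i) IH) => z; rewrite big_cons.
Qed.
Lemma cmeas_nm (f : T -> C) : cmeas f -> measurable_fun setT (fun z => nm (f z)).
Proof.
move=> [f1 f2].
rewrite (_ : (fun z => _) = Num.sqrt \o
  (fun z => complex.Re (f z) ^+ 2 + complex.Im (f z) ^+ 2)); last first.
  by apply/funext => z /=; case: (f z).
apply: measurableT_comp.
  exact: (continuous_measurable_fun (@sqrt_continuous R)).
by apply: measurable_funD; exact: measurable_funX.
Qed.
Lemma cmeas_rot (f : T -> C) a : cmeas f -> cmeas (f \o rotate_circle a).
Proof.
have mr : measurable_fun setT (rotate_circle a).
  apply: circle_measurable_fun; have [s _ <-] := cis_surj a.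
  rewrite (_ : _ \o _ = @cis R \o (fun t => s + t)); last first.
    by apply/funext => t; apply: val_inj; rewrite /= -[LHS]cisD.
  apply: measurableT_comp; first exact: measurable_cis.
  exact: measurable_funD.
by move=> [f1 f2]; split;
  [exact: (measurableT_comp f1)|exact: (measurableT_comp f2)].
Qed.

Lemma measurable_rot a : measurable_fun setT (@rotate_circle R a).
Proof.
apply: circle_measurable_fun; have [s _ <-] := cis_surj a.
rewrite (_ : _ \o _ = @cis R \o (fun t => s + t)); last first.
  by apply/funext => t; apply: val_inj; rewrite /= -[LHS]cisD.
apply: measurableT_comp; first exact: measurable_cis.
exact: measurable_funD.
Qed.

(** ** Rotation invariance *)

Lemma lebesgue_translation (s : R) (A : set R) : measurable A ->
  lebesgue_measure ((fun t => s + t) @^-1` A) = lebesgue_measure A.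
Proof.
have ms : measurable_fun [set: R] (fun t : R => s + t) by exact: measurable_funD.
pose nu : {measure set (measurableTypeR R) -> \bar R} :=
  measure_function_pushforward__canonical__measure_function_Measure
  (@lebesgue_measure R) (ms : @measurable_fun _ _ (measurableTypeR R) (measurableTypeR R) setT _).
move=> mA; apply/esym; apply: (@lebesgue_measure_unique R nu) => // X.
move=> [[a b] _ <-] /=; rewrite /pushforward.
have -> : (fun t => s + t) @^-1` `]a, b] = `](a - s), (b - s)]%classic.
  by apply/seteqP; split=> t /=; rewrite !in_itv /= ltrBlDl lerBrDl.
by rewrite !lebesgue_measure_itv /= !lte_fin ltrD2r; case: ifP => // _;
  rewrite -!EFinB; congr (_%:E); ring.
Qed.

Lemma circle_measureE (A : set T) : circle_measure A =
  (((2 * pi)^-1)%:E * lebesgue_measure ((@cis R) @^-1` A `&` `[0%R, (2 * pi)%R[))%E.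
Proof. by []. Qed.

(** Turning by e^(is) translates the angles by s; the part of the translated
    interval that leaves [0, 2 pi[ is brought back by the period. *)
Theorem circle_measure_rot (a : T) (A : set T) : measurable A ->
  mu (rotate_circle a @^-1` A) = mu A.
Proof.
move=> mA; have [s /andP[s0 s2] <-] := cis_surj a; rewrite !circle_measureE.
congr (_ * _)%E.
pose B := (@cis R) @^-1` A; have mB : measurable B by exact: mA.
have mI (x y : R) : measurable (B `&` `[x, y[%classic).
  by apply: measurableI => //; exact: measurable_itv.
have BE t : B (t + 2 * pi) = B t by rewrite /B /= cis2pi.
have -> : (@cis R) @^-1` (rotate_circle (cis s) @^-1` A) `&` `[0%R, 2 * pi[ =
    (fun t => s + t) @^-1` (B `&` `[s, (s + 2 * pi)%R[).
  apply/seteqP; split=> t /= [h]; rewrite /B /= !in_itv /= => ht.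
    split; last by rewrite lerDl ltrD2l.
    by congr A : h; apply: val_inj; rewrite [RHS]cisD.
  split; last by move: ht; rewrite lerDl ltrD2l.
  by congr A : h; apply: val_inj; rewrite [LHS]cisD.
rewrite lebesgue_translation //.
have split2 (x y z : R) : x <= y -> y <= z ->
    lebesgue_measure (B `&` `[x, z[%classic) =
    (lebesgue_measure (B `&` `[x, y[%classic) + lebesgue_measure (B `&` `[y, z[%classic))%E.
  move=> xy yz; rewrite -measureU; [|exact: mI|exact: mI|].
    congr lebesgue_measure; rewrite -setIUr; congr (_ `&` _).
    apply/seteqP; split=> t /=; rewrite !in_itv /=.
      by move=> /andP[-> tz]; rewrite tz andbT /= ; case: ltP => h; [left|right].
    by move=> [/andP[-> ty]|/andP[yt ->]]; rewrite ?andbT /=; [exact: lt_le_trans ty yz|exact: le_trans xy yt].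
  apply/seteqP; split=> // t [[_]] /=; rewrite !in_itv /= => /andP[_ ty] [_ /andP[yt _]].
  by have := lt_le_trans ty yt; rewrite ltxx.
have pi20 : 0 <= 2 * pi :> R by rewrite mulr_ge0 // pi_ge0.
rewrite (split2 s (2 * pi)) //; [|exact: ltW|by rewrite lerDr].
rewrite (split2 0 s (2 * pi)) // ?(ltW s2) // addeC; congr (_ + _)%E.
rewrite -(lebesgue_translation (2 * pi)) //; congr lebesgue_measure.
apply/seteqP; split=> t /= []; rewrite -(BE t) addrC !in_itv /= => hB ht; split=> //.
  by case/andP: ht => h1 h2; apply/andP; split; lra.
by case/andP: ht => h1 h2; apply/andP; split; lra.
Qed.

(** ** Real and complex integrals *)

Implicit Types (g h : T -> R).

Definition rint (g : T -> R) := mu.-integrable setT (EFin \o g).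
Definition rI (g : T -> R) : R := Rintegral mu setT g.

Lemma rint_meas g : rint g -> measurable_fun setT g.
Proof. by move=> /measurable_int /measurable_EFinP. Qed.
Lemma rint_cst c : rint (fun _ => c).
Proof. by apply: finite_measure_integrable_cst. Qed.
Lemma rint_dom g h : measurable_fun setT g -> rint h ->
  (forall z, `|g z| <= h z) -> rint g.
Proof.
move=> mg ih gh; apply: le_integrable ih => //; first exact/measurable_EFinP.
by move=> z _ /=; rewrite lee_fin (le_trans (gh z)) // ler_norm.
Qed.
Lemma rint_bounded g B : measurable_fun setT g -> (forall z, `|g z| <= B) -> rint g.
Proof. by move=> mg gB; apply: rint_dom (rint_cst B) _. Qed.
Lemma rintD g h : rint g -> rint h -> rint (fun z => g z + h z).
Proof. by move=> ig ih; have := integrableD measurableT ig ih. Qed.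
Lemma rintZ c g : rint g -> rint (fun z => c * g z).
Proof. by move=> ig; have := integrableZl measurableT c ig. Qed.
Lemma rint_ext g h : g =1 h -> rint g -> rint h.
Proof. by move=> /funext ->. Qed.
Lemma rintN g : rint g -> rint (fun z => - g z).
Proof. by move=> ig; apply: rint_ext (rintZ (-1) ig) => z; rewrite mulN1r. Qed.
Lemma rintB g h : rint g -> rint h -> rint (fun z => g z - h z).
Proof. by move=> ig /rintN; exact: rintD. Qed.
Lemma rint_norm g : rint g -> rint (fun z => `|g z|).
Proof. by move=> /integrable_norm. Qed.
Lemma rI_ext g h : g =1 h -> rI g = rI h.
Proof. by move=> /funext ->. Qed.
Lemma rID g h : rint g -> rint h -> rI (fun z => g z + h z) = rI g + rI h.
Proof. by move=> ig ih; exact: RintegralD. Qed.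
Lemma rIB g h : rint g -> rint h -> rI (fun z => g z - h z) = rI g - rI h.
Proof. by move=> ig ih; exact: RintegralB. Qed.
Lemma rIZ c g : rint g -> rI (fun z => c * g z) = c * rI g.
Proof. by move=> ig; exact: RintegralZl. Qed.
Lemma rI_cst c : rI (fun _ => c) = c.
Proof. by rewrite /rI Rintegral_cst //= (_ : circle_measure _ = 1%E) ?mulr1 //; exact: circle_measureT. Qed.
Lemma rI_ge0 g : (forall z, 0 <= g z) -> 0 <= rI g.
Proof. by move=> g0; apply: Rintegral_ge0. Qed.
Lemma le_rI g h : rint g -> rint h -> (forall z, g z <= h z) -> rI g <= rI h.
Proof. by move=> ig ih gh; apply: le_Rintegral. Qed.
Lemma rI_norm g : rint g -> `|rI g| <= rI (fun z => `|g z|).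
Proof. by move=> ig; exact: le_normr_Rintegral. Qed.
Lemma rI_EFin g : rint g -> (\int[mu]_z (g z)%:E = (rI g)%:E)%E.
Proof. by move=> ig; rewrite fineK //; exact: integrable_fin_num. Qed.
Lemma rint_ge0P g M : measurable_fun setT g -> (forall z, 0 <= g z) ->
  (\int[mu]_z (g z)%:E <= M%:E)%E -> rint g /\ rI g <= M.
Proof.
move=> mg g0 h; have ig : rint g.
  apply/integrableP; split; first exact/measurable_EFinP.
  under eq_integral do rewrite /= ger0_norm //.
  exact: le_lt_trans h (ltry _).
by split=> //; rewrite -lee_fin -rI_EFin.
Qed.
Lemma rint_ae g h : measurable_fun setT h -> rint g ->
  {ae mu, forall z, g z = h z} -> rint h /\ rI h = rI g.
Proof.
move=> mh ig gh; have ih : rint h.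
  apply/integrableP; split; first exact/measurable_EFinP.
  rewrite (_ : (\int[mu]_x `|(EFin \o h) x| = \int[mu]_x `|(EFin \o g) x|)%E).
    by case/integrableP : ig.
  apply: ae_eq_integral => //.
  - by apply/measurableT_comp => //; exact/measurable_EFinP.
  - by apply: measurableT_comp => //; case/integrableP : ig.
  - by apply: filterS gh => z /= -> _.
split=> //; congr fine; apply: ae_eq_integral => //.
- exact/measurable_EFinP.
- by case/integrableP : ig.
- by apply: filterS gh => z /= -> _.
Qed.

Lemma rI_rot g a : rint g -> rint (g \o rotate_circle a) /\
  rI (g \o rotate_circle a) = rI g.
Proof.
move=> ig; have mr := measurable_rot a.
have mg : measurable_fun setT (EFin \o g) by case/integrableP : ig.
have meq (A : set T) : measurable A -> A `<=` setT ->
    mu A = pushforward mu (rotate_circle a) A.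
  by move=> mA _; rewrite /pushforward circle_measure_rot.
have i1 : rint (g \o rotate_circle a).
  apply/integrableP; split; first exact: (measurableT_comp mg).
  case/integrableP : (ig) => _; rewrite (eq_measure_integral _ meq).
  by rewrite ge0_integral_pushforward //; exact: measurableT_comp.
split=> //; congr fine; rewrite [RHS](eq_measure_integral _ meq).
exact: esym (integral_pushforward mr mg i1 measurableT).
Qed.

Definition cint (f : T -> C) := cmeas f /\ rint (fun z => nm (f z)).
Definition cI (f : T -> C) : C :=
  rI (fun z => complex.Re (f z)) +i* rI (fun z => complex.Im (f z)).
Implicit Types f : T -> C.

Lemma cint_ext f f' : f =1 f' -> cint f -> cint f'.
Proof. by move=> /funext ->. Qed.
Lemma cI_ext f f' : f =1 f' -> cI f = cI f'.
Proof. by move=> /funext ->. Qed.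
Lemma cint_dom f (h : T -> R) : cmeas f -> rint h -> (forall z, nm (f z) <= h z) -> cint f.
Proof.
move=> mf ih fh; split=> //; apply: rint_dom ih _; first exact: cmeas_nm.
by move=> z; rewrite ger0_norm ?nm_ge0.
Qed.
Lemma cint_bounded f B : cmeas f -> (forall z, nm (f z) <= B) -> cint f.
Proof. by move=> mf fB; apply: cint_dom (rint_cst B) fB. Qed.
Lemma cint_Re f : cint f -> rint (fun z => complex.Re (f z)).
Proof. by move=> [[mf _] i]; apply: rint_dom i _ => // z; exact: Re_nm. Qed.
Lemma cint_Im f : cint f -> rint (fun z => complex.Im (f z)).
Proof. by move=> [[_ mf] i]; apply: rint_dom i _ => // z; exact: Im_nm. Qed.
Lemma cintD f f' : cint f -> cint f' -> cint (fun z => f z + f' z).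
Proof.
move=> [mf hf] [mg hg]; apply: cint_dom (rintD hf hg) _; first exact: cmeasD.
by move=> z; exact: nmD.
Qed.
Lemma cintM f f' B : cint f -> cmeas f' -> (forall z, nm (f' z) <= B) ->
  cint (fun z => f z * f' z).
Proof.
move=> [mf hf] mg gB; apply: cint_dom (rintZ B hf) _; first exact: cmeasM.
by move=> z; rewrite nmM mulrC ler_wpM2r ?nm_ge0.
Qed.
Lemma cintZ c f : cint f -> cint (fun z => c * f z).
Proof.
move=> hf; apply: cint_ext (cintM hf (cmeas_cst c) (fun=> lexx _)) => z.
by rewrite mulrC.
Qed.
Lemma cintB f f' : cint f -> cint f' -> cint (fun z => f z - f' z).
Proof.
move=> hf hg; apply: cint_ext (cintD hf (cintZ (-1) hg)) => z.
by rewrite mulN1r.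
Qed.
Lemma cID f f' : cint f -> cint f' -> cI (fun z => f z + f' z) = cI f + cI f'.
Proof.
move=> hf hg; rewrite /cI (rI_ext (fun z => ReD (f z) (f' z))).
rewrite (rI_ext (fun z => ImD (f z) (f' z))).
by rewrite (rID (cint_Re hf) (cint_Re hg)) (rID (cint_Im hf) (cint_Im hg)).
Qed.
Lemma cIZ c f : cint f -> cI (fun z => c * f z) = c * cI f.
Proof.
move=> hf; case: c => a b; rewrite /cI.
have -> : rI (fun z => complex.Re ((a +i* b) * f z)) =
    rI (fun z => a * complex.Re (f z) - b * complex.Im (f z)).
  by apply: rI_ext => z; case: (f z).
have -> : rI (fun z => complex.Im ((a +i* b) * f z)) =
    rI (fun z => a * complex.Im (f z) + b * complex.Re (f z)).
  by apply: rI_ext => z; case: (f z).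
rewrite rIB ?rID ?rIZ //; do ?[exact: rintZ (cint_Re hf)|exact: rintZ (cint_Im hf)
  |exact: cint_Re|exact: cint_Im].
Qed.
Lemma cIB f f' : cint f -> cint f' -> cI (fun z => f z - f' z) = cI f - cI f'.
Proof.
move=> hf hg; have -> : cI f - cI f' = cI f + (-1) * cI f' by rewrite mulN1r.
rewrite -cIZ // -cID //; last exact: cintZ.
by apply: cI_ext => z; rewrite mulN1r.
Qed.
Lemma cI_cst c : cI (fun _ => c) = c.
Proof. by case: c => a b; rewrite /cI !rI_cst. Qed.
Lemma cint_sum (I : Type) (s : seq I) (F : I -> T -> C) :
  (forall i, cint (F i)) -> cint (fun z => \sum_(i <- s) F i z).
Proof.
move=> hF; elim: s => [|i s IH].
  apply: cint_ext (cint_bounded (cmeas_cst 0) (fun=> lexx _)) => z.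
  by rewrite big_nil.
by apply: cint_ext (cintD (hF i) IH) => z; rewrite big_cons.
Qed.
Lemma cI_sum (I : Type) (s : seq I) (F : I -> T -> C) :
  (forall i, cint (F i)) -> cI (fun z => \sum_(i <- s) F i z) = \sum_(i <- s) cI (F i).
Proof.
move=> hF; elim: s => [|i s IH].
  by rewrite big_nil -[RHS]cI_cst; apply: cI_ext => z; rewrite big_nil.
rewrite big_cons -IH -cID //; last exact: cint_sum.
by apply: cI_ext => z; rewrite big_cons.
Qed.
Lemma nm_cI f : cint f -> nm (cI f) <= rI (fun z => nm (f z)).
Proof.
move=> hf; have [->|n0] := eqVneq (cI f) 0.
  by rewrite nm0; apply: rI_ge0 => z; exact: nm_ge0.
pose u := (cI f)^*%C / (nm (cI f))%:C.
have nn : 0 < nm (cI f) by rewrite nm_gt0.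
have u1 : nm u = 1.
  by rewrite nmM nmV nm_conj nmR_ge0 ?ltW // mulfV ?gt_eqF.
have E : u * cI f = (nm (cI f))%:C.
  have h : (cI f)^*%C * cI f = (nm (cI f) ^+ 2)%:C.
    by rewrite mulrC -sqr_normc normE rmorphXn.
  rewrite /u mulrAC h expr2 rmorphM mulfK //.
  by apply: contraNneq n0 => /complexI/eqP; rewrite nm_eq0.
have -> : nm (cI f) = complex.Re (cI (fun z => u * f z)) by rewrite cIZ // E.
rewrite /cI /=; apply: le_rI; first exact/cint_Re/cintZ.
  exact: hf.2.
by move=> z; rewrite (le_trans (ler_norm _)) // (le_trans (Re_nm _)) // nmM u1 mul1r.
Qed.
Lemma cI_rot f a : cint f -> cint (f \o rotate_circle a) /\ cI (f \o rotate_circle a) = cI f.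
Proof.
move=> hf; split; first by split; [exact: cmeas_rot hf.1|exact: (rI_rot a hf.2).1].
by rewrite /cI -(rI_rot a (cint_Re hf)).2 -(rI_rot a (cint_Im hf)).2.
Qed.
Lemma cint_ae f f' : cmeas f' -> cint f -> {ae mu, forall z, f z = f' z} ->
  cint f' /\ cI f' = cI f.
Proof.
move=> mf' hf ff'; split.
  split=> //; apply: (rint_ae (cmeas_nm mf') hf.2 _).1.
  by apply: filterS ff' => z ->.
rewrite /cI (rint_ae mf'.1 (cint_Re hf) _).2; last by apply: filterS ff' => z ->.
by rewrite (rint_ae mf'.2 (cint_Im hf) _).2 //; apply: filterS ff' => z ->.
Qed.

(** ** Orthogonality of the characters *)

Lemma circle_conj (z : T) : pt z * (pt z)^*%C = 1.
Proof. by rewrite -sqr_normc normE nm_circle rmorph1 expr1n. Qed.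

Lemma cmeas_char k l : cmeas (fun z : T => pt z ^+ k * (pt z)^*%C ^+ l).
Proof. by apply: cmeasM; apply: cmeasX; [exact: cmeas_id|exact/cmeas_conj/cmeas_id]. Qed.

Lemma nm_char k l (z : T) : nm (pt z ^+ k * (pt z)^*%C ^+ l) = 1.
Proof. by rewrite nmM !nmX nm_conj nm_circle !expr1n mulr1. Qed.

Lemma cint_char k l : cint (fun z : T => pt z ^+ k * (pt z)^*%C ^+ l).
Proof. by apply: (cint_bounded (cmeas_char k l)) => z; rewrite nm_char. Qed.

Lemma cI_char k l : cI (fun z : T => pt z ^+ k * (pt z)^*%C ^+ l) = (k == l)%:R.
Proof.
have aux (m j i : nat) : (0 < m)%N -> (j = i + m \/ i = j + m)%N ->
    cI (fun z : T => pt z ^+ j * (pt z)^*%C ^+ i) = 0.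
  move=> m0 hji; pose a := cis (pi / m%:R : R).
  have am : pt a ^+ m = -1.
    by rewrite cisX mulrCA mulfV ?mulr1 ?pnatr_eq0 -?lt0n // cis_pi.
  have aji : pt a ^+ j * (pt a)^*%C ^+ i = -1.
    case: hji => ->; rewrite exprD.
      by rewrite mulrAC -exprMn circle_conj expr1n mul1r am.
    rewrite mulrA -exprMn circle_conj expr1n mul1r -rmorphXn.
    by rewrite am rmorphN rmorph1.
  have [_] := cI_rot a (cint_char j i).
  have -> : (fun z : T => pt z ^+ j * (pt z)^*%C ^+ i) \o rotate_circle a =
      fun z => -1 * (pt z ^+ j * (pt z)^*%C ^+ i).
    by apply/funext => z; rewrite /comp -aji pt_rot rmorphM !exprMn mulrACA.
  rewrite cIZ ?mulN1r; last exact: cint_char.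
  set X := cI _ => /eqP; rewrite eq_sym -addr_eq0 -mulr2n mulrn_eq0 => /eqP.
  by [].
case: (ltngtP k l) => [kl|lk|->].
- by rewrite (aux (l - k)%N) ?subn_gt0 //; right; rewrite subnKC // ltnW.
- by rewrite (aux (k - l)%N) ?subn_gt0 //; left; rewrite subnKC // ltnW.
- rewrite -[RHS](cI_cst 1); apply: cI_ext => z.
  by rewrite -exprMn circle_conj expr1n.
Qed.

Lemma cmeas_poly n (c : nat -> C) :
  cmeas (fun z : T => \sum_(k < n) c k * pt z ^+ k).
Proof.
by apply: cmeas_sum => k; apply: cmeasM; [exact: cmeas_cst|exact: (cmeasX _ cmeas_id)].
Qed.

Lemma nm_poly_le n (c : nat -> C) (z : T) :
  nm (\sum_(k < n) c k * pt z ^+ k) <= \sum_(k < n) nm (c k).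
Proof.
rewrite (le_trans (nm_sum _ _ _)) //; apply: ler_sum => k _.
by rewrite nmM nmX nm_circle expr1n mulr1.
Qed.

Lemma parseval n (c : nat -> C) :
  rI (fun z : T => nm (\sum_(k < n) c k * pt z ^+ k) ^+ 2) = \sum_(k < n) nm (c k) ^+ 2.
Proof.
have sq (w : C) : w * w^*%C = (nm w ^+ 2)%:C.
  by rewrite -sqr_normc normE rmorphXn.
pose F (z : T) := \sum_(k < n) c k * pt z ^+ k.
have -> : rI (fun z => nm (F z) ^+ 2) = complex.Re (cI (fun z => F z * (F z)^*%C)).
  by rewrite /cI /=; apply: rI_ext => z; rewrite sq.
have FE z : F z * (F z)^*%C =
    \sum_(k < n) \sum_(l < n) (c k * (c l)^*%C) * (pt z ^+ k * (pt z)^*%C ^+ l).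
  rewrite /F rmorph_sum mulr_suml; apply: eq_bigr => k _.
  rewrite mulr_sumr; apply: eq_bigr => l _.
  by rewrite rmorphM rmorphXn mulrACA.
have ci k l : cint (fun z : T => (c k * (c l)^*%C) * (pt z ^+ k * (pt z)^*%C ^+ l)).
  exact/cintZ/cint_char.
rewrite (cI_ext FE) cI_sum; last by move=> k; apply: cint_sum => l; exact: ci.
rewrite Re_sum; apply: eq_bigr => k _.
rewrite cI_sum; last by move=> l; exact: ci.
rewrite (bigD1 k) //= big1 ?addr0; last first.
  move=> l lk; rewrite cIZ ?cI_char; last exact: cint_char.
  by rewrite eq_sym (negbTE lk : (l == k :> nat) = false) mulr0.
by rewrite cIZ ?cI_char ?eqxx ?mulr1 ?sq //; exact: cint_char.
Qed.

End CircleBasics.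

(** * Power series *)

Section PowerSeries.
Context {R : realType}.
Local Notation C := R[i].
Local Notation T := (circle R).
Implicit Types (a b : nat -> C) (z l : C) (r s q M : R).

Lemma exists_pow_lt q (B e : R) : 0 <= q < 1 -> 0 < e ->
  exists N, forall n, (N <= n)%N -> B * q ^+ n < e.
Proof.
move=> /andP[q0 q1] e0.
have B1 : 0 < `|B| + 1 by rewrite ltr_wpDl.
have : q ^+ n @[n --> \oo] --> (0 : R) by apply: cvg_expr; rewrite ger0_norm.
move=> /cvgrPdist_lt/(_ _ (divr_gt0 e0 B1))[N _ hN]; exists N => n /hN /=.
rewrite sub0r normrN ger0_norm ?exprn_ge0 // ltr_pdivlMr // mulrC.
apply: le_lt_trans; rewrite ler_wpM2r ?exprn_ge0 //.
by rewrite (le_trans (ler_norm _)) // lerDl.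
Qed.

Lemma tends_unique (u : nat -> C) l l' : tends u l -> tends u l' -> l = l'.
Proof.
move=> h h'; apply/eqP; rewrite -subr_eq0 -nm_eq0 eq_le nm_ge0 andbT.
apply/ler_addgt0Pr => e e0; have e2 : 0 < e / 2 by rewrite divr_gt0.
have [N hN] := h _ e2; have [N' hN'] := h' _ e2.
rewrite add0r (le_trans (nm_tri (u (maxn N N')) _ _)) // [e]splitr lerD //.
  by rewrite nmC ltW // hN // leq_maxl.
by rewrite ltW // hN' // leq_maxr.
Qed.
Lemma tendsD (u v : nat -> C) l l' : tends u l -> tends v l' ->
  tends (fun n => u n + v n) (l + l').
Proof.
move=> h h' e e0; have e2 : 0 < e / 2 by rewrite divr_gt0.
have [N hN] := h _ e2; have [N' hN'] := h' _ e2; exists (maxn N N') => k.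
rewrite geq_max => /andP[k1 k2]; rewrite opprD addrACA (le_lt_trans (nmD _ _)) //.
by rewrite [e]splitr ltrD ?hN ?hN'.
Qed.
Lemma tendsZ c (u : nat -> C) l : tends u l -> tends (fun n => c * u n) (c * l).
Proof.
move=> h e e0; have c1 : 0 < nm c + 1 by rewrite ltr_wpDl ?nm_ge0.
have [N hN] := h _ (divr_gt0 e0 c1); exists N => k /hN.
rewrite ltr_pdivlMr // -mulrBr nmM => hk; apply: le_lt_trans hk.
by rewrite mulrC ler_wpM2l ?nm_ge0 // lerDl.
Qed.
Lemma tends_ext (u v : nat -> C) l : (forall n, u n = v n) -> tends u l -> tends v l.
Proof. by move=> /funext ->. Qed.
Lemma tends_nm_le (u : nat -> C) l (B : R) : tends u l ->
  (exists N, forall n, (N <= n)%N -> nm (u n) <= B) -> nm l <= B.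
Proof.
move=> h [N hB]; apply/ler_addgt0Pr => e e0; have [N' hN'] := h _ e0.
have := hN' _ (leq_maxr N N'); have := hB _ (leq_maxl N N').
have := nm_tri (u (maxn N N')) l 0; rewrite !subr0 nmC; lra.
Qed.
Lemma tendsM (u v : nat -> C) l l' : tends u l -> tends v l' ->
  tends (fun n => u n * v n) (l * l').
Proof.
move=> h h'; have [N0 h0] := h' 1 ltr01.
have Bv : forall n, (N0 <= n)%N -> nm (v n) <= nm l' + 1.
  by move=> n /h0 hn; have := nm_tri l' (v n) 0; rewrite !subr0; lra.
move=> e e0; set K := nm l' + 1 in Bv; set L := nm l + 1.
have K0 : 0 < K by rewrite /K ltr_wpDl ?nm_ge0.
have L0 : 0 < L by rewrite /L ltr_wpDl ?nm_ge0.
have [N1 h1] := h _ (divr_gt0 e0 (mulr_gt0 (ltr0Sn R 1) K0)).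
have [N2 h2] := h' _ (divr_gt0 e0 (mulr_gt0 (ltr0Sn R 1) L0)).
exists (maxn N0 (maxn N1 N2)) => k; rewrite !geq_max => /andP[k0 /andP[k1 k2]].
have -> : u k * v k - l * l' = (u k - l) * v k + l * (v k - l') by ring.
rewrite (le_lt_trans (nmD _ _)) // !nmM [e]splitr.
have := h1 k k1; have := h2 k k2; rewrite !ltr_pdivlMr ?mulr_gt0 // => a2 a1.
have b1 : nm (u k - l) * nm (v k) <= nm (u k - l) * K.
  by rewrite ler_wpM2l ?nm_ge0 // Bv.
have b2 : nm l * nm (v k - l') <= L * nm (v k - l').
  by rewrite ler_wpM2r ?nm_ge0 // /L lerDl.
have c1 : nm (u k - l) * K < e / 2 by rewrite ltr_pdivlMr // -mulrA [K * _]mulrC.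
have c2 : L * nm (v k - l') < e / 2.
  rewrite ltr_pdivlMr //; apply: le_lt_trans a2; rewrite le_eqVlt; apply/orP; left; apply/eqP; ring.
by apply: ltrD; [exact: le_lt_trans c1|exact: le_lt_trans c2].
Qed.

Definition cbd a r M := forall k, nm (a k) * r ^+ k <= M.

Lemma cbd_ge0 a r M : cbd a r M -> 0 <= M.
Proof. by move=> /(_ 0%N); rewrite expr0 mulr1; exact: le_trans (nm_ge0 _). Qed.

(** The sum of the power series a at z, a total function of z. *)
Definition pev a z : C := xget 0 [set l | tends (fun n => \sum_(k < n) a k * z ^+ k) l].

Lemma geometric_tail (u : nat -> C) M q : 0 <= q < 1 ->
  (forall k, nm (u k) <= M * q ^+ k) ->
  forall n m, nm (\sum_(k < n + m) u k - \sum_(k < n) u k) <= M * q ^+ n / (1 - q).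
Proof.
move=> /andP[q0 q1] hu n m.
have M0 : 0 <= M by have := le_trans (nm_ge0 _) (hu 0%N); rewrite expr0 mulr1.
have d0 : 0 < 1 - q by rewrite subr_gt0.
have -> : \sum_(k < n + m) u k - \sum_(k < n) u k = \sum_(k < m) u (n + k)%N.
  by rewrite big_split_ord /= addrAC subrr add0r.
suff h : \sum_(k < m) nm (u (n + k)%N) * (1 - q) <= M * q ^+ n * (1 - q ^+ m).
  rewrite (le_trans (nm_sum _ _ _)) // ler_pdivlMr // mulr_suml (le_trans h) //.
  by rewrite ler_piMr ?mulr_ge0 ?exprn_ge0 // gerBl exprn_ge0.
elim: m => [|m IH]; first by rewrite big_ord0 expr0 subrr mulr0.
rewrite big_ord_recr /=; have h1 := hu (n + m)%N.
have h2 := ler_wpM2r (ltW d0) h1; rewrite (le_trans (lerD IH h2)) //.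
rewrite exprD exprS le_eqVlt; apply/orP; left; apply/eqP; ring.
Qed.

(** Convergence at a geometric rate inside the radius; the later exchanges of
    limits rest on this estimate. *)
Lemma pev_tail a r M q z : cbd a r M -> 0 < r -> 0 <= q < 1 -> nm z <= q * r ->
  forall n, nm (pev a z - \sum_(k < n) a k * z ^+ k) <= M * q ^+ n / (1 - q).
Proof.
move=> ha r0 hq zq; have /andP[q0 q1] := hq.
have hu k : nm (a k * z ^+ k) <= M * q ^+ k.
  have h : nm z ^+ k <= (q * r) ^+ k.
    by apply: lerXn2r zq; rewrite nnegrE ?nm_ge0 ?mulr_ge0 // ltW.
  rewrite nmM nmX (le_trans (ler_wpM2l (nm_ge0 _) h)) //.
  by rewrite exprMn mulrCA mulrC ler_wpM2r ?exprn_ge0.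
have ht := geometric_tail hq hu.
have [l hl] : exists l, tends (fun n => \sum_(k < n) a k * z ^+ k) l.
  apply: complex_complete => e e0; have e2 : 0 < e / 2 by rewrite divr_gt0.
  have [N hN] := exists_pow_lt (M / (1 - q)) hq e2.
  exists N => k m Nk Nm; rewrite (le_lt_trans (nm_tri (\sum_(j < N) a j * z ^+ j) _ _)) //.
  have hNN := hN N (leqnn _); rewrite mulrAC in hNN.
  rewrite [e]splitr ltrD //; last rewrite nmC.
    by have := ht N (k - N)%N; rewrite subnKC // => h; exact: le_lt_trans h hNN.
  by have := ht N (m - N)%N; rewrite subnKC // => h; exact: le_lt_trans h hNN.
have hp : tends (fun n => \sum_(k < n) a k * z ^+ k) (pev a z).
  by rewrite /pev; case: xgetP => [x -> //|/(_ l)].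
move=> n; apply/ler_addgt0Pr => e e0; have [N hN] := hp _ e0.
rewrite (le_trans (nm_tri (\sum_(k < n + N) a k * z ^+ k) _ _)) // addrC lerD //.
by rewrite nmC ltW // hN // leq_addl.
Qed.

Lemma pevP a r M z : cbd a r M -> nm z < r ->
  tends (fun n => \sum_(k < n) a k * z ^+ k) (pev a z).
Proof.
move=> ha zr; have r0 : 0 < r by exact: le_lt_trans (nm_ge0 _) zr.
have hq : 0 <= nm z / r < 1.
  by rewrite divr_ge0 ?nm_ge0 ?(ltW r0) // ltr_pdivrMr // mul1r.
have ht : nm z <= nm z / r * r by rewrite divfK // gt_eqF.
move=> e e0; have [N hN] := exists_pow_lt (M / (1 - nm z / r)) hq e0.
exists N => n /hN; rewrite mulrAC nmC; apply: le_lt_trans.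
exact: pev_tail ha r0 hq ht n.
Qed.

Lemma pev_eq a z l : tends (fun n => \sum_(k < n) a k * z ^+ k) l -> pev a z = l.
Proof.
move=> h; rewrite /pev; case: xgetP => [x -> hx|/(_ l)//].
exact: tends_unique hx h.
Qed.

Lemma cbd_le a r s M : 0 <= r <= s -> cbd a s M -> cbd a r M.
Proof.
move=> /andP[r0 rs] ha k; rewrite (le_trans _ (ha k)) // ler_wpM2l ?nm_ge0 //.
by apply: lerXn2r; rewrite ?nnegrE // (le_trans r0).
Qed.

Lemma pev_le a r M q z : cbd a r M -> 0 < r -> 0 <= q < 1 -> nm z <= q * r ->
  nm (pev a z) <= M / (1 - q).
Proof.
move=> ha r0 hq zq; have := pev_tail ha r0 hq zq 0.
by rewrite big_ord0 subr0 expr0 mulr1.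
Qed.

(** ** The series on circles inside the disc of convergence *)

Definition dil a r : T -> C := fun z : T => pev a (r%:C * pt z).

Lemma nm_rpt r (z : T) : 0 <= r -> nm (r%:C * pt z) = r.
Proof. by move=> r0; rewrite nmM nm_circle mulr1 nmR_ge0. Qed.

Section Circles.
Variables (a : nat -> C) (s r M : R).
Hypotheses (ha : cbd a s M) (r0 : 0 <= r) (rs : r < s).

Let s0 : 0 < s. Proof. exact: le_lt_trans r0 rs. Qed.
Let q := r / s.
Let hq : 0 <= q < 1.
Proof. by rewrite divr_ge0 ?(ltW s0) // ltr_pdivrMr // mul1r. Qed.
Let zq (z : T) : nm (r%:C * pt z) <= q * s.
Proof. by rewrite nm_rpt // divfK // gt_eqF. Qed.
Let S n (z : T) := \sum_(k < n) (a k * r%:C ^+ k) * pt z ^+ k.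
Let SE n (z : T) : S n z = \sum_(k < n) a k * (r%:C * pt z) ^+ k.
Proof. by apply: eq_bigr => k _; rewrite exprMn mulrA. Qed.

Lemma dil_tail n (z : T) :
  nm (dil a r z - S n z) <= M * q ^+ n / (1 - q).
Proof. by rewrite SE; exact: pev_tail ha s0 hq (zq z) n. Qed.

Lemma dil_le (z : T) : nm (dil a r z) <= M / (1 - q).
Proof. exact: pev_le ha s0 hq (zq z). Qed.

Lemma cmeas_dil : cmeas (dil a r).
Proof.
have lim (g : C -> R) (z : T) : (forall x y, `|g x - g y| <= nm (x - y)) ->
    g (S n z) @[n --> \oo] --> g (dil a r z).
  move=> hg; apply/cvgrPdist_lt => e e0.
  have [N hN] := exists_pow_lt (M / (1 - q)) hq e0.
  exists N => // n /= /hN; rewrite mulrAC; apply: le_lt_trans.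
  by rewrite (le_trans (hg _ _)) // dil_tail.
have mS n := cmeas_poly n (fun k => a k * r%:C ^+ k).
split.
  apply: (measurable_fun_cvg (fun n => (mS n).1)) => z _.
  by apply: lim => x y; rewrite -ReN -ReD Re_nm.
apply: (measurable_fun_cvg (fun n => (mS n).2)) => z _.
by apply: lim => x y; rewrite -ImN -ImD Im_nm.
Qed.

Lemma cint_dil : cint (dil a r).
Proof. exact: cint_bounded cmeas_dil dil_le. Qed.

Lemma dil_small_tail (e : R) : 0 < e -> exists N, forall n, (N <= n)%N ->
  forall z : T, nm (dil a r z - S n z) < e.
Proof.
move=> e0; have [N hN] := exists_pow_lt (M / (1 - q)) hq e0.
exists N => n /hN; rewrite mulrAC => h z; exact: le_lt_trans (dil_tail n z) h.
Qed.

Lemma cint_S n : cint (S n).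
Proof.
apply: (@cint_bounded _ _ (\sum_(k < n) nm (a k * r%:C ^+ k))).
  exact: cmeas_poly n (fun k => a k * r%:C ^+ k).
by move=> z; exact: nm_poly_le n (fun k => a k * r%:C ^+ k) z.
Qed.

(** The series may be integrated term by term, and the characters are orthonormal. *)
Lemma dil_coef (l : nat) : cI (fun z : T => dil a r z * (pt z)^*%C ^+ l) = a l * r%:C ^+ l.
Proof.
apply/eqP; rewrite -subr_eq0 -nm_eq0 eq_le nm_ge0 andbT.
apply/ler_addgt0Pr => e e0; rewrite add0r.
have [N hN] := dil_small_tail e0; pose n := maxn N l.+1.
have mc : cmeas (fun z : T => (pt z)^*%C ^+ l) by exact/cmeasX/cmeas_conj/cmeas_id.
have n1 (z : T) : nm ((pt z)^*%C ^+ l) <= 1 by rewrite nmX nm_conj nm_circle expr1n.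
have <- : cI (fun z : T => S n z * (pt z)^*%C ^+ l) = a l * r%:C ^+ l.
  have ci k : cint (fun z : T => (a k * r%:C ^+ k) * (pt z ^+ k * (pt z)^*%C ^+ l)).
    exact/cintZ/cint_char.
  rewrite (@cI_ext _ _ (fun z : T => \sum_(k < n) (a k * r%:C ^+ k) * (pt z ^+ k * (pt z)^*%C ^+ l))).
    rewrite cI_sum; last by move=> k; exact: ci.
    rewrite (bigD1 (Ordinal (leq_maxr N l.+1))) //= big1 ?addr0.
      by rewrite cIZ ?cI_char ?eqxx ?mulr1 //; exact: cint_char.
    move=> k kl; rewrite cIZ ?cI_char; last exact: cint_char.
    by rewrite (negbTE kl : (k == l :> nat) = false) mulr0.
  by move=> z; rewrite mulr_suml; apply: eq_bigr => k _; rewrite mulrA.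
rewrite -cIB; [|exact: cintM cint_dil mc n1|exact: cintM (cint_S n) mc n1].
rewrite (le_trans (nm_cI _)) //.
  by apply: cintB; [exact: cintM cint_dil mc n1|exact: cintM (cint_S n) mc n1].
rewrite -[X in _ <= X](rI_cst e); apply: le_rI; last first.
- move=> z; rewrite -mulrBl nmM nmX nm_conj nm_circle expr1n mulr1.
  by rewrite ltW // hN // leq_maxl.
- exact: rint_cst.
- by case: (cintB (cintM cint_dil mc n1) (cintM (cint_S n) mc n1)).
Qed.

Lemma nm_coef_le (l : nat) : nm (a l) * r ^+ l <= rI (fun z : T => nm (dil a r z)).
Proof.
have -> : nm (a l) * r ^+ l = nm (a l * r%:C ^+ l).
  by rewrite nmM nmX nmR_ge0.
have mc : cmeas (fun z : T => (pt z)^*%C ^+ l) by exact/cmeasX/cmeas_conj/cmeas_id.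
have n1 (z : T) : nm ((pt z)^*%C ^+ l) <= 1 by rewrite nmX nm_conj nm_circle expr1n.
rewrite -dil_coef (le_trans (nm_cI _)) //; first exact: cintM cint_dil mc n1.
rewrite le_eqVlt; apply/orP; left; apply/eqP/rI_ext => z.
by rewrite nmM nmX nm_conj nm_circle expr1n mulr1.
Qed.

Lemma cauchy_bound (B : R) (l : nat) : (forall z : T, nm (dil a r z) <= B) ->
  nm (a l) * r ^+ l <= B.
Proof.
move=> hB; rewrite (le_trans (nm_coef_le l)) // -[X in _ <= X]rI_cst.
by apply: le_rI => //; [case: cint_dil|exact: rint_cst].
Qed.

Lemma rint_dil_sqr : rint (fun z : T => nm (dil a r z) ^+ 2).
Proof.
apply: (@rint_bounded _ _ ((M / (1 - q)) ^+ 2)).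
  by apply: measurable_funX; exact: (cmeas_nm cmeas_dil).
move=> z; rewrite ger0_norm ?sqr_ge0 //; apply: lerXn2r; rewrite ?nnegrE ?nm_ge0 //.
  exact: le_trans (nm_ge0 _) (dil_le z).
exact: dil_le.
Qed.

Lemma parseval_dil (e : R) : 0 < e -> exists N, forall n, (N <= n)%N ->
  `|rI (fun z : T => nm (dil a r z) ^+ 2) - \sum_(k < n) (nm (a k) * r ^+ k) ^+ 2| <= e.
Proof.
move=> e0; set K := M / (1 - q).
have K0 (z : T) : nm (dil a r z) <= K := dil_le z.
have Kge0 : 0 <= K by exact: le_trans (nm_ge0 _) (K0 (cis 0)).
have d0 : 0 < Num.min 1 (e / (2 * K + 1)).
  by rewrite lt_min ltr01 divr_gt0 // ltr_wpDl // mulr_ge0.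
have [N hN] := dil_small_tail d0; exists N => n Nn.
have mS : cmeas (S n) by exact: cmeas_poly n (fun k => a k * r%:C ^+ k).
have rS : rint (fun z : T => nm (S n z) ^+ 2).
  apply: (@rint_bounded _ _ ((\sum_(k < n) nm (a k * r%:C ^+ k)) ^+ 2)).
    by apply: measurable_funX; exact: (cmeas_nm mS).
  move=> z; rewrite ger0_norm ?sqr_ge0 //.
  have h := nm_poly_le n (fun k => a k * r%:C ^+ k) z.
  by apply: lerXn2r; rewrite ?nnegrE ?nm_ge0 // (le_trans (nm_ge0 _) h).
have -> : \sum_(k < n) (nm (a k) * r ^+ k) ^+ 2 = rI (fun z : T => nm (S n z) ^+ 2).
  rewrite (parseval n (fun k => a k * r%:C ^+ k)); apply: eq_bigr => k _.
  by rewrite nmM nmX nmR_ge0.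
rewrite -rIB //; last exact: rint_dil_sqr.
have rD := rintB rint_dil_sqr rS.
rewrite (le_trans (rI_norm rD)) // -[X in _ <= X](rI_cst e).
apply: le_rI; [exact: rint_norm|exact: rint_cst|move=> z].
have hz := hN n Nn z; move: hz; rewrite lt_min => /andP[h1 h2].
have k1 : `|nm (dil a r z) - nm (S n z)| <= nm (dil a r z - S n z).
  rewrite ler_norml; apply/andP; split.
    have := nm_tri (dil a r z) (S n z) 0; rewrite !subr0 nmC; lra.
  by have := nm_tri (S n z) (dil a r z) 0; rewrite !subr0; lra.
have k2 : nm (dil a r z) + nm (S n z) <= 2 * K + 1.
  have := K0 z; have := nm_tri (dil a r z) (S n z) 0.
  by rewrite !subr0 nmC; lra.
rewrite subr_sqr normrM [X in _ * X]ger0_norm ?addr_ge0 ?nm_ge0 //.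
have p0 : 0 < 2 * K + 1 by rewrite ltr_wpDl // mulr_ge0.
rewrite (le_trans (ler_pM _ _ (le_trans k1 (ltW h2)) k2)) ?addr_ge0 ?nm_ge0 //.
by rewrite divfK // gt_eqF.
Qed.

Lemma bessel n : \sum_(k < n) (nm (a k) * r ^+ k) ^+ 2 <= rI (fun z : T => nm (dil a r z) ^+ 2).
Proof.
apply/ler_addgt0Pr => e e0; have [N hN] := parseval_dil e0.
have := hN _ (leq_maxr n N); rewrite ler_norml => /andP[h1 h2].
have : \sum_(k < n) (nm (a k) * r ^+ k) ^+ 2 <=
    \sum_(k < maxn n N) (nm (a k) * r ^+ k) ^+ 2.
  rewrite -(subnKC (leq_maxl n N)) big_split_ord /= lerDl.
  by apply: sumr_ge0 => k _; exact: sqr_ge0.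
lra.
Qed.

Lemma parseval_le (B : R) : (forall n, \sum_(k < n) (nm (a k) * r ^+ k) ^+ 2 <= B) ->
  rI (fun z : T => nm (dil a r z) ^+ 2) <= B.
Proof.
move=> hB; apply/ler_addgt0Pr => e e0; have [N hN] := parseval_dil e0.
have := hN N (leqnn _); rewrite ler_norml => /andP[h1 h2].
have := hB N; lra.
Qed.

End Circles.

(** The coefficients are the Fourier coefficients on that circle. *)
Lemma pev_inj a b s M M' r : cbd a s M -> cbd b s M' -> 0 < r < s ->
  (forall z : T, dil a r z = dil b r z) -> a = b.
Proof.
move=> ha hb /andP[r0 rs] hz; apply/funext => l.
have rl : r%:C ^+ l != 0 :> C.
  by rewrite expf_neq0 //; apply/eqP => /complexI h; move: r0; rewrite h ltxx.
apply: (mulIf rl); rewrite -(dil_coef ha (ltW r0) rs) -(dil_coef hb (ltW r0) rs).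
by apply: cI_ext => z; rewrite hz.
Qed.

End PowerSeries.

(** ** Re-expansion about another centre *)

Section Taylor.
Context {R : realType}.
Local Notation C := R[i].
Implicit Types (a b : nat -> C) (r s q M : R).

(* Partial sums of the m-th Taylor coefficient at z of the series a. *)
Let tc a (z : C) K m := \sum_(k < K) a k * 'C(k, m)%:R * z ^+ (k - m).

(** The left side is one term of the binomial expansion of |a_k| (|z| + t)^k. *)
Lemma taylor_bound a r M (z : C) (t : R) : cbd a r M -> 0 < r -> 0 <= t ->
  nm z + t < r -> forall k m, nm (a k * 'C(k, m)%:R * z ^+ (k - m)) * t ^+ m <=
    M * ((nm z + t) / r) ^+ k.
Proof.
move=> ha r0 t0 ztr k m.
have z0 := nm_ge0 z.
have hb : 'C(k, m)%:R * nm z ^+ (k - m) * t ^+ m <= (nm z + t) ^+ k.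
  have [mk|km] := leqP m k; last first.
    by rewrite bin_small // !mul0r exprn_ge0 // addr_ge0.
  rewrite -mulrA mulr_natl exprDn (bigD1 (inord m)) //= inordK ?ltnS // lerDl.
  by apply: sumr_ge0 => i _; rewrite mulrn_wge0 // mulr_ge0 ?exprn_ge0.
have -> : nm (a k * 'C(k, m)%:R * z ^+ (k - m)) * t ^+ m =
    nm (a k) * ('C(k, m)%:R * nm z ^+ (k - m) * t ^+ m).
  by rewrite !nmM nm_nat nmX !mulrA.
rewrite (le_trans (ler_wpM2l (nm_ge0 _) hb)) //.
rewrite expr_div_n mulrA ler_pdivlMr ?exprn_gt0 // mulrAC ler_wpM2r ?ha //.
by rewrite exprn_ge0 // addr_ge0.
Qed.

Definition taylor a (z : C) m := xget 0 [set l | tends (fun K => tc a z K m) l].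

Section Fixed.
Variables (a : nat -> C) (r M : R) (z : C) (t : R).
Hypotheses (ha : cbd a r M) (r0 : 0 < r) (t0 : 0 < t) (ztr : nm z + t < r).

Let q := (nm z + t) / r.
Let hq : 0 <= q < 1.
Proof.
rewrite divr_ge0 ?addr_ge0 ?nm_ge0 ?(ltW t0) ?(ltW r0) //.
by rewrite ltr_pdivrMr // mul1r.
Qed.

Let tc_tail K L m : (K <= L)%N ->
  nm (tc a z L m - tc a z K m) * t ^+ m <= M * q ^+ K / (1 - q).
Proof.
move=> KL; have tm : 0 < t ^+ m by rewrite exprn_gt0.
have hu k : nm (a k * 'C(k, m)%:R * z ^+ (k - m)) <= M / t ^+ m * q ^+ k.
  rewrite [leRHS]mulrAC ler_pdivlMr //; exact: (taylor_bound ha r0 (ltW t0) ztr k m).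
rewrite -ler_pdivlMr //; have := geometric_tail hq hu K (L - K).
rewrite subnKC // (_ : M / t ^+ m * q ^+ K / (1 - q) = M * q ^+ K / (1 - q) / t ^+ m) //.
ring.
Qed.

Let taylorP m : tends (fun K => tc a z K m) (taylor a z m).
Proof.
have tm : 0 < t ^+ m by rewrite exprn_gt0.
have [l hl] : exists l, tends (fun K => tc a z K m) l.
  apply: complex_complete => e e0.
  have [N hN] := exists_pow_lt (M / (1 - q)) hq (divr_gt0 (mulr_gt0 e0 tm) (ltr0Sn R 1)).
  exists N => k l Nk Nl; have hNN := hN N (leqnn _); rewrite mulrAC in hNN.
  have h1 := le_lt_trans (tc_tail m Nk) hNN.
  have h2 := le_lt_trans (tc_tail m Nl) hNN.
  rewrite -(ltr_pM2r tm) (le_lt_trans (ler_wpM2r (ltW tm) (nm_tri (tc a z N m) _ _))) //.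
  by rewrite mulrDl [X in _ < X]splitr ltrD // nmC.
by rewrite /taylor; case: xgetP => [x -> //|/(_ l)].
Qed.

Let taylor_tail K m : nm (taylor a z m - tc a z K m) * t ^+ m <= M * q ^+ K / (1 - q).
Proof.
have tm : 0 < t ^+ m by rewrite exprn_gt0.
apply/ler_addgt0Pr => e e0; have [N hN] := taylorP m (divr_gt0 e0 tm).
rewrite (le_trans (ler_wpM2r (ltW tm) (nm_tri (tc a z (maxn K N) m) _ _))) //.
rewrite mulrDl addrC lerD //; first exact/tc_tail/leq_maxl.
by rewrite nmC -ler_pdivlMr // ltW // hN // leq_maxr.
Qed.

Lemma cbd_taylor : cbd (taylor a z) t (M / (1 - q)).
Proof.
move=> m; have := taylor_tail 0 m.
by rewrite /tc big_ord0 subr0 expr0 mulr1.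
Qed.

(** A rearrangement of an absolutely convergent double series. *)
Lemma pev_taylor (h : C) : nm h < t -> pev (taylor a z) h = pev a (z + h).
Proof.
move=> ht; have zh : nm (z + h) < r.
  by rewrite (le_lt_trans (nmD _ _)) // (lt_trans _ ztr) // ltrD2l.
have hp := pevP ha zh; have ht' := pevP cbd_taylor ht.
pose p := nm h / t.
have hp01 : 0 <= p < 1 by rewrite divr_ge0 ?nm_ge0 ?(ltW t0) // ltr_pdivrMr // mul1r.
have poly K : \sum_(k < K) a k * (z + h) ^+ k = \sum_(m < K) tc a z K m * h ^+ m.
  rewrite /tc; under [RHS]eq_bigr do rewrite mulr_suml.
  rewrite exchange_big /=; apply: eq_bigr => k _.
  rewrite exprDn mulr_sumr.
  rewrite (big_ord_widen K (fun m => a k * (z ^+ (k - m) * h ^+ m *+ 'C(k, m)))) //.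
  rewrite [RHS](bigID (fun m : 'I_K => (m < k.+1)%N)) /= [X in _ = _ + X]big1 ?addr0.
    by apply: eq_bigr => m _; rewrite -mulr_natl; ring.
  by move=> m; rewrite -leqNgt => km; rewrite bin_small // mulr0 !mul0r.
apply: (tends_unique ht') => e e0; have e2 : 0 < e / 2 by rewrite divr_gt0.
have [N1 h1] := hp _ e2.
have [N2 h2] := exists_pow_lt (M / (1 - q) / (1 - p)) hq e2.
exists (maxn N1 N2) => K; rewrite geq_max => /andP[K1 K2].
rewrite (le_lt_trans (nm_tri (\sum_(k < K) a k * (z + h) ^+ k) _ _)) //.
rewrite [e]splitr ltrD ?h1 // poly -sumrB.
have q1 : 0 < 1 - q by rewrite subr_gt0 (andP hq).2.
have p1 : 0 < 1 - p by rewrite subr_gt0 (andP hp01).2.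
have key (m : nat) : nm ((taylor a z m - tc a z K m) * h ^+ m) <=
    (M * q ^+ K / (1 - q)) * p ^+ m.
  have tm : 0 < t ^+ m by rewrite exprn_gt0.
  have -> : p ^+ m = nm h ^+ m / t ^+ m by rewrite /p expr_div_n.
  rewrite nmM nmX [leRHS]mulrA ler_pdivlMr // mulrAC ler_wpM2r ?exprn_ge0 ?nm_ge0 //.
have := geometric_tail hp01 key 0 K; rewrite big_ord0 subr0 expr0 mulr1 => h3.
under eq_bigr do rewrite -mulrBl; rewrite (le_lt_trans h3) //.
by rewrite (_ : _ / _ = M / (1 - q) / (1 - p) * q ^+ K) ?h2 //; field; rewrite !gt_eqF.
Qed.

End Fixed.

Lemma taylor_coefE a r M (z : C) m : cbd a r M -> nm z < r ->
  taylor a z m = pev (fun j => a (j + m)%N * 'C(j + m, m)%:R) z.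
Proof.
move=> ha zr; have r0 : 0 < r by exact: le_lt_trans (nm_ge0 _) zr.
pose t := (r - nm z) / 2.
have t0 : 0 < t by rewrite divr_gt0 // subr_gt0.
have ztr : nm z + t < r by rewrite /t; lra.
have tends_tc : tends (fun K => tc a z K m) (taylor a z m).
  have := cbd_taylor ha r0 t0 ztr => _.
  have [l hl] : exists l, tends (fun K => tc a z K m) l.
    have tm : 0 < t ^+ m by rewrite exprn_gt0.
    have hq : 0 <= (nm z + t) / r < 1.
      rewrite divr_ge0 ?addr_ge0 ?nm_ge0 ?(ltW t0) ?(ltW r0) //.
      by rewrite ltr_pdivrMr // mul1r.
    pose u k := a k * 'C(k, m)%:R * z ^+ (k - m).
    have cu : cbd u ((nm z + t) / r)^-1 (M / t ^+ m).
      move=> k; rewrite exprVn -/(_ / _) ler_pdivrMr ?exprn_gt0 //.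
        rewrite [leRHS]mulrAC ler_pdivlMr //; exact: taylor_bound ha r0 (ltW t0) ztr k m.
      by rewrite divr_gt0 // ltr_wpDl ?nm_ge0.
    exists (pev u 1); apply: tends_ext (pevP cu _) => [n|].
      by apply: eq_bigr => k _; rewrite expr1n mulr1.
    rewrite nm1 invf_gt1 ?(andP hq).2 // divr_gt0 // ltr_wpDl ?nm_ge0 //.
  by rewrite /taylor; case: xgetP => [x -> //|/(_ l)].
apply/esym/pev_eq => e e0; have [N hN] := tends_tc _ e0.
exists N => n Nn; have := hN (n + m)%N (leq_trans Nn (leq_addr _ _)).
congr (nm (_ - _) < e); rewrite /tc addnC big_split_ord /= big1 ?add0r; last first.
  by move=> k _; rewrite bin_small // mulr0 mul0r.
by apply: eq_bigr => k _; rewrite addnC addnK.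
Qed.

End Taylor.

(** ** From local to global power series *)

Section Global.
Context {R : realType}.
Local Notation C := R[i].
Local Notation T := (circle R).
Implicit Types (a b : nat -> C) (r s M d : R) (x : disc R -> C).

Lemma near_nm (z : C) (P : set C) : (\forall u \near z, P u) <->
  exists2 e : R, 0 < e & forall u, nm (u - z) < e -> P u.
Proof.
split=> [/nbhs_ballP[e /= e0 he]|[e e0 he]].
  move: e0; rewrite ltcE /= => /andP[/eqP eI e0]; exists (complex.Re e) => // u hu.
  apply: he; rewrite -ball_normE /ball_ /= -normrN opprB normE [e]complexE eI.
  by rewrite mulr0 addr0 ltcR.
apply/nbhs_ballP; exists e%:C; first by rewrite /= ltcR.
by move=> u; rewrite -ball_normE /ball_ /= -normrN opprB normE ltcR; exact: he.
Qed.

Lemma cvg_tends (u : nat -> C) l : u @ \oo --> l <-> tends u l.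
Proof.
rewrite cvgrPdist_lt; split=> [h e e0|h e e0].
  have [N _ hN] := h e%:C (eq_ind_r is_true e0 (ltcR _ _)).
  by exists N => k /hN /=; rewrite -normrN opprB normE ltcR.
move: e0; rewrite ltcE /= => /andP[/eqP eI e0]; have [N hN] := h _ e0.
exists N => //= k /hN; rewrite -normrN opprB normE [e]complexE eI.
by rewrite mulr0 addr0 ltcR.
Qed.

Lemma tends_bounded (u : nat -> C) l : tends u l -> exists M, forall k, nm (u k) <= M.
Proof.
move=> /(_ 1 ltr01) [N hN]; exists (\sum_(k < N) nm (u k) + (nm l + 1)) => k.
have s0 : 0 <= \sum_(k < N) nm (u k) by apply: sumr_ge0 => i _; exact: nm_ge0.
have [kN|Nk] := ltnP k N; last first.
  rewrite ler_wpDl // -(subrK l (u k)) (le_trans (nmD _ _)) // addrC lerD2l ltW //.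
  exact: hN.
rewrite ler_wpDr ?addr_ge0 ?nm_ge0 // (bigD1 (Ordinal kN)) //= lerDl.
by apply: sumr_ge0 => i _; exact: nm_ge0.
Qed.

(** The radius of convergence is at least 1. *)
Definition disc_coef a := forall r, 0 <= r < 1 -> exists M, cbd a r M.

Lemma ext_disc x (z : disc R) : ext x (val z) = x z.
Proof. by rewrite /ext valK. Qed.

Lemma nm_disc (z : disc R) : nm (val z) < 1.
Proof. by rewrite -ltcR -normE; exact: (valP z). Qed.

Lemma disc_of (z : C) : nm z < 1 -> exists u : disc R, val u = z.
Proof. by rewrite -ltcR -normE => hz; exists (exist _ z hz). Qed.

(* x is the sum of a power series of radius at least d about z, with a bound
   that is coded by d too so that a single number measures uniformity. *)
Let good x z d := exists2 b, cbd b d d^-1 &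
  forall h, nm h < d -> ext x (z + h) = pev b h.

Let good_le x z d d' : 0 < d' <= d -> good x z d -> good x z d'.
Proof.
move=> /andP[d0' dd] [b hb hx]; have d0 := lt_le_trans d0' dd.
exists b => [k|h hh]; last by rewrite hx // (lt_le_trans hh).
by rewrite (le_trans (cbd_le _ hb k)) ?dd ?(ltW d0') // lef_pV2 ?posrE.
Qed.

Let good_shift x z z' d : 0 < d -> good x z d -> nm (z' - z) < d / 4 ->
  good x z' (d / 4).
Proof.
move=> d0 [b hb hx] zz; set u := z' - z in zz.
have ut : nm u + d / 2 < d by lra.
have d2 : 0 < d / 2 by rewrite divr_gt0.
have ht := cbd_taylor hb d0 d2 ut.
exists (taylor b u) => [k|h hh]; last first.
  rewrite (pev_taylor hb d0 d2 ut); last by lra.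
  by rewrite -hx; [congr ext; rewrite /u; ring|rewrite (le_lt_trans (nmD _ _)) //; lra].
have h1 : cbd (taylor b u) (d / 4) (d^-1 / (1 - (nm u + d / 2) / d)).
  by apply: cbd_le ht; lra.
rewrite (le_trans (h1 k)) // invf_div ler_pdivrMr; last first.
  by rewrite subr_gt0 ltr_pdivrMr // mul1r.
have -> : 4 / d * (1 - (nm u + d / 2) / d) = (4 - 4 * (nm u + d / 2) / d) / d.
  by field; rewrite gt_eqF.
rewrite -[leLHS]mul1r ler_wpM2r ?invr_ge0 ?(ltW d0) //.
by rewrite lerBrDr -lerBrDl ler_pdivrMr //; lra.
Qed.

Let analytic_good x (z : disc R) : analytic x -> exists2 d, 0 < d & good x (val z) d.
Proof.
move=> /(_ z) [a /near_nm[e e0 he]].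
have hs h : nm h < e -> tends (fun n => \sum_(k < n) a k * h ^+ k) (ext x (val z + h)).
  move=> hh; have := he (val z + h); rewrite addrAC subrr add0r => /(_ hh)/cvg_tends.
  by apply: tends_ext => n; rewrite /series /= big_mkord.
have e2 : 0 < e / 2 by rewrite divr_gt0.
have hh : nm (e / 2)%:C < e by rewrite nmR_ge0 ?ltW //; lra.
have [M hM] := tends_bounded (hs _ hh).
have ha : cbd a (e / 2) (M + M).
  move=> k; rewrite -{1}(nmR_ge0 (ltW e2)) -nmX -nmM.
  have -> : a k * (e / 2)%:C ^+ k = \sum_(i < k.+1) a i * (e / 2)%:C ^+ i -
     \sum_(i < k) a i * (e / 2)%:C ^+ i by rewrite big_ord_recr /= addrAC subrr add0r.
  by rewrite (le_trans (nmB _ _)) // lerD.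
have M0 := cbd_ge0 ha.
pose d := Num.min (e / 2) (M + M + 1)^-1.
have d0 : 0 < d by rewrite lt_min e2 invr_gt0; lra.
exists d => //; exists a => [k|h hd]; last first.
  apply/esym/pev_eq/hs; rewrite (lt_le_trans hd) // ge_min; apply/orP; left; lra.
rewrite (le_trans (cbd_le _ ha k)) ?(ltW d0) ?ge_min ?lexx //.
have : d <= (M + M + 1)^-1 by rewrite ge_min lexx orbT.
by rewrite -[X in X <= _]invrK lef_pV2 ?posrE ?invr_gt0 ?ltr_wpDl ?addr_ge0 //; lra.
Qed.

(** By compactness of the closed disc of radius r, parametrized by a rectangle. *)
Let good_uniform x r : analytic x -> 0 <= r < 1 ->
  exists2 d, 0 < d & forall z, nm z <= r -> good x z d.
Proof.
move=> hx /andP[r0 r1].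
pose K := `[0, r]%classic `*` `[0, 2 * pi]%classic : set (R * R).
have cK : compact K by apply: compact_setX; exact: segment_compact.
pose phi (p : R * R) : C := p.1%:C * pt (cis p.2).
have cphi (p : R * R) (e : R) : 0 < e -> \forall q \near p, nm (phi q - phi p) < e.
  move=> e0; have e2 : 0 < e / 2 by rewrite divr_gt0.
  have cre : (fun q : R * R => q.1 * cos q.2) q @[q --> p] --> p.1 * cos p.2.
    by apply: cvgM; [exact: cvg_fst|apply: continuous_cvg; [exact: continuous_cos|exact: cvg_snd]].
  have cim : (fun q : R * R => q.1 * sin q.2) q @[q --> p] --> p.1 * sin p.2.
    by apply: cvgM; [exact: cvg_fst|apply: continuous_cvg; [exact: continuous_sin|exact: cvg_snd]].
  move/cvgrPdist_lt : cre => /(_ _ e2) hre; move/cvgrPdist_lt : cim => /(_ _ e2) him.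
  near=> q; rewrite (le_lt_trans (nm_ReIm _)) // [e]splitr ltrD //.
    rewrite (_ : complex.Re _ = q.1 * cos q.2 - p.1 * cos p.2); last first.
      by rewrite /phi /pt /=; ring.
    by rewrite distrC; near: q.
  rewrite (_ : complex.Im _ = q.1 * sin q.2 - p.1 * sin p.2); last first.
    by rewrite /phi /pt /=; ring.
  by rewrite distrC; near: q.
have phiK z : nm z <= r -> exists2 p, K p & phi p = z.
  move=> zr; have [->|z0] := eqVneq z 0.
    exists (0, 0); last by rewrite /phi /= mul0r.
    by rewrite /K /= !in_itv /= !lexx r0 /= mulr_ge0 // pi_ge0.
  have nz : 0 < nm z by rewrite nm_gt0.
  have hu : `|(nm z)^-1%:C * z| == 1.
    by apply/eqP; rewrite normE nmM nmR_ge0 ?invr_ge0 ?nm_ge0 // mulVf ?gt_eqF.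
  have [t /andP[t0 t2] ht] := cis_surj (exist (fun z : C => `|z| == 1) _ hu : T).
  exists (nm z, t); first by rewrite /K /= !in_itv /= nm_ge0 zr t0 (ltW t2).
  rewrite /phi /= ht /pt /= mulrA -rmorphM /= divff ?gt_eqF // mul1r //.
have /compact_near_coveringP nK := cK.
have hnear : \forall d \near (0 : R)^'+, K `<=` (fun p => good x (phi p) d).
  apply: (nK R _ (fun d p => good x (phi p) d)) => p [/= p1 p2].
  have hp : nm (phi p) < 1.
    by have /andP[p10 p1r] : 0 <= p.1 <= r by []; rewrite nm_rpt // (le_lt_trans p1r).
  have [u hu] := disc_of hp; have [d d0] := analytic_good u hx; rewrite hu => gd.
  have d4 : 0 < d / 4 by rewrite divr_gt0.
  have hc := cphi p _ d4.
  near=> q e => /=; apply: (@good_le _ _ (d / 4)).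
    by apply/andP; split; near: e; [exact: nbhs_right_gt|apply: nbhs_right_le].
  by apply: good_shift d0 gd _; near: q.
have [d [d0 hd]] : exists d, 0 < d /\ K `<=` (fun p => good x (phi p) d).
  near (0 : R)^'+ => d; exists d; split; near: d; last exact: hnear.
  exact: nbhs_right_gt.
by exists d => // z /phiK[p /hd + <-].
Unshelve. all: by end_near. Qed.

Let half_sum n : \sum_(i < n) (2^-1 : R) ^+ i = 2 - 2 * 2^-1 ^+ n.
Proof.
elim: n => [|n IH]; first by rewrite big_ord0 expr0 mulr1 subrr.
by rewrite big_ord_recr /= IH exprS; field.
Qed.

Section Step.
Variables (x : disc R -> C) (r0 d : R).
Hypotheses (d0 : 0 < d) (hd : forall z, nm z <= r0 -> good x z d).
Variable a : nat -> C.

Let rep r := exists2 M, cbd a r M & forall h, nm h < r -> ext x h = pev a h.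

(* Every z with |z| = s has Taylor coefficients bounded by d^(-1-m) there, and
   Cauchy's estimates on that circle bound a_k C(k,m) s^(k-m) by the same. *)
Let rep_step r : rep r -> d <= r -> r - d / 4 <= r0 -> rep (r + d / 4).
Proof.
move=> [M ha hx] dr rr; set s := r - d / 4 in rr.
have d1 := d0.
have s0 : 0 < s by rewrite /s; lra.
have r_gt0 : 0 < r by lra.
have sr : s < r by rewrite /s; lra.
have tE z : nm z = s -> exists2 b, taylor a z = b & cbd b d d^-1 /\
    forall h, nm h < d -> ext x (z + h) = pev b h.
  move=> zs; have [|b hb hxb] := hd (z := z); first by rewrite zs.
  exists b => //; pose t := d / 8; have t0 : 0 < t by rewrite divr_gt0.
  have ztr : nm z + t < r by rewrite zs /s /t; lra.
  have hcb := cbd_taylor ha r_gt0 t0 ztr.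
  have hbt : cbd b t d^-1 by apply: cbd_le hb; rewrite /t; lra.
  apply: (pev_inj hcb hbt (r := t / 2)); first by apply/andP; split; lra.
  move=> u; rewrite /dil.
  have hu : nm ((t / 2)%:C * pt u) < t by rewrite nm_rpt; lra.
  rewrite (pev_taylor ha r_gt0 t0 ztr hu) -hxb; last by rewrite (lt_trans hu) // /t; lra.
  by rewrite hx // (le_lt_trans (nmD _ _)) // (lt_trans _ ztr) // ltrD2l.
have key k m : (m <= k)%N -> 'C(k, m)%:R * nm (a k) * s ^+ (k - m) <= d^-1 * (d^-1) ^+ m.
  move=> mk; pose c := fun j => a (j + m)%N * 'C(j + m, m)%:R.
  pose t := d / 16; pose s' := s + d / 8.
  have t0 : 0 < t by rewrite divr_gt0.
  have cc : cbd c s' (M / t ^+ m).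
    move=> j; rewrite ler_pdivlMr ?exprn_gt0 //.
    have s'0 : 0 <= s' by rewrite /s'; lra.
    have ztr : nm s'%:C + t < r by rewrite nmR_ge0 // /s' /s /t; lra.
    have := taylor_bound ha r_gt0 (ltW t0) ztr (j + m) m.
    rewrite addnK nmM nmX nmR_ge0 // => /le_trans; apply.
    rewrite ler_piMr ?(cbd_ge0 ha) // exprn_ile1 //.
      by apply: divr_ge0; [exact: addr_ge0 s'0 (ltW t0)|exact: ltW].
    by rewrite ler_pdivrMr // mul1r ltW // (le_lt_trans _ ztr) // nmR_ge0.
  have ss : s < s' by rewrite /s'; lra.
  have := @cauchy_bound _ c s' s _ cc (ltW s0) ss (d^-1 * d^-1 ^+ m) (k - m).
  have -> : nm (c (k - m)%N) = 'C(k, m)%:R * nm (a k) by rewrite /c subnK // nmM nm_nat mulrC.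
  apply=> u.
  have zs : nm (s%:C * pt u) = s by rewrite nm_rpt // ltW.
  have [b tb [hb _]] := tE _ zs.
  rewrite /dil -(taylor_coefE (r := r) m ha) ?zs // tb.
  by rewrite exprVn ler_pdivlMr ?exprn_gt0.
have sd : 0 < s + d / 2 by lra.
have ha' : cbd a (s + d / 2) (2 / d).
  move=> k; rewrite exprDn mulr_sumr.
  have hm (m : 'I_k.+1) : nm (a k) * (s ^+ (k - m) * (d / 2) ^+ m *+ 'C(k, m)) <=
      d^-1 * 2^-1 ^+ m.
    rewrite -mulr_natl.
    have -> : nm (a k) * ('C(k, m)%:R * (s ^+ (k - m) * (d / 2) ^+ m)) =
       ('C(k, m)%:R * nm (a k) * s ^+ (k - m)) * (d / 2) ^+ m by ring.
    have -> : d^-1 * 2^-1 ^+ m = (d^-1 * d^-1 ^+ m) * (d / 2) ^+ m.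
      rewrite -mulrA -exprMn; congr (_ * _ ^+ _); field; lra.
    by rewrite ler_wpM2r ?exprn_ge0 ?divr_ge0 ?(ltW d0) // key // -ltnS.
  rewrite (le_trans (ler_sum _ (fun m _ => hm m))) // -mulr_sumr mulrC ler_wpM2r //.
    by rewrite invr_ge0 ltW.
  rewrite (_ : \sum_(i < k.+1) _ = 2 - 2 * 2^-1 ^+ k.+1); last exact: half_sum.
  by rewrite lerBlDr lerDl mulr_ge0 // exprn_ge0 // invr_ge0.
exists (2 / d); first by apply: cbd_le ha'; rewrite /s; lra.
move=> h hh; have [hs|hs] := ltP (nm h) r; first exact: hx.
have h0 : 0 < nm h by lra.
pose z := (s / nm h)%:C * h.
have sh : 0 <= s / nm h by rewrite divr_ge0 // ltW.
have zs : nm z = s by rewrite nmM nmR_ge0 // divfK // gt_eqF.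
have hz : nm (h - z) = nm h - s.
  have -> : h - z = (1 - s / nm h)%:C * h by rewrite [(1 - _)%:C](rmorphB (real_complex R)) (rmorph1 (real_complex R)) mulrBl mul1r.
  have sh1 : s / nm h <= 1 by rewrite ler_pdivrMr // mul1r; lra.
  by rewrite nmM nmR_ge0 ?subr_ge0 // [LHS]mulrBl mul1r divfK ?gt_eqF.
have [b tb [hb hxb]] := tE _ zs.
have hzd : nm (h - z) < d / 2 by rewrite hz; move: hh; rewrite /s; lra.
have zh : z + (h - z) = h by rewrite addrC subrK.
have := hxb (h - z); rewrite zh => ->; last by lra.
pose t := (nm (h - z) + d / 2) / 2.
have t0 : 0 < t by rewrite /t; have := nm_ge0 (h - z); lra.
by rewrite -tb (pev_taylor ha' sd t0) ?zh // ?zs /t; lra.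
Qed.

(** The disc on which the series a represents x grows by a fixed amount at each step
    until it contains the disc of radius r0. *)
Lemma rep_reach r : rep r -> d <= r -> r0 < 1 -> exists2 r', r0 <= r' & rep r'.
Proof.
move=> hr dr r01; have d1 := d0.
have [n hn] : exists n : nat, (r0 - r) / (d / 4) < n%:R.
  by eexists; apply: (le_lt_trans (ler_norm _)); exact: archi_boundP.
elim: n r hr dr hn => [|n IH] r hr dr hn.
  by exists r => //; move: hn; rewrite ltr_pdivrMr; lra.
have [h|h] := leP r0 r; first by exists r.
have d4 : 0 < d / 4 by rewrite divr_gt0.
apply: (IH (r + d / 4)); [by apply: rep_step => //; lra|lra|].
by move: hn; rewrite !ltr_pdivrMr // -natr1 mulrDl mul1r; lra.
Qed.

End Step.

(** The local expansions have a uniform radius d on each smaller closed disc, so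
    that the expansion at 0 can be continued outwards by steps of length d / 4. *)
Theorem analytic_pseries x : analytic x ->
  exists2 a, disc_coef a & forall z : disc R, x z = pev a (val z).
Proof.
move=> hx; have [u hu] : exists u : disc R, val u = 0 by apply: disc_of; rewrite nm0.
have [d0 d0_gt0] := analytic_good u hx; rewrite hu => -[a ha hxa].
have main r : 0 <= r < 1 -> exists2 M, cbd a r M & forall h, nm h < r -> ext x h = pev a h.
  move=> hr; have /andP[r0 r1] := hr; have [d1 d1_gt0 hd1] := good_uniform hx hr.
  pose d := Num.min d0 d1; have d_gt0 : 0 < d by rewrite lt_min d0_gt0.
  have hd z : nm z <= r -> good x z d.
    by move=> /hd1; apply: good_le; rewrite d_gt0 ge_min lexx orbT.
  have [|r' rr' [M hM hr']] := @rep_reach x r d d_gt0 hd a d _ (lexx _) r1.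
    exists d0^-1; first by apply: cbd_le ha; rewrite (ltW d_gt0) ge_min lexx.
    move=> h hh; rewrite -hxa ?add0r // (lt_le_trans hh) // ge_min lexx //.
  exists M; first by apply: cbd_le hM; rewrite r0.
  by move=> h hh; apply: hr'; exact: lt_le_trans rr'.
exists a => [r /main[M hM _]|z]; first by exists M.
rewrite -ext_disc; pose r := (nm (val z) + 1) / 2; have z1 := nm_disc z.
have [|M _ ->//] := main r; rewrite /r; have := nm_ge0 (val z); lra.
Qed.

End Global.

(** ** Sums of power series as analytic functions *)

(** Power series are kept apart from functions on nat, whose ring structure is
    the pointwise one. *)
Definition fps (R : realType) : Type := nat -> R[i].

HB.instance Definition _ (R : realType) := GRing.Lmodule.copy (fps R) (nat -> R[i]).

Section Series.
Context {R : realType}.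
Local Notation C := R[i].
Local Notation T := (circle R).
Local Notation P := (fps R).
Implicit Types (a b : P) (r s M d : R) (x : disc R -> C) (z : C).

Definition psum a : disc R -> C := fun u => pev a (val u).

Lemma ext_psum a z : nm z < 1 -> ext (psum a) z = pev a z.
Proof. by move=> /disc_of[u <-]; rewrite ext_disc. Qed.

Lemma disc_coefP a z : disc_coef a -> nm z < 1 ->
  tends (fun n => \sum_(k < n) a k * z ^+ k) (pev a z).
Proof.
move=> ha z1; have z0 := nm_ge0 z.
have [|M hM] := ha ((nm z + 1) / 2); first by apply/andP; split; lra.
by apply: pevP hM _; lra.
Qed.

Lemma pev_expand a z : disc_coef a -> nm z < 1 ->
  exists b t M, [/\ cbd b t M, 0 < t /\ nm z + t < 1, b 0 = pev a z,
    b 1 = pev (fun k => a k.+1 * k.+1%:R) z &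
    forall h, nm h < t -> pev a (z + h) = pev b h].
Proof.
move=> ha z1; have z0 := nm_ge0 z; pose r := (nm z + 1) / 2.
have hr : 0 <= r < 1 by apply/andP; rewrite /r; split; lra.
have [M hM] := ha r hr; pose t := (1 - nm z) / 4.
have t0 : 0 < t by rewrite /t; lra.
have zt : nm z + t < r by rewrite /t /r; lra.
have r0 : 0 < r by rewrite /r; lra.
have zr : nm z < r by rewrite /r; lra.
have hc := cbd_taylor hM r0 t0 zt.
eexists; exists t; eexists; split; first exact: hc.
- by split=> //; rewrite /t; lra.
- rewrite (taylor_coefE 0 hM zr); congr (pev _ z); apply/funext => j.
  by rewrite addn0 bin0 mulr1.
- rewrite (taylor_coefE 1 hM zr); congr (pev _ z); apply/funext => j.
  by rewrite addn1 bin1.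
- by move=> h ht; rewrite (pev_taylor hM r0 t0 zt ht).
Qed.

Lemma psum_analytic a : disc_coef a -> analytic (psum a).
Proof.
move=> ha z; have [b [t [M [hb [t0 zt] _ _ hx]]]] := @pev_expand a (val z) ha (nm_disc z).
exists b; apply/near_nm; exists t => // u hu; apply/cvg_tends.
have u1 : nm u < 1.
  by rewrite -(subrK (val z) u) (le_lt_trans (nmD _ _)) //; lra.
have zu : val z + (u - val z) = u by rewrite addrC subrK.
rewrite ext_psum // -[X in pev a X]zu hx //.
by apply: tends_ext (pevP hb hu) => n; rewrite /series /= big_mkord.
Qed.

Lemma derive1_local (f : C -> C) z b t M : 0 < t -> cbd b t M ->
  (forall h, nm h < t -> f (z + h) = pev b h) -> derive1 f z = b 1.
Proof.
move=> t0 hb hf; have t2 : 0 < t / 2 by rewrite divr_gt0.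
have M0 := cbd_ge0 hb.
have b0 : pev b 0 = b 0.
  apply: pev_eq => e e0; exists 1 => -[//|n] _.
  rewrite big_ord_recl expr0 mulr1 big1 ?addr0 ?subrr ?nm0 // => i _.
  by rewrite expr0n mulr0.
have fz : f z = b 0 by rewrite -[z]addr0 hf ?nm0 // b0.
rewrite /derive1; apply: cvg_lim => //; apply/cvgrPdist_lt => e.
rewrite ltcE /= => /andP[/eqP eI e0].
pose K := M / t ^+ 2 / (1 - 2^-1) + 1.
have K0 : 0 < K by rewrite ltr_wpDl // !divr_ge0 ?exprn_ge0 ?(ltW t0) //; lra.
rewrite /dnbhs /within /=; apply/near_nm.
exists (Num.min (t / 2) (complex.Re e / K)); first by rewrite lt_min t2 divr_gt0.
move=> h; rewrite subr0 lt_min => /andP[h1 h2] hn0.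
have hp : 0 < nm h by rewrite nm_gt0.
rewrite -normrN opprB normE [e]complexE eI mulr0 addr0 ltcR.
rewrite [h + z]addrC hf ?fz; last by lra.
have -> : h^-1 *: (pev b h - b 0) - b 1 = h^-1 * (pev b h - (b 0 + b 1 * h)).
  rewrite mulrBr mulrDr [h^-1 *: _]mulrBr; 
  by rewrite [_ * (b 1 * h)]mulrCA mulVf // mulr1 opprD addrA.
rewrite nmM nmV mulrC ltr_pdivrMr //.
have q01 : 0 <= nm h / t < 1.
  by rewrite divr_ge0 ?(ltW hp) ?(ltW t0) //= ltr_pdivrMr // mul1r; lra.
have := pev_tail hb t0 q01 (z := h); rewrite divfK ?gt_eqF // => /(_ (lexx _) 2).
rewrite !big_ord_recl big_ord0 expr0 mulr1 expr1 addr0 => /le_lt_trans; apply.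
have -> : M * (nm h / t) ^+ 2 / (1 - nm h / t) = M / t ^+ 2 / (1 - nm h / t) * nm h * nm h.
  by field; rewrite !gt_eqF // subr_gt0; lra.
rewrite ltr_pM2r //.
have : M / t ^+ 2 / (1 - nm h / t) <= M / t ^+ 2 / (1 - 2^-1).
  have hq : nm h / t <= 2^-1 by rewrite ler_pdivrMr // mulrC; lra.
  by rewrite ler_wpM2l ?divr_ge0 ?exprn_ge0 ?(ltW t0) // lef_pV2 ?posrE ?lerD2l ?lerN2 //; lra.
move=> hK; rewrite (@le_lt_trans _ _ ((K - 1) * nm h)) ?ler_wpM2r ?(ltW hp) //.
  by rewrite /K addrK.
move: h2; rewrite ltr_pdivlMr // => h2; have : 0 < nm h by []. 
by rewrite mulrBl mul1r mulrC; lra.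
Qed.

Definition dcoef a : P := fun k => a k.+1 * k.+1%:R.

Lemma poly_growth (q : R) (m : nat) : 0 <= q < 1 ->
  exists B, forall k, k.+1%:R * q ^+ k <= B.
Proof.
move=> /andP[q0 q1]; exists (1 / (1 - q)) => k.
have q10 : 0 < 1 - q by rewrite subr_gt0.
have : \sum_(i < k.+1) q ^+ i <= 1 / (1 - q).
  rewrite ler_pdivlMr // mulrC -opprB mulNr -subrX1 opprB gerBl exprn_ge0 //.
apply: le_trans; rewrite -[X in X%:R * _](card_ord k.+1) -sum1_card natr_sum mulr_suml.
apply: ler_sum => i _; rewrite mul1r.
by apply: ler_wiXn2l; rewrite ?(ltW q1) // -ltnS.
Qed.

Lemma pow_ratio (r s : R) k : s != 0 -> r ^+ k = s ^+ k * (r / s) ^+ k.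
Proof. by move=> s0; rewrite -exprMn mulrC divfK. Qed.

Lemma disc_dcoef a : disc_coef a -> disc_coef (dcoef a).
Proof.
move=> ha r /andP[r0 r1]; pose s := (r + 1) / 2.
have s0 : 0 < s by rewrite /s; lra.
have [|M hM] := ha s; first by apply/andP; rewrite /s; split; lra.
have q01 : 0 <= r / s < 1.
  by rewrite divr_ge0 ?(ltW s0) //= ltr_pdivrMr // mul1r /s; lra.
have [B hB] := poly_growth 0 q01; exists (M / s * B) => k.
have -> : nm (dcoef a k) * r ^+ k = nm (a k.+1) * s ^+ k.+1 / s * (k.+1%:R * (r / s) ^+ k).
  by rewrite nmM nm_nat (pow_ratio r k (lt0r_neq0 s0)) exprS; field; rewrite gt_eqF.
apply: ler_pM => //; rewrite ?mulr_ge0 ?nm_ge0 ?exprn_ge0 ?invr_ge0 ?(ltW s0) //.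
  by rewrite (andP q01).1.
by rewrite ler_wpM2r // invr_ge0 ltW.
Qed.

Lemma disc_dcoefn n a : disc_coef a -> disc_coef (iter n dcoef a).
Proof. by elim: n => [//|n IH] /IH /disc_dcoef. Qed.

(** The derivative at z is read on the expansion about z. *)
Lemma dderive_psum n a : disc_coef a -> dderive n (psum a) = psum (iter n dcoef a).
Proof.
move=> ha; suff h z : nm z < 1 -> derive1n n (ext (psum a)) z = pev (iter n dcoef a) z.
  by apply/funext => u; rewrite /dderive h // nm_disc.
elim: n z => [|n IH] z z1; first exact: ext_psum.
have [b [t [M [hb [t0 zt] _ b1 hx]]]] := pev_expand (disc_dcoefn n ha) z1.
rewrite /derive1n !iterS -/(derive1n n _) [RHS]/= -b1; apply: derive1_local t0 hb _ => h ht.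
by rewrite IH ?hx // (le_lt_trans (nmD _ _)) //; lra.
Qed.

Lemma psum_inj a b : disc_coef a -> disc_coef b -> psum a = psum b -> a = b.
Proof.
move=> ha hb ab; have h2 : 0 <= (2^-1 : R) < 1 by apply/andP; split; lra.
have [M hM] := ha _ h2; have [M' hM'] := hb _ h2.
apply: (pev_inj hM hM' (r := 4^-1)); first by apply/andP; split; lra.
move=> z; have [|u hu] := @disc_of R (4^-1%:C * pt z); first by rewrite nm_rpt; lra.
by rewrite /dil -hu; have := congr1 (fun f => f u) ab.
Qed.

Lemma pevD a b z : disc_coef a -> disc_coef b -> nm z < 1 ->
  pev (a + b) z = pev a z + pev b z.
Proof.
move=> ha hb z1; apply/pev_eq/(tends_ext _ (tendsD (disc_coefP ha z1) (disc_coefP hb z1))).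
by move=> n; rewrite -big_split; apply: eq_bigr => k _; rewrite [RHS]mulrDl.
Qed.

Lemma pevZ c a z : disc_coef a -> nm z < 1 -> pev (c *: a) z = c * pev a z.
Proof.
move=> ha z1; apply/pev_eq/(tends_ext _ (tendsZ c (disc_coefP ha z1))).
by move=> n; rewrite mulr_sumr; apply: eq_bigr => k _; rewrite mulrA.
Qed.

Lemma disc_coefD a b : disc_coef a -> disc_coef b -> disc_coef (a + b).
Proof.
move=> ha hb r hr; have [M hM] := ha r hr; have [M' hM'] := hb r hr.
have r0 : 0 <= r by have /andP[] := hr.
exists (M + M') => k; rewrite (le_trans (ler_wpM2r _ (nmD _ _))) ?exprn_ge0 //.
by rewrite mulrDl lerD.
Qed.

Lemma disc_coefZ c a : disc_coef a -> disc_coef (c *: a).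
Proof.
move=> ha r /ha [M hM]; exists (nm c * M) => k.
by rewrite nmM -mulrA ler_wpM2l ?nm_ge0.
Qed.

Lemma disc_coef0 : disc_coef (0 : P).
Proof. by move=> r _; exists 0 => k; rewrite nm0 mul0r. Qed.

End Series.

(** ** The ring of power series *)

Section PowerSeries.
Context {R : realType}.
Local Notation C := R[i].
Local Notation P := (fps R).
Implicit Types (a b c : P) (z : C).

Definition cprod a b : P := fun k => \sum_(i < k.+1) a i * b (k - i)%N.

(** Products of series are computed on truncations, which are polynomials; the ring
    axioms follow from those of polynomials. *)
Lemma cprodE n a b k : (k < n)%N ->
  cprod a b k = (\poly_(i < n) a i * \poly_(i < n) b i)`_k.
Proof.
move=> kn; rewrite coefM; apply: eq_bigr => i _; rewrite !coef_poly.
have -> : (i < n)%N by apply: leq_ltn_trans kn; rewrite -ltnS.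
by have -> : (k - i < n)%N by exact: leq_ltn_trans (leq_subr _ _) kn.
Qed.

Let cprod_ext n a b (p q : {poly C}) k : (k < n)%N -> (forall i, (i < n)%N -> a i = p`_i) ->
  (forall i, (i < n)%N -> b i = q`_i) -> cprod a b k = (p * q)`_k.
Proof.
move=> kn ha hb; rewrite coefM; apply: eq_bigr => i _.
rewrite ha ?hb //; first exact: leq_ltn_trans (leq_subr _ _) kn.
by apply: leq_ltn_trans kn; rewrite -ltnS.
Qed.

Let cprodA : associative cprod.
Proof.
move=> a b c; apply/funext => k.
pose t (u : P) := \poly_(i < k.+1) u i.
have tE (u : P) i : (i < k.+1)%N -> u i = (t u)`_i by move=> h; rewrite coef_poly h.
rewrite (@cprod_ext k.+1 _ _ (t a) (t b * t c)) ?mulrA //; [|exact: tE|by move=> i /cprodE].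
by rewrite (@cprod_ext k.+1 (cprod a b) c (t a * t b) (t c)) // => i; [move/cprodE|exact: tE].
Qed.

Let cprodC : commutative cprod.
Proof.
by move=> a b; apply/funext => k; rewrite !(@cprodE k.+1) // mulrC.
Qed.

Definition fps1 : P := fun k => (k == 0)%N%:R.

Let cprod1 : left_id fps1 cprod.
Proof.
move=> a; apply/funext => k; rewrite /cprod big_ord_recl mul1r subn0 big1 ?addr0 // => i _.
by rewrite mul0r.
Qed.

Let cprodDl : left_distributive cprod (@GRing.add P).
Proof.
move=> a b c; apply/funext => k; rewrite [RHS]/GRing.add /= -big_split /=.
by apply: eq_bigr => i _; rewrite -mulrDl.
Qed.

Let fps1_neq0 : fps1 != 0.
Proof. by apply/eqP => /(congr1 (fun f : P => f 0%N))/eqP; rewrite oner_eq0. Qed.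

HB.instance Definition _ := GRing.Zmodule_isComNzRing.Build P cprodA cprodC cprod1
  cprodDl fps1_neq0.

Lemma fpsM a b k : (a * b) k = \sum_(i < k.+1) a i * b (k - i)%N.
Proof. by []. Qed.
Lemma fpsD a b k : (a + b) k = a k + b k. Proof. by []. Qed.
Lemma fpsN a k : (- a) k = - a k. Proof. by []. Qed.
Lemma fpsZ (u : C) a k : (u *: a) k = u * a k. Proof. by []. Qed.
Lemma fpsZl (u : C) a b : (u *: a) * b = u *: (a * b).
Proof.
by apply/funext => k; rewrite fpsZ !fpsM mulr_sumr; apply: eq_bigr => i _; rewrite mulrA.
Qed.
Lemma fpsZr (u : C) a b : a * (u *: b) = u *: (a * b).
Proof. by rewrite mulrC fpsZl mulrC. Qed.

Lemma dcoefM a b : dcoef (a * b) = dcoef a * b + a * dcoef b :> P.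
Proof.
apply/funext => k; pose t (u : P) := \poly_(i < k.+2) u i.
have tE (u : P) i : (i < k.+2)%N -> u i = (t u)`_i by move=> h; rewrite coef_poly h.
have dE (u : P) i : (i < k.+1)%N -> dcoef u i = (t u)^`()`_i.
  by move=> h; rewrite coef_deriv -tE // -mulr_natr.
rewrite fpsD -[(dcoef a * b) k]/(cprod _ _ k) -[(a * dcoef b) k]/(cprod _ _ k).
rewrite (@cprod_ext k.+1 _ _ (t a)^`() (t b)) ?(@cprod_ext k.+1 a _ (t a) (t b)^`()) //.
- rewrite /dcoef -[(a * b) _]/(cprod _ _ _) (@cprod_ext k.+2 _ _ (t a) (t b)) //; try exact: tE.
  by rewrite mulr_natr -coef_deriv derivM coefD.
- by move=> i /ltnW; exact: tE.
- exact: dE.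
- exact: dE.
- by move=> i /ltnW; exact: tE.
Qed.

Lemma cbdM a b r M M' : 0 <= r -> cbd a r M -> cbd b r M' ->
  forall k, nm ((a * b) k) * r ^+ k <= k.+1%:R * (M * M').
Proof.
move=> r0 ha hb k; rewrite fpsM (le_trans (ler_wpM2r _ (nm_sum _ _ _))) ?exprn_ge0 //.
rewrite mulr_suml -[X in X%:R * _](card_ord k.+1) -sum1_card natr_sum mulr_suml.
apply: ler_sum => i _; rewrite mul1r nmM.
have -> : nm (a i) * nm (b (k - i)%N) * r ^+ k =
    (nm (a i) * r ^+ i) * (nm (b (k - i)%N) * r ^+ (k - i)).
  have ik : (i <= k)%N by rewrite -ltnS.
  by rewrite -[X in r ^+ X](subnKC ik) exprD; ring.
by apply: ler_pM; rewrite ?mulr_ge0 ?nm_ge0 ?exprn_ge0.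
Qed.

Lemma disc_coefM a b : disc_coef a -> disc_coef b -> disc_coef (a * b).
Proof.
move=> ha hb r /andP[r0 r1]; pose s := (r + 1) / 2.
have s0 : 0 < s by rewrite /s; lra.
have hs : 0 <= s < 1 by apply/andP; rewrite /s; split; lra.
have [M hM] := ha s hs; have [M' hM'] := hb s hs.
have q01 : 0 <= r / s < 1.
  by rewrite divr_ge0 ?(ltW s0) //= ltr_pdivrMr // mul1r /s; lra.
have [B hB] := poly_growth 0 q01; exists (M * M' * B) => k.
have -> : nm ((a * b) k) * r ^+ k = nm ((a * b) k) * s ^+ k * (r / s) ^+ k.
  by rewrite (pow_ratio r k (lt0r_neq0 s0)) mulrA.
have h := cbdM (ltW s0) hM hM' k.
rewrite (le_trans (ler_wpM2r _ h)) ?exprn_ge0 ?(andP q01).1 //.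
rewrite mulrAC mulrC ler_wpM2l ?hB // mulr_ge0 ?(cbd_ge0 hM) ?(cbd_ge0 hM') //.
Qed.

(** The product of two truncations differs from the truncated product by a tail
    of a dominated geometric series. *)
Lemma pevM a b z : disc_coef a -> disc_coef b -> nm z < 1 ->
  pev (a * b) z = pev a z * pev b z.
Proof.
move=> ha hb z1; have z0 := nm_ge0 z; pose s := (nm z + 1) / 2.
have s0 : 0 < s by rewrite /s; lra.
pose s' := (s + 1) / 2.
have hs' : 0 <= s' < 1 by apply/andP; rewrite /s' /s; split; lra.
have s'0 : 0 < s' by rewrite /s' /s; lra.
have [M hM] := ha s' hs'; have [M' hM'] := hb s' hs'.
have q01 : 0 <= s / s' < 1.
  by rewrite divr_ge0 ?(ltW s0) ?(ltW s'0) //= ltr_pdivrMr // mul1r /s' /s; lra.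
have p01 : 0 <= nm z / s < 1.
  by rewrite divr_ge0 ?(ltW s0) //= ltr_pdivrMr // mul1r /s; lra.
have [B hB] := poly_growth 0 q01.
pose t n (u : P) : P := fun i => if (i < n)%N then u i else 0.
have tb n (u : P) K : cbd u s' K -> cbd (t n u) s' K.
  move=> h k; rewrite /t; case: ifP => // _.
  by rewrite nm0 mul0r (cbd_ge0 h).
have tP n (u : P) : t n u = fun i => (\poly_(i < n) u i)`_i.
  by apply/funext => i; rewrite coef_poly.
apply: (tends_unique (disc_coefP (disc_coefM ha hb) z1)).
have hab := tendsM (disc_coefP ha z1) (disc_coefP hb z1).
move=> e e0; have e2 : 0 < e / 2 by rewrite divr_gt0.
have [N1 h1] := hab _ e2.
have [N2 h2] := exists_pow_lt (B * (M * M') / (1 - nm z / s)) p01 e2.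
exists (maxn N1 N2) => n; rewrite geq_max => /andP[n1 n2].
rewrite (le_lt_trans (nm_tri ((\sum_(k < n) a k * z ^+ k) * (\sum_(k < n) b k * z ^+ k)) _ _)) //.
rewrite [e]splitr ltrD ?h1 // nmC.
have sE (u : P) : \sum_(k < n) u k * z ^+ k = (\poly_(i < n) u i).[z] by rewrite horner_poly.
have -> : \sum_(k < n) (a * b) k * z ^+ k = \sum_(k < n) (t n a * t n b) k * z ^+ k.
  apply: eq_bigr => k _; congr (_ * _); rewrite !fpsM; apply: eq_bigr => i _; rewrite /t.
  have -> : (i < n)%N by apply: leq_ltn_trans (ltn_ord k); rewrite -ltnS.
  by have -> : (k - i < n)%N by exact: leq_ltn_trans (leq_subr _ _) (ltn_ord k).
have -> : (\sum_(k < n) a k * z ^+ k) * (\sum_(k < n) b k * z ^+ k) =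
    \sum_(k < n + n) (t n a * t n b) k * z ^+ k.
  rewrite !sE -hornerM (@horner_coef_wide _ (n + n)); last first.
    by rewrite (leq_trans (size_polyMleq _ _)) // (leq_trans (leq_pred _)) // leq_add // size_poly.
  apply: eq_bigr => k _; congr (_ * _); rewrite coefM fpsM !tP //.
have hu k : nm ((t n a * t n b) k * z ^+ k) <= B * (M * M') * (nm z / s) ^+ k.
  have h := cbdM (ltW s'0) (tb n _ _ hM) (tb n _ _ hM') k.
  rewrite nmM nmX.
  have -> : nm ((t n a * t n b) k) * nm z ^+ k =
     nm ((t n a * t n b) k) * s' ^+ k * (s / s') ^+ k * (nm z / s) ^+ k.
    rewrite (pow_ratio (nm z) k (lt0r_neq0 s0)) (pow_ratio s k (lt0r_neq0 s'0)).
    by rewrite !mulrA.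
  rewrite ler_wpM2r ?exprn_ge0 ?(andP p01).1 //.
  rewrite (le_trans (ler_wpM2r _ h)) ?exprn_ge0 ?(andP q01).1 //.
  rewrite mulrAC ler_wpM2r ?hB // mulr_ge0 ?(cbd_ge0 hM) ?(cbd_ge0 hM') //.
have := geometric_tail p01 hu n n; move/le_lt_trans; apply.
by rewrite mulrAC h2.
Qed.

End PowerSeries.

(** * Hardy spaces *)

(** ** Factorization of polynomials *)

Section Factor.
Context {R : realType}.
Local Notation C := R[i].
Local Notation T := (circle R).
Local Notation P := (fps R).
Implicit Types (a b h : P) (p q : {poly C}) (r s M : R) (z u : C).

Definition pfps p : P := fun k => p`_k.

Lemma pfpsM p q : pfps (p * q) = pfps p * pfps q.
Proof. by apply/funext => k; rewrite /pfps coefM fpsM. Qed.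

Lemma pfps1 : pfps 1 = 1.
Proof. by apply/funext => k; rewrite /pfps coef1. Qed.

Lemma pfps_bounded p : exists M, forall k, nm (pfps p k) <= M.
Proof.
exists (\sum_(i < size p) nm p`_i) => k; rewrite /pfps.
have [kp|/leq_sizeP/(_ _ (leqnn _)) ->] := ltnP k (size p); last first.
  by rewrite nm0 sumr_ge0 // => i _; rewrite nm_ge0.
by rewrite (bigD1 (Ordinal kp)) //= lerDl sumr_ge0 // => i _; rewrite nm_ge0.
Qed.

Lemma disc_coef_bounded a M : (forall k, nm (a k) <= M) -> disc_coef a.
Proof.
move=> h r /andP[r0 r1]; exists M => k; rewrite (le_trans _ (h k)) //.
by rewrite ler_piMr ?nm_ge0 // exprn_ile1 // ltW.
Qed.

Lemma disc_pfps p : disc_coef (pfps p).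
Proof. by have [M hM] := pfps_bounded p; exact: disc_coef_bounded hM. Qed.

Lemma pev_pfps p z : pev (pfps p) z = p.[z].
Proof.
apply: pev_eq => e e0; exists (size p) => n np.
by rewrite (horner_coef_wide z np) subrr nm0.
Qed.

(** The coefficients of x (u z). *)
Definition dilc u a : P := fun k => u ^+ k * a k.

Lemma dilcM u a b : dilc u (a * b) = dilc u a * dilc u b.
Proof.
apply/funext => k; rewrite /dilc !fpsM mulr_sumr; apply: eq_bigr => i _.
have ik : (i <= k)%N by rewrite -ltnS.
by rewrite -[X in u ^+ X * _](subnKC ik) exprD; ring.
Qed.

Lemma pev_dilc u a z : pev (dilc u a) z = pev a (u * z).
Proof.
rewrite /pev; congr (xget _ _); apply/funext => l; congr (tends _ l).
apply/funext => n.
by apply: eq_bigr => k _; rewrite /dilc exprMn; ring.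
Qed.

Lemma disc_dilc u a : nm u <= 1 -> disc_coef a -> disc_coef (dilc u a).
Proof.
move=> u1 ha r hr; have [M hM] := ha r hr; exists M => k.
rewrite (le_trans _ (hM k)) // ler_wpM2r ?exprn_ge0 ?(andP hr).1 //.
by rewrite nmM nmX ler_piMl ?nm_ge0 // exprn_ile1 ?nm_ge0.
Qed.

(** The Taylor coefficients of (1 - z)^(1/2), given by the binomial series. *)
Definition sqc : P := fun k => (\prod_(i < k) ((i%:R - 2^-1) / i.+1%:R : R))%:C.

Lemma sqcS k : sqc k.+1 * k.+1%:R = sqc k * (k%:R - 2^-1).
Proof.
rewrite /sqc big_ord_recr /= rmorphM /= -mulrA; congr (_ * _).
rewrite rmorphM /= fmorphV rmorph_nat divfK ?pnatr_eq0 //.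
by rewrite rmorphB /= fmorphV !rmorph_nat.
Qed.

Lemma sqc_bounded k : nm (sqc k) <= 1.
Proof.
elim: k => [|k IH]; first by rewrite /sqc big_ord0 nm1.
have -> : sqc k.+1 = sqc k * ((k%:R - 2^-1) / k.+1%:R)%:C.
  by rewrite /sqc big_ord_recr /= rmorphM.
rewrite nmM mulr_ile1 ?nm_ge0 // nmR.
rewrite normrM normfV [`|_.+1%:R|]ger0_norm // ler_pdivrMr ?ltr0n // mul1r ler_norml.
have := ler0n R k; rewrite -natr1; lra.
Qed.

Lemma mul_1X a k : (pfps (1 - 'X) * a) k = a k - (if k is j.+1 then a j else 0).
Proof.
rewrite fpsM big_ord_recl subn0 /pfps coefB coef1 coefX subr0 mul1r; congr (_ + _).
case: k => [|k]; first by rewrite big_ord0 oppr0.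
rewrite big_ord_recl big1 ?addr0 => [|i _]; last by rewrite coefB coef1 coefX subr0 mul0r.
by rewrite coefB coef1 coefX sub0r mulN1r /= subn1.
Qed.

(** The square satisfies the differential equation (1 - z) Y' = - Y of 1 - z. *)
Lemma sqc_sqr : sqc * sqc = pfps (1 - 'X).
Proof.
set Y := sqc * sqc.
have hs : pfps (1 - 'X) * dcoef sqc = (- 2^-1) *: sqc.
  apply/funext => k; rewrite mul_1X fpsZ /dcoef sqcS.
  by case: k => [|k]; field.
have hY : pfps (1 - 'X) * dcoef Y = - Y.
  rewrite dcoefM [sqc * dcoef _]mulrC mulrDr !mulrA hs fpsZl -/Y.
  by apply/funext => k; rewrite fpsD fpsZ fpsN; field.
have hk k : Y k.+1 * k.+1%:R = Y k * (k%:R - 1).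
  have := congr1 (fun f : P => f k) hY; rewrite mul_1X fpsN /dcoef.
  case: k => [|k] => [|h]; first by rewrite subr0 => ->; rewrite sub0r mulrN1.
  by rewrite -[LHS](subrK (Y k.+1 * k.+1%:R)) h; ring.
have Y0 : Y 0 = 1 by rewrite /Y fpsM big_ord_recl big_ord0 addr0 subn0 /sqc big_ord0 mulr1.
have Y1 : Y 1 = -1 by have := hk 0; rewrite mulr1 Y0 mul1r sub0r.
have Y2 k : Y k.+2 = 0.
  have nz (j : nat) : (j.+1%:R : C) != 0 by rewrite pnatr_eq0.
  have step j : Y j.+2 * j.+2%:R = 0 -> Y j.+2 = 0.
    by move=> /eqP; rewrite mulf_eq0 (negPf (nz _)) orbF => /eqP.
  by elim: k => [|k IH]; apply: step; rewrite hk ?IH ?subrr ?mulr0 ?mul0r.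
apply/funext => -[|[|k]]; rewrite /pfps coefB coef1 coefX.
- by rewrite Y0 subr0.
- by rewrite Y1 sub0r.
- by rewrite Y2 subr0.
Qed.

Lemma disc_sqc : disc_coef sqc.
Proof. exact: disc_coef_bounded sqc_bounded. Qed.

Lemma dilc_sqc u : dilc u sqc * dilc u sqc = pfps (1 - u%:P * 'X).
Proof.
rewrite -dilcM sqc_sqr; apply/funext => k; rewrite /dilc /pfps !coefB !coef1 coefCM coefX.
by case: k => [|[|k]] /=; rewrite ?expr0 ?expr1; ring.
Qed.

Lemma blaschke_norm z u : nm (1 - u^*%C * z) ^+ 2 - nm (z - u) ^+ 2 =
  (1 - nm z ^+ 2) * (1 - nm u ^+ 2).
Proof. by rewrite !nm_sqr; case: z => x y; case: u => v w /=; ring. Qed.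

Lemma blaschke_factor u : nm u < 1 -> exists b, [/\ disc_coef b,
  pfps (1 - (u^*%C)%:P * 'X) * b = pfps ('X - u%:P) &
  forall z, nm z < 1 -> nm (pev b z) <= 1].
Proof.
move=> u1; pose g : P := fun k => (u^*%C) ^+ k.
have dg : disc_coef g.
  by apply: (@disc_coef_bounded _ 1) => k; rewrite nmX nm_conj exprn_ile1 ?nm_ge0 // ltW.
have gE : pfps (1 - (u^*%C)%:P * 'X) * g = 1.
  have -> : g = dilc u^*%C (fun=> 1) by apply/funext => k; rewrite /dilc mulr1.
  rewrite -dilc_sqc -!dilcM sqc_sqr -[LHS]/(dilc _ _).
  apply/funext => k; rewrite /dilc mul_1X; case: k => [|k]; first by rewrite subr0 mulr1.
  by rewrite subrr mulr0.
exists (pfps ('X - u%:P) * g); split; first exact: disc_coefM (disc_pfps _) dg.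
  by rewrite mulrCA gE mulr1.
move=> z z1; have hu : nm (u^*%C * z) < 1.
  by rewrite nmM nm_conj mulr_ilt1 ?nm_ge0.
have d0 : 0 < nm (1 - u^*%C * z).
  rewrite nm_gt0 subr_eq0; apply: contraTneq hu => <-; by rewrite nm1 ltxx.
have : pev (pfps (1 - (u^*%C)%:P * 'X) * (pfps ('X - u%:P) * g)) z = z - u.
  by rewrite mulrCA gE mulr1 pev_pfps !hornerE.
rewrite pevM //; [|exact: disc_pfps|exact: disc_coefM (disc_pfps _) dg].
rewrite pev_pfps !hornerE => h.
rewrite -(ler_pM2l d0) -nmM h mulr1 -(@ler_pXn2r _ 2) ?nnegrE ?nm_ge0 //.
rewrite -subr_ge0 blaschke_norm mulr_ge0 // subr_ge0 exprn_ile1 ?nm_ge0 // ltW //.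
Qed.

(** A root inside the disc is reflected in the circle at the cost of a Blaschke
    factor; the other linear factors have analytic square roots in the disc. *)
Lemma poly_sqrt_blaschke p : exists h b q, [/\ disc_coef h /\ disc_coef b,
  h * h = pfps q, pfps q * b = pfps p, forall z, nm z < 1 -> nm (pev b z) <= 1 &
  forall z, nm z = 1 -> nm q.[z] = nm p.[z]].
Proof.
have [rs ->] := closed_field_poly_normal p.
elim: rs => [|u rs [h [b [q [[dh db] hq qb b1 qp]]]]].
  rewrite big_nil -mul_polyC mulr1; set c := lead_coef p.
  exists (pfps (sqrtC c)%:P), 1, c%:P; split=> //.
  - by split; [exact: disc_pfps|rewrite -pfps1; exact: disc_pfps].
  - by rewrite -pfpsM -polyCM -expr2 sqrtCK.
  - by rewrite mulr1.
  - by move=> z _; rewrite -pfps1 pev_pfps hornerC nm1.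
rewrite big_cons scalerAr mulrC; set p0 := _ *: _ in qb qp *.
have [u1|u1] := ltP (nm u) 1; last first.
  have u0 : u != 0 by rewrite -nm_gt0 (lt_le_trans ltr01).
  have uV : nm u^-1 <= 1 by rewrite nmV invf_le1 // (lt_le_trans ltr01).
  exists (h * (sqrtC (- u) *: dilc u^-1 sqc)), b, (q * ('X - u%:P)); split=> //.
  - split=> //; apply: disc_coefM => //; apply: disc_coefZ.
    exact: disc_dilc disc_sqc.
  - rewrite mulrACA hq pfpsM; congr (_ * _).
    rewrite fpsZl fpsZr scalerA -expr2 sqrtCK dilc_sqc.
    apply/funext => k; rewrite fpsZ /pfps !coefB coef1 coefCM coefX coefC.
    by case: k => [|[|k]] /=; field.
  - by rewrite !pfpsM mulrAC qb.
  - by move=> z z1; rewrite !hornerM !nmM qp.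
have [be [dbe be1 be2]] := blaschke_factor u1.
exists (h * dilc u^*%C sqc), (b * be), (q * (1 - (u^*%C)%:P * 'X)); split=> //.
- split; last exact: disc_coefM.
  by apply: disc_coefM => //; apply: disc_dilc disc_sqc; rewrite nm_conj ltW.
- by rewrite mulrACA hq dilc_sqc pfpsM.
- by rewrite !pfpsM mulrACA qb be1.
- move=> z z1; rewrite pevM // nmM; apply: mulr_ile1; rewrite ?nm_ge0 ?b1 ?be2 //.
- move=> z z1; rewrite !hornerM !nmM qp //; congr (_ * _).
  apply/eqP; rewrite -(@eqrXn2 _ 2) ?nm_ge0 //; apply/eqP/subr0_eq.
  by rewrite !hornerE blaschke_norm z1 expr1n subrr mul0r.
Qed.

End Factor.

(** ** Functions of the Hardy space are products of two square summable series *)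

Section HardyFactor.
Context {R : realType}.
Local Notation C := R[i].
Local Notation T := (circle R).
Local Notation P := (fps R).
Implicit Types (a b h : P) (p q : {poly C}) (r s M B : R) (z u : C).

Lemma bernoulli_1X r n : 0 <= r <= 1 -> 1 - r ^+ n <= n%:R * (1 - r).
Proof.
move=> /andP[r0 r1]; elim: n => [|n IH]; first by rewrite expr0 subrr mul0r.
have h : r ^+ n <= 1 by rewrite exprn_ile1.
have h0 : 0 <= r ^+ n by rewrite exprn_ge0.
have -> : 1 - r ^+ n.+1 = (1 - r ^+ n) + r ^+ n * (1 - r) by rewrite exprS; ring.
rewrite -natr1 mulrDl mul1r lerD // ler_piMl // subr_ge0 //.
Qed.

Lemma realC_X1 (t : R) n : (t ^+ n - 1)%:C = t%:C ^+ n - 1.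
Proof. by rewrite (rmorphB (real_complex R)) (rmorphXn (real_complex R)) rmorph1. Qed.

(** The squared l^2 norm is at most B. *)
Definition l2le a B := forall n, \sum_(l < n) nm (a l) ^+ 2 <= B.

Lemma l2le_ge0 a B : l2le a B -> 0 <= B.
Proof. by move=> /(_ 0); rewrite big_ord0. Qed.

Lemma l2le_coef a B l : l2le a B -> nm (a l) <= B + 1.
Proof.
move=> /(_ l.+1); rewrite big_ord_recr /=.
have : 0 <= \sum_(i < l) nm (a i) ^+ 2 by apply: sumr_ge0 => i _; exact: sqr_ge0.
have : 0 <= (nm (a l) - 1) ^+ 2 by exact: sqr_ge0.
by rewrite sqrrB1; have := nm_ge0 (a l); have := sqr_ge0 (nm (a l)); 
  rewrite -mulr_natl; lra.
Qed.

Lemma l2le_disc a B : l2le a B -> disc_coef a.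
Proof. by move=> h; apply: disc_coef_bounded => l; exact: l2le_coef h. Qed.

Lemma disc_pair a r : disc_coef a -> 0 <= r < 1 -> exists s M, cbd a s M /\ r < s.
Proof.
move=> ha /andP[r0 r1]; have [|M hM] := ha ((r + 1) / 2); first by apply/andP; split; lra.
by exists ((r + 1) / 2), M; split=> //; lra.
Qed.

Lemma dil_mul a b r (z : T) : disc_coef a -> disc_coef b -> 0 <= r < 1 ->
  dil (a * b) r z = dil a r z * dil b r z.
Proof.
by move=> ha hb /andP[r0 r1]; rewrite /dil pevM // nm_rpt.
Qed.

Lemma dil_pfps p r (z : T) : dil (pfps p) r z = p.[r%:C * pt z].
Proof. by rewrite /dil pev_pfps. Qed.

Lemma poly_dil_lip p : exists K, forall r (z : T), 0 <= r <= 1 ->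
  nm (p.[r%:C * pt z] - p.[pt z]) <= K * (1 - r).
Proof.
exists (\sum_(i < size p) nm p`_i * i%:R) => r z hr.
have /andP[r0 r1] := hr.
rewrite !horner_coef -sumrB mulr_suml (le_trans (nm_sum _ _ _)) //.
apply: ler_sum => i _; rewrite -mulrBr nmM -mulrA ler_wpM2l ?nm_ge0 //.
have -> : (r%:C * pt z) ^+ i - pt z ^+ i = (r ^+ i - 1)%:C * pt z ^+ i.
  by rewrite exprMn realC_X1 mulrBl mul1r.
rewrite nmM nmR nmX nm_circle expr1n mulr1 distrC ger0_norm ?bernoulli_1X //.
by rewrite subr_ge0 exprn_ile1.
Qed.

Lemma cmeas_horner p : cmeas (fun z : T => p.[pt z]).
Proof.
apply: cmeas_ext (cmeas_poly (size p) (fun i => p`_i)) => z.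
by rewrite horner_coef.
Qed.

Lemma cint_horner p : cint (fun z : T => p.[pt z]).
Proof.
apply: (cint_bounded (cmeas_horner p) (B := \sum_(i < size p) nm p`_i)) => z.
by rewrite horner_coef; exact: (@nm_poly_le _ (size p) (fun i => p`_i) z).
Qed.

Lemma l2le_lim a B (K : R) : disc_coef a -> (forall r, 0 < r < 1 ->
    rI (fun z : T => nm (dil a r z) ^+ 2) <= B + K * (1 - r)) -> l2le a B.
Proof.
move=> ha hB n; pose S := \sum_(l < n) nm (a l) ^+ 2 * (2 * l)%:R.
have S0 : 0 <= S by apply: sumr_ge0 => i _; rewrite mulr_ge0 ?sqr_ge0.
apply/ler_addgt0Pr => e e0; pose d := e / (S + `|K| + 1 + e).
have D0 : 0 < S + `|K| + 1 + e by have := normr_ge0 K; lra.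
have d0 : 0 < d by rewrite divr_gt0.
have d1 : d < 1 by rewrite ltr_pdivrMr // mul1r; have := normr_ge0 K; lra.
pose r := 1 - d; have hr : 0 < r < 1 by rewrite /r; apply/andP; split; lra.
have r01 : 0 <= r <= 1 by apply/andP; split; rewrite ltW // ?(andP hr).1 ?(andP hr).2.
have hr' : 0 <= r < 1 by rewrite (andP r01).1 (andP hr).2.
have [s [M [hs rs]]] := disc_pair ha hr'.
have := bessel hs (andP r01).1 rs n => hb.
have hS : \sum_(l < n) nm (a l) ^+ 2 <= \sum_(l < n) (nm (a l) * r ^+ l) ^+ 2 + S * d.
  rewrite mulr_suml -big_split /=; apply: ler_sum => l _.
  rewrite exprMn -exprM mulnC -mulrA -mulrDr ler_peMr ?sqr_ge0 //.
  by have := bernoulli_1X (2 * l) r01; rewrite /r; lra.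
have := hB r hr => h2.
have hd : (S + `|K|) * d <= e.
  rewrite mulrA ler_pdivrMr // mulrC ler_wpM2l ?(ltW e0) //; lra.
have : K * (1 - r) <= `|K| * d.
  by rewrite /r opprB addrC subrK ler_wpM2r ?(ltW d0) // ler_norm.
move: hd; rewrite mulrDl; lra.
Qed.

(** In the factorization h (h b) of p, the modulus of h squared is that of p on the
    circle, and |b| <= 1; so the mean of |p| bounds the squared norm of both factors. *)
Lemma poly_factor p : exists h k : P, [/\ h * k = pfps p,
  l2le h (rI (fun z : T => nm p.[pt z])) & l2le k (rI (fun z : T => nm p.[pt z]))].
Proof.
have [h [b [q [[dh db] hq qb b1 qp]]]] := poly_sqrt_blaschke p.
have [K hK] := poly_dil_lip q.
have dhb := disc_coefM dh db.
have eqI : rI (fun z : T => nm p.[pt z]) = rI (fun z : T => nm q.[pt z]).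
  by apply: rI_ext => z; rewrite qp // nm_circle.
have key (k : P) : disc_coef k -> (forall r (z : T), 0 <= r < 1 -> nm (dil k r z) <= nm (dil h r z)) ->
    l2le k (rI (fun z : T => nm p.[pt z])).
  move=> dk kh; apply: (@l2le_lim _ _ K) => // r /andP[r0 r1].
  have hr : 0 <= r < 1 by rewrite ltW.
  have [s [M [hs rs]]] := disc_pair dk hr.
  rewrite eqI -[X in _ + X](@rI_cst R) -rID; [|exact: (cint_horner q).2|exact: rint_cst].
  apply: le_rI; [exact: rint_dil_sqr hs (ltW r0) rs|by apply: rintD; [exact: (cint_horner q).2|exact: rint_cst]|].
  move=> z; rewrite (le_trans (_ : _ <= nm (dil h r z) ^+ 2)) //.
    by apply: lerXn2r; rewrite ?nnegrE ?nm_ge0 ?kh.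
  rewrite expr2 -nmM -dil_mul // hq dil_pfps.
  have := hK r z; rewrite (ltW r0) (ltW r1) => /(_ isT) hh.
  have := nmD (q.[r%:C * pt z] - q.[pt z]) q.[pt z]; rewrite subrK => /le_trans; apply.
  by rewrite addrC lerD2l.
exists h, (h * b); split; first by rewrite mulrA hq.
  by apply: key.
apply: key => // r z hr; rewrite dil_mul // nmM ler_piMr ?nm_ge0 // /dil b1 //.
by rewrite nm_rpt ?(andP hr).1 ?(andP hr).2.
Qed.

(** Bounded sequences of power series have coefficientwise limits along an
    ultrafilter, so the factorizations of the truncations of a function of the
    Hardy space have a limit. *)
Lemma ultra_lim (U : set_system nat) (u : nat -> C) B : UltraFilter U ->
  (forall j, nm (u j) <= B) -> exists l : C, u @ U --> l.
Proof.
move=> UU hB.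
have lim (v : nat -> R) : (forall j, `|v j| <= B) -> exists l : R, v @ U --> l.
  move=> hv; have cK := @segment_compact R (- B) B.
  have UV : UltraFilter (v @ U).
    split; first exact: fmap_proper_filter.
    move=> G GF sG; apply/seteqP; split=> // A GA.
    have [//|nA] := in_ultra_setVsetC (v @^-1` A) UU.
    have := sG _ (nA : (v @ U) (~` A)) => GnA.
    by have := filterI GA GnA; rewrite setICr => h; case: (filter_not_empty G (h _)).
  move: cK; rewrite compact_ultra => /(_ (v @ U) UV) [|l [_ hl]]; last by exists l.
  change (U (v @^-1` `[- B, B]%classic)).
  by apply: filterE => j; rewrite /= in_itv /= -ler_norml; exact: hv.
have [x hx] := lim (fun j => complex.Re (u j)) (fun j => le_trans (Re_nm _) (hB j)).
have [y hy] := lim (fun j => complex.Im (u j)) (fun j => le_trans (Im_nm _) (hB j)).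
exists (x +i* y); apply/cvgrPdist_lt => e; rewrite ltcE /= => /andP[/eqP eI e0].
have e2 : 0 < complex.Re e / 2 by rewrite divr_gt0.
move/cvgrPdist_lt : hx => /(_ _ e2) hx; move/cvgrPdist_lt : hy => /(_ _ e2) hy.
near=> j; rewrite normE [e]complexE eI mulr0 addr0 ltcR.
rewrite (le_lt_trans (nm_ReIm _)) // [ltRHS]splitr ltrD //.
  by rewrite ReD ReN /=; near: j.
by rewrite ImD ImN /=; near: j.
Unshelve. all: by end_near. Qed.

Lemma cvg_ord_sum (K : numFieldType) (V : normedModType K) (F : set_system nat)
    {FF : Filter F} n (u : nat -> nat -> V) (v : nat -> V) :
  (forall i, u i j @[j --> F] --> v i) ->
  \sum_(i < n) u i j @[j --> F] --> \sum_(i < n) v i.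
Proof.
move=> h; elim: n => [|n IH].
  by rewrite big_ord0; under eq_fun do rewrite big_ord0; exact: cvg_cst.
by rewrite big_ord_recr /=; under eq_fun do rewrite big_ord_recr /=; exact: cvgD.
Qed.

Lemma cvg_nm (F : set_system nat) {FF : Filter F} (u : nat -> C) l :
  u @ F --> l -> nm (u j) @[j --> F] --> nm l.
Proof.
move=> hu; apply/cvgrPdist_lt => e e0.
move/cvgrPdist_lt : hu => /(_ e%:C); rewrite ltcR => /(_ e0); apply: filterS => j.
rewrite normE ltcR; apply: le_lt_trans.
rewrite ler_norml lerBlDr lerBrDr addrC; apply/andP; split.
  have := nmD (u j - l) l; rewrite subrK nmC; lra.
have := nmD (l - u j) (u j); rewrite subrK; lra.
Qed.

(** Truncations of x (r z), with r tending to 1, are factored as polynomials with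
    bounded l^2 norms; the factors converge along an ultrafilter. *)
Lemma hardy_factor a M : disc_coef a ->
  (forall r, 0 <= r < 1 -> rI (fun z : T => nm (dil a r z)) <= M) ->
  exists h k : P, [/\ h * k = a, l2le h (M + 1) & l2le k (M + 1)].
Proof.
move=> ha hM; pose r (j : nat) : R := 1 - j.+2%:R^-1.
have hr j : 0 <= r j < 1.
  by rewrite /r subr_ge0 invf_le1 ?ltr0n // ler1n /= ltrBlDr ltrDl invr_gt0 ltr0n.
have hp j : exists p, (forall k, (k <= j)%N -> p`_k = a k * (r j)%:C ^+ k) /\
    rI (fun z : T => nm p.[pt z]) <= M + 1.
  have [s [K [hs rs]]] := disc_pair ha (hr j); have r0 := (andP (hr j)).1.
  have [N hN] := dil_small_tail hs r0 rs ltr01.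
  pose n := maxn N j.+1; exists (\poly_(i < n) (a i * (r j)%:C ^+ i)); split.
    by move=> k kj; rewrite coef_poly /n leq_max ltnS kj orbT.
  rewrite -[X in _ + X](@rI_cst R) (le_trans _ (lerD (hM _ (hr j)) (lexx _))) //.
  rewrite -rID; [|exact: (cint_dil hs r0 rs).2|exact: rint_cst].
  apply: le_rI; [exact: (cint_horner _).2|by apply: rintD; [exact: (cint_dil hs r0 rs).2|exact: rint_cst]|].
  move=> z; rewrite horner_poly; have := hN n (leq_maxl _ _) z; rewrite nmC.
  set S := \sum_(i < n) _ => hS; have := nmD (S - dil a (r j) z) (dil a (r j) z).
  by rewrite subrK; lra.
have {}hp j : exists hk : P * P, [/\ forall k, (k <= j)%N -> (hk.1 * hk.2) k = a k * (r j)%:C ^+ k,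
    l2le hk.1 (M + 1) & l2le hk.2 (M + 1)].
  have [p [pa pM]] := hp j; have [h [k [hk h2 k2]]] := poly_factor p.
  exists (h, k); rewrite /= hk; split; first by move=> i ij; rewrite /pfps pa.
    by move=> n; rewrite (le_trans (h2 n)).
  by move=> n; rewrite (le_trans (k2 n)).
pose hk j := projT1 (cid (hp j)); have hkP j := projT2 (cid (hp j)).
have [U [UU hU]] := @ultraFilterLemma nat \oo _.
have PU : ProperFilter U by exact: ultra_proper.
have lim (g : nat -> P) : (forall j, l2le (g j) (M + 1)) ->
    exists f : P, (forall k, g j k @[j --> U] --> f k) /\ l2le f (M + 1).
  move=> hg; have hl k := ultra_lim UU (fun j => l2le_coef k (hg j)).
  exists (fun k => projT1 (cid (hl k))).
  have hf k : g j k @[j --> U] --> projT1 (cid (hl k)) := projT2 (cid (hl k)).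
  split=> // n; have : (\sum_(l < n) nm (g j l) ^+ 2) @[j --> U] -->
      \sum_(l < n) nm (projT1 (cid (hl l))) ^+ 2.
    apply: (@cvg_ord_sum _ R^o U _ n (fun l j => nm (g j l) ^+ 2) (fun l => nm (projT1 (cid (hl l))) ^+ 2)).
    by move=> l; rewrite expr2; under eq_fun do rewrite expr2; apply: cvgM; exact: cvg_nm.
  move=> /cvgrPdist_lt hc; apply/ler_addgt0Pr => e /hc /filter_ex[j].
  by rewrite ltr_distl => /andP[_]; have := hg j n; lra.
have [|h [hh h2]] := lim (fun j => (hk j).1); first by move=> j; have [] := hkP j.
have [|k [kh k2]] := lim (fun j => (hk j).2); first by move=> j; have [] := hkP j.
exists h, k; split=> //; apply/funext => l.
have h1 : ((hk j).1 * (hk j).2) l @[j --> U] --> (h * k) l.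
  rewrite fpsM; under eq_fun do rewrite fpsM.
  apply: (@cvg_ord_sum _ C^o U _ l.+1 (fun i j => (hk j).1 i * (hk j).2 (l - i)%N) (fun i => h i * k (l - i)%N)).
  by move=> i; apply: cvgM; [exact: hh|exact: kh].
have h3 : ((hk j).1 * (hk j).2) l @[j --> \oo] --> a l.
  apply/cvg_tends => e e0; pose K := nm (a l) * l%:R.
  have K0 : 0 <= K by rewrite mulr_ge0 ?nm_ge0.
  have [N hN] : exists N : nat, K / e < N%:R.
    by eexists; apply: (le_lt_trans (ler_norm _)); exact: archi_boundP.
  exists (maxn N l) => j; rewrite geq_max => /andP[Nj lj].
  have [-> // _ _] := hkP j; have /andP[r0 r1] := hr j.
  have -> : a l * (r j)%:C ^+ l - a l = a l * (r j ^+ l - 1)%:C.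
    by rewrite realC_X1 mulrBr mulr1.
  rewrite nmM nmR distrC ger0_norm; last by rewrite subr_ge0 exprn_ile1 // ltW.
  have hb : 1 - r j ^+ l <= l%:R * (1 - r j) by apply: bernoulli_1X; rewrite r0 ltW.
  rewrite (le_lt_trans (ler_wpM2l (nm_ge0 _) hb)) // mulrA -/K /r opprB addrC subrK.
  rewrite ltr_pdivrMr // mulrC -ltr_pdivrMr // (lt_le_trans hN) // ler_nat.
  by rewrite (leq_trans Nj) // leqW.
have h4 : ((hk j).1 * (hk j).2) l @[j --> U] --> a l by move=> A /h3; exact: hU.
exact: (cvg_unique _ h1 h4).
Qed.

End HardyFactor.

(** ** Means converge to the boundary values *)

Section HardyLimit.
Context {R : realType}.
Local Notation C := R[i].
Local Notation T := (circle R).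
Local Notation P := (fps R).
Local Notation mu := (@circle_measure R).
Implicit Types (a b h : P) (r s M B : R) (z : T).

Lemma rI_fatou (g : nat -> T -> R) (f : T -> R) c :
  (forall j, rint (g j)) -> (forall j z, 0 <= g j z) ->
  measurable_fun setT f -> (forall z, 0 <= f z) ->
  {ae mu, forall z, g j z @[j --> \oo] --> f z} ->
  (forall j, rI (g j) <= c) -> rint f /\ rI f <= c.
Proof.
move=> ig g0 mf f0 gf hc; apply: rint_ge0P => //.
have mg j : measurable_fun setT (EFin \o g j) by case/integrableP : (ig j).
have hl : (limn_einf (fun n => \int[mu]_(x in setT) (EFin \o g n) x) <= c%:E)%E.
  rewrite limn_einf_lim; apply: lime_le; first exact: is_cvg_einfs.
  apply: nearW => n; apply: (@le_trans _ _ (\int[mu]_x (EFin \o g n) x)%E).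
    by apply: ereal_inf_lbound; exists n => //=.
  by rewrite rI_EFin // lee_fin hc.
have H : (\int[mu]_(z in setT) limn_einf (fun j => (EFin \o g j) z) <= c%:E)%E.
  by apply: (le_trans _ hl); apply: fatou => // j z _; rewrite lee_fin.
apply: (le_trans _ H).
rewrite le_eqVlt; apply/orP; left; apply/eqP; apply: ae_eq_integral => //.
- exact/measurable_EFinP.
- rewrite (_ : (fun z => _) = -%E \o (fun z => limn_esup (fun j => - (EFin \o g j) z)%E)) //.
  apply: measurableT_comp => //.
  apply: measurable_fun_limn_esup => j.
  exact: measurableT_comp.
- case: gf => N [mN N0 hN]; exists N; split=> // z /= hz; apply: hN => /= hz'; apply: hz => _.
  have /cvg_ex hh : exists l : \bar R, (g j z)%:E @[j --> \oo] --> l.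
    by exists (f z)%:E; apply: cvg_EFin; [exact: nearW|exact: hz'].
  rewrite is_cvg_limn_einfE //; apply/esym/cvg_lim => //.
  by apply: cvg_EFin => //; apply: nearW.
Qed.

Lemma dil_negcoef a s M r m : cbd a s M -> 0 <= r -> r < s -> (0 < m)%N ->
  cI (fun z : T => dil a r z * pt z ^+ m) = 0.
Proof.
move=> ha r0 rs m0; apply/eqP; rewrite -nm_eq0 eq_le nm_ge0 andbT.
apply/ler_addgt0Pr => e e0; rewrite add0r.
have [N hN] := dil_small_tail ha r0 rs e0.
have mc : cmeas (fun z : T => pt z ^+ m) by exact/cmeasX/cmeas_id.
have n1 (z : T) : nm (pt z ^+ m) <= 1 by rewrite nmX nm_circle expr1n.
pose S (z : T) := \sum_(k < N) (a k * r%:C ^+ k) * pt z ^+ k.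
have cS : cint S.
  apply: (cint_bounded (cmeas_poly N (fun k => a k * r%:C ^+ k))) => z.
  exact: (@nm_poly_le _ N (fun k => a k * r%:C ^+ k) z).
have S0 : cI (fun z : T => S z * pt z ^+ m) = 0.
  have ci k : cint (fun z : T => (a k * r%:C ^+ k) * (pt z ^+ (k + m) * (pt z)^*%C ^+ 0)).
    exact/cintZ/cint_char.
  rewrite (@cI_ext _ _ (fun z : T => \sum_(k < N) (a k * r%:C ^+ k) * (pt z ^+ (k + m) * (pt z)^*%C ^+ 0))).
    rewrite cI_sum; last by move=> k; exact: ci.
    rewrite big1 // => k _; rewrite cIZ ?cI_char; last exact: cint_char.
    by rewrite addn_eq0 -[m == 0]negbK -lt0n m0 andbF mulr0.
  by move=> z; rewrite mulr_suml; apply: eq_bigr => k _; rewrite expr0 mulr1 exprD mulrA.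
have cd := cint_dil ha r0 rs.
rewrite -[cI _]subr0 -S0 -cIB; [|exact: cintM cd mc n1|exact: cintM cS mc n1].
have cc := cintB (cintM cd mc n1) (cintM cS mc n1).
rewrite (le_trans (nm_cI cc)) // -[X in _ <= X](@rI_cst R); apply: le_rI; last first.
- move=> z; rewrite -mulrBl nmM nmX nm_circle expr1n mulr1.
  by rewrite ltW // hN.
- exact: rint_cst.
- exact: cc.2.
Qed.

Section Dil.
Variables (a : P) (r : R).
Hypotheses (ha : disc_coef a) (hr : 0 <= r < 1).

Lemma disc_dil : exists s M, [/\ cbd a s M, 0 <= r & r < s].
Proof.
have [s [M [h rs]]] := disc_pair ha hr; have /andP[r0 _] := hr.
by exists s, M.
Qed.

Lemma cint_ddil : cint (dil a r).
Proof. by have [s [M [h r0 rs]]] := disc_dil; exact: cint_dil h r0 rs. Qed.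

Lemma ddil_bounded : exists B, forall z, nm (dil a r z) <= B.
Proof. by have [s [M [h r0 rs]]] := disc_dil; eexists; exact: dil_le h r0 rs. Qed.

Lemma rint_ddil_sqr : rint (fun z : T => nm (dil a r z) ^+ 2).
Proof. by have [s [M [h r0 rs]]] := disc_dil; exact: rint_dil_sqr h r0 rs. Qed.

Lemma l2le_dil B : l2le a B -> rI (fun z : T => nm (dil a r z) ^+ 2) <= B.
Proof.
move=> h; have [s [M [hs r0 rs]]] := disc_dil.
apply: (parseval_le hs r0 rs) => n; rewrite (le_trans _ (h n)) //.
apply: ler_sum => l _; apply: lerXn2r; rewrite ?nnegrE ?mulr_ge0 ?nm_ge0 ?exprn_ge0 //.
by rewrite ler_piMr ?nm_ge0 // exprn_ile1 // ltW // (andP hr).2.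
Qed.

End Dil.

Lemma l2le_tail h B e : l2le h B -> 0 < e ->
  exists N, forall n, \sum_(l < n | (N <= l)%N) nm (h l) ^+ 2 <= e.
Proof.
move=> hB e0; pose S n := \sum_(l < n) nm (h l) ^+ 2.
have hs : has_sup (range S).
  by split; [exists (S 0), 0|exists B => _ [n _ <-]; exact: hB].
have [_ [N _ <-] hN] := sup_adherent e0 hs; exists N => n.
have hu : S (maxn n N) <= sup (range S) by apply: ub_le_sup; [exact: hs.2|exists (maxn n N)].
have -> : \sum_(l < n | (N <= l)%N) nm (h l) ^+ 2 =
    \sum_(0 <= l < n | (N <= l)%N) nm (h l) ^+ 2 by rewrite big_mkord.
have h1 : \sum_(0 <= l < n | (N <= l)%N) nm (h l) ^+ 2 <=
    \sum_(0 <= l < maxn n N | (N <= l)%N) nm (h l) ^+ 2.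
  rewrite [leRHS](@big_cat_nat _ _ _ n _ _ _ _ (leq0n n) (leq_maxl n N)) /= lerDl.
  by apply: sumr_ge0 => *; exact: sqr_ge0.
rewrite (le_trans h1) //; move: hu hN; rewrite /S -!(big_mkord xpredT (fun l => nm (h l) ^+ 2)).
rewrite (bigID (fun l => (N <= l)%N)) /= => hu hN.
have : \sum_(0 <= i < N) nm (h i) ^+ 2 <= \sum_(0 <= i < maxn n N | ~~ (N <= i)%N) nm (h i) ^+ 2.
  rewrite [leRHS](@big_cat_nat _ _ _ N _ _ _ _ (leq0n N) (leq_maxr n N)) /= big_mkcond.
  rewrite -[leLHS]addr0 lerD //; last by apply: sumr_ge0 => *; exact: sqr_ge0.
  rewrite [leRHS]big_mkcond /= !big_mkord; apply: ler_sum => i _ /=.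
  by rewrite -ltnNge ltn_ord.
lra.
Qed.

(** By Parseval the mean is the sum of |h_k|^2 (r^k - s^k)^2, whose tail is small
    uniformly in r and s. *)
Lemma l2_cauchy h B e : l2le h B -> 0 < e -> exists2 rho, 0 <= rho < 1 &
  forall r s, rho <= r < 1 -> rho <= s < 1 ->
    rI (fun z => nm (dil h r z - dil h s z) ^+ 2) <= e.
Proof.
move=> hB e0; have [N hN] := l2le_tail hB (divr_gt0 e0 (ltr0Sn R 1)).
have B0 := l2le_ge0 hB; pose D := (B + 1) * (N%:R ^+ 2 + 1).
have D0 : 0 < D by rewrite mulr_gt0 // ltr_wpDl ?sqr_ge0.
pose d := Num.min (1 / 2) (Num.min 1 (e / 2 / D)).
have d0 : 0 < d by rewrite !lt_min ltr01 !divr_gt0.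
have d1 : d <= 1 / 2 by rewrite ge_min lexx.
have d2 : d <= 1 by rewrite /d !ge_min lexx !orbT.
have d3 : d <= e / 2 / D by rewrite /d !ge_min lexx !orbT.
exists (1 - d); first by apply/andP; split; lra.
move=> r s /andP[r0 r1] /andP[s0 s1].
have hr : 0 <= r < 1 by apply/andP; split; lra.
have hs : 0 <= s < 1 by apply/andP; split; lra.
have [t [t0 t1 rt st]] : exists t, [/\ 0 < t, t < 1, r < t & s < t].
  have rm : r <= Num.max r s by rewrite le_max lexx.
  have sm : s <= Num.max r s by rewrite le_max lexx orbT.
  have m1 : Num.max r s < 1 by rewrite gt_max r1.
  by exists ((Num.max r s + 1) / 2); split; lra.
pose c : P := fun l => h l * ((r / t)%:C ^+ l - (s / t)%:C ^+ l).
have c1 : cbd c 1 ((B + 1) * 2).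
  move=> l; rewrite expr1n mulr1 nmM; apply: ler_pM; rewrite ?nm_ge0 ?(l2le_coef l hB) //.
  rewrite (le_trans (nmB _ _)) // !nmX !nmR_ge0 ?divr_ge0 ?(ltW t0) ?(andP hr).1 ?(andP hs).1 //.
  have q1 (v : R) : 0 <= v -> v < t -> (v / t) ^+ l <= 1.
    move=> v0 vt; rewrite exprn_ile1 ?divr_ge0 ?(ltW t0) //.
    by rewrite ler_pdivrMr // mul1r ltW.
  by rewrite (_ : 2 = 1 + 1) // lerD // q1 ?(andP hr).1 ?(andP hs).1.
have cE z : dil c t z = dil h r z - dil h s z.
  have dh := l2le_disc hB.
  have dE (u : R) : 0 <= u < t -> dil (dilc (u / t)%:C h) t z = dil h u z.
    move=> /andP[u0 ut]; rewrite /dil pev_dilc mulrA -rmorphM /= divfK ?gt_eqF //.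
  have dd (u : R) : 0 <= u < t -> disc_coef (dilc (u / t)%:C h).
    move=> /andP[u0 ut]; apply: disc_dilc => //; rewrite nmR_ge0 ?divr_ge0 ?(ltW t0) //.
    by rewrite ler_pdivrMr // mul1r ltW.
  have hr' : 0 <= r < t by rewrite (andP hr).1.
  have hs' : 0 <= s < t by rewrite (andP hs).1.
  rewrite -(dE r) // -(dE s) // /dil.
  have zt : nm (t%:C * pt z) < 1 by rewrite nm_rpt // ltW.
  have := pevD (dd r hr') (disc_coefZ (-1) (dd s hs')) zt; rewrite (pevZ (-1) (dd s hs') zt) mulN1r => <-.
  congr (pev _ _); apply/funext => l; rewrite fpsD fpsZ /c /dilc.
  by rewrite mulN1r [_ * h l]mulrC [_ * h l]mulrC -mulrBr.
under eq_fun do rewrite -cE.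
apply: (parseval_le c1 (ltW t0) t1) => n.
have cl l : (nm (c l) * t ^+ l) ^+ 2 = nm (h l) ^+ 2 * (r ^+ l - s ^+ l) ^+ 2.
  have -> : nm (c l) * t ^+ l = nm (h l) * `|r ^+ l - s ^+ l|.
    rewrite nmM -mulrA; congr (_ * _).
    have -> : (r / t)%:C ^+ l - (s / t)%:C ^+ l = ((r / t) ^+ l - (s / t) ^+ l)%:C.
      by rewrite (rmorphB (real_complex R)) !(rmorphXn (real_complex R)).
    rewrite nmR -[t ^+ l in LHS]ger0_norm ?exprn_ge0 ?(ltW t0) // -normrM.
    by congr (`| _ |); rewrite mulrBl -!exprMn !divfK ?gt_eqF.
  by rewrite exprMn real_normK ?num_real.
under eq_bigr do rewrite cl.
have pl l u : 1 - d <= u < 1 -> 0 <= u ^+ l <= 1 /\ 1 - u ^+ l <= l%:R * d.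
  move=> /andP[u0 u1]; have u00 : 0 <= u by lra.
  split; first by rewrite exprn_ge0 // exprn_ile1 // ltW.
  have u01 : 0 <= u <= 1 by rewrite u00 ltW.
  by rewrite (le_trans (bernoulli_1X l u01)) // ler_wpM2l //; lra.
rewrite (bigID (fun l : 'I_n => (N <= l)%N)) /= [leRHS]splitr lerD //.
  rewrite (le_trans _ (hN n)) //; apply: ler_sum => l _; rewrite ler_piMr ?sqr_ge0 //.
  have [|ra _] := pl l r; first by rewrite r0.
  have [|sa _] := pl l s; first by rewrite s0.
  have : `|r ^+ l - s ^+ l| <= 1 by rewrite ler_norml; lra.
  by move=> h1; rewrite -real_normK ?num_real // exprn_ile1.
have hl (l : 'I_n) : ~~ (N <= l)%N -> nm (h l) ^+ 2 * (r ^+ l - s ^+ l) ^+ 2 <= nm (h l) ^+ 2 * (N%:R ^+ 2 * d).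
  rewrite -ltnNge => lN; rewrite ler_wpM2l ?sqr_ge0 //.
  have [|ra ra'] := pl l r; first by rewrite r0.
  have [|sa sa'] := pl l s; first by rewrite s0.
  have ld : l%:R * d <= N%:R * d by rewrite ler_wpM2r ?(ltW d0) // ler_nat ltnW.
  have h1 : `|r ^+ l - s ^+ l| <= N%:R * d by rewrite ler_norml; lra.
  rewrite -real_normK ?num_real // (le_trans (lerXn2r 2 _ _ h1)) ?nnegrE ?mulr_ge0 ?(ltW d0) //.
  by rewrite exprMn ler_wpM2l ?sqr_ge0 // expr2 ler_piMl ?(ltW d0).
rewrite (le_trans (ler_sum _ hl)) // -mulr_suml.
have hb : \sum_(l < n | ~~ (N <= l)%N) nm (h l) ^+ 2 <= B.
  rewrite (le_trans _ (hB n)) // [leRHS](bigID (fun l : 'I_n => (N <= l)%N)) /= lerDr.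
  by apply: sumr_ge0 => *; exact: sqr_ge0.
rewrite (le_trans (ler_wpM2r _ hb)) ?mulr_ge0 ?sqr_ge0 ?(ltW d0) //.
have : d * D <= e / 2 by rewrite -ler_pdivlMr.
apply: le_trans; rewrite mulrA [leRHS]mulrC ler_wpM2r ?(ltW d0) // /D.
by apply: ler_pM; rewrite ?sqr_ge0 // lerDl.
Qed.


Let half_sum_le (y1 y2 y3 y4 v w e : R) : v = e / 2 -> w <= e / 2 ->
  y1 <= w -> y4 <= w -> y2 <= v -> y3 <= v ->
  2^-1 * y1 + 2^-1 * y2 + (2^-1 * y4 + 2^-1 * y3) <= e.
Proof. by lra. Qed.

(** |x_r - x_s| <= |h_r| |k_r - k_s| + |h_r - h_s| |k_s| for x = h k, and each
    factor is a Cauchy family in L^2. *)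
Lemma hardy_cauchy a M e : disc_coef a ->
  (forall r, 0 <= r < 1 -> rI (fun z : T => nm (dil a r z)) <= M) -> 0 < e ->
  exists2 rho, 0 <= rho < 1 & forall r s, rho <= r < 1 -> rho <= s < 1 ->
    rI (fun z => nm (dil a r z - dil a s z)) <= e.
Proof.
move=> ha hM e0; have [h [k [<- hh hk]]] := hardy_factor ha hM.
have dh := l2le_disc hh; have dk := l2le_disc hk.
set B := M + 1 in hh hk; have B0 := l2le_ge0 hh.
have [c c0 cB] : exists2 c, 0 < c & c * B <= e / 2.
  have B1 : 0 < 2 * (B + 1) by rewrite mulr_gt0 // ltr_wpDl.
  exists (e / (2 * (B + 1))); first by rewrite divr_gt0.
  rewrite mulrAC ler_pdivrMr // (_ : e / 2 * _ = e * B + e); first by rewrite lerDl ltW.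
  by field.
pose e' := c * e / 2; have e'0 : 0 < e' by rewrite !divr_gt0 // mulr_gt0.
have [r1 /andP[r10 r11] h1] := l2_cauchy hh e'0; have [r2 /andP[r20 r21] h2] := l2_cauchy hk e'0.
exists (Num.max r1 r2); first by rewrite le_max r10 gt_max r11.
move=> r s; rewrite !ge_max => /andP[/andP[r1r r2r] r_lt1] /andP[/andP[r1s r2s] s_lt1].
have hr : 0 <= r < 1 by rewrite r_lt1 (le_trans r10).
have hs : 0 <= s < 1 by rewrite s_lt1 (le_trans r10).
pose X1 z := nm (dil h r z) ^+ 2; pose X2 z := nm (dil k r z - dil k s z) ^+ 2.
pose X3 z := nm (dil h r z - dil h s z) ^+ 2; pose X4 z := nm (dil k s z) ^+ 2.
have i1 : rint X1 by exact: rint_ddil_sqr.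
have i4 : rint X4 by exact: rint_ddil_sqr.
have idiff (b : P) : disc_coef b -> rint (fun z => nm (dil b r z - dil b s z) ^+ 2).
  move=> db; have [B1 hB1] := ddil_bounded db hr; have [B2 hB2] := ddil_bounded db hs.
  have m := cmeasB (cint_ddil db hr).1 (cint_ddil db hs).1.
  apply: (@rint_bounded _ _ ((B1 + B2) ^+ 2)).
    by apply: measurable_funX; exact: (cmeas_nm m).
  move=> z; rewrite ger0_norm ?sqr_ge0 //; apply: lerXn2r; rewrite ?nnegrE ?nm_ge0 //.
    by apply: addr_ge0; [exact: le_trans (nm_ge0 _) (hB1 z)|exact: le_trans (nm_ge0 _) (hB2 z)].
  by rewrite (le_trans (nmB _ _)) // lerD.
have i2 : rint X2 by exact: idiff.
have i3 : rint X3 by exact: idiff.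
have am (x y : R) : 0 <= x -> 0 <= y -> x * y <= 2^-1 * (c * x ^+ 2) + 2^-1 * (c^-1 * y ^+ 2).
  move=> x0 y0; have : 0 <= (c * x - y) ^+ 2 * c^-1 by rewrite mulr_ge0 ?sqr_ge0 // invr_ge0 ltW.
  have -> : (c * x - y) ^+ 2 * c^-1 = c * x ^+ 2 + c^-1 * y ^+ 2 - 2 * (x * y).
    by field; rewrite gt_eqF.
  lra.
have ic (t : R) X : rint X -> rint (fun z => 2^-1 * (t * X z)) /\
    rI (fun z => 2^-1 * (t * X z)) = 2^-1 * (t * rI X).
  by move=> iX; split; [exact/rintZ/rintZ|rewrite rIZ ?rIZ //; exact: rintZ].
have [j1 e1] := ic c _ i1; have [j2 e2] := ic c^-1 _ i2.
have [j3 e3] := ic c^-1 _ i3; have [j4 e4] := ic c _ i4.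
have dhk := disc_coefM dh dk.
apply: (@le_trans _ _ (rI (fun z => (2^-1 * (c * X1 z) + 2^-1 * (c^-1 * X2 z)) +
    (2^-1 * (c * X4 z) + 2^-1 * (c^-1 * X3 z))))).
  apply: le_rI; first exact: (cintB (cint_ddil dhk hr) (cint_ddil dhk hs)).2.
    exact: (rintD (rintD j1 j2) (rintD j4 j3)).
  move=> z; rewrite !dil_mul //.
  rewrite /X1 /X2 /X3 /X4; move: (dil h r z) (dil k r z) (dil h s z) (dil k s z) => p q u v.
  have -> : p * q - u * v = p * (q - v) + v * (p - u) by ring.
  by rewrite (le_trans (nmD _ _)) // !nmM lerD // am ?nm_ge0.
rewrite (rID (rintD j1 j2) (rintD j4 j3)) (rID j1 j2) (rID j4 j3) e1 e2 e3 e4.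
have b1 : c * rI X1 <= c * B by rewrite ler_wpM2l ?(ltW c0) //; exact: l2le_dil.
have b4 : c * rI X4 <= c * B by rewrite ler_wpM2l ?(ltW c0) //; exact: l2le_dil.
have b2 : c^-1 * rI X2 <= c^-1 * e'.
  by rewrite ler_wpM2l ?invr_ge0 ?(ltW c0) // h2 // ?r2r ?r2s.
have b3 : c^-1 * rI X3 <= c^-1 * e'.
  by rewrite ler_wpM2l ?invr_ge0 ?(ltW c0) // h1 // ?r1r ?r1s.
have ce : c^-1 * e' = e / 2 by rewrite /e'; field; rewrite gt_eqF.
exact: half_sum_le ce cB b1 b4 b2 b3.
Qed.

(** Functions of the Hardy space converge in mean to their boundary values, by
    Fatou's lemma applied to a Cauchy family. *)
Theorem hardy_mean_limit a M (f : T -> C) : disc_coef a ->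
  (forall r, 0 <= r < 1 -> rI (fun z : T => nm (dil a r z)) <= M) -> cmeas f ->
  {ae mu, forall z, dil a r z @[r --> 1^'-] --> f z} ->
  cint f /\ forall e, 0 < e -> exists2 rho, 0 <= rho < 1 &
    forall r, rho <= r < 1 -> rI (fun z => nm (dil a r z - f z)) <= e.
Proof.
move=> ha hM mf haf.
pose s (j : nat) : R := 1 - j.+1%:R^-1.
have hs j : 0 <= s j < 1 by rewrite /s subr_ge0 invf_le1 ?ltr0n // ler1n /= ltrBlDr ltrDl invr_gt0 ltr0n.
have snear (rho : R) : rho < 1 -> \forall j \near \oo, rho <= s j.
  move=> r1; have d0 : 0 < 1 - rho by rewrite subr_gt0.
  have [N hN] : exists N : nat, (1 - rho)^-1 < N%:R.
    by eexists; apply: (le_lt_trans (ler_norm _)); exact: archi_boundP.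
  exists N => // j /= Nj; rewrite /s lerBrDr addrC -lerBrDr.
  rewrite -[leRHS]invrK lef_pV2 ?posrE ?invr_gt0 ?ltr0n // (le_trans (ltW hN)) // ler_nat.
  exact: leqW.
have s1 : s j @[j --> \oo] --> 1^'-.
  move=> A [e /= e0 hA].
  have /snear : 1 - e / 2 < 1 by rewrite ltrBlDr ltrDl divr_gt0.
  apply: filterS => j hj; apply: hA; rewrite /= ?(andP (hs j)).2 //.
  by rewrite ger0_norm ?subr_ge0 ?ltW ?(andP (hs j)).2 //; lra.
have hlim : {ae mu, forall z, dil a (s j) z @[j --> \oo] --> f z}.
  case: haf => N [mN N0 hN]; exists N; split=> // z /= hz; apply: hN => /= hz'; apply: hz.
  exact: (cvg_comp s (fun r => dil a r z) s1 hz').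
have conv r : 0 <= r < 1 -> (forall j0, exists2 N : nat, (j0 <= N)%N & True) ->
    forall c, (\forall j \near \oo, rI (fun z => nm (dil a r z - dil a (s j) z)) <= c) ->
    rint (fun z => nm (dil a r z - f z)) /\ rI (fun z => nm (dil a r z - f z)) <= c.
  move=> hr _ c [N _ hN].
  apply: (@rI_fatou (fun j z => nm (dil a r z - dil a (s (j + N)%N) z))).
  - by move=> j; exact: (cintB (cint_ddil ha hr) (cint_ddil ha (hs _))).2.
  - by move=> j z; exact: nm_ge0.
  - by apply: cmeas_nm; apply: cmeasB mf; exact: (cint_ddil ha hr).1.
  - by move=> z; exact: nm_ge0.
  - case: hlim => N' [mN N0 hN']; exists N'; split=> // z /= hz; apply: hN' => /= hz'; apply: hz.
    apply: cvg_nm; apply: cvgB; first exact: cvg_cst.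
    by rewrite (cvg_shiftn N (fun j => dil a (s j) z)).
  - by move=> j; apply: hN => /=; exact: leq_addl.
have main e : 0 < e -> exists2 rho, 0 <= rho < 1 & forall r, rho <= r < 1 ->
    rint (fun z => nm (dil a r z - f z)) /\ rI (fun z => nm (dil a r z - f z)) <= e.
  move=> e0; have [rho h01 hrho] := hardy_cauchy ha hM e0; exists rho => // r hr.
  have hr' : 0 <= r < 1 by rewrite (andP hr).2 (le_trans (andP h01).1) ?(andP hr).1.
  apply: conv => //; first by move=> j0; exists j0.
  have := snear _ (andP h01).2; apply: filterS => j hj; apply: hrho => //.
  by rewrite hj (andP (hs j)).2.
split; last first.
  by move=> e /main[rho h01 h]; exists rho => // r /h[].
split=> //; have [rho h01 /(_ rho)] := main _ ltr01.
rewrite lexx (andP h01).2 => /(_ isT)[i1 _].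
apply: rint_dom (rintD i1 (cint_ddil ha h01).2) _; first exact: cmeas_nm.
move=> z; rewrite ger0_norm ?nm_ge0 // addrC.
by have := nmB (dil a rho z) (dil a rho z - f z); rewrite subKr.
Qed.

(** The Fourier coefficients of the dilates are a_k r^k and 0, and they pass to the
    limit by convergence in mean. *)
Theorem hardy_fourier a M (f : T -> C) : disc_coef a ->
  (forall r, 0 <= r < 1 -> rI (fun z : T => nm (dil a r z)) <= M) -> cmeas f ->
  {ae mu, forall z, dil a r z @[r --> 1^'-] --> f z} ->
  [/\ cint f, forall l, cI (fun z => f z * (pt z)^*%C ^+ l) = a l &
    forall m, (0 < m)%N -> cI (fun z => f z * pt z ^+ m) = 0].
Proof.
move=> ha hM mf haf; have [cf hf] := hardy_mean_limit ha hM mf haf.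
have key (chi : T -> C) (u : C) n : cmeas chi -> (forall z, nm (chi z) <= 1) ->
    (forall r, 0 <= r < 1 -> cI (fun z => dil a r z * chi z) = u * r%:C ^+ n) ->
    cI (fun z => f z * chi z) = u.
  move=> mc c1 hr; apply/eqP; rewrite -subr_eq0 -nm_eq0 eq_le nm_ge0 andbT.
  apply/ler_addgt0Pr => e e0; rewrite add0r.
  pose K := nm u * n%:R + 1; have K0 : 0 < K by rewrite ltr_wpDl // mulr_ge0 ?nm_ge0.
  have e2 : 0 < e / 2 by rewrite divr_gt0.
  have [rho /andP[rho0 rho1] h] := hf _ e2.
  pose r := Num.max rho (1 - e / 2 / K).
  have d0 : 0 < e / 2 / K by rewrite divr_gt0.
  have r1 : r < 1 by rewrite gt_max rho1 ltrBlDr ltrDl.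
  have rr : rho <= r by rewrite le_max lexx.
  have rK : 1 - e / 2 / K <= r by rewrite le_max lexx orbT.
  have r0 : 0 <= r by rewrite (le_trans rho0).
  have r01 : 0 <= r < 1 by rewrite r0.
  rewrite (le_trans (nm_tri (u * r%:C ^+ n) _ _)) // [leRHS]splitr lerD //.
    rewrite -(hr r) // nmC; have cd := cint_ddil ha r01.
    have c1' := cintM cd mc c1; have c2 := cintM cf mc c1.
    rewrite -cIB // (le_trans (nm_cI (cintB c1' c2))) // (le_trans _ (h r _)) ?rr //.
    apply: le_rI; [exact: (cintB c1' c2).2|exact: (cintB cd cf).2|move=> z].
    by rewrite -mulrBl nmM ler_piMr ?nm_ge0.
  have -> : u * r%:C ^+ n - u = u * (r ^+ n - 1)%:C by rewrite realC_X1; ring.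
  rewrite nmM nmR distrC ger0_norm; last by rewrite subr_ge0 exprn_ile1 // ltW.
  have hb : 1 - r ^+ n <= n%:R * (1 - r) by apply: bernoulli_1X; rewrite r0 ltW.
  rewrite (le_trans (ler_wpM2l (nm_ge0 _) hb)) // mulrA.
  apply: (@le_trans _ _ (K * (e / 2 / K))); last by rewrite mulrC divfK ?gt_eqF.
  by apply: ler_pM; rewrite ?mulr_ge0 ?nm_ge0 ?lerDl //; lra.
split=> // [l|m m0].
  apply: (key (fun z => (pt z)^*%C ^+ l) _ l); first exact/cmeasX/cmeas_conj/cmeas_id.
    by move=> z; rewrite nmX nm_conj nm_circle expr1n.
  by move=> r hr; have [s [M' [hs r0 rs]]] := disc_dil ha hr; exact: dil_coef hs r0 rs l.
apply: (key (fun z => pt z ^+ m) 0 0); first exact/cmeasX/cmeas_id.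
  by move=> z; rewrite nmX nm_circle expr1n.
move=> r hr; have [s [M' [hs r0 rs]]] := disc_dil ha hr.
by rewrite mul0r; exact: dil_negcoef hs r0 rs m0.
Qed.

End HardyLimit.

(** ** The Poisson kernel *)

Section Poisson.
Context {R : realType}.
Local Notation C := R[i].
Local Notation T := (circle R).
Local Notation P := (fps R).
Local Notation mu := (@circle_measure R).
Implicit Types (a b h : P) (r s M B : R) (z x : T) (f : T -> C).

Let conjR (t : R) : (t%:C)^*%C = t%:C.
Proof. by apply/eqP; rewrite eq_complex /= oppr0 !eqxx. Qed.
Let conjM (u v : C) : (u * v)^*%C = u^*%C * v^*%C.
Proof. exact: (rmorphM (@conjc R)). Qed.
Let conj1B (u : C) : (1 - u)^*%C = 1 - u^*%C.
Proof. by rewrite (rmorphB (@conjc R)) rmorph1. Qed.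

(** The Poisson kernel, for the point r z of the disc and the point x of the circle. *)
Definition pk r z x : R := (1 - r ^+ 2) / nm (1 - r%:C * pt z * (pt x)^*%C) ^+ 2.

(* The geometric series 1 / (1 - r conj(z) x), as a function of x. *)
Definition szego r z : T -> C := dil (fun k => (pt z)^*%C ^+ k) r.

(** The Fourier coefficients of nonnegative index. *)
Definition fc f : P := fun l => cI (fun x => f x * (pt x)^*%C ^+ l).

Section Fixed.
Variables (r : R).
Hypotheses (hr : 0 <= r < 1).
Let r0 : 0 <= r. Proof. by have /andP[] := hr. Qed.
Let r1 : r < 1. Proof. by have /andP[] := hr. Qed.

Let cbd_szego z : cbd (fun k => (pt z)^*%C ^+ k) 1 1.
Proof. by move=> k; rewrite nmX nm_conj nm_circle !expr1n mulr1. Qed.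

Lemma cmeas_szego z : cmeas (szego r z).
Proof. exact: cmeas_dil (cbd_szego z) r0 r1. Qed.

Lemma nm_szego z x : nm (szego r z x) <= 1 / (1 - r / 1).
Proof. exact: dil_le (cbd_szego z) r0 r1 x. Qed.

Let wN1 z x : 1 - r%:C * (pt z)^*%C * pt x != 0.
Proof.
rewrite subr_eq0; apply/eqP => h; have := congr1 (fun u : C => nm u) h.
by rewrite nm1 !nmM nm_conj !nm_circle !mulr1 nmR_ge0 // => h'; move: r1; rewrite -h' ltxx.
Qed.

Lemma szegoE z x : szego r z x = (1 - r%:C * (pt z)^*%C * pt x)^-1.
Proof.
set w := r%:C * (pt z)^*%C * pt x.
have w1 : nm w = r by rewrite !nmM nm_conj !nm_circle !mulr1 nmR_ge0.
apply: pev_eq => e e0.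
have hq : 0 <= r < 1 by [].
have [N hN] := exists_pow_lt (nm (1 - w)^-1) hq e0; exists N => n /hN.
have -> : \sum_(k < n) (pt z)^*%C ^+ k * (r%:C * pt x) ^+ k = \sum_(k < n) w ^+ k.
  by apply: eq_bigr => k _; rewrite -exprMn /w; congr (_ ^+ _); ring.
have -> : \sum_(k < n) w ^+ k = (1 - w ^+ n) * (1 - w)^-1.
  apply: (canRL (mulfK (wN1 z x))).
  by rewrite -/w -(opprB w 1) mulrN mulrC -subrX1 opprB.
have -> : (1 - w ^+ n) * (1 - w)^-1 - (1 - w)^-1 = - ((1 - w)^-1 * w ^+ n) by ring.
by rewrite nmN nmM nmX w1.
Qed.

Lemma pkE z x : (pk r z x)%:C = szego r z x + (szego r z x)^*%C - 1.
Proof.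
rewrite szegoE; set w := r%:C * (pt z)^*%C * pt x.
have w0 : 1 - w != 0 by exact: wN1.
have cw : w^*%C = r%:C * pt z * (pt x)^*%C.
  by rewrite /w !conjM conjcK conjR.
have nw : w * w^*%C = (r ^+ 2)%:C.
  rewrite cw /w; have -> : r%:C * (pt z)^*%C * pt x * (r%:C * pt z * (pt x)^*%C) =
    r%:C ^+ 2 * (pt z * (pt z)^*%C) * (pt x * (pt x)^*%C) by ring.
  by rewrite !circle_conj !mulr1 rmorphXn.
have cc := conj1B w.
have n2 : (nm (1 - w^*%C) ^+ 2)%:C = (1 - w) * (1 - w^*%C).
  rewrite -cc nm_conj -sqr_normc normE rmorphXn //.
have w0' : 1 - w^*%C != 0 by rewrite -cc conjc_eq0.
have h1 : (1 - r ^+ 2)%:C = 1 - w * w^*%C by rewrite nw (rmorphB (real_complex R)) rmorph1.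
rewrite /pk -cw rmorphM /= fmorphV /= n2 h1 conjc_inv cc.
by move: w0 w0'; move: (w^*%C) => v; move: (w) => u u0 v0; field; rewrite u0 v0.
Qed.

Lemma pk_ge0 z x : 0 <= pk r z x.
Proof.
by rewrite divr_ge0 ?sqr_ge0 // subr_ge0 exprn_ile1 // ltW.
Qed.

Let pk_den z x : 1 - r <= nm (1 - r%:C * pt z * (pt x)^*%C).
Proof.
have := nm_tri 0 1 (r%:C * pt z * (pt x)^*%C); rewrite subr0 sub0r nmN.
have := nmD (1 - r%:C * pt z * (pt x)^*%C) (r%:C * pt z * (pt x)^*%C); rewrite subrK.
by rewrite !nmM nm_conj !nm_circle !mulr1 nmR_ge0 // nm1; lra.
Qed.

Lemma pk_le z x : pk r z x <= 2 / (1 - r).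
Proof.
have d0 : 0 < 1 - r by rewrite subr_gt0.
rewrite /pk; set N := nm _; have hN : 1 - r <= N by exact: pk_den.
have N0 : 0 < N by exact: lt_le_trans hN.
rewrite ler_pdivrMr ?exprn_gt0 // mulrAC ler_pdivlMr //.
have -> : 1 - r ^+ 2 = (1 + r) * (1 - r) by ring.
have h1 : (1 - r) * (1 - r) <= N ^+ 2 by rewrite expr2; apply: ler_pM; rewrite ?(ltW d0).
rewrite -mulrA; apply: ler_pM => //; [by rewrite addr_ge0|by rewrite mulr_ge0 ?(ltW d0)|lra].
Qed.

Lemma pk_far z x : pk r z x * nm (pt x - pt z) ^+ 2 <= 8 * (1 - r).
Proof.
have d0 : 0 < 1 - r by rewrite subr_gt0.
rewrite /pk; set N := nm _; have hN : 1 - r <= N by exact: pk_den.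
have N0 : 0 < N by exact: lt_le_trans hN.
have hd : nm (pt x - pt z) <= 2 * N.
  have -> : nm (pt x - pt z) = nm (1 - pt z * (pt x)^*%C).
    rewrite -[LHS]mulr1 -(nm_circle x) -(nm_conj (pt x)) -nmM mulrBl circle_conj.
    by [].
  have := nmD (1 - r%:C * pt z * (pt x)^*%C) ((r - 1)%:C * pt z * (pt x)^*%C).
  have -> : 1 - r%:C * pt z * (pt x)^*%C + (r - 1)%:C * pt z * (pt x)^*%C = 1 - pt z * (pt x)^*%C.
    by rewrite (rmorphB (real_complex R)) rmorph1; ring.
  rewrite -/N [nm (_%:C * _ * _)]nmM nmM nm_conj !nm_circle !mulr1 nmR distrC ger0_norm ?(ltW d0) //; lra.
rewrite mulrAC ler_pdivrMr ?exprn_gt0 //.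
have -> : 1 - r ^+ 2 = (1 + r) * (1 - r) by ring.
have h4 : nm (pt x - pt z) ^+ 2 <= 4 * N ^+ 2.
  rewrite (_ : 4 * N ^+ 2 = (2 * N) ^+ 2); last by ring.
  by apply: lerXn2r; rewrite ?nnegrE ?nm_ge0 // mulr_ge0 // ltW.
have -> : 8 * (1 - r) * N ^+ 2 = (2 * (1 - r)) * (4 * N ^+ 2) by ring.
apply: ler_pM; rewrite ?sqr_ge0 //; first by rewrite mulr_ge0 ?(ltW d0) // addr_ge0.
by apply: ler_wpM2r; rewrite ?(ltW d0) //; lra.
Qed.

Lemma pk_sym z x : pk r z x = pk r x z.
Proof.
rewrite /pk -[in LHS]nm_conj conj1B !conjM conjcK conjR.
by congr (_ / nm (_ - _) ^+ 2); ring.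
Qed.

Lemma cmeas_pk z : cmeas (fun x => (pk r z x)%:C).
Proof.
apply: (cmeas_ext (fun x => esym (pkE z x))).
apply: cmeasB (cmeas_cst 1); apply: cmeasD; first exact: cmeas_szego.
exact/cmeas_conj/cmeas_szego.
Qed.

Lemma nm_pk z x : nm (pk r z x)%:C <= 2 / (1 - r).
Proof. by rewrite nmR_ge0 ?pk_ge0 // pk_le. Qed.

Section Moments.
Variable f : T -> C.
Hypothesis cf : cint f.

Lemma cint_szego z : cint (fun x => f x * szego r z x).
Proof. exact: cintM cf (cmeas_szego z) (nm_szego z). Qed.

Lemma cint_szegoC z : cint (fun x => f x * (szego r z x)^*%C).
Proof.
apply: cintM cf (cmeas_conj (cmeas_szego z)) _ => x; rewrite nm_conj; exact: nm_szego.
Qed.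

Let szego_tail z (e : R) : 0 < e -> exists N, forall n, (N <= n)%N ->
  rI (fun x => nm (f x * (szego r z x - \sum_(k < n) (pt z)^*%C ^+ k * r%:C ^+ k * pt x ^+ k))) < e.
Proof.
move=> e0; pose K := rI (fun x => nm (f x)) + 1.
have K0 : 0 < K by rewrite ltr_wpDl // rI_ge0 // => x; exact: nm_ge0.
have [N hN] := dil_small_tail (cbd_szego z) r0 r1 (divr_gt0 e0 K0).
exists N => n nN; rewrite (@le_lt_trans _ _ (rI (fun x => e / K * nm (f x)))) //; last first.
  rewrite rIZ ?cf.2 // mulrAC ltr_pdivrMr // ltr_pM2l // /K ltrDl //.
apply: le_rI; last 1 first.
- by move=> x; rewrite nmM mulrC ler_wpM2r ?nm_ge0 // ltW // hN.
- have mS : cmeas (fun x : T => szego r z x - \sum_(k < n) (pt z)^*%C ^+ k * r%:C ^+ k * pt x ^+ k).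
    by apply: cmeasB; [exact: cmeas_szego|exact: (cmeas_poly n (fun k => (pt z)^*%C ^+ k * r%:C ^+ k))].
  by apply: (@cintM _ f _ (e / K) cf mS _).2 => x; rewrite ltW //; exact: hN.
- exact: rintZ cf.2.
Qed.


Let cf_char (g : T -> C) : cmeas g -> (forall x, nm (g x) <= 1) -> cint (fun x => f x * g x).
Proof. by move=> mg; exact: cintM cf mg. Qed.

Let mX n : cmeas (fun x : T => pt x ^+ n). Proof. exact/cmeasX/cmeas_id. Qed.
Let nX n (x : T) : nm (pt x ^+ n) <= 1. Proof. by rewrite nmX nm_circle expr1n. Qed.

(* Integrating the geometric series term by term. *)
Lemma szego_int z (g : nat -> C) (l : C) : (forall k, cI (fun x => f x * pt x ^+ k) = g k) ->
  tends (fun n => \sum_(k < n) (pt z)^*%C ^+ k * r%:C ^+ k * g k) l ->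
  cI (fun x => f x * szego r z x) = l.
Proof.
move=> hg; apply: tends_unique => e e0; have [N hN] := szego_tail z e0; exists N => n nN.
pose c k := (pt z)^*%C ^+ k * r%:C ^+ k; pose S x := \sum_(k < n) c k * pt x ^+ k.
have cS : cint (fun x => f x * S x).
  exact: (cintM cf (cmeas_poly n c) (@nm_poly_le _ n c)).
have ci k : cint (fun x => c k * (f x * pt x ^+ k)) by apply/cintZ/cf_char.
have -> : \sum_(k < n) c k * g k = cI (fun x => f x * S x).
  rewrite (@cI_ext _ _ (fun x => \sum_(k < n) c k * (f x * pt x ^+ k))).
    by rewrite cI_sum //; apply: eq_bigr => k _; rewrite cIZ ?hg //; exact: cf_char.
  by move=> x; rewrite mulr_sumr; apply: eq_bigr => k _; ring.
rewrite nmC -cIB //; last exact: cint_szego.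
have cB := cintB (cint_szego z) cS.
rewrite (le_lt_trans (nm_cI cB)) // (le_lt_trans _ (hN n nN)) // le_eqVlt; apply/orP; left.
by apply/eqP/rI_ext => x; rewrite -mulrBr.
Qed.

Lemma nm_fc l : nm (fc f l) <= rI (fun x => nm (f x)).
Proof.
have mc : cmeas (fun x : T => (pt x)^*%C ^+ l) by exact/cmeasX/cmeas_conj/cmeas_id.
have n1 (x : T) : nm ((pt x)^*%C ^+ l) <= 1 by rewrite nmX nm_conj nm_circle expr1n.
have ci := cf_char mc n1; rewrite (le_trans (nm_cI ci)) //.
apply: le_rI; [exact: ci.2|exact: cf.2|by move=> x; rewrite nmM ler_piMr ?nm_ge0].
Qed.

Lemma disc_fc : disc_coef (fc f).
Proof. exact: disc_coef_bounded nm_fc. Qed.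

End Moments.

Lemma cI_conj (g : T -> C) : cint g -> cI (fun x => (g x)^*%C) = (cI g)^*%C.
Proof.
move=> cg; rewrite /cI /=; congr (_ +i* _); first by apply: rI_ext => x; case: (g x).
rewrite -[RHS]mulN1r -rIZ; last exact: cint_Im.
by apply: rI_ext => x; rewrite mulN1r; case: (g x).
Qed.

(** The kernel is the sum of a geometric series and of its conjugate; against the
    conjugate only moments of f appear, which vanish. *)
Lemma poisson (f : T -> C) z : cint f -> (forall m, (0 < m)%N -> cI (fun x => f x * pt x ^+ m) = 0) ->
  dil (fc f) r z = cI (fun x => f x * (pk r z x)%:C).
Proof.
move=> cf f0; have cfc : cint (fun x => (f x)^*%C).
  by split; [exact/cmeas_conj/cf.1|apply: rint_ext cf.2 => x; rewrite nm_conj].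
have e1 : cI (fun x => f x * szego r z x) = cI f.
  apply: (@szego_int f cf z (fun k => cI (fun x => f x * pt x ^+ k))) => // e e0.
  exists 1 => -[//|n] _; rewrite big_ord_recl !expr0 !mul1r big1 ?addr0.
    by rewrite (@cI_ext _ _ f) ?subrr ?nm0 // => x; rewrite expr0 mulr1.
  by move=> k _; rewrite f0 // mulr0.
have e2 : cI (fun x => f x * (szego r z x)^*%C) = dil (fc f) r z.
  have ck k : cI (fun x => (f x)^*%C * pt x ^+ k) = (fc f k)^*%C.
    have mc : cmeas (fun x : T => (pt x)^*%C ^+ k) by exact/cmeasX/cmeas_conj/cmeas_id.
    have n1 (x : T) : nm ((pt x)^*%C ^+ k) <= 1 by rewrite nmX nm_conj nm_circle expr1n.
    rewrite /fc -cI_conj; last exact: cintM cf mc n1.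
    by apply: cI_ext => x; rewrite conjM rmorphXn /= conjcK.
  have h : cI (fun x => (f x)^*%C * szego r z x) = (dil (fc f) r z)^*%C.
    apply: (szego_int cfc ck) => e e0.
    have := disc_coefP (disc_fc cf) (z := r%:C * pt z); rewrite nm_rpt // => /(_ r1) h.
    have [N hN] := h e e0; exists N => n /hN; rewrite -nm_conj; congr (nm _ < e).
    rewrite (rmorphB (@conjc R)) (rmorph_sum (@conjc R)) /=; congr (_ - _).
    apply: eq_bigr => k _; rewrite conjM rmorphXn /= conjM conjR exprMn; ring.
  rewrite -[RHS]conjcK -h -cI_conj; last exact: cint_szego.
  by apply: cI_ext => x; rewrite conjM conjcK.
have i1 := cint_szego cf z; have i2 := cint_szegoC cf z.
rewrite (@cI_ext _ (fun x => f x * (pk r z x)%:C)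
  (fun x => (f x * szego r z x + f x * (szego r z x)^*%C) - f x)); last first.
  by move=> x; rewrite pkE; ring.
by rewrite cIB ?cID ?e1 ?e2 //; [ring|exact: cintD].
Qed.

Lemma rint_pk z : rint (pk r z).
Proof.
apply: rint_ext (cint_Re (cint_bounded (cmeas_pk z) (nm_pk z))) => x.
by [].
Qed.

Lemma rI_pk z : rI (pk r z) = 1.
Proof.
have c1 : cint (fun _ : T => (1 : C)) by exact: cint_bounded (cmeas_cst 1) (fun=> lexx _).
have h0 m : (0 < m)%N -> cI (fun x : T => 1 * pt x ^+ m) = 0.
  move=> m0; rewrite (@cI_ext _ _ (fun x => pt x ^+ m * (pt x)^*%C ^+ 0)).
    by rewrite cI_char -[m == 0]negbK -lt0n m0.
  by move=> x; rewrite mul1r expr0 mulr1.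
have fcE : fc (fun=> 1) = (fun l => (0 == l)%N%:R).
  apply/funext => l; rewrite /fc (@cI_ext _ _ (fun x => pt x ^+ 0 * (pt x)^*%C ^+ l)) ?cI_char //.
have := poisson z c1 h0; rewrite fcE => h.
have hd : dil (fun l => (0 == l)%N%:R) r z = 1.
  apply: pev_eq => e e0; exists 1 => -[//|n] _.
  rewrite big_ord_recl !expr0 mul1r big1 ?addr0 ?subrr ?nm0 // => i _.
  by rewrite mul0r.
have <- : complex.Re (cI (fun x => 1 * (pk r z x)%:C)) = 1 by rewrite -h hd.
by apply: rI_ext => x; rewrite mul1r.
Qed.

End Fixed.
End Poisson.

(** ** Lebesgue points on the circle *)

Section LebesguePoints.
Context {R : realType}.
Local Notation C := R[i].
Local Notation T := (circle R).
Local Notation mu := (@circle_measure R).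
Local Notation leb := (@lebesgue_measure R).
Implicit Types (z x : T) (f : T -> C) (s t u v : R).
Let I := `[0 : R, 2 * pi[%classic.

Let pi0 : 0 < pi :> R. Proof. exact: pi_gt0. Qed.

Lemma circle_integralE (g : T -> \bar R) : measurable_fun setT g -> (forall x, (0 <= g x)%E) ->
  (\int[mu]_x g x = ((2 * pi)^-1)%:E * \int[leb]_(t in I) g (cis t))%E.
Proof.
move=> mg g0; have mI := measurable_itv `[0%R, (2 * pi : R)%R[.
have mgc : measurable_fun setT (g \o @cis R) by apply: measurableT_comp => //; exact: measurable_cis.
rewrite /circle_measure ge0_integral_pushforward //=; last exact: measurable_cis.
rewrite preimage_setT ge0_integral_mscale //=.
congr (_ * _)%E.
have h := @ge0_negligible_integral _ _ _
  (mrestr leb (measurable_itv `[0%R, (2 * pi)%R[)) setT (~` I) (g \o @cis R)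
  (measurableC mI) measurableT mgc (fun v _ => g0 (cis v)).
rewrite [LHS]h; last by rewrite /= /mrestr setICl measure0.
rewrite setTD setCK; apply: eq_measure_integral => A mA AI.
by rewrite /= /mrestr (setIidl AI).
Qed.

Lemma nm_cisB s t : nm (pt (cis s) - pt (cis t)) = 2 * `|sin ((s - t) / 2)|.
Proof.
apply/eqP; rewrite -(@eqrXn2 _ 2) ?nm_ge0 ?mulr_ge0 //; apply/eqP.
rewrite nm_sqr exprMn real_normK ?num_real // ReD ReN ImD ImN /=.
have e1 : cos (s - t) = cos s * cos t + sin s * sin t by rewrite cosB.
have e2 : cos (s - t) = 1 - sin ((s - t) / 2) ^+ 2 *+ 2.
  rewrite -[in LHS](divfK (_ : 2 != 0 :> R) (s - t)) // mulr_natr cos_mulr2n cos2sin2.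
  ring.
have := cos2Dsin2 s; have := cos2Dsin2 t.
have -> : (cos s - cos t) ^+ 2 + (sin s - sin t) ^+ 2 = (cos s ^+ 2 + sin s ^+ 2) +
   (cos t ^+ 2 + sin t ^+ 2) - 2 * (cos s * cos t + sin s * sin t) by ring.
by move=> -> ->; rewrite -e1 e2 -mulr_natr; ring.
Qed.

(** Chords are comparable to arcs away from the antipodal point. *)
Lemma sin_lower (Y : R) : Y < pi -> exists2 k : R, 0 < k & forall y, 0 <= y <= Y -> k * y <= sin y.
Proof.
move=> Ypi; have near1 (y : R) : 0 <= y <= 1 -> cos 1 * y <= sin y.
  move=> /andP[]; rewrite le_eqVlt => /predU1P[<- _|y0 y1]; first by rewrite mulr0 sin0.
  have [|c /andP[c0 cy]] := @MVT R (@sin R) (@cos R) 0 y y0 (fun v _ => is_derive_sin v).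
    by apply: continuous_subspaceT; exact: continuous_sin.
  rewrite sin0 !subr0 => ->; rewrite ler_wpM2r ?(ltW y0) //.
  have pi2 : 2 <= pi :> R by exact: pi_ge2.
  rewrite ltW // ltr_cos ?in_itv /=; move: c0 cy; rewrite ?bnd_simp; lra.
have [Y1|Y1] := leP Y 1.
  exists (cos 1); first exact: cos1_gt0.
  by move=> y /andP[y0 yY]; apply: near1; rewrite y0 (le_trans yY).
have [|c] := @EVT_min R (@sin R) 1 Y (ltW Y1).
  by apply: continuous_subspaceT; exact: continuous_sin.
rewrite in_itv /= => /andP[c1 cY] hc.
have sc : 0 < sin c by apply: sin_gt0_pi; apply/andP; split; lra.
have Y0 : 0 < Y by lra.
exists (Num.min (cos 1) (sin c / Y)); first by rewrite lt_min cos1_gt0 divr_gt0.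
move=> y /andP[y0 yY]; have [y1|y1] := leP y 1.
  by rewrite (le_trans _ (near1 y _)) ?y0 // ler_wpM2r // ge_min lexx.
rewrite (@le_trans _ _ (sin c / Y * y)) ?ler_wpM2r ?ge_min ?lexx ?orbT //.
rewrite (@le_trans _ _ (sin c)) ?hc ?in_itv /= ?(ltW y1) //.
by rewrite mulrAC ler_pdivrMr // ler_wpM2l // ltW.
Qed.

Lemma cis_inj s t : 0 <= s < 2 * pi -> 0 <= t < 2 * pi -> cis s = cis t -> s = t.
Proof.
move=> /andP[s0 s2] /andP[t0 t2] st; have := nm_cisB s t; rewrite st subrr nm0.
move=> /esym/eqP; rewrite mulf_eq0 pnatr_eq0 /= normr_eq0 => /eqP h.
apply/eqP; rewrite eq_le; apply/andP; split; rewrite leNgt; apply/negP => lt.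
  have : 0 < sin ((s - t) / 2) by apply: sin_gt0_pi; apply/andP; split; lra.
  by rewrite h ltxx.
have : 0 < sin ((t - s) / 2) by apply: sin_gt0_pi; apply/andP; split; lra.
by rewrite -(opprB s t) mulNr sinN h oppr0 ltxx.
Qed.

Lemma cis_int (k : int) t : cis (t - k%:~R * (2 * pi)) = cis t.
Proof.
have cn (n : nat) : pt (cis (n%:R * (2 * pi : R))) = 1.
  rewrite -cisX (_ : pt (cis (2 * pi : R)) = 1) ?expr1n //.
  by rewrite -[2 * pi]add0r cis2pi /pt /= cos0 sin0.
have ck : pt (cis (- (k%:~R * (2 * pi : R)))) = 1.
  case: k => n; last by rewrite NegzE mulrNz mulNr opprK cn.
  have := cisD (n%:R * (2 * pi : R)) (- (n%:R * (2 * pi))).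
  by rewrite cn mul1r subrr => <-; rewrite -[RHS](cn 0) mul0r.
by apply: val_inj; have := cisD t (- (k%:~R * (2 * pi))); rewrite ck mulr1.
Qed.

(** The angles of the points of the exceptional set are the translates, by multiples
    of 2 pi, of a null set of the interval. *)
Lemma ae_circle (Q : T -> Prop) : {ae leb, forall t, I t -> Q (cis t)} -> {ae mu, forall z, Q z}.
Proof.
move=> [N [mN N0 hN]]; pose N' := N `&` I.
have mI := measurable_itv `[0%R, (2 * pi : R)%R[.
have mN' : measurable N' by exact: measurableI.
have p2 : 0 < 2 * pi :> R by rewrite mulr_gt0.
pose M : set T := (@cis R) @` N'.
have MI u : I u -> M (cis u) -> N' u.
  move=> Iu [v Nv]; have : I v by case: Nv.
  move: Iu; rewrite /I /= !in_itv /= => hu hv /(cis_inj hv hu) <-.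
  exact: Nv.
have cM : (@cis R) @^-1` M = \bigcup_(k : int) ((fun t : R => t - k%:~R * (2 * pi)) @^-1` N').
  apply/seteqP; split=> t /=; last by move=> [k _ /= Nk]; rewrite -(cis_int k); exists (t - k%:~R * (2 * pi)).
  move=> Mt; pose k := Num.floor (t / (2 * pi)); exists k => //=.
  apply: MI; last by rewrite cis_int.
  have := real_floor_itv (num_real (t / (2 * pi))); rewrite -/k => /andP[k1 k2].
  move: k1 k2; rewrite ler_pdivlMr // ltr_pdivrMr // rmorphD /= [X in _ < X]mulrDl [1 * _]mul1r => k1 k2.
  by rewrite /I /= in_itv /= subr_ge0 k1 ltrBlDl.
have mM : measurable M.
  rewrite /measurable /= /circle_measurable /= cM.
  apply: countable_bigcupT_measurable => // k; rewrite -[X in measurable X]setTI.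
  by apply: (measurable_funB (@measurable_id _ _ _) (measurable_cst _)).
exists M; split=> //.
  rewrite circle_measureE (_ : leb _ = 0%E) ?mule0 //.
  apply: (subset_measure0 _ mN) => //.
    by apply: measurableI => //; exact: mM.
  by move=> t [Mt It]; case: (MI t It Mt).
move=> z /= hz; have [t /andP[t0 t2] tz] := cis_surj z; exists t => //.
have It : I t by rewrite /I /= in_itv /= t0.
by split=> //; apply: hN => /= h; apply: hz; rewrite -tz; exact: h.
Qed.

(** The oscillation of f over the arc of chordal radius s around z, without
    normalization by the length of the arc. *)
Definition osc f z s : R := rI (fun x => if nm (pt x - pt z) < s then nm (f x - f z) else 0).

Lemma measurable_arc z s : measurable_fun setT (fun x : T => nm (pt x - pt z) < s).
Proof.
apply: measurable_fun_ltr; last exact: measurable_cst.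
by apply: cmeas_nm; exact: cmeasB cmeas_id (cmeas_cst _).
Qed.

Lemma rint_osc f z s : cint f -> rint (fun x => if nm (pt x - pt z) < s then nm (f x - f z) else 0).
Proof.
move=> cf; have cB : cint (fun x => f x - f z).
  by apply: cintB cf _; exact: cint_bounded (cmeas_cst _) (fun=> lexx _).
apply: (rint_dom _ cB.2).
  apply: measurable_fun_ifT; [exact: measurable_arc|exact: cmeas_nm cB.1|exact: measurable_cst].
by move=> x; case: ifP => _; rewrite ger0_norm ?nm_ge0.
Qed.

Let loc (g : T -> R) : rint g -> locally_integrable setT ((g \o @cis R) \_ I).
Proof.
move=> ig; have mI := measurable_itv `[0%R, (2 * pi : R)%R[.
have mg := rint_meas ig.
apply: open_integrable_locally; first exact: openT.
rewrite -restrict_EFin.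
have [h _] := @integrable_mkcond _ _ _ leb I (EFin \o (g \o @cis R)) mI.
apply: h; apply/integrableP; split.
  apply/measurable_EFinP; apply: measurable_funTS.
  by apply: measurableT_comp mg _; exact: measurable_cis.
have mag : measurable_fun setT (fun x : T => `|(g x)%:E|%E).
  by apply: measurableT_comp => //; exact/measurable_EFinP.
have := circle_integralE mag (fun x => abse_ge0 _).
case/integrableP : ig => _ hfin; move: hfin => /= hfin.
move=> hE; move: hfin; rewrite hE lte_pdivrMl ?mulr_gt0 // => /lt_le_trans; apply.
by rewrite leey.
Qed.

Let ball_mean (F : R -> R) (t e : R) : lebesgue_pt F t -> 0 < e -> exists2 d : R, 0 < d &
  forall s, 0 < s < d -> (\int[leb]_(y in ball t s) `|(F y - F t)%:E| <= (2 * s * e)%:E)%E.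
Proof.
move=> hF e0; have : \forall s \near (0 : R)^'+, (davg F t s < e%:E)%E.
  apply: (hF (fun y => (y < e%:E)%E)); apply: open_ereal_lt'; rewrite lte_fin; exact: e0.
move=> [d /= d0 hd]; exists d => // s /andP[s0 sd].
have := hd s; rewrite /= sub0r normrN gtr0_norm // => /(_ sd s0).
rewrite /davg /iavg (lebesgue_measure_ball t (ltW s0)) inver mulrn_eq0 /= gt_eqF //.
rewrite lte_pdivrMl ?mulrn_wgt0 // => /ltW.
by rewrite -EFinM (_ : s *+ 2 * e = 2 * s * e) // mulr_natl.
Qed.

Let mean_arith (p k s e : R) : p != 0 -> k != 0 ->
  (2 * p)^-1 * (2 * (s / k) * (e * k) + 2 * (s / k) * (e * k)) = (2 / p) * (e * s).
Proof. by move=> p0 k0; field; rewrite p0 k0. Qed.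

(** Lebesgue's differentiation theorem on the line, at the angles in the interior of
    the interval. *)
Theorem circle_lebesgue_point f : cint f -> {ae mu, forall z, forall e, 0 < e ->
  exists2 s0 : R, 0 < s0 & forall s, 0 < s <= s0 -> osc f z s <= e * s}.
Proof.
move=> cf.
have mI := measurable_itv `[0%R, (2 * pi : R)%R[.
have hr := lebesgue_differentiation (loc (cint_Re cf)).
have hi := lebesgue_differentiation (loc (cint_Im cf)).
apply: ae_circle.
have h0 : {ae leb, forall t, t != 0}.
  exists [set 0]; split; [exact: measurable_set1|exact: lebesgue_measure_set1|].
  by move=> t /= /negP; rewrite negbK => /eqP.
have FF := ae_filter_ringOfSetsType leb.
move: hr hi h0; apply: (@filterS3 _ _ FF) => /= t; move: (t : R) => {}t hr hi t0 It e e0.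
have /andP[t0' t2] : 0 <= t < 2 * pi by move: It; rewrite /I /= in_itv.
have tgt0 : 0 < t by rewrite lt_neqAle eq_sym t0.
pose Y := Num.max (t / 2) (pi - t / 2).
have [|k k0 hk] := @sin_lower Y; first by rewrite gt_max; apply/andP; split; lra.
have far (v : R) : I v -> k * `|v - t| <= nm (pt (cis v) - pt (cis t)).
  move=> Iv; have /andP[v0 v2] : 0 <= v < 2 * pi by move: Iv; rewrite /I /= in_itv.
  rewrite nm_cisB.
  have hv : `|v - t| / 2 <= Y.
    rewrite le_max; have [h|h] := leP v t.
      by rewrite ler0_norm ?subr_le0 //; apply/orP; left; lra.
    by rewrite gtr0_norm ?subr_gt0 //; apply/orP; right; lra.
  have := hk (`|v - t| / 2); rewrite divr_ge0 //= hv => /(_ isT) h.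
  have -> : `|sin ((v - t) / 2)| = `|sin (`|v - t| / 2)|.
    have [h'|h'] := leP 0 (v - t); first by rewrite [`|v - t|]ger0_norm.
    by rewrite [`|v - t|]ltr0_norm // mulNr sinN normrN.
  have := le_trans h (ler_norm _).
  by rewrite mulrA ler_pdivrMr // [2 * _]mulrC.
pose e1 := e * k; have e10 : 0 < e1 by rewrite mulr_gt0.
have [d1 d10 h1] := ball_mean hr e10; have [d2 d20 h2] := ball_mean hi e10.
have m0 : 0 < Num.min d1 d2 by rewrite lt_min d10.
exists (k * (Num.min d1 d2 / 2)); first by rewrite mulr_gt0 // divr_gt0.
move=> s /andP[s0 ss]; pose s' := s / k.
have s'0 : 0 < s' by rewrite divr_gt0.
have sm : s' < Num.min d1 d2.
  by rewrite ltr_pdivrMr // (le_lt_trans ss) // mulrC ltr_pM2r //; lra.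
have {}h1 := h1 s'; have {}h2 := h2 s'.
have hs1 : 0 < s' < d1 by rewrite s'0 (lt_le_trans sm) // ge_min lexx.
have hs2 : 0 < s' < d2 by rewrite s'0 (lt_le_trans sm) // ge_min lexx orbT.
have {}h1 := h1 hs1; have {}h2 := h2 hs2.
have io := rint_osc (cis t) s cf.
rewrite -lee_fin /osc -rI_EFin // circle_integralE; last 2 first.
- by case/integrableP : io.
- by move=> x; rewrite lee_fin; case: ifP => // _; exact: nm_ge0.
set Fr := (_ \o _) \_ I in hr h1; set Fi := (_ \o _) \_ I in hi h2.
have mF (g : T -> R) : rint g -> measurable_fun setT ((g \o @cis R) \_ I).
  move=> ig; apply/(measurable_restrictT _ mI); apply: measurable_funTS.
  by apply: measurableT_comp (rint_meas ig) _; exact: measurable_cis.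
have mr : measurable_fun setT Fr by exact: mF (cint_Re cf).
have mi : measurable_fun setT Fi by exact: mF (cint_Im cf).
have mb := measurable_ball t s'.
have mD (F : R -> R) : measurable_fun setT F -> measurable_fun (ball t s') (fun y => `|(F y - F t)%:E|%E).
  move=> m; apply: measurable_funTS; apply: measurableT_comp => //.
  by apply/measurable_EFinP; exact: measurable_funB.
apply: (@le_trans _ _ (((2 * pi)^-1)%:E * (\int[leb]_(y in ball t s') `|(Fr y - Fr t)%:E| +
   \int[leb]_(y in ball t s') `|(Fi y - Fi t)%:E|))%E).
  apply: lee_wpmul2l; first by rewrite lee_fin invr_ge0 mulr_ge0 // pi_ge0.
  have mcis (g : T -> R) : rint g -> measurable_fun I (g \o @cis R).
    move=> ig; apply: measurable_funTS.
    by apply: measurableT_comp (rint_meas ig) _; exact: measurable_cis.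
  rewrite -ge0_integralD //; [|exact: mD|exact: mD].
  rewrite [leLHS]integral_mkcond [leRHS]integral_mkcond; apply: ge0_le_integral => //.
  - move=> v _; rewrite /patch; case: ifP => // _; rewrite lee_fin; case: ifP => // _; exact: nm_ge0.
  - apply/(measurable_restrictT _ mI); apply/measurable_EFinP; exact: mcis io.
  - apply/(measurable_restrictT _ mb); apply: emeasurable_funD; exact: mD.
  move=> v _; rewrite [in leLHS]/patch; case: ifPn => [Iv|_]; last first.
    by rewrite /patch; case: ifP => // _; exact: adde_ge0.
  have {}Iv : I v by exact: set_mem.
  case: ifPn => [hv|_]; last by rewrite /patch; case: ifP => // _; exact: adde_ge0.
  have bv : ball t s' v.
    rewrite /ball /= distrC ltr_pdivlMr // mulrC.
    exact: le_lt_trans (far v Iv) hv.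
  rewrite /patch mem_set // /= -EFinD lee_fin /Fr /Fi /patch !mem_set //=.
  by rewrite -ReN -ReD -ImN -ImD; exact: nm_ReIm.
apply: (@le_trans _ _ (((2 * pi)^-1)%:E * ((2 * s' * e1)%:E + (2 * s' * e1)%:E))%E).
  apply: lee_wpmul2l; first by rewrite lee_fin invr_ge0 mulr_ge0 // pi_ge0.
  exact: leeD.
rewrite -EFinD -EFinM lee_fin.
have -> : (2 * pi)^-1 * (2 * s' * e1 + 2 * s' * e1) = (2 / pi) * (e * s).
  have k1 : k != 0 by rewrite gt_eqF.
  have p1 : pi != 0 :> R by rewrite gt_eqF.
  exact: mean_arith.
by rewrite ler_piMl ?mulr_ge0 ?(ltW e0) ?(ltW s0) // ler_pdivrMr // mul1r pi_ge2.
Qed.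

End LebesguePoints.

(** ** Boundary values of Poisson integrals *)

Section Fatou.
Context {R : realType}.
Local Notation C := R[i].
Local Notation T := (circle R).
Local Notation P := (fps R).
Local Notation mu := (@circle_measure R).
Implicit Types (z x : T) (f : T -> C) (s r e d : R).

Let measurable_pk2 r : 0 <= r < 1 ->
  measurable_fun setT (fun p : T * T => pk r p.1 p.2).
Proof.
move=> /andP[r0 r1].
have mp (g : T * T -> T) (h : T -> R) : measurable_fun setT g -> measurable_fun setT h ->
    measurable_fun setT (fun p => h (g p)) by move=> mg mh; exact: measurableT_comp mh mg.
have [mre mim] := @cmeas_id R.
have m1r := mp _ _ measurable_fst mre; have m1i := mp _ _ measurable_fst mim.
have m2r := mp _ _ measurable_snd mre; have m2i := mp _ _ measurable_snd mim.
pose c := (1 - r) ^+ 2; have c0 : 0 < c by rewrite exprn_gt0 // subr_gt0.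
pose inv (t : R) := (Num.max t c)^-1.
have minv : measurable_fun setT inv.
  apply: continuous_measurable_fun => t.
  apply: (@cvgV _ _ _ _ (fun u => Num.max u c)).
    by rewrite gt_eqF // lt_max c0 orbT.
  by apply: (@continuous_max R R id (fun=> c)); [exact: cvg_id|exact: cvg_cst].
pose Re2 (p : T * T) := 1 - r * (complex.Re (pt p.1) * complex.Re (pt p.2) + complex.Im (pt p.1) * complex.Im (pt p.2)).
pose Im2 (p : T * T) := r * (complex.Im (pt p.1) * complex.Re (pt p.2) - complex.Re (pt p.1) * complex.Im (pt p.2)).
have mR : measurable_fun setT Re2.
  apply: measurable_funB; first exact: measurable_cst.
  apply: measurable_funM; first exact: measurable_cst.
  by apply: measurable_funD; exact: measurable_funM.
have mI : measurable_fun setT Im2.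
  apply: measurable_funM; first exact: measurable_cst.
  by apply: measurable_funB; exact: measurable_funM.
have -> : (fun p : T * T => pk r p.1 p.2) = (fun p => (1 - r ^+ 2) * inv (Re2 p ^+ 2 + Im2 p ^+ 2)).
  apply/funext => -[z x] /=; rewrite /pk; congr (_ * _).
  have nE : nm (1 - r%:C * pt z * (pt x)^*%C) ^+ 2 = Re2 (z, x) ^+ 2 + Im2 (z, x) ^+ 2.
    rewrite nm_sqr /Re2 /Im2 /=; case: (pt z) => a b; case: (pt x) => u v /=; ring.
  rewrite -nE /inv max_l // /c; apply: lerXn2r; rewrite ?nnegrE ?nm_ge0 ?subr_ge0 ?(ltW r1) //.
  have := nmD (1 - r%:C * pt z * (pt x)^*%C) (r%:C * pt z * (pt x)^*%C); rewrite subrK nm1.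
  by rewrite !nmM nm_conj !nm_circle !mulr1 nmR_ge0 //; lra.
apply: measurable_funM; first exact: measurable_cst.
apply: measurableT_comp minv _.
by apply: measurable_funD; exact: measurable_funX.
Qed.

Let rint_fpk f r z : cint f -> 0 <= r < 1 -> rint (fun x => nm (f x) * pk r z x).
Proof.
move=> cf hr; apply: rint_ext (cintM cf (cmeas_pk hr z) (nm_pk hr z)).2 => x.
by rewrite nmM nmR_ge0 // pk_ge0.
Qed.

(** Tonelli's theorem, since the kernel has mean 1 in each variable. *)
Lemma hardy_fc f r : cint f -> (forall m, (0 < m)%N -> cI (fun x => f x * pt x ^+ m) = 0) ->
  0 <= r < 1 -> rI (fun z => nm (dil (fc f) r z)) <= rI (fun x => nm (f x)).
Proof.
move=> cf f0 hr.
have cd := cint_ddil (disc_fc cf) hr.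
have le1 z : nm (dil (fc f) r z) <= rI (fun x => nm (f x) * pk r z x).
  rewrite (poisson hr z cf f0) (le_trans (nm_cI (cintM cf (cmeas_pk hr z) (nm_pk hr z)))) //.
  rewrite le_eqVlt; apply/orP; left; apply/eqP; apply: rI_ext => x.
  by rewrite nmM nmR_ge0 // pk_ge0.
rewrite -lee_fin -!rI_EFin //; [|exact: cf.2|exact: cd.2].
pose g (p : T * T) : \bar R := (nm (f p.2) * pk r p.1 p.2)%:E.
have mg : measurable_fun setT g.
  apply/measurable_EFinP; apply: measurable_funM; last exact: measurable_pk2.
  by apply: measurableT_comp (cmeas_nm cf.1) _; exact: measurable_snd.
have g0 p : (0 <= g p)%E by rewrite lee_fin mulr_ge0 ?nm_ge0 // pk_ge0.
have := @fubini_tonelli _ _ T T R mu mu g mg g0 => ft.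
apply: (@le_trans _ _ (\int[mu]_z \int[mu]_x g (z, x))%E).
  apply: ge0_le_integral; first exact: measurableT.
  - by move=> z _; rewrite lee_fin nm_ge0.
  - by case/integrableP : cd.2.
  - exact: measurable_fun_fubini_tonelli_F.
  by move=> z _; rewrite /g /= (rI_EFin (rint_fpk z cf hr)) lee_fin le1.
rewrite ft le_eqVlt; apply/orP; left; apply/eqP; apply: eq_integral => x _.
rewrite /g /=.
have e z : nm (f x) * pk r z x = nm (f x) * pk r x z by rewrite pk_sym.
under eq_integral do rewrite e.
have ik := rint_pk hr x.
by rewrite (rI_EFin (rintZ (nm (f x)) ik)) (rIZ _ ik) (rI_pk hr x) mulr1.
Qed.

Lemma pow2_floor (q : R) : 1 <= q -> exists n, 2 ^+ n <= q /\ q < 2 ^+ n.+1.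
Proof.
move=> q1; have ex : exists n : nat, q < 2 ^+ n.+1.
  have [n hn] : exists n : nat, q < n%:R.
    by eexists; apply: (le_lt_trans (ler_norm _)); exact: archi_boundP.
  exists n; rewrite (lt_trans hn) // -natrX ltr_nat.
  by rewrite (leq_trans (ltn_expl n (ltnSn 1))) // leq_exp2l.
exists (ex_minn ex); case: ex_minnP => -[|n] hn hmin; first by rewrite expr0.
split=> //; rewrite leNgt; apply/negP => /hmin; by rewrite ltnn.
Qed.

(** On the dyadic arc of size S / 2^i the kernel is at most a constant times
    (1 - r) 4^i / S^2, and it is never more than 2 / (1 - r). *)
Let pk_dyadic r z x S n : 0 <= r < 1 -> 0 < S -> let d := nm (pt x - pt z) in d < S ->
  pk r z x <= \sum_(i < n) (if d < S / 2 ^+ i then 32 * (1 - r) * 4 ^+ i / S ^+ 2 else 0) +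
    (if d < S / 2 ^+ n then 2 / (1 - r) else 0).
Proof.
move=> hr S0 d dS; have r1 := (andP hr).2; have d1 : 0 < 1 - r by rewrite subr_gt0.
have t0 i : 0 <= (if d < S / 2 ^+ i then 32 * (1 - r) * 4 ^+ i / S ^+ 2 else 0).
  by case: ifP => // _; rewrite !mulr_ge0 ?invr_ge0 ?exprn_ge0 // ltW.
elim: n => [|n IH]; first by rewrite big_ord0 add0r expr0 divr1 dS pk_le.
have s0 k : 0 <= \sum_(i < k) (if d < S / 2 ^+ i then 32 * (1 - r) * 4 ^+ i / S ^+ 2 else 0).
  by apply: sumr_ge0.
have [h1|h1] := ltP d (S / 2 ^+ n.+1).
  by rewrite (le_trans (pk_le hr z x)) // lerDr.
rewrite addr0 big_ord_recr /=; move: IH; case: ifP => [h2 _|_ IH]; last by rewrite !addr0 in IH *.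
rewrite (le_trans _ (_ : 32 * (1 - r) * 4 ^+ n / S ^+ 2 <= _)) ?lerDr //.
have p0 : 0 < S / 2 ^+ n.+1 by rewrite divr_gt0 // exprn_gt0.
have dd : 0 < d by exact: lt_le_trans p0 h1.
have hd : (S / 2 ^+ n.+1) ^+ 2 <= d ^+ 2 by apply: lerXn2r => //; rewrite nnegrE ltW.
have : pk r z x * (S / 2 ^+ n.+1) ^+ 2 <= 8 * (1 - r).
  by rewrite (le_trans _ (pk_far hr z x)) // ler_wpM2l ?pk_ge0.
rewrite -ler_pdivlMr ?exprn_gt0 // => /le_trans; apply.
rewrite le_eqVlt; apply/orP; left; apply/eqP.
have -> : 4 ^+ n = 2 ^+ n * 2 ^+ n :> R by rewrite -exprMn; congr (_ ^+ _); ring.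
have q0 : 2 ^+ n != 0 :> R by rewrite expf_neq0.
have S1 : S != 0 by rewrite gt_eqF.
  by rewrite [2 ^+ n.+1]exprS; field; rewrite q0 S1.
exact: s0.
Qed.

(** Fatou's theorem: near a Lebesgue point the mass of |f - f z| on each dyadic arc
    is a small multiple of its size, and the dyadic bounds of the kernel add up;
    the kernel is uniformly small on the rest of the circle. *)
Lemma poisson_lebesgue f z : cint f -> (forall e, 0 < e ->
    exists2 s0 : R, 0 < s0 & forall s, 0 < s <= s0 -> osc f z s <= e * s) ->
  forall e, 0 < e -> exists2 rho, 0 <= rho < 1 & forall r, rho <= r < 1 ->
    rI (fun x => nm (f x - f z) * pk r z x) <= e.
Proof.
move=> cf hosc e e0; pose e1 := e / 72; have e10 : 0 < e1 by rewrite divr_gt0.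
have [S S0 hS] := hosc _ e10.
have cg : cint (fun x => f x - f z).
  by apply: cintB cf _; exact: cint_bounded (cmeas_cst _) (fun=> lexx _).
pose g x := nm (f x - f z); have ig : rint g := cg.2.
have g0 x : 0 <= g x by exact: nm_ge0.
pose I := rI g; have I0 : 0 <= I by exact: rI_ge0.
pose K := 8 * (I + 1) / S ^+ 2.
have K0 : 0 < K by rewrite divr_gt0 ?exprn_gt0 // mulr_gt0 // ltr_wpDl.
pose d0 := Num.min 1 (Num.min S (e / 2 / K)).
have d00 : 0 < d0 by rewrite !lt_min ltr01 S0 /= divr_gt0 // divr_gt0.
exists (1 - d0); first by rewrite subr_ge0 ge_min lexx /= ltrBlDr ltrDl.
move=> r /andP[r0 r1]; pose d := 1 - r.
have dpos : 0 < d by rewrite subr_gt0.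
have dd0 : d <= d0 by rewrite /d lerBlDr addrC -lerBlDr.
have dS : d <= S by rewrite (le_trans dd0) // /d0 !ge_min lexx !orbT.
have dK : d * K <= e / 2.
  by rewrite -ler_pdivlMr // (le_trans dd0) // /d0 !ge_min lexx !orbT.
have hr : 0 <= r < 1 by rewrite r1 (le_trans _ r0) // subr_ge0 ge_min lexx.
have [|n [n1 n2]] := @pow2_floor (S / d); first by rewrite ler_pdivlMr // mul1r.
pose o s x := if nm (pt x - pt z) < s then g x else 0.
have io s : rint (o s) by exact: rint_osc.
have oE s : rI (o s) = osc f z s by [].
pose c i := 32 * d * 4 ^+ i / S ^+ 2.
have p2 i : 0 < 2 ^+ i :> R by rewrite exprn_gt0.
pose G x := (\sum_(i < n) c i * o (S / 2 ^+ i) x + 2 / d * o (S / 2 ^+ n) x) + 8 * d / S ^+ 2 * g x.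
have is1 : rint (fun x => \sum_(i < n) c i * o (S / 2 ^+ i) x) /\
    rI (fun x => \sum_(i < n) c i * o (S / 2 ^+ i) x) = \sum_(i < n) c i * rI (o (S / 2 ^+ i)).
  elim: (n) => [|k [IH1 IH2]].
    split; first by apply: rint_ext (rint_cst 0) => x; rewrite big_ord0.
    by rewrite big_ord0 -[RHS](@rI_cst R); apply: rI_ext => x; rewrite big_ord0.
  have ic : rint (fun x => c k * o (S / 2 ^+ k) x) by exact: rintZ.
  split; first by apply: rint_ext (rintD IH1 ic) => x; rewrite big_ord_recr.
  rewrite big_ord_recr /= -IH2 -(rIZ _ (io _)) -(rID IH1 ic).
  by apply: rI_ext => x; rewrite big_ord_recr.
have i2 : rint (fun x => 2 / d * o (S / 2 ^+ n) x) by exact: rintZ.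
have i3 : rint (fun x => 8 * d / S ^+ 2 * g x) by exact: rintZ.
have iG : rint G := rintD (rintD is1.1 i2) i3.
have gG x : g x * pk r z x <= G x.
  have o0 s : 0 <= o s x by rewrite /o; case: ifP.
  have c0 i : 0 <= c i by rewrite !mulr_ge0 ?invr_ge0 ?exprn_ge0 // ltW.
  have [hd|hd] := ltP (nm (pt x - pt z)) S.
    rewrite /G ler_wpDr ?mulr_ge0 ?invr_ge0 ?exprn_ge0 ?(ltW dpos) ?(ltW S0) //.
    have := pk_dyadic n hr S0 hd; rewrite -/d => h; rewrite (le_trans (ler_wpM2l (g0 x) h)) //.
    rewrite mulrDr mulr_sumr lerD //.
      apply: ler_sum => i _; rewrite /o; case: ifP => _; last by rewrite !mulr0.
      by rewrite mulrC.
    by rewrite /o; case: ifP => _; rewrite ?mulr0 // mulrC.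
  rewrite /G ler_wpDl //.
    by rewrite addr_ge0 ?sumr_ge0 // => [i _|]; rewrite mulr_ge0 // divr_ge0 // ltW.
  rewrite mulrC ler_wpM2r // ler_pdivlMr ?exprn_gt0 //.
  rewrite (le_trans _ (pk_far hr z x)) // ler_wpM2l ?pk_ge0 //.
  by apply: lerXn2r; rewrite ?nnegrE ?nm_ge0 ?(ltW S0).
apply: (@le_trans _ _ (rI G)).
  apply: le_rI => //; apply: rint_ext (cintM cg (cmeas_pk hr z) (nm_pk hr z)).2 => x.
  by rewrite nmM [nm _%:C]nmR_ge0 // pk_ge0.
rewrite /G (rID (rintD is1.1 i2) i3) (rID is1.1 i2) is1.2 !rIZ // !oE.
have ho i : osc f z (S / 2 ^+ i) <= e1 * (S / 2 ^+ i).
  apply: hS; rewrite divr_gt0 //= ler_pdivrMr // ler_peMr ?(ltW S0) //.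
  by rewrite exprn_ege1 // ler1n.
have b1 : \sum_(i < n) c i * osc f z (S / 2 ^+ i) <= 32 * e1.
  have hi (i : 'I_n) : c i * osc f z (S / 2 ^+ i) <= 32 * e1 * d / S * 2 ^+ i.
    have c0 : 0 <= c i by rewrite !mulr_ge0 ?invr_ge0 ?exprn_ge0 // ltW.
    rewrite (le_trans (ler_wpM2l c0 (ho i))) // le_eqVlt; apply/orP; left; apply/eqP.
    rewrite /c (_ : 4 = 2 * 2 :> R); last by ring.
    by rewrite exprMn; field; rewrite ?expf_neq0 ?gt_eqF.
  rewrite (le_trans (ler_sum _ (fun i _ => hi i))) // -mulr_sumr.
  have hs : \sum_(i < n) (2 : R) ^+ i <= 2 ^+ n.
    elim: (n) => [|k IH]; first by rewrite big_ord0 expr0.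
    by rewrite big_ord_recr /= exprS mulr_natl mulr2n lerD2r.
  have hn : \sum_(i < n) (2 : R) ^+ i <= S / d by exact: le_trans n1.
  have c0 : 0 <= 32 * e1 * d / S by apply: ltW; rewrite divr_gt0 // mulr_gt0 // mulr_gt0.
  rewrite (le_trans (ler_wpM2l c0 hn)) //.
  by rewrite le_eqVlt; apply/orP; left; apply/eqP; field; rewrite !gt_eqF.
have b2 : 2 / d * osc f z (S / 2 ^+ n) <= 4 * e1.
  have c0 : 0 <= 2 / d by rewrite divr_ge0 // ltW.
  rewrite (le_trans (ler_wpM2l c0 (ho n))) //.
  have -> : 2 / d * (e1 * (S / 2 ^+ n)) = 2 * e1 * (S / d / 2 ^+ n).
    by field; rewrite ?expf_neq0 ?gt_eqF.
  have h2 : S / d / 2 ^+ n <= 2 by rewrite ler_pdivrMr // -exprS ltW.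
  have h3 := ler_wpM2l (mulr_ge0 (ler0n R 2) (ltW e10)) h2.
  by rewrite (le_trans h3) // (_ : 2 * e1 * 2 = 4 * e1) //; ring.
have b3 : 8 * d / S ^+ 2 * rI g <= e / 2.
  rewrite (le_trans _ dK) // /K (_ : 8 * d / S ^+ 2 * rI g = d * (8 * I / S ^+ 2)); last by rewrite /I; ring.
  rewrite ler_wpM2l ?(ltW dpos) // ler_wpM2r ?invr_ge0 ?exprn_ge0 ?(ltW S0) // ler_wpM2l // lerDl //.
have -> : e = 32 * e1 + 4 * e1 + e / 2 by rewrite /e1; field.
exact: lerD (lerD b1 b2) b3.
Qed.

Theorem hardy_boundary f : cint f -> (forall m, (0 < m)%N -> cI (fun x => f x * pt x ^+ m) = 0) ->
  {ae mu, forall z, dil (fc f) r z @[r --> 1^'-] --> f z}.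
Proof.
move=> cf f0; have := circle_lebesgue_point cf.
case=> N [mN N0 hN]; exists N; split=> // z /= hz; apply: hN => /= hz'; apply: hz.
apply/cvgrPdist_lt => e; rewrite ltcE /= => /andP[/eqP eI e0].
have e2 : 0 < complex.Re e / 2 by rewrite divr_gt0.
have [rho /andP[rho0 rho1] h] := poisson_lebesgue cf hz' e2.
near=> r.
have r1 : r < 1 by near: r; exact: nbhs_left_lt.
have rr : rho <= r by near: r; exact: nbhs_left_ge.
have hr : 0 <= r < 1 by rewrite r1 (le_trans rho0).
rewrite normE [e]complexE eI mulr0 addr0 ltcR nmC.
have c1 := cintM cf (cmeas_pk hr z) (nm_pk hr z).
have c2 : cint (fun x => f z * (pk r z x)%:C).
  exact: cintM (cint_bounded (cmeas_cst (f z)) (fun=> lexx _)) (cmeas_pk hr z) (nm_pk hr z).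
have ck : cint (fun x => (pk r z x)%:C) by exact: cint_bounded (cmeas_pk hr z) (nm_pk hr z).
have k1 : cI (fun x => (pk r z x)%:C) = 1.
  rewrite /cI (rI_pk hr z) (_ : rI _ = 0) // -[RHS](@rI_cst R).
  by apply: rI_ext => x.
have fz : f z = cI (fun x => f z * (pk r z x)%:C) by rewrite cIZ // k1 mulr1.
rewrite (poisson hr z cf f0) [X in _ - X]fz -cIB //.
have cB := cintB c1 c2; rewrite (le_lt_trans (nm_cI cB)) //.
apply: (@le_lt_trans _ _ (complex.Re e / 2)); last lra.
rewrite (le_trans _ (h r _)) ?rr ?r1 // le_eqVlt; apply/orP; left; apply/eqP/rI_ext => x.
by rewrite -mulrBl nmM [nm _%:C]nmR_ge0 // pk_ge0.
Unshelve. all: by end_near. Qed.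

End Fatou.

(** ** Banach ideal spaces between L^oo and L^1 *)

Section LebesgueClasses.
Context {R : realType}.
Local Notation C := R[i].
Local Notation T := (circle R).
Local Notation mu := (@circle_measure R).
Implicit Types (f g : T -> C).

Lemma Lp1_cint f : @Lp R 1%E f -> cint f.
Proof. by move=> [mf /Lfun1_integrable]. Qed.

Let mu_gt0 : (0 < mu [set: T])%E.
Proof. by rewrite [X in (0 < X)%E]circle_measureT. Qed.

Lemma LooP f : @Lp R +oo%E f <-> cmeas f /\ exists B, {ae mu, forall z, nm (f z) <= B}.
Proof.
split=> [[mf]|[mf [B hB]]].
  rewrite inE /= => /andP[_]; rewrite inE /= /finite_norm unlock mu_gt0 => hs.
  split=> //; have := ess_sup_ge mu (abse \o (EFin \o (fun z => nm (f z)))).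
  move: hs; case: (ess_sup _ _) => [s|//|] _ h.
    exists s; apply: filterS h => z /=; rewrite lee_fin ger0_norm ?nm_ge0 //.
  by exists 0; apply: filterS h => z /=; rewrite leeNy_eq.
split=> //; rewrite inE /=; apply/andP; split.
  by rewrite inE /=; exact: cmeas_nm.
rewrite inE /= /finite_norm unlock mu_gt0; apply: (@le_lt_trans _ _ B%:E); last exact: ltry.
apply/ess_supP; apply: filterS hB => z /=; rewrite lee_fin ger0_norm ?nm_ge0 //.
Qed.

End LebesgueClasses.

Section IdealSpace.
Context {R : realType}.
Local Notation C := R[i].
Local Notation T := (circle R).
Local Notation mu := (@circle_measure R).
Variable Y0 : banachIdealSpace R.
Local Notation Y := (bis_carrier Y0).
Hypotheses (LooY : @Lp R +oo%E `<=` Y) (YL1 : Y `<=` @Lp R 1%E).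
Implicit Types (f g : T -> C) (B : R).
Local Notation N := (bis_norm Y0).

Let aeF : Filter (almost_everywhere mu).
Proof. exact: (ae_filter_ringOfSetsType mu). Qed.

Lemma bis_cint f : Y f -> cint f. Proof. by move=> /YL1/Lp1_cint. Qed.

Lemma bis_sub f g : Y f -> Y g -> Y (f - g).
Proof.
move=> hf hg; rewrite -[f - g]/(f + - g) -scaleN1r.
by apply: bis_add hf _; exact: bis_scale.
Qed.

Lemma bis_normN f : Y f -> N (- f) = N f.
Proof. by move=> hf; rewrite -scaleN1r bis_norm_scale // nmN nm1 mul1r. Qed.

Lemma bis_norm0 : N 0 = 0.
Proof. by rewrite -[0 in LHS](scale0r 0) bis_norm_scale ?nm0 ?mul0r //; exact: bis_zero. Qed.

Lemma bis_norm_ge0 f : Y f -> 0 <= N f.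
Proof.
move=> hf; have hN : Y (- f) by rewrite -scaleN1r; exact: bis_scale.
have := bis_norm_triangle hf hN; rewrite subrr bis_norm0 bis_normN //; lra.
Qed.

Lemma bis_ideal_nm f g : cmeas f -> Y g -> {ae mu, forall z, nm (f z) <= nm (g z)} ->
  Y f /\ N f <= N g.
Proof.
move=> mf hg h; apply: bis_ideal => //; apply: filterS h => z.
by rewrite !normE lecR.
Qed.

Lemma bis_ae f g : cmeas g -> Y f -> {ae mu, forall z, f z = g z} -> Y g /\ N g = N f.
Proof.
move=> mg hf h.
have [hg h1] : Y g /\ N g <= N f.
  by apply: bis_ideal_nm => //; apply: filterS h => z ->.
split=> //; apply/eqP; rewrite eq_le h1 /=.
have mf : cmeas f := (bis_cint hf).1.
by have [] := @bis_ideal_nm f g mf hg _; first by apply: filterS h => z ->.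
Qed.

(** Compare with the constant function B. *)
Lemma bis_bounded f B : cmeas f -> {ae mu, forall z, nm (f z) <= B} -> Y f /\ N f <= B * N (fun=> 1).
Proof.
move=> mf hB; have hf : Y f by apply: LooY; apply/LooP; split=> //; exists B.
have h1 : Y (fun=> 1).
  apply: LooY; apply/LooP; split; first exact: cmeas_cst.
  by exists 1; apply: nearW => z; rewrite nm1.
have hB1 : Y (B%:C *: (fun=> 1)) by exact: bis_scale.
have := @bis_ideal_nm f (B%:C *: (fun=> 1)) mf hB1 _ => -[|_].
  apply: filterS hB => z h; rewrite (le_trans h) // nmM nm1 mulr1 nmR.
  exact: ler_norm.
rewrite bis_norm_scale // nmR => /le_trans h.
have [B0|B0] := leP 0 B; first by split=> //; apply: h; rewrite ger0_norm.
have [z hz] : exists z : T, nm (f z) <= B.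
  apply: contrapT => hn; have : {ae mu, forall z : T, False}.
    by apply: filterS hB => z hz; apply: hn; exists z.
  move=> [N' [mN N0 hN]]; have : mu [set: T] = 0%E.
    apply: (subset_measure0 _ mN) => //; apply: (subset_trans _ hN) => z _ /=; exact.
  by rewrite [X in X = _]circle_measureT => /eqP; rewrite onee_eq0.
by have := le_lt_trans (le_trans (nm_ge0 _) hz) B0; rewrite ltxx.
Qed.

(* The pointwise modulus, as a member of Y. *)
Let md f : T -> C := fun z => (nm (f z))%:C.

Let cmeas_md f : cmeas f -> cmeas (md f).
Proof.
by move=> mf; split; [exact: cmeas_nm|exact: measurable_cst].
Qed.

Let md_bis f : Y f -> Y (md f) /\ N (md f) <= N f.
Proof.
move=> hf; apply: bis_ideal_nm => //; first exact/cmeas_md/(bis_cint hf).1.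
by apply: nearW => z; rewrite nmR_ge0 ?nm_ge0.
Qed.

(** The inclusion of Y in L^1 is bounded: otherwise a convergent series of
    moduli in Y would have arbitrarily large integrals, although its sum, which
    dominates the partial sums because Y is a lattice, is integrable. *)
Lemma bis_L1_bounded : exists2 K, 0 <= K & forall f, Y f -> rI (fun z => nm (f z)) <= K * N f.
Proof.
apply: contrapT => hn.
have bad k : exists f, [/\ Y f, N f <= 2^-1 ^+ k & 2 ^+ k <= rI (fun z => nm (f z))].
  apply: contrapT => hk; apply: hn; exists (4 ^+ k); first exact: exprn_ge0.
  move=> f hf; rewrite leNgt; apply/negP => hlt; apply: hk.
  have N0 : 0 < N f.
    rewrite lt_neqAle bis_norm_ge0 // andbT; apply/eqP => h0.
    move: hlt; rewrite -h0 mulr0; have f0 := bis_norm_eq0 hf (esym h0).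
    have [|_ ->] := rint_ae (cmeas_nm (bis_cint hf).1) (rint_cst 0) _; last by rewrite rI_cst ltxx.
    by apply: filterS f0 => z ->; rewrite nm0.
  pose c := 2^-1 ^+ k / N f; have c0 : 0 < c by rewrite divr_gt0 ?exprn_gt0 ?invr_gt0.
  exists (c%:C *: f); split; first exact: bis_scale.
    by rewrite bis_norm_scale // nmR_ge0 ?(ltW c0) // divfK ?gt_eqF.
  have -> : rI (fun z => nm ((c%:C *: f) z)) = c * rI (fun z => nm (f z)).
    rewrite -rIZ; last exact: (bis_cint hf).2.
    by apply: rI_ext => z; rewrite nmM nmR_ge0 // ltW.
  have e4 : 2 ^+ k = 2^-1 ^+ k * 4 ^+ k :> R by rewrite -exprMn; congr (_ ^+ _); field.
  rewrite /c mulrAC ler_pdivlMr // e4 -mulrA ler_wpM2l ?exprn_ge0 ?invr_ge0 //.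
  exact: ltW.
pose g k := md (projT1 (cid (bad k))).
have gP k : [/\ Y (g k), N (g k) <= 2^-1 ^+ k & 2 ^+ k <= rI (fun z => complex.Re (g k z))].
  have [hf f1 f2] := projT2 (cid (bad k)); have [h1 h2] := md_bis hf.
  by split=> //; exact: le_trans f1.
have gge k z : 0 <= complex.Re (g k z) by exact: nm_ge0.
have gIm k z : g k z = (complex.Re (g k z))%:C by [].
pose G n : T -> C := \sum_(k < n) g k.
have YG n : Y (G n).
  rewrite /G; elim: n => [|n IH]; first by rewrite big_ord0; exact: bis_zero.
  by rewrite big_ord_recr /=; apply: bis_add => //; case: (gP n).
have GE n m : (n <= m)%N -> N (G m - G n) <= 2 * 2^-1 ^+ n.
  move=> /subnKC <-; elim: (m - n)%N => [|d IH].
    by rewrite addn0 subrr bis_norm0 mulr_ge0 ?exprn_ge0 ?invr_ge0.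
  suff : N (G (n + d.+1)%N - G n) <= 2 * 2^-1 ^+ n - 2 * 2^-1 ^+ (n + d.+1).
    by move/le_trans; apply; rewrite gerBl mulr_ge0 ?exprn_ge0 ?invr_ge0.
  elim: d.+1 => [|e IHe]; first by rewrite addn0 !subrr bis_norm0.
  have -> : G (n + e.+1)%N - G n = (G (n + e)%N - G n) + g (n + e)%N.
    by rewrite /G addnS big_ord_recr /= addrAC.
  have [Yg g1 _] := gP (n + e)%N.
  rewrite (le_trans (bis_norm_triangle (bis_sub (YG _) (YG _)) Yg)) //.
  rewrite (le_trans (lerD IHe g1)) // addnS exprS; lra.
have [|F YF hF] := bis_complete YG.
  move=> e e0; have [n hn2] := exists_half_lt 4 e0; exists n => k m nk nm_.
  have -> : G k - G m = (G k - G n) - (G m - G n) by rewrite opprB addrA subrK.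
  have s1 := bis_sub (YG k) (YG n); have s2 := bis_sub (YG m) (YG n).
  have : N ((G k - G n) - (G m - G n)) <= N (G k - G n) + N (G m - G n).
    by rewrite -(bis_normN s2); apply: bis_norm_triangle => //; rewrite -scaleN1r; exact: bis_scale.
  have := GE _ _ nk; have := GE _ _ nm_; lra.
have GRe n z : complex.Re (G n z) = \sum_(k < n) complex.Re (g k z).
  rewrite /G; have -> : (\sum_(k < n) g k) z = \sum_(k < n) g k z.
    by elim: n => [|n IH]; rewrite ?big_ord0 // !big_ord_recr /= -IH.
  exact: Re_sum.
(* The positive part of G n - Re F is below |G m - F| for all m >= n. *)
pose pos n : T -> C := fun z => (Num.max (complex.Re (G n z) - complex.Re (F z)) 0)%:C.
have mpos n : cmeas (pos n).
  split; last exact: measurable_cst.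
  apply: measurable_maxr; last exact: measurable_cst.
  apply: measurable_funB; first exact: (bis_cint (YG n)).1.1.
  exact: (bis_cint YF).1.1.
have posle n m : (n <= m)%N -> Y (pos n) /\ N (pos n) <= N (G m - F).
  move=> nm_; apply: bis_ideal_nm; [exact: mpos|exact: bis_sub|apply: nearW => z].
  rewrite nmR_ge0 ?le_max ?lexx ?orbT // ge_max nm_ge0 andbT.
  apply: (le_trans _ (Re_nm _)); apply: (le_trans _ (ler_norm _)).
  rewrite -[(G m - F) z]/(G m z + - F z) ReD ReN lerD2r !GRe -(subnKC nm_) big_split_ord /= lerDl.
  by apply: sumr_ge0 => i _; exact: nm_ge0.
have pos0 n : {ae mu, forall z, complex.Re (G n z) <= complex.Re (F z)}.
  have [Yp _] := posle n n (leqnn n).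
  have : N (pos n) = 0.
    apply/eqP; rewrite eq_le bis_norm_ge0 // andbT; apply/ler_addgt0Pr => e e0; rewrite add0r.
    move/cvgrPdist_lt : hF => /(_ _ e0) [M _ hM].
    have := hM (maxn n M) (leq_maxr _ _); rewrite /= sub0r normrN => h.
    have [_ h1] := posle n _ (leq_maxl n M).
    by rewrite (le_trans h1) // (le_trans (ler_norm _)) // ltW.
  move=> /(bis_norm_eq0 Yp); apply: filterS => z /(congr1 (@complex.Re R)) /= h.
  by rewrite -subr_le0 -[leRHS]h le_max lexx.
pose I := rI (fun z => nm (F z)).
have big n : 2 ^+ n <= I.
  have [Yg _ g2] := gP n; rewrite (le_trans g2) //.
  have ig : rint (fun z => complex.Re (g n z)) by exact: cint_Re (bis_cint Yg).
  pose h z := Num.min (complex.Re (g n z)) (nm (F z)).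
  have mh : measurable_fun setT h.
    by apply: measurable_minr; [exact: rint_meas ig|exact: (cmeas_nm (bis_cint YF).1)].
  have [|ih <-] := rint_ae mh ig _.
    apply: filterS (pos0 n.+1) => z hz; rewrite /h min_l //.
    rewrite (le_trans _ (le_trans (ler_norm _) (Re_nm (F z)))) // (le_trans _ hz) // GRe.
    rewrite big_ord_recr /= lerDr; apply: sumr_ge0 => i _; exact: nm_ge0.
  apply: le_rI => //; first exact: (bis_cint YF).2.
  by move=> z; rewrite /h ge_min lexx orbT.
have [n hn2] : exists n : nat, I < n%:R.
  by eexists; apply: (le_lt_trans (ler_norm _)); exact: archi_boundP.
have := le_lt_trans (big n) hn2; rewrite -natrX ltr_nat ltnNge.
by rewrite ltnW // ltn_expl.
Qed.

End IdealSpace.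

(** ** The Hardy space of Y as a space of power series *)

Section HardySeries.
Context {R : realType}.
Local Notation C := R[i].
Local Notation T := (circle R).
Local Notation P := (fps R).
Local Notation mu := (@circle_measure R).
Implicit Types (a b : P) (f g : T -> C) (r s B e : R) (z : T).

Definition analytic_moments f := forall m, (0 < m)%N -> cI (fun x => f x * pt x ^+ m) = 0.

(** f is the boundary function of the power series a. *)
Definition bval a f := [/\ cint f, analytic_moments f & fc f = a].

Definition radial a f := {ae mu, forall z, dil a r z @[r --> 1^'-] --> f z}.

Let aeF : Filter (almost_everywhere mu).
Proof. exact: (ae_filter_ringOfSetsType mu). Qed.

Lemma bval_radial a f : bval a f ->
  [/\ disc_coef a, radial a f & forall r, 0 <= r < 1 -> rI (fun z => nm (dil a r z)) <= rI (fun z => nm (f z))].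
Proof.
move=> [cf f0 <-]; split; [exact: disc_fc|exact: hardy_boundary|].
by move=> r; exact: hardy_fc.
Qed.

(** Functions of the Hardy space are determined by their boundary values. *)
Lemma radial_bval a f M : disc_coef a -> (forall r, 0 <= r < 1 -> rI (fun z => nm (dil a r z)) <= M) ->
  cmeas f -> radial a f -> bval a f.
Proof.
move=> ha hM mf h; have [cf c1 c2] := hardy_fourier ha hM mf h.
by split=> //; apply/funext.
Qed.

Lemma radial_unique a f g : radial a f -> radial a g -> {ae mu, forall z, f z = g z}.
Proof.
move=> hf hg; apply: filterS2 hf hg => z h1 h2.
exact: (cvg_unique _ h1 h2).
Qed.

Lemma radial_le a f B : disc_coef a -> radial a f ->
  (forall r z, 0 <= r < 1 -> nm (dil a r z) <= B) -> {ae mu, forall z, nm (f z) <= B}.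
Proof.
move=> ha hf hB; apply: filterS hf => z hz; apply/ler_addgt0Pr => e e0.
move/cvgrPdist_lt : hz => /(_ e%:C); rewrite ltcR => /(_ e0) hz.
have : \forall r \near (1 : R)^'-, nm (f z) <= B + e.
  near=> r.
  have h : nm (f z - dil a r z) < e by rewrite -ltcR -normE; near: r.
  have r1 : r < 1 by near: r; exact: nbhs_left_lt.
  have r0 : 0 <= r by near: r; apply: nbhs_left_ge.
  have hr : 0 <= r < 1 by rewrite r0.
  have := nmD (f z - dil a r z) (dil a r z); rewrite subrK => /le_trans; apply.
  by rewrite addrC lerD ?hB // ltW.
by move=> /filter_ex[].
Unshelve. all: by end_near. Qed.

Lemma bvalD a b f g : bval a f -> bval b g -> bval (a + b) (f + g).
Proof.
move=> [cf f0 fa] [cg g0 gb]; split; first exact: cintD.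
  move=> m m0; rewrite (@cI_ext _ _ (fun x => f x * pt x ^+ m + g x * pt x ^+ m)) => [|x]; last exact: mulrDl.
  have mc : cmeas (fun x : T => pt x ^+ m) by exact/cmeasX/cmeas_id.
  have n1 (x : T) : nm (pt x ^+ m) <= 1 by rewrite nmX nm_circle expr1n.
  by rewrite (cID (cintM cf mc n1) (cintM cg mc n1)) f0 ?g0 ?addr0.
apply/funext => l; rewrite fpsD -fa -gb /fc.
rewrite (@cI_ext _ _ (fun x => f x * (pt x)^*%C ^+ l + g x * (pt x)^*%C ^+ l)) => [|x]; last exact: mulrDl.
have mc : cmeas (fun x : T => (pt x)^*%C ^+ l) by exact/cmeasX/cmeas_conj/cmeas_id.
have n1 (x : T) : nm ((pt x)^*%C ^+ l) <= 1 by rewrite nmX nm_conj nm_circle expr1n.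
by rewrite (cID (cintM cf mc n1) (cintM cg mc n1)).
Qed.

Lemma bvalZ c a f : bval a f -> bval (c *: a) (c *: f).
Proof.
move=> [cf f0 fa]; split; first exact: cintZ.
  move=> m m0; rewrite (@cI_ext _ _ (fun x => c * (f x * pt x ^+ m))) => [|x]; last by rewrite mulrA.
  have mc : cmeas (fun x : T => pt x ^+ m) by exact/cmeasX/cmeas_id.
  have n1 (x : T) : nm (pt x ^+ m) <= 1 by rewrite nmX nm_circle expr1n.
  by rewrite (cIZ _ (cintM cf mc n1)) f0 ?mulr0.
apply/funext => l; rewrite fpsZ -fa /fc.
rewrite (@cI_ext _ _ (fun x => c * (f x * (pt x)^*%C ^+ l))) => [|x]; last by rewrite mulrA.
have mc : cmeas (fun x : T => (pt x)^*%C ^+ l) by exact/cmeasX/cmeas_conj/cmeas_id.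
have n1 (x : T) : nm ((pt x)^*%C ^+ l) <= 1 by rewrite nmX nm_conj nm_circle expr1n.
by rewrite (cIZ _ (cintM cf mc n1)).
Qed.

Lemma bval0 : bval 0 (0 : T -> C).
Proof.
have c0 : cint (0 : T -> C) by exact: cint_bounded (cmeas_cst 0) (fun=> lexx _).
have i0 (g : T -> C) : cI (fun x => (0 : T -> C) x * g x) = 0.
  by rewrite -[RHS](@cI_cst R); apply: cI_ext => x; rewrite mul0r.
split; [exact: c0|by move=> m _; exact: i0|apply/funext => l; exact: i0].
Qed.

Lemma bval_unique a f g : bval a f -> bval a g -> {ae mu, forall z, f z = g z}.
Proof.
by move=> /bval_radial[_ h1 _] /bval_radial[_ h2 _]; exact: radial_unique h1 h2.
Qed.

Lemma dilate_psum a r z : 0 <= r < 1 -> dilate (psum a) r z = dil a r z.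
Proof. by move=> /andP[r0 r1]; rewrite /dilate ext_psum ?nm_rpt. Qed.

Lemma boundary_psum a f : boundary_values (psum a) f <-> radial a f.
Proof.
have h z : (fun r => dilate (psum a) r z) @ (1 : R)^'- = dil a r z @[r --> (1 : R)^'-].
  have near_eq : \forall r \near (1 : R)^'-, dilate (psum a) r z = dil a r z.
    near=> r; apply: dilate_psum.
    have r1 : r < 1 by near: r; exact: nbhs_left_lt.
    have r0 : 0 <= r by near: r; apply: nbhs_left_ge.
    by rewrite r0.
  apply/seteqP; split=> A /= hA; apply: filterS2 near_eq hA => r /= e hr; first by rewrite -e.
  by rewrite e.
by split; apply: filterS => z; rewrite h.
Unshelve. all: by end_near. Qed.

Lemma hardy1_psum a : disc_coef a -> (hardy1 (psum a) <->
  exists M, forall r, 0 <= r < 1 -> rI (fun z => nm (dil a r z)) <= M).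
Proof.
move=> ha; have e r : 0 <= r < 1 ->
    (\int[mu]_z (Normc.normc (dilate (psum a) r z))%:E = (rI (fun z => nm (dil a r z)))%:E)%E.
  move=> hr; rewrite -(rI_EFin (cint_ddil ha hr).2); apply: eq_integral => z _.
  by rewrite dilate_psum.
split=> [[_ [M hM]]|[M hM]].
  by exists M => r hr; rewrite -lee_fin -e // hM.
split; first exact: psum_analytic.
by exists M => r hr; rewrite e // lee_fin hM.
Qed.

(** Through the Taylor coefficients, the part of E in the Hardy space consists of the
    functions of E without negative frequencies. *)
Lemma hardy_capP (E : set (T -> C)) a : disc_coef a -> (E `<=` [set f | cmeas f]) ->
  hardy_cap E (psum a) <-> exists2 f, E f & bval a f.
Proof.
move=> ha mE; split=> [[/(hardy1_psum ha)[M hM] [f [Ef /boundary_psum hf]]]|[f Ef hf]].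
  by exists f => //; apply: radial_bval ha hM (mE _ Ef) hf.
have [_ h1 h2] := bval_radial hf; split; last by exists f; split=> //; exact/boundary_psum.
by apply/(hardy1_psum ha); exists (rI (fun z => nm (f z))).
Qed.

End HardySeries.

Section HardyBanach.
Context {R : realType}.
Local Notation C := R[i].
Local Notation T := (circle R).
Local Notation P := (fps R).
Local Notation mu := (@circle_measure R).
Variable Y0 : banachIdealSpace R.
Local Notation Y := (bis_carrier Y0).
Hypotheses (LooY : @Lp R +oo%E `<=` Y) (YL1 : Y `<=` @Lp R 1%E).
Implicit Types (a b : P) (f g : T -> C) (r s B e : R) (z : T).
Local Notation N := (bis_norm Y0).

(** a is the sequence of Fourier coefficients of an analytic function of Y. *)
Definition hser a := exists2 f, Y f & bval a f.

Definition hser_norm a := N (xget 0 [set f | Y f /\ bval a f]).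

Lemma hser_normE a f : Y f -> bval a f -> hser_norm a = N f.
Proof.
move=> hf ha; rewrite /hser_norm; case: xgetP => [g -> [hg hb]|/(_ f)[]//].
exact: (bis_ae YL1 (bis_cint YL1 hg).1 hf (bval_unique ha hb)).2.
Qed.

Lemma hardy_cap_psum a : disc_coef a -> hardy_cap Y (psum a) <-> hser a.
Proof. by move=> ha; apply: hardy_capP => // f /(bis_cint YL1)[]. Qed.

Lemma hardy_norm_psum a : hser a -> hardy_norm Y0 (psum a) = hser_norm a.
Proof.
move=> [f hf hb]; rewrite (hser_normE hf hb) /hardy_norm.
have [ha hr _] := bval_radial hb.
case: xgetP => [g -> [hg /boundary_psum hgr]|/(_ f)[]]; last by split=> //; apply/boundary_psum.
exact: (bis_ae YL1 (bis_cint YL1 hg).1 hf (radial_unique hr hgr)).2.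
Qed.

Lemma hser_disc a : hser a -> disc_coef a.
Proof. by move=> [f _ /bval_radial[]]. Qed.


Lemma hser0 : hser 0. Proof. by exists 0; [exact: bis_zero|exact: bval0]. Qed.

Lemma hserZ c a : hser a -> hser (c *: a).
Proof. by move=> [f hf hb]; exists (c *: f); [exact: bis_scale|exact: bvalZ]. Qed.

Lemma hserD a b : hser a -> hser b -> hser (a + b).
Proof.
by move=> [f hf fa] [g hg gb]; exists (f + g); [exact: bis_add|exact: bvalD].
Qed.

Lemma hserB a b : hser a -> hser b -> hser (a - b).
Proof.
move=> ha hb; have -> : a - b = a + (-1) *: b by rewrite scaleN1r.
exact: hserD ha (hserZ (-1) hb).
Qed.

Lemma hser_normD a b : hser a -> hser b -> hser_norm (a + b) <= hser_norm a + hser_norm b.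
Proof.
move=> [f hf fa] [g hg gb]; rewrite (hser_normE hf fa) (hser_normE hg gb).
rewrite (hser_normE (bis_add hf hg) (bvalD fa gb)); exact: bis_norm_triangle.
Qed.

Lemma hser_normZ c a : hser a -> hser_norm (c *: a) = nm c * hser_norm a.
Proof.
move=> [f hf fa]; rewrite (hser_normE hf fa) (hser_normE (bis_scale c hf) (bvalZ c fa)).
exact: bis_norm_scale.
Qed.

Lemma hser_norm_eq0 a : hser a -> hser_norm a = 0 -> a = 0.
Proof.
move=> [f hf fa]; rewrite (hser_normE hf fa) => /(bis_norm_eq0 hf) f0.
have [_ _ <-] := fa; apply/funext => l; rewrite /fc.
have mc : cmeas (fun x : T => (pt x)^*%C ^+ l) by exact/cmeasX/cmeas_conj/cmeas_id.
have n1 (x : T) : nm ((pt x)^*%C ^+ l) <= 1 by rewrite nmX nm_conj nm_circle expr1n.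
have ci := cintM (bis_cint YL1 hf) mc n1.
have FF := ae_filter_ringOfSetsType mu.
have [|_ e] := cint_ae (cmeas_cst 0) ci _.
  by apply: filterS f0 => z ->; rewrite mul0r.
by rewrite -e; exact: cI_cst.
Qed.

(** Both conditions defining [bval] pass to limits in L^1, hence in Y. *)
Lemma hser_complete (u : nat -> P) : (forall k, hser (u k)) ->
  (forall e, 0 < e -> exists M : nat, forall k m, (M <= k)%N -> (M <= m)%N ->
    hser_norm (u k - u m) < e) ->
  exists2 l, hser l & forall e, 0 < e -> exists M : nat, forall k, (M <= k)%N ->
    hser_norm (u k - l) < e.
Proof.
move=> hu hc.
have [k|f hf] := @boolp.choice _ _ (fun k g => Y g /\ bval (u k) g) _.
  by have [g] := hu k; exists g.
have bB a b g h : bval a g -> bval b h -> bval (a - b) (g - h).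
  move=> ga hb; have h1 := bvalD ga (bvalZ (-1) hb).
  have -> : a - b = a + (-1) *: b by rewrite scaleN1r.
  by have -> : g - h = g + (-1) *: h by rewrite scaleN1r.
have [F YF hF] : exists2 F, Y F & N (f k - F) @[k --> \oo] --> (0 : R).
  apply: bis_complete => [k|e e0]; first exact: (hf k).1.
  have [M hM] := hc _ e0; exists M => k m kM mM.
  rewrite -(hser_normE (bis_sub (hf k).1 (hf m).1) (bB _ _ _ _ (hf k).2 (hf m).2)).
  exact: hM.
have lim e : 0 < e -> exists M : nat, forall k, (M <= k)%N -> N (f k - F) < e.
  move=> e0; move/cvgrPdist_lt : hF => /(_ _ e0) [M _ hM]; exists M => k kM.
  by have := hM k kM; rewrite sub0r normrN; apply: le_lt_trans; exact: ler_norm.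
have [K K0 hK] := bis_L1_bounded YL1.
have cc (g : T -> C) : cmeas g -> (forall x, nm (g x) <= 1) -> forall k,
    nm (cI (fun x => f k x * g x) - cI (fun x => F x * g x)) <= K * N (f k - F).
  move=> mg g1 k; have [ci1 ci2] : cint (f k) /\ cint F.
    by split; apply: (bis_cint YL1) => //; exact: (hf k).1.
  rewrite -cIB; [|exact: cintM ci1 mg g1|exact: cintM ci2 mg g1].
  rewrite (@cI_ext _ _ (fun x => (f k - F) x * g x)) => [|x]; last by rewrite -mulrBl.
  have ci3 : cint (f k - F) by exact: cintB.
  have ci4 := cintM ci3 mg g1.
  apply: (le_trans (nm_cI ci4)); apply: le_trans (hK _ (bis_sub (hf k).1 YF)).
  apply: le_rI; [exact: ci4.2|exact: ci3.2|move=> x].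
  by rewrite nmM -[leRHS]mulr1 ler_wpM2l ?nm_ge0.
have [mX X1] : (forall m, cmeas (fun x : T => pt x ^+ m)) /\
    (forall m (x : T), nm (pt x ^+ m) <= 1).
  by split=> m; [exact/cmeasX/cmeas_id|move=> x; rewrite nmX nm_circle expr1n].
have FB : bval (fc F) F.
  split=> //; first exact: (bis_cint YL1).
  move=> m m0; apply/eqP; rewrite -nm_eq0 eq_le nm_ge0 andbT.
  apply/ler_addgt0Pr => e e0; rewrite add0r.
  have [M hM] := lim (e / (K + 1)) (divr_gt0 e0 (ltr_wpDl K0 ltr01)).
  have [_ f0 _] := (hf M).2.
  have := cc _ (mX m) (X1 m) M; rewrite f0 // sub0r nmN => /le_trans; apply.
  apply: (@le_trans _ _ ((K + 1) * N (f M - F))).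
    by rewrite ler_wpM2r ?lerDl // (bis_norm_ge0 (bis_sub (hf M).1 YF)).
  by rewrite mulrC -ler_pdivlMr ?ltr_wpDl // ltW // hM.
exists (fc F); first by exists F.
move=> e /lim [M hM]; exists M => k /hM.
by rewrite (hser_normE (bis_sub (hf k).1 YF) (bB _ _ _ _ (hf k).2 FB)).
Qed.

End HardyBanach.

(** ** Integration of Hardy series *)

Section LogKernel.
Context {R : realType}.
Local Notation C := R[i].
Implicit Types (u : C).

Let geo (u : C) m n : C := \sum_(k < n) u ^+ (m + k).+1 / (m + k).+1%:R.

Let geo_abel u m n : nm u = 1 ->
  nm ((1 - u) * geo u m n + u ^+ (m + n).+1 / (m + n).+1%:R) <=
  2 / m.+1%:R - ((m + n).+1%:R)^-1.
Proof.
move=> u1; elim: n => [|n IH].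
  rewrite /geo big_ord0 mulr0 add0r addn0 nmM nmX u1 expr1n mul1r nmV nm_nat.
  have -> : 2 / m.+1%:R = m.+1%:R^-1 + m.+1%:R^-1 :> R by rewrite mulrDl mul1r.
  by rewrite addrK.
set A := (1 - u) * geo u m n + _ in IH.
move: IH; set s : R := ((m + n).+1%:R)^-1; set t : R := ((m + n.+1).+1%:R)^-1 => IH.
have st : t <= s by rewrite lef_pV2 ?posrE ?ltr0Sn // ler_nat !ltnS leq_add2l.
have -> : (1 - u) * geo u m n.+1 + u ^+ (m + n.+1).+1 / (m + n.+1).+1%:R =
    A - u ^+ (m + n.+1).+1 * (s - t)%:C.
  rewrite /A /geo big_ord_recr /= -/(geo u m n) [(s - t)%:C](rmorphB (real_complex R)) /=.
  rewrite /s /t !(fmorphV (real_complex R)) !(rmorph_nat (real_complex R)).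
  rewrite addnS [u ^+ (m + n).+2]exprS; set v := u ^+ (m + n).+1; set x := _^-1; set y := _^-1; set g := geo _ _ _.
  by ring.
apply: (le_trans (nmB _ _)); rewrite nmM nmX u1 expr1n mul1r nmR_ge0 ?subr_ge0 //.
move: IH; set L := 2 / _; move: (nm A) => a; move: s t st => s t st; lra.
Qed.

Let geo_le u m n : nm u = 1 -> nm (1 - u) * nm (geo u m n) <= 2 / m.+1%:R.
Proof.
move=> u1; have := geo_abel m n u1; set v := u ^+ _ / _.
have hv : nm v = ((m + n).+1%:R)^-1 by rewrite /v nmM nmX u1 expr1n mul1r nmV nm_nat.
rewrite -nmM => h; have := nmB ((1 - u) * geo u m n + v) v; rewrite addrK hv.
move: h; move: (nm _) => p; move: (nm _) => q; set L := 2 / _; move: (_^-1) => w; lra.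
Qed.

(** The partial sums of 2i sum sin (k t) / k. *)
Definition logker n u : C := \sum_(k < n) (u ^+ k.+1 - (u^*%C) ^+ k.+1) / k.+1%:R.

Let nm_pow_conj u k : nm u = 1 -> nm (u ^+ k - (u^*%C) ^+ k) <= 2 * k%:R * nm (1 - u).
Proof.
move=> u1.
have h (v : C) n : nm v = 1 -> nm (v ^+ n - 1) <= n%:R * nm (1 - v).
  move=> v1; elim: n => [|n IH]; first by rewrite expr0 subrr mul0r Normc.normc0.
  have -> : v ^+ n.+1 - 1 = v ^+ n * (v - 1) + (v ^+ n - 1).
    by rewrite exprSr mulrBr mulr1 addrA subrK.
  rewrite (le_trans (nmD _ _)) // nmM nmX v1 expr1n mul1r (nmC v).
  by rewrite [n.+1%:R]mulrS mulrDl mul1r lerD2l.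
have c1 : nm (u^*%C) = 1 by rewrite nm_conj.
have hc : nm (1 - u^*%C) = nm (1 - u).
  rewrite -[RHS]nm_conj; congr nm; rewrite [RHS](rmorphB (@conjc R)) /=.
  by rewrite [X in _ = X - _](rmorph1 (@conjc R)).
have -> : u ^+ k - (u^*%C) ^+ k = (u ^+ k - 1) - ((u^*%C) ^+ k - 1) by ring.
rewrite (le_trans (nmB _ _)) //; have := h _ k u1; have := h _ k c1; rewrite hc.
move=> h1 h2; have -> : 2 * k%:R * nm (1 - u) = k%:R * nm (1 - u) + k%:R * nm (1 - u).
  by rewrite -mulrA mulrDl mul1r.
exact: lerD.
Qed.

Let logker_split m n u : logker (m + n) u = logker m u + (geo u m n - geo u^*%C m n).
Proof.
rewrite /logker big_split_ord /=; congr (_ + _); rewrite /geo -sumrB.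
by apply: eq_bigr => k _; rewrite mulrBl.
Qed.

Let logker_head m u : nm u = 1 -> nm (logker m u) <= 2 * m%:R * nm (1 - u).
Proof.
move=> u1; apply: (le_trans (nm_sum _ _ _)).
apply: (@le_trans _ _ (\sum_(k < m) 2 * nm (1 - u))); last first.
  by rewrite sumr_const card_ord -[X in X <= _]mulr_natr mulrAC.
apply: ler_sum => k _; rewrite nmM nmV nm_nat ler_pdivrMr ?ltr0Sn //.
by rewrite -mulrA [nm _ * _]mulrC mulrA nm_pow_conj.
Qed.

(** Terms with k <= 1 / |1 - u| are bounded by 2 |1 - u| each; an Abel summation
    bounds the other ones together. *)
Lemma logker_bounded n u : nm u = 1 -> nm (logker n u) <= 6.
Proof.
move=> u1; set d := nm (1 - u).
have d0 : 0 <= d by exact: nm_ge0.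
have [nd|nd] := leP (n%:R * d) 1.
  rewrite (le_trans (logker_head n u1)) // -mulrA -/d.
  by move: (n%:R * d) nd => x hx; lra.
have dp : 0 < d.
  by rewrite lt_neqAle d0 andbT; apply: contraTN nd => /eqP <-; rewrite mulr0 ltNge ler01.
have [m [mn m1 m2]] : exists m, [/\ (m <= n)%N, m%:R * d <= 1 & 1 <= m.+1%:R * d].
  elim: n nd => [|n IH] nd; first by rewrite mul0r ltNge ler01 in nd.
  have [h|h] := leP (n%:R * d) 1; first by exists n; split=> //; exact: ltW.
  by have [m [h1 h2 h3]] := IH h; exists m; split=> //; exact: leqW.
have hc : nm (1 - u^*%C) = d.
  rewrite -[RHS]nm_conj; congr nm; rewrite [RHS](rmorphB (@conjc R)) /=.
  by rewrite [X in _ = X - _](rmorph1 (@conjc R)).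
rewrite -(subnKC mn) logker_split.
have g1 v : nm v = 1 -> nm (1 - v) = d -> nm (geo v m (n - m)) <= 2.
  move=> v1 hv; have := geo_le m (n - m) v1; rewrite hv => h.
  rewrite -(ler_pM2l dp) (le_trans h) // ler_pdivrMr ?ltr0Sn //.
  by rewrite mulrAC [d * _]mulrC ler_peMl.
have c1 : nm u^*%C = 1 by rewrite nm_conj.
have h1 := logker_head m u1; rewrite -/d -mulrA in h1.
have h2 := g1 _ u1 erefl; have h3 := g1 _ c1 hc.
rewrite (le_trans (nmD _ _)) //.
have -> : 6 = 2 * 1 + (2 + 2) :> R by ring.
apply: lerD; last by rewrite (le_trans (nmB _ _)) // lerD.
by rewrite (le_trans h1) // ler_wpM2l.
Qed.

End LogKernel.

Section Integration.
Context {R : realType}.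
Local Notation C := R[i].
Local Notation T := (circle R).
Local Notation P := (fps R).
Local Notation mu := (@circle_measure R).
Implicit Types (a b : P) (f g : T -> C) (r s B e : R) (z : T).

(** The Taylor coefficients of the primitive that vanishes at 0. *)
Definition icoef a : P := fun k => if k is j.+1 then a j / j.+1%:R else 0.

Lemma icoefS a k : icoef a k.+1 = a k / k.+1%:R. Proof. by []. Qed.

Lemma dcoefK a : dcoef (icoef a) = a.
Proof. by apply/funext => k; rewrite /dcoef icoefS mulfVK // pnatr_eq0. Qed.

Lemma icoefK a k : icoef (dcoef a) k = if k == 0%N then 0 else a k.
Proof. by case: k => [//|k]; rewrite icoefS /dcoef mulfK // pnatr_eq0. Qed.

Lemma icoef_lin c a b : icoef (c *: a + b) = c *: icoef a + icoef b.
Proof.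
apply/funext => -[|k].
  by rewrite fpsD fpsZ /icoef mulr0 addr0.
by rewrite fpsD fpsZ !icoefS fpsD fpsZ mulrDl mulrA.
Qed.

Lemma dcoef_lin c a b : dcoef (c *: a + b) = c *: dcoef a + dcoef b.
Proof. by apply/funext => k; rewrite fpsD fpsZ /dcoef fpsD fpsZ mulrDl mulrA. Qed.

Lemma disc_icoef a : disc_coef a -> disc_coef (icoef a).
Proof.
move=> ha r hr; have [M hM] := ha r hr; exists M.
have [r0 r1] : 0 <= r /\ r <= 1 by move/andP : hr => [? /ltW].
case=> [|k]; first by rewrite nm0 mul0r (cbd_ge0 hM).
rewrite icoefS nmM nmV nm_nat exprS; apply: le_trans (hM k).
have -> : nm (a k) * k.+1%:R^-1 * (r * r ^+ k) = nm (a k) * r ^+ k * (k.+1%:R^-1 * r).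
  by move: (nm _) (_^-1) (_ ^+ _) => x y z; ring.
rewrite ler_piMr ?mulr_ge0 ?nm_ge0 ?exprn_ge0 // mulr_ile1 ?invr_ge0 //.
by rewrite invf_le1 ?ler1n ?ltr0Sn.
Qed.

Let chr_cint f (u : T -> C) : cint f -> cmeas u -> (forall x, nm (u x) <= 1) ->
  cint (fun x => f x * u x).
Proof. by move=> cf mu1 u1; exact: cintM cf mu1 u1. Qed.

Let mX n : cmeas (fun x : T => pt x ^+ n). Proof. exact/cmeasX/cmeas_id. Qed.
Let mXc n : cmeas (fun x : T => (pt x)^*%C ^+ n).
Proof. exact/cmeasX/cmeas_conj/cmeas_id. Qed.
Let X1 n (x : T) : nm (pt x ^+ n) <= 1. Proof. by rewrite nmX nm_circle expr1n. Qed.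
Let Xc1 n (x : T) : nm ((pt x)^*%C ^+ n) <= 1.
Proof. by rewrite nmX nm_conj nm_circle expr1n. Qed.

(** Since the moments of f vanish, the partial sums of the integrated series are
    integrals of f against [logker], in which the conjugate terms have been added. *)
Lemma icoef_psum_le b g z n : bval b g ->
  nm (\sum_(k < n) b k / k.+1%:R * pt z ^+ k.+1) <= 6 * rI (fun x => nm (g x)).
Proof.
move=> [cg g0 gb].
pose F (k : nat) (x : T) : C := (k.+1%:R^-1 * pt z ^+ k.+1) * (g x * (pt x)^*%C ^+ k) -
  (k.+1%:R^-1 * (pt z)^*%C ^+ k.+1) * (g x * pt x ^+ k.+2).
have c1 k := chr_cint cg (mXc k) (Xc1 k).
have c2 k := chr_cint cg (mX k.+2) (X1 k.+2).
have cF k : cint (F k) by apply: cintB; apply: cintZ; [exact: c1|exact: c2].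
have FE k : cI (F k) = b k / k.+1%:R * pt z ^+ k.+1.
  rewrite /F cIB; [|exact: cintZ (c1 k)|exact: cintZ (c2 k)].
  rewrite (cIZ _ (c1 k)) (cIZ _ (c2 k)) g0 // mulr0 subr0 -gb /fc.
  by rewrite mulrC mulrA.
have -> : \sum_(k < n) b k / k.+1%:R * pt z ^+ k.+1 = cI (fun x => \sum_(k < n) F k x).
  by rewrite cI_sum //; apply: eq_bigr => k _; rewrite FE.
have cS : cint (fun x => \sum_(k < n) F k x) by exact: cint_sum.
have bd x : nm (\sum_(k < n) F k x) <= 6 * nm (g x).
  have -> : \sum_(k < n) F k x = g x * (pt x * logker n (pt z * (pt x)^*%C)).
    rewrite /logker [pt x * _]mulr_sumr mulr_sumr; apply: eq_bigr => k _; rewrite /F.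
    have -> : (pt z * (pt x)^*%C)^*%C = (pt z)^*%C * pt x.
      by rewrite [LHS](rmorphM (@conjc R)) /= conjcK.
    have e : (pt x)^*%C ^+ k = pt x * (pt x)^*%C ^+ k.+1 by rewrite exprS mulrA circle_conj mul1r.
    rewrite !exprMn e [pt x ^+ k.+2]exprS.
    move: (pt z ^+ _) ((pt z)^*%C ^+ _) ((pt x)^*%C ^+ _) (pt x ^+ _) => p q u v.
    by move: (_^-1) (g x) (pt x) => i y x'; ring.
  rewrite mulrC nmM ler_wpM2r ?nm_ge0 // nmM nm_circle mul1r.
  by apply: logker_bounded; rewrite nmM nm_conj !nm_circle mulr1.
rewrite (le_trans (nm_cI cS)) // -(rIZ _ cg.2).
by apply: le_rI => //; [exact: cS.2|exact: rintZ cg.2].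
Qed.

Lemma bval_dil a r : disc_coef a -> 0 <= r < 1 -> bval (dilc r%:C a) (dil a r).
Proof.
move=> ha hr; have [s [M [hM rs]]] := disc_pair ha hr.
have r0 : 0 <= r by case/andP : hr.
split; first exact: cint_dil hM r0 rs.
  by move=> m m0; exact: dil_negcoef hM r0 rs m0.
by apply/funext => l; rewrite /fc (dil_coef hM r0 rs) mulrC.
Qed.

(* The value at r z of the integrated series. *)
Let icoef_dil a r z : disc_coef a -> 0 <= r < 1 ->
  tends (fun n => r%:C * \sum_(k < n) (dilc r%:C a) k / k.+1%:R * pt z ^+ k.+1)
    (dil (icoef a) r z).
Proof.
move=> ha hr; have /andP[r0 r1] := hr.
have n1 : nm (r%:C * pt z) < 1 by rewrite nm_rpt.
have h := disc_coefP (disc_icoef ha) n1.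
move=> e e0; have [M hM] := h e e0; exists M => n Mn.
have := hM n.+1 (leqW Mn); rewrite big_ord_recl mul0r add0r.
rewrite mulr_sumr (eq_bigr (fun k : 'I_n => r%:C * ((dilc r%:C a) k / k.+1%:R * pt z ^+ k.+1))) //.
move=> k _; rewrite lift0 icoefS /dilc exprMn [r%:C ^+ k.+1]exprS.
by rewrite !mulrA; congr (_ * _); rewrite -!mulrA; ring.
Qed.

Let icoef_le a r z B : disc_coef a -> 0 <= r < 1 ->
  rI (fun x => nm (dil a r x)) <= B -> nm (dil (icoef a) r z) <= 6 * B.
Proof.
move=> ha hr hB; have /andP[r0 r1] := hr.
apply: (tends_nm_le (icoef_dil z ha hr)); exists 0%N => n _.
rewrite nmM nmR_ge0 //; have := icoef_psum_le z n (bval_dil ha hr).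
set X := nm _ => hX; apply: (@le_trans _ _ (1 * X)); last first.
  by rewrite mul1r (le_trans hX) // ler_wpM2l.
by rewrite ler_wpM2r ?nm_ge0 // ltW.
Qed.

Let icoef_lip a r s z B e : disc_coef a -> 0 <= r < 1 -> 0 <= s < 1 ->
  rI (fun x => nm (dil a s x)) <= B -> rI (fun x => nm (dil a r x - dil a s x)) <= e ->
  nm (dil (icoef a) r z - dil (icoef a) s z) <= 6 * e + `|r - s| * (6 * B).
Proof.
move=> ha hr hs hB he; have /andP[r0 r1] := hr.
have h := tendsD (icoef_dil z ha hr) (tendsZ (-1) (icoef_dil z ha hs)).
rewrite mulN1r in h; apply: (tends_nm_le h); exists 0%N => n _.
set Sr := \sum_(k < n) _; set Ss := \sum_(k < n) _.
have -> : r%:C * Sr + -1 * (s%:C * Ss) = r%:C * (Sr - Ss) + (r - s)%:C * Ss.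
  by rewrite [(r - s)%:C](rmorphB (real_complex R)) /=; ring.
rewrite (le_trans (nmD _ _)) //; apply: lerD; last first.
  rewrite nmM nmR ler_wpM2l //; apply: (le_trans (icoef_psum_le z n (bval_dil ha hs))).
  by rewrite ler_wpM2l.
have := icoef_psum_le z n (bvalD (bval_dil ha hr) (bvalZ (-1) (bval_dil ha hs))).
have -> : \sum_(k < n) (dilc r%:C a + -1 *: dilc s%:C a) k / k.+1%:R * pt z ^+ k.+1 = Sr - Ss.
  rewrite /Sr /Ss -sumrB; apply: eq_bigr => k _.
  by rewrite fpsD fpsZ mulN1r mulrBl mulrBl.
have -> : rI (fun x => nm ((dil a r + -1 *: dil a s) x)) = rI (fun x => nm (dil a r x - dil a s x)).
  by apply: rI_ext => x; rewrite -[LHS]/(nm (dil a r x + -1 * dil a s x)) mulN1r.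
move=> hX; rewrite nmM nmR_ge0 //; apply: (@le_trans _ _ (1 * nm (Sr - Ss))).
  by rewrite ler_wpM2r ?nm_ge0 // ltW.
by rewrite mul1r (le_trans hX) // ler_wpM2l.
Qed.

Let cmeas_lim (u : nat -> T -> C) g : (forall n, cmeas (u n)) ->
  (forall z, tends (fun n => u n z) (g z)) -> cmeas g.
Proof.
move=> mu1 ug.
have lim (h : C -> R) (z : T) : (forall x y, `|h x - h y| <= nm (x - y)) ->
    h (u n z) @[n --> \oo] --> h (g z).
  move=> hh; apply/cvgrPdist_lt => e e0; have [N hN] := ug z e e0.
  by exists N => // n /= /hN; apply: le_lt_trans; rewrite distrC.
split.
  apply: (measurable_fun_cvg (fun n => (mu1 n).1)) => z _.
  by apply: lim => x y; rewrite -ReN -ReD Re_nm.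
apply: (measurable_fun_cvg (fun n => (mu1 n).2)) => z _.
by apply: lim => x y; rewrite -ImN -ImD Im_nm.
Qed.

(** The integral of a Hardy series is bounded, with boundary values obtained as a
    uniform limit. *)
Theorem bval_icoef a f : bval a f ->
  exists2 g, bval (icoef a) g & forall z, nm (g z) <= 6 * rI (fun x => nm (f x)).
Proof.
move=> hf; have [ha _ hle] := bval_radial hf; set B := rI _ in hle *.
have B0 : 0 <= B by apply: rI_ge0 => x; exact: nm_ge0.
have [rn hrn rn_lim] : exists2 rn : nat -> R, forall n, 0 <= rn n < 1 &
    forall s, s < 1 -> exists N, forall n, (N <= n)%N -> s <= rn n.
  exists (fun n => 1 - 2^-1 ^+ n) => [n|s s1].
    apply/andP; split; last by rewrite ltrBlDr ltrDl exprn_gt0 ?invr_gt0.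
    by rewrite subr_ge0 exprn_ile1 ?invr_ge0 ?invf_le1 ?ler1n.
  have h2 : 0 <= (2^-1 : R) < 1 by rewrite invr_ge0 ler0n /= invf_lt1 ?ltr1n.
  have s2 : 0 < 1 - s by rewrite subr_gt0.
  have [N hN] := exists_pow_lt 1 h2 s2; exists N => n /hN; rewrite mul1r.
  by move: (_ ^+ n) => p h; lra.
have cau e : 0 < e -> exists2 rho, 0 <= rho < 1 & forall r s, rho <= r < 1 -> rho <= s < 1 ->
    forall z, nm (dil (icoef a) r z - dil (icoef a) s z) <= e.
  move=> e0; have e1 : 0 < e / 12 by rewrite divr_gt0.
  have [rho /andP[rho0 rho1] hrho] := hardy_cauchy ha hle e1.
  have B1 : 0 < 12 * (B + 1) by rewrite mulr_gt0 // ltr_wpDl.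
  pose d := e / (12 * (B + 1)).
  have d0 : 0 < d by rewrite divr_gt0.
  exists (Num.max rho (1 - d)).
    by rewrite le_max rho0 /= gt_max rho1 /= ltrBlDr ltrDl.
  move=> r s /andP[]; rewrite ge_max => /andP[rr rd] r1 /andP[]; rewrite ge_max => /andP[sr sd] s1 z.
  have hr : 0 <= r < 1 by rewrite r1 (le_trans rho0).
  have hs : 0 <= s < 1 by rewrite s1 (le_trans rho0).
  have hrs : rI (fun x => nm (dil a r x - dil a s x)) <= e / 12.
    by apply: hrho; rewrite ?rr ?sr.
  rewrite (le_trans (icoef_lip z ha hr hs (hle s hs) hrs)) //.
  have d1 : `|r - s| <= d by rewrite ler_norml; move: d rd sd d0 r1 s1 => d; lra.
  apply: (@le_trans _ _ (6 * (e / 12) + d * (6 * (B + 1)))).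
    by rewrite lerD2l ler_pM // ?mulr_ge0 // ler_wpM2l // lerDl.
  have -> : d * (6 * (B + 1)) = e / 2.
    rewrite /d; have : B + 1 != 0 by rewrite gt_eqF // ltr_wpDl.
    by move: (B + 1) => b b0; field.
  by rewrite le_eqVlt; apply/orP; left; apply/eqP; field.
have [g hg] : exists g : T -> C, forall z, tends (fun n => dil (icoef a) (rn n) z) (g z).
  have [z|g hg] := @boolp.choice _ _ (fun z l => tends (fun n => dil (icoef a) (rn n) z) l) _.
    apply: complex_complete => e e0; have e2 : 0 < e / 2 by rewrite divr_gt0.
    have [rho /andP[_ rho1] h] := cau _ e2; have [N hN] := rn_lim _ rho1.
    exists N => k m /hN hk /hN hm; apply: (@le_lt_trans _ _ (e / 2)); last by move: e0; lra.
    have /andP[_ k1] := hrn k; have /andP[_ m1] := hrn m.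
    by apply: h; rewrite ?hk ?hm.
  by exists g.
have gB z : nm (g z) <= 6 * B.
  apply: (tends_nm_le (hg z)); exists 0%N => n _.
  exact: icoef_le ha (hrn n) (hle _ (hrn n)).
have mg : cmeas g.
  apply: (@cmeas_lim (fun n => dil (icoef a) (rn n)) g) => // n.
  exact: (cint_ddil (disc_icoef ha) (hrn n)).1.
exists g => //; apply: (@radial_bval _ _ _ (6 * B) (disc_icoef ha)) => //.
  move=> r hr; rewrite -[leRHS](@rI_cst R); apply: le_rI; last first.
  - by move=> z; exact: icoef_le ha hr (hle _ hr).
  - exact: rint_cst.
  exact: (cint_ddil (disc_icoef ha) hr).2.
apply: nearW => z; apply/cvgrPdist_lt => e; rewrite ltcE /= => /andP[/eqP eI e0].
have e2 : 0 < complex.Re e / 2 by rewrite divr_gt0.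
have [rho /andP[rho0 rho1] h] := cau _ e2.
near=> r.
have r1 : r < 1 by near: r; exact: nbhs_left_lt.
have rr : rho <= r by near: r; exact: nbhs_left_ge.
rewrite normE [e]complexE eI mulr0 addr0 ltcR.
apply: (@le_lt_trans _ _ (complex.Re e / 2)); last by move: e0; lra.
have hh := tendsD (hg z) (tendsZ (-1) (_ : tends (fun=> dil (icoef a) r z) (dil (icoef a) r z))).
rewrite -[X in nm (_ - X)]mul1r -mulNr; apply: (tends_nm_le (hh _)).
  by move=> e' e'0; exists 0%N => k _; rewrite subrr nm0.
have [N hN] := rn_lim _ rho1; exists N => n /hN hn.
have /andP[_ n1] := hrn n; rewrite mulN1r; apply: h; by rewrite ?hn ?rr.
Unshelve. all: by end_near. Qed.

End Integration.

(** ** Bounded multipliers *)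

Section Multipliers.
Context {R : realType}.
Local Notation C := R[i].
Local Notation T := (circle R).
Local Notation P := (fps R).
Local Notation mu := (@circle_measure R).
Implicit Types (a b w : P) (f g : T -> C) (r s B e : R) (z : T).

(** The bounded analytic functions, with a bound that holds at every point of the
    circle. *)
Definition mult w B := exists2 g, bval w g & forall z, nm (g z) <= B.

Lemma mult_ge0 w B : mult w B -> 0 <= B.
Proof. by move=> [g _ gB]; apply: le_trans (nm_ge0 _) (gB (cis 0)). Qed.

Lemma mult_disc w B : mult w B -> disc_coef w.
Proof. by move=> [g /bval_radial[]]. Qed.

(** By Poisson's formula. *)
Lemma mult_dil w B r z : mult w B -> 0 <= r < 1 -> nm (dil w r z) <= B.
Proof.
move=> [g [cg g0 <-] gB] hr; rewrite (poisson hr z cg g0).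
have ci := cintM cg (cmeas_pk hr z) (nm_pk hr z).
rewrite (le_trans (nm_cI ci)) // -[leRHS]mulr1 -(rI_pk hr z) -(rIZ _ (rint_pk hr z)).
apply: le_rI; [exact: ci.2|exact: rintZ (rint_pk hr z)|move=> x].
by rewrite nmM nmR_ge0 ?pk_ge0 // ler_wpM2r // pk_ge0.
Qed.

(** Bessel's inequality. *)
Lemma mult_bessel w B : mult w B -> l2le w (B ^+ 2).
Proof.
move=> hw; have dw := mult_disc hw; apply: (@l2le_lim _ _ _ 0 dw) => r /andP[r0 r1].
have hr : 0 <= r < 1 by rewrite ltW.
rewrite mul0r addr0 -[leRHS](@rI_cst R); apply: le_rI; [exact: rint_ddil_sqr|exact: rint_cst|].
by move=> z; apply: lerXn2r => //; rewrite ?nnegrE ?nm_ge0 ?(mult_ge0 hw) ?mult_dil.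
Qed.

Lemma bval_mul w g a f B : bval w g -> (forall z, nm (g z) <= B) -> bval a f ->
  bval (w * a) (fun z => g z * f z).
Proof.
move=> hw gB ha; have [da ra la] := bval_radial ha; have [dw rw _] := bval_radial hw.
have mw : mult w B by exists g.
have B0 := mult_ge0 mw.
have FF := ae_filter_ringOfSetsType mu.
apply: (@radial_bval _ _ _ (B * rI (fun z => nm (f z))) (disc_coefM dw da)).
- move=> r hr; have ci := cint_ddil da hr.
  apply: (@le_trans _ _ (B * rI (fun z => nm (dil a r z)))); last by rewrite ler_wpM2l ?la.
  rewrite -(rIZ _ ci.2); apply: le_rI; last first.
  - by move=> z; rewrite dil_mul // nmM ler_wpM2r ?nm_ge0 // mult_dil.
  - exact: rintZ ci.2.
  exact: (cint_ddil (disc_coefM dw da) hr).2.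
- by apply: cmeasM; [exact: (let: And3 h _ _ := hw in h).1|exact: (let: And3 h _ _ := ha in h).1].
apply: filterS2 rw ra => z hw' ha'.
have : \forall r \near (1 : R)^'-, dil w r z * dil a r z = dil (w * a) r z.
  near=> r; rewrite dil_mul //.
  have r1 : r < 1 by near: r; exact: nbhs_left_lt.
  have r0 : 0 <= r by near: r; apply: nbhs_left_ge.
  by rewrite r0.
move=> /near_eq_cvg/cvg_trans; apply; exact: cvgM hw' ha'.
Unshelve. all: by end_near. Qed.

Lemma mult_lin c w w' B B' : mult w B -> mult w' B' -> exists B0, mult (c *: w + w') B0.
Proof.
move=> [g hg gB] [g' hg' gB']; exists (nm c * B + B'), (c *: g + g').
  by apply: bvalD => //; exact: bvalZ.
move=> z; rewrite -[(c *: g + g') z]/(c * g z + g' z) (le_trans (nmD _ _)) //.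
by rewrite lerD // nmM ler_wpM2l ?nm_ge0.
Qed.

(** The Taylor coefficients of z^k. *)
Definition mon k : P := fun j => (j == k)%:R.

Lemma mult_mon k : mult (mon k) 1.
Proof.
exists (fun z => pt z ^+ k); last by move=> z; rewrite nmX nm_circle expr1n.
split.
- by apply: cint_bounded (cmeasX _ cmeas_id) _ => z; rewrite nmX nm_circle expr1n.
- move=> m m0; rewrite (@cI_ext _ _ (fun x => pt x ^+ (k + m) * (pt x)^*%C ^+ 0)) => [|x].
    by rewrite cI_char addn_eq0 (gtn_eqF m0) andbF.
  by rewrite exprD expr0 mulr1.
by apply/funext => l; rewrite /fc cI_char eq_sym.
Qed.

Lemma mon0 : mon 0 = 1. Proof. by []. Qed.

Lemma monM k a j : (mon k * a) j = if (k <= j)%N then a (j - k)%N else 0.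
Proof.
rewrite fpsM; case: leqP => kj.
  have kj' : (k < j.+1)%N by [].
  rewrite (bigD1 (Ordinal kj')) //= /mon eqxx mul1r big1 ?addr0 // => i ik.
  by rewrite -val_eqE in ik; rewrite (negPf ik) mul0r.
rewrite big1 // => i _; rewrite /mon.
by have := ltn_ord i; rewrite ltnS => ij; rewrite ltn_eqF ?mul0r // (leq_ltn_trans ij).
Qed.

(** The primitive of a function of the Hardy space is bounded. *)
Lemma mult_dcoef w B : mult (dcoef w) B -> exists B0, mult w B0.
Proof.
move=> [g hg gB]; have [g' hg' gB'] := bval_icoef hg.
have h1 : mult (icoef (dcoef w)) (6 * rI (fun x => nm (g x))) by exists g'.
have [B0 hB0] := mult_lin (w 0%N) (mult_mon 0) h1; exists B0.
suff <- : w 0%N *: mon 0 + icoef (dcoef w) = w by [].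
by apply/funext => -[|k]; rewrite fpsD fpsZ icoefK /mon ?mulr1 ?addr0 //= mulr0 add0r.
Qed.

(** An essentially bounded boundary function can be changed on a null set into a
    bounded one. *)
Lemma bval_mult w f : bval w f -> @Lp R +oo%E f -> exists B, mult w B.
Proof.
move=> hw /LooP[mf [B hB]]; have FF := ae_filter_ringOfSetsType mu.
have [da ra la] := bval_radial hw.
exists `|B|, (fun z => if nm (f z) <= B then f z else 0); last first.
  by move=> z; case: ifP => [/le_trans|_]; [apply; exact: ler_norm|rewrite nm0].
have mA : measurable [set z | nm (f z) <= B].
  have := cmeas_nm mf measurableT (measurable_itv `]-oo, B]).
  rewrite setTI; congr (measurable _); apply/seteqP; split=> z /=; rewrite in_itv //=.
apply: (radial_bval da la).
  have mb : measurable_fun setT (fun z => nm (f z) <= B).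
    by apply: measurable_fun_ler; [exact: cmeas_nm|exact: measurable_cst].
  split.
    apply: (eq_measurable_fun (fun z => if nm (f z) <= B then complex.Re (f z) else 0)).
      by move=> z _; case: ifP.
    by apply: measurable_fun_ifT => //; [exact: mf.1].
  apply: (eq_measurable_fun (fun z => if nm (f z) <= B then complex.Im (f z) else 0)).
    by move=> z _; case: ifP.
  by apply: measurable_fun_ifT => //; [exact: mf.2].
by apply: filterS2 hB ra => z ->.
Qed.

End Multipliers.

Section HardyOperators.
Context {R : realType}.
Local Notation C := R[i].
Local Notation T := (circle R).
Local Notation P := (fps R).
Local Notation mu := (@circle_measure R).
Variable Y0 : banachIdealSpace R.
Local Notation Y := (bis_carrier Y0).
Hypotheses (LooY : @Lp R +oo%E `<=` Y) (YL1 : Y `<=` @Lp R 1%E).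
Implicit Types (a b w : P) (f g : T -> C) (r s B e : R) (z : T).
Local Notation N := (bis_norm Y0).
Local Notation hser := (hser Y0).
Local Notation hnorm := (hser_norm Y0).
Local Notation N1 := (N (fun=> 1)).

Lemma hser_norm_ge0 a : hser a -> 0 <= hnorm a.
Proof. by move=> [f hf hb]; rewrite (hser_normE YL1 hf hb); exact: bis_norm_ge0. Qed.

Lemma bis1_ge0 : 0 <= N1.
Proof.
apply: bis_norm_ge0; apply: (bis_bounded LooY (@cmeas_cst R 1) (B := 1) _).1.
have FF := ae_filter_ringOfSetsType mu.
by apply: nearW => z; rewrite nm1.
Qed.

(** The ideal property of Y, applied to the boundary functions. *)
Lemma mult_hser w a B : mult w B -> hser a ->
  hser (w * a) /\ hnorm (w * a) <= B * hnorm a.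
Proof.
move=> mw [f hf hb]; have [g hg gB] := mw; have hm := bval_mul hg gB hb.
have B0 := mult_ge0 mw.
have [h1 h2] : Y (fun z => g z * f z) /\ N (fun z => g z * f z) <= N (B%:C *: f).
  apply: bis_ideal_nm => //.
  - exact: (let: And3 h _ _ := hm in h).1.
  - exact: bis_scale.
  apply: nearW => z; rewrite -[(B%:C *: f) z]/(B%:C * f z) !nmM nmR_ge0 //.
  by rewrite ler_wpM2r ?nm_ge0.
split; first by exists (fun z => g z * f z).
by rewrite (hser_normE YL1 h1 hm) (hser_normE YL1 hf hb) (le_trans h2) // bis_norm_scale // nmR_ge0.
Qed.

Lemma mult_in_hser a B : mult a B -> hser a /\ hnorm a <= B * N1.
Proof.
move=> [g hg gB]; have [cg _ _] := hg.
have FF := ae_filter_ringOfSetsType mu.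
have [|h1 h2] := bis_bounded LooY cg.1 (B := B) _; first exact: nearW.
by split; [exists g|rewrite (hser_normE YL1 h1 hg)].
Qed.

(** The boundary function satisfies the same bound almost everywhere. *)
Lemma hser_sup a e : hser a -> (forall r z, 0 <= r < 1 -> nm (dil a r z) <= e) ->
  hnorm a <= e * N1.
Proof.
move=> [f hf hb] he; have [da ra _] := bval_radial hb.
rewrite (hser_normE YL1 hf hb).
exact: (bis_bounded LooY (bis_cint YL1 hf).1 (radial_le da ra he)).2.
Qed.

(** Integration maps Y to bounded functions, boundedly for the norms of Y and
    L^oo. *)
Lemma hser_icoef : exists2 K, 0 <= K & forall a, hser a -> mult (icoef a) (K * hnorm a).
Proof.
have [K K0 hK] := bis_L1_bounded YL1; exists (6 * K) => [|a [f hf hb]].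
  by rewrite mulr_ge0.
have [g hg gB] := bval_icoef hb; exists g => // z.
rewrite (hser_normE YL1 hf hb) (le_trans (gB z)) // -mulrA ler_wpM2l //; exact: hK.
Qed.

Lemma hser_coef : exists2 K, 0 <= K & forall a k, hser a -> nm (a k) <= K * hnorm a.
Proof.
have [K K0 hK] := bis_L1_bounded YL1; exists K => // a k [f hf hb].
rewrite (hser_normE YL1 hf hb); have [cf f0 <-] := hb.
by rewrite (le_trans (nm_fc cf k)) // hK.
Qed.

(** Rotating the boundary function multiplies its k-th Fourier coefficient by
    alpha^k. *)
Lemma hser_rot (alpha : T) a : rotation_invariant Y0 -> hser a ->
  hser (dilc (pt alpha) a) /\ hnorm (dilc (pt alpha) a) = hnorm a.
Proof.
move=> Yrot [f hf hb]; have [h1 h2] := Yrot alpha f hf.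
suff hb' : bval (dilc (pt alpha) a) (f \o rotate_circle alpha).
  by split; [exists (f \o rotate_circle alpha)|
    rewrite (hser_normE YL1 h1 hb') (hser_normE YL1 hf hb)].
have [cf f0 fa] := hb; have [cr _] := cI_rot alpha cf.
have aa : pt alpha * (pt alpha)^*%C = 1 by exact: circle_conj.
have mX n : cmeas (fun x : T => pt x ^+ n) by exact/cmeasX/cmeas_id.
have mXc n : cmeas (fun x : T => (pt x)^*%C ^+ n) by exact/cmeasX/cmeas_conj/cmeas_id.
have X1 n (x : T) : nm (pt x ^+ n) <= 1 by rewrite nmX nm_circle expr1n.
have Xc1 n (x : T) : nm ((pt x)^*%C ^+ n) <= 1 by rewrite nmX nm_conj nm_circle expr1n.
split=> //.
- move=> m m0; have c1 := cintM cf (mX m) (X1 m).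
  have [c2 e1] := cI_rot alpha c1; have e2 := etrans e1 (f0 m m0).
  rewrite (@cI_ext _ _ (fun x => (pt alpha)^*%C ^+ m *
      ((fun x => f x * pt x ^+ m) \o rotate_circle alpha) x)) => [|x].
    by rewrite (cIZ _ c2) e2 mulr0.
  have : (pt alpha)^*%C ^+ m * pt alpha ^+ m = 1 by rewrite -exprMn mulrC aa expr1n.
  rewrite /= pt_rot exprMn; move: (_^*%C ^+ m) (pt alpha ^+ m) (pt x ^+ m) => p q v pq.
  by rewrite mulrCA [p * _]mulrA pq mul1r.
apply/funext => l; rewrite /fc /dilc -fa /fc.
have c1 := cintM cf (mXc l) (Xc1 l); have [c2 e2] := cI_rot alpha c1.
rewrite -e2 -(cIZ _ c2); apply: cI_ext => x /=.
have : pt alpha ^+ l * (pt alpha)^*%C ^+ l = 1 by rewrite -exprMn aa expr1n.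
have -> : (pt (rotate_circle alpha x))^*%C = (pt alpha)^*%C * (pt x)^*%C.
  by rewrite pt_rot; exact: (rmorphM (@conjc R)).
rewrite exprMn.
move: (pt alpha ^+ l) (_^*%C ^+ l) (_^*%C ^+ l) => p q v pq.
by rewrite mulrCA [p * _]mulrA pq mul1r.
Qed.

End HardyOperators.

(** ** Normed subspaces of a module as Banach spaces *)

Section Submodule.
Context {R : realType} {V : lmodType R[i]}.

(** A complete norm on a submodule, given on the ambient module; the Banach space is
    the subtype. *)
Record seqspace := Seqspace {
  ss_mem :> V -> Prop;
  ss_norm : V -> R;
  ss0 : ss_mem 0;
  ssL : forall c x y, ss_mem x -> ss_mem y -> ss_mem (c *: x + y);
  ss_normD : forall x y, ss_mem x -> ss_mem y -> ss_norm (x + y) <= ss_norm x + ss_norm y;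
  ss_normZ : forall c x, ss_mem x -> ss_norm (c *: x) = nm c * ss_norm x;
  ss_norm_eq0 : forall x, ss_mem x -> ss_norm x = 0 -> x = 0;
  ss_complete : forall u : nat -> V, (forall k, ss_mem (u k)) ->
    (forall e : R, 0 < e -> exists M : nat, forall k m, (M <= k)%N -> (M <= m)%N ->
      ss_norm (u k - u m) < e) ->
    exists2 l, ss_mem l & forall e : R, 0 < e -> exists M : nat, forall k, (M <= k)%N ->
      ss_norm (u k - l) < e }.

Variable S : seqspace.

Definition ss_pred : {pred V} := [pred x | `[< S x >]].

Lemma ss_predE v : (v \in ss_pred) = `[< S v >]. Proof. by []. Qed.

Fact ss_submod_closed : submod_closed ss_pred.
Proof.
split; first by rewrite ss_predE; apply/asboolP; exact: (ss0 S).
by move=> c x y; rewrite !ss_predE => /asboolP hx /asboolP hy; apply/asboolP; exact: ssL.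
Qed.

HB.instance Definition _ := GRing.isSubmodClosed.Build R[i] V ss_pred ss_submod_closed.

Definition ss_sort : Type := {x : V | x \in ss_pred}.
HB.instance Definition _ := SubChoice.on ss_sort.
HB.instance Definition _ := [SubChoice_isSubLmodule of ss_sort by <:].

Implicit Types x y : ss_sort.

Lemma ss_val x : S (val x).
Proof. by have := valP x; rewrite ss_predE => /asboolP. Qed.

Lemma ss_sub v : S v -> exists x : ss_sort, val x = v.
Proof.
move=> hv; have h : v \in ss_pred by rewrite ss_predE; apply/asboolP.
by exists (Sub v h); rewrite SubK.
Qed.

Fact ss_complete_sub (u : nat -> ss_sort) :
  (forall e : R, 0 < e -> exists M : nat, forall k m,
    (M <= k)%N -> (M <= m)%N -> ss_norm S (val (u k - u m)) < e) ->
  exists l : ss_sort, forall e : R, 0 < e -> exists M : nat, forall k,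
    (M <= k)%N -> ss_norm S (val (u k - l)) < e.
Proof.
move=> h; have [l hl lim] := ss_complete (fun k => ss_val (u k)) h.
by have [l' el] := ss_sub hl; exists l'; rewrite -el in lim.
Qed.

Fact ss_eq0_sub x : ss_norm S (val x) = 0 -> x = 0.
Proof. by move=> h; apply: val_inj; rewrite (ss_norm_eq0 (ss_val x) h). Qed.

Definition ss_banach : banach R := @Banach R ss_sort (fun x => ss_norm S (val x))
  (fun x y => ss_normD (ss_val x) (ss_val y)) (fun c x => ss_normZ c (ss_val x))
  ss_eq0_sub ss_complete_sub.

Definition ssv (x : ss_banach) : V := val (x : ss_sort).

Lemma ssv_inj : injective ssv. Proof. exact: val_inj. Qed.

Lemma ssv_mem (x : ss_banach) : S (ssv x). Proof. exact: ss_val. Qed.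

Lemma ssvL c (x y : ss_banach) : ssv (c *: x + y) = c *: ssv x + ssv y.
Proof. by []. Qed.

Lemma ssv0 : ssv 0 = 0. Proof. by []. Qed.

Lemma ssvD (x y : ss_banach) : ssv (x + y) = ssv x + ssv y. Proof. by []. Qed.

Lemma ssvB (x y : ss_banach) : ssv (x - y) = ssv x - ssv y. Proof. by []. Qed.

Lemma ssvZ c (x : ss_banach) : ssv (c *: x) = c *: ssv x. Proof. by []. Qed.

Lemma bn_ssv (x : ss_banach) : bn x = ss_norm S (ssv x). Proof. by []. Qed.

Lemma ssv_onto v : S v -> exists x : ss_banach, ssv x = v.
Proof. exact: ss_sub. Qed.

End Submodule.
Arguments seqspace {R} V.

Section Lift.
Context {R : realType} {V V' : lmodType R[i]}.
Variables (S : seqspace V) (S' : seqspace V').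
Implicit Types (F G : V -> V').

Definition ss_map F := (forall c x y, F (c *: x + y) = c *: F x + F y) /\
  exists2 M : R, 0 <= M & forall x, S x -> S' (F x) /\ ss_norm S' (F x) <= M * ss_norm S x.

(** The map induced between the Banach spaces; its value at x is meaningful when
    F x is in S'. *)
Definition lift F (x : ss_banach S) : ss_banach S' := insubd (0 : ss_sort S') (F (ssv x)).

Lemma liftE F x : ss_map F -> ssv (lift F x) = F (ssv x).
Proof.
move=> [_ [M _ h]]; rewrite /lift /ssv insubdK // ss_predE; apply/asboolP.
exact: (h _ (ssv_mem x)).1.
Qed.

Lemma lift_bop F : ss_map F -> bop (lift F).
Proof.
move=> hF; have [lF [M M0 hM]] := hF; split.
  by move=> c x y; apply: ssv_inj; rewrite ssvL !liftE // ssvL lF.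
exists M => // x; rewrite !bn_ssv liftE //; exact: (hM _ (ssv_mem x)).2.
Qed.

Lemma ss_map_ext F G : F =1 G -> ss_map F -> ss_map G.
Proof. by move=> /funext ->. Qed.

Lemma ss_norm_ge0 x : S x -> 0 <= ss_norm S x.
Proof. by move=> /ssv_onto[y <-]; rewrite -bn_ssv bn_ge0. Qed.

Lemma ss_map_lin c F G : ss_map F -> ss_map G -> ss_map (fun x => c *: F x + G x).
Proof.
move=> [lF [M M0 hM]] [lG [K K0 hK]]; split.
  move=> d x y; rewrite lF lG !scalerDr !scalerA [c * d]mulrC -!addrA; congr (_ + _).
  by rewrite addrCA.
exists (nm c * M + K) => [|x hx]; first by rewrite addr_ge0 ?mulr_ge0 ?nm_ge0.
have [h1 h2] := hM x hx; have [h3 h4] := hK x hx; split; first exact: ssL.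
have h5 : S' (c *: F x) by rewrite -[c *: _]addr0; apply: ssL => //; exact: ss0.
rewrite (le_trans (ss_normD h5 h3)) // mulrDl lerD // ss_normZ // -mulrA.
by rewrite ler_wpM2l ?nm_ge0.
Qed.

Lemma ss_map0 : ss_map (fun=> 0).
Proof.
split=> [c x y|]; first by rewrite scaler0 addr0.
exists 0 => // x hx; split; first exact: ss0.
have := @ss_normZ _ _ S' 0 0 (ss0 S'); rewrite scaler0 nm0 mul0r => ->.
by rewrite mul0r.
Qed.

Lemma ss_mapZ c F : ss_map F -> ss_map (fun x => c *: F x).
Proof.
move=> hF; apply: (ss_map_ext _ (ss_map_lin c hF ss_map0)) => x.
by rewrite addr0.
Qed.

Lemma lift_lin c F G x : ss_map F -> ss_map G ->
  lift (fun x => c *: F x + G x) x = c *: lift F x + lift G x.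
Proof.
move=> hF hG; apply: ssv_inj; rewrite ssvL !liftE //; exact: ss_map_lin.
Qed.

End Lift.
Arguments lift {R V V'} S S' F x.

Section LiftComp.
Context {R : realType} {V V' V'' : lmodType R[i]}.
Variables (S : seqspace V) (S' : seqspace V') (S'' : seqspace V'').

Lemma ss_map_id : ss_map S S (fun x => x).
Proof. by split=> //; exists 1 => // x hx; rewrite mul1r. Qed.

Lemma ss_map_comp (F : V -> V') (G : V' -> V'') : ss_map S' S'' G -> ss_map S S' F ->
  ss_map S S'' (fun x => G (F x)).
Proof.
move=> [lG [K K0 hK]] [lF [M M0 hM]]; split=> [c x y|]; first by rewrite lF lG.
exists (K * M) => [|x hx]; first exact: mulr_ge0.
have [h1 h2] := hM x hx; have [h3 h4] := hK _ h1; split=> //.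
by rewrite (le_trans h4) // -mulrA ler_wpM2l.
Qed.

Lemma lift_comp (F : V -> V') (G : V' -> V'') x : ss_map S' S'' G -> ss_map S S' F ->
  lift S S'' (fun x => G (F x)) x = lift S' S'' G (lift S S' F x).
Proof.
move=> hG hF; apply: ssv_inj; rewrite !liftE //; exact: ss_map_comp.
Qed.

End LiftComp.

(** ** The Hardy space as a Banach space of sequences *)

Section HardySpace.
Context {R : realType}.
Local Notation C := R[i].
Local Notation T := (circle R).
Local Notation P := (fps R).
Variable Y0 : banachIdealSpace R.
Local Notation Y := (bis_carrier Y0).
Hypotheses (LooY : @Lp R +oo%E `<=` Y) (YL1 : Y `<=` @Lp R 1%E).
Implicit Types (a b w : P) (r s B e : R) (z : T).
Local Notation N := (bis_norm Y0).

Definition hardyS : seqspace P := @Seqspace R P (hser Y0) (hser_norm Y0) (hser0 Y0)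
  (fun c a b ha hb => hserD (hserZ c ha) hb) (hser_normD YL1) (hser_normZ YL1)
  (hser_norm_eq0 YL1) (hser_complete YL1).
Local Notation H := hardyS.

Lemma hardy_mult w B : mult w B -> ss_map H H (fun a => w * a).
Proof.
move=> hw; split=> [c x y|]; first by rewrite mulrDr fpsZr.
by exists B => [|x hx]; [exact: mult_ge0 hw|exact: mult_hser].
Qed.

Lemma hardy_icoef : ss_map H H (@icoef R).
Proof.
split; first exact: icoef_lin.
have [K K0 hK] := hser_icoef YL1; exists (K * N (fun=> 1)) => [|a ha].
  by rewrite mulr_ge0 ?bis1_ge0.
have [h1 h2] := mult_in_hser LooY YL1 (hK a ha); split=> //.
by rewrite mulrAC.
Qed.

Lemma mult_monP k : hser Y0 (mon k).
Proof. exact: (mult_in_hser LooY YL1 (mult_mon k)).1. Qed.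

Lemma coef_bop k : bop (fun x : ss_banach H => (ssv x) k : scalars R).
Proof.
split=> [c x y|]; first by rewrite ssvL.
have [K K0 hK] := hser_coef YL1; exists K => // x; exact: hK (ssv_mem x).
Qed.

Let trunc n a : P := fun k => if (k < n)%N then a k else 0.

Let truncS n a : trunc n.+1 a = trunc n a + a n *: mon n.
Proof.
apply/funext => k; rewrite fpsD fpsZ /trunc /mon ltnS leq_eqVlt.
by case: eqP => [->|_] /=; rewrite ?ltnn ?mulr1 ?add0r // mulr0 addr0.
Qed.

Let trunc_frank (F : P -> P) n : ss_map H H F ->
  exists2 G, ss_map H H G & frank (lift H H G) /\ G = (fun a => trunc n (F a)).
Proof.
move=> hF; elim: n => [|n [G hG [fG eG]]].
  exists (fun=> 0); first exact: ss_map0.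
  split; last by [].
  apply: frank_ext (frank_zero _ _) => x; apply: ssv_inj.
  by rewrite liftE //; exact: ss_map0.
have [m hm] := ssv_onto (mult_monP n : H (mon n)).
have hG' : ss_map H H (fun a => F a n *: mon n).
  split=> [c x y|]; first by rewrite hF.1 fpsD fpsZ scalerDl scalerA.
  have [_ [M M0 hM]] := hF; have [K K0 hK] := hser_coef YL1; have h0 := mult_monP n.
  exists (K * M * hser_norm Y0 (mon n)) => [|a ha].
    by rewrite !mulr_ge0 // hser_norm_ge0.
  have [h1 h2] := hM a ha; split; first exact: hserZ.
  rewrite [ss_norm _ _](hser_normZ YL1) // mulrAC ler_wpM2r ?hser_norm_ge0 //.
  by rewrite (le_trans (hK _ n h1)) // -mulrA ler_wpM2l.
exists (fun a => 1 *: G a + F a n *: mon n); first exact: ss_map_lin.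
split; last by apply/funext => a; rewrite scale1r eG truncS.
apply: (@frank_ext _ _ _ (fun x => lift H H G x + (ssv (lift H H F x) n : scalars R) *: m)).
  move=> x; rewrite lift_lin // scale1r; congr (_ + _); apply: ssv_inj.
  by rewrite ssvZ !liftE // hm.
apply: frank_cons => //.
exact: (bop_comp (coef_bop n) (lift_bop hF)).
Qed.

Let amgm (x y q : R) : 0 < q -> x * y <= (q * x ^+ 2 + q^-1 * y ^+ 2) / 2.
Proof.
move=> q0; have q1 : q != 0 by rewrite gt_eqF.
rewrite ler_pdivlMr //; have : 0 <= q^-1 * (q * x - y) ^+ 2.
  by rewrite mulr_ge0 ?invr_ge0 ?sqr_ge0 // ltW.
have -> : q^-1 * (q * x - y) ^+ 2 = q * x ^+ 2 + q^-1 * y ^+ 2 - x * y * 2 by field.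
by rewrite subr_ge0.
Qed.

Let inv_sqr_sum n m : \sum_(k < m) ((n + k).+2%:R^-1) ^+ 2 <= n.+1%:R^-1 - (n + m).+1%:R^-1 :> R.
Proof.
elim: m => [|m IH]; first by rewrite big_ord0 addn0 subrr.
rewrite big_ord_recr /= addnS; apply: (le_trans (lerD IH (lexx _))).
have p1 : 0 < (n + m).+1%:R :> R by exact: ltr0Sn.
have e : (n + m).+2%:R = (n + m).+1%:R + 1 :> R by rewrite -[in LHS]addn1 natrD.
rewrite e; move: ((n + m).+1%:R) p1 => p p1; set q := n.+1%:R^-1.
have p2 : 0 < p + 1 by rewrite addr_gt0.
rewrite -addrA lerD2l addrC -subr_ge0.
have -> : - (p + 1)^-1 - ((p + 1)^-1 ^+ 2 - p^-1) = (p * (p + 1) ^+ 2)^-1.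
  by field; rewrite !gt_eqF.
by rewrite invr_ge0 mulr_ge0 ?sqr_ge0 // ltW.
Qed.

Let homog_eq (t q s p : R) : t != 0 -> q != 0 ->
  t * (q * s ^+ 2 + q^-1 * p) / 2 = (q / t * (s * t) ^+ 2 + (q / t)^-1 * p) / 2.
Proof. by move=> t0 q0; field; rewrite t0 q0. Qed.

(** Integrating twice, with a bounded multiplier in between, is a compact
    operation: the first integral is a bounded function, whose coefficients are
    square summable, so that the second series has a uniformly small tail. *)
Theorem icoef_mult_icoef_ap w B : mult w B ->
  ap (lift H H (fun a => icoef (w * icoef a))).
Proof.
move=> hw; have B0 := mult_ge0 hw.
have hF : ss_map H H (fun a => icoef (w * icoef a)).
  exact: (ss_map_comp hardy_icoef (ss_map_comp (hardy_mult hw) hardy_icoef)).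
split; first exact: lift_bop.
move=> e e0; have [K K0 hK] := hser_icoef YL1.
pose S := B * K; have S0 : 0 <= S by rewrite mulr_ge0.
have N10 := bis1_ge0 LooY; set N1 := N _ in N10.
pose q := e / (N1 + 1) / (S ^+ 2 + 1).
have q0 : 0 < q by rewrite !divr_gt0 ?ltr_wpDl ?sqr_ge0.
have [n hn] : exists n, q^-1 * n.+1%:R^-1 <= e / (N1 + 1).
  have h : 0 < e / (N1 + 1) by rewrite divr_gt0 // ltr_wpDl.
  exists (Num.bound (q^-1 / (e / (N1 + 1)))).
  have /archi_boundP : 0 <= q^-1 / (e / (N1 + 1)) by rewrite divr_ge0 ?invr_ge0 // ltW.
  rewrite ltr_pdivrMr // => /ltW/le_trans hh; rewrite ler_pdivrMr ?ltr0Sn // hh //.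
  by rewrite mulrC ler_wpM2l ?(ltW h) // ler_nat.
have [G hG [fG eG]] := trunc_frank n.+2 hF.
exists (lift H H G) => // x; set a := ssv x.
have ha : hser Y0 a := ssv_mem x.
have [g1 g2] : mult (icoef a) (K * hser_norm Y0 a) /\ 0 <= hser_norm Y0 a.
  by split; [exact: hK|exact: hser_norm_ge0].
have [t0|t0] := leP (hser_norm Y0 a) 0.
  have -> : x = 0.
    by apply: (@bn_eq0 _ (ss_banach H)); apply/eqP; rewrite eq_le t0 g2.
  by rewrite (bop_0 (lift_bop hF)) (bop_0 (lift_bop hG)) subrr !bn0 mulr0.
set t := hser_norm Y0 a in t0 g1 g2.
have hv : mult (w * icoef a) (S * t).
  have [g hg gB] := hw; have [g' hg' gB'] := g1.
  exists (fun z => g z * g' z); first exact: bval_mul hg gB hg'.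
  by move=> z; rewrite nmM /S -mulrA ler_pM ?nm_ge0.
set v := w * icoef a in hv; have hb := mult_bessel hv.
pose d : P := icoef v - trunc n.+2 (icoef v).
have vd : ssv (lift H H (fun a => icoef (w * icoef a)) x - lift H H G x) = d.
  by rewrite ssvB !liftE // eG.
have hd : hser Y0 d by rewrite -[hser Y0 d]/(hardyS d) -vd; exact: ssv_mem.
rewrite !bn_ssv vd -/a -[ss_norm H a]/t -[ss_norm H d]/(hser_norm Y0 d).
have dE k : d k = if (k < n.+2)%N then 0 else v k.-1 / k%:R.
  rewrite /d fpsD fpsN /trunc; case: k => [|k]; first by rewrite subrr.
  by case: ifP; rewrite ?subrr // subr0.
have part m : \sum_(k < m) nm (d k) <= t * (q * S ^+ 2 + q^-1 * n.+1%:R^-1) / 2.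
  have -> : t * (q * S ^+ 2 + q^-1 * n.+1%:R^-1) / 2 =
     (q / t * (S * t) ^+ 2 + (q / t)^-1 * n.+1%:R^-1) / 2.
    have t1 : t != 0 by rewrite gt_eqF.
    have q1 : q != 0 by rewrite gt_eqF.
    exact: homog_eq.
  apply: (@le_trans _ _ (\sum_(k < n.+2 + m) nm (d k))).
    by rewrite addnC big_split_ord /= lerDl; apply: sumr_ge0 => i _; exact: nm_ge0.
  rewrite big_split_ord /= big1 ?add0r => [|i _]; last by rewrite dE ltn_ord nm0.
  apply: (@le_trans _ _ (\sum_(k < m) (q / t * nm (v (n.+1 + k)%N) ^+ 2 +
      (q / t)^-1 * ((n + k).+2%:R^-1) ^+ 2) / 2)).
    apply: ler_sum => k _; rewrite dE ltnNge leq_addr /= nmM nmV nm_nat.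
    exact: amgm (divr_gt0 q0 t0).
  rewrite -mulr_suml ler_wpM2r ?invr_ge0 // big_split /= -!mulr_sumr.
  have qt : 0 < q / t by rewrite divr_gt0.
  apply: lerD; last first.
    rewrite ler_wpM2l ?invr_ge0 ?(ltW qt) // (le_trans (inv_sqr_sum n m)) //.
    by rewrite gerBl invr_ge0.
  rewrite ler_wpM2l ?(ltW qt) // (le_trans _ (hb (n.+1 + m)%N)) //.
  by rewrite big_split_ord /= lerDr; apply: sumr_ge0 => i _; exact: sqr_ge0.
have bd r z : 0 <= r < 1 -> nm (dil d r z) <= e / (N1 + 1) * t.
  move=> hr; have /andP[r0 r1] := hr; have hdd := hser_disc hd.
  apply: (tends_nm_le (disc_coefP hdd (_ : nm (r%:C * pt z) < 1))).
    by rewrite nm_rpt.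
  exists 0%N => m _; rewrite (le_trans (nm_sum _ _ _)) //.
  apply: (@le_trans _ _ (\sum_(k < m) nm (d k))).
    apply: ler_sum => k _; rewrite nmM nmX nm_rpt //.
    by rewrite ler_piMr ?nm_ge0 // exprn_ile1 // ltW.
  rewrite (le_trans (part m)) // -[t * _ / 2]mulrA [leRHS]mulrC ler_wpM2l ?(ltW t0) //.
  rewrite ler_pdivrMr // mulr_natr mulr2n lerD //.
  rewrite /q mulrAC -mulrA ler_piMr //; first by rewrite divr_ge0 ?(ltW e0) // ltW ?ltr_wpDl.
  by rewrite ler_pdivrMr ?ltr_wpDl ?sqr_ge0 // mul1r lerDl.
apply: (le_trans (hser_sup LooY YL1 hd bd)); rewrite -/N1 mulrAC ler_wpM2r ?(ltW t0) //.
rewrite mulrAC ler_pdivrMr ?ltr_wpDl // ler_wpM2l ?(ltW e0) //.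
by rewrite lerDl.
Qed.

End HardySpace.

(** ** Operators intertwined up to approximable operators *)

(** The extension lemmas under the weaker assumption that f i and i f' differ by an
    approximable operator. *)
Section Shift.
Context {R : realType} (E E' : banach R).
Variables (i : E' -> E) (q : E -> E') (f : E -> E) (f' : E' -> E').
Hypotheses (bi : bop i) (bq : bop q) (qi : forall x, q (i x) = x).
Hypothesis fiq : frank (fun x => x - i (q x)).
Hypotheses (bf : bop f) (bf' : bop f').
Hypothesis fi : ap (fun x => f (i x) - i (f' x)).

(** The operator that acts as f' on the range of i and as the identity on the
    kernel of q: it extends f' exactly, and differs from f by an approximable
    operator. *)
Let g x := i (f' (q x)) + (x - i (q x)).

Let bg : bop g.
Proof.
apply: bop_add; first exact: bop_comp bi (bop_comp bf' bq).
by apply: bop_sub; [exact: bop_id|exact: bop_comp].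
Qed.

Let gi x : g (i x) = i (f' x). Proof. by rewrite /g qi subrr addr0. Qed.

Let apg : ap (fun x => g x - f x).
Proof.
have h1 : ap (fun x => (x - i (q x)) - f (x - i (q x))).
  apply: apB; first exact: frank_ap.
  exact: ap_compl bf (frank_ap fiq).
have h2 := apN (ap_compr bq fi).
apply: (ap_ext _ (apD h2 h1)) => x; rewrite /g (bopB _ _ bf). vec_eq.
Qed.

Let apf : ap (fun x => f x - g x).
Proof. by apply: (ap_ext _ (apN apg)) => x; rewrite opprB. Qed.

Lemma LF_shift : LF f <-> LF f'.
Proof.
rewrite -(LF_extend bi bq qi fiq bg gi).
by split=> h; [exact: LF_ap h apg|exact: LF_ap h apf].
Qed.

Lemma FP_shift : FP f <-> FP f'.
Proof.
rewrite -(FP_extend bi bq qi fiq bg gi).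
by split=> h; [exact: FP_ap h apg|exact: FP_ap h apf].
Qed.

Lemma IF_shift : IF f' -> IF f.
Proof.
move=> h; apply: IF_ap apf; exact: (IF_extend bi bq qi fiq bg gi).
Qed.

(** g and f' have the same kernel and cokernel. *)
Lemma IF_unshift : thin f' -> IF f -> IF f'.
Proof.
move=> tf' hf; have [p [[e [e0 eS eI]] [d [dS dI]]]] := IF_dims (IF_ap hf apg).
have qg x : q (g x) = f' (q x).
  rewrite /g (bopD _ _ bq) (bopB _ _ bq) !qi subrr addr0 //.
have g0 x : g x = 0 -> x = i (q x) /\ f' (q x) = 0.
  move=> gx; have h : f' (q x) = 0 by rewrite -qg gx bop_0.
  by move: gx; rewrite /g h (bop_0 bi) add0r => /eqP; rewrite subr_eq0 => /eqP.
apply: (dims_IF bf' tf' (p := p)).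
  exists (fun k => q (e k)); split.
  - by move=> k; exact: (g0 _ (e0 k)).2.
  - move=> x hx; have [c hc] := eS (i x) (etrans (gi x) (etrans (congr1 i hx) (bop_0 bi))).
    exists c; rewrite -[x]qi hc (bop_sum _ _ _ bq); apply: eq_bigr => k _.
    by rewrite (bopZ _ _ bq).
  move=> c hc; apply: eI.
  rewrite (eq_bigr (fun k => i (c k *: q (e k)))) => [|k _].
    by rewrite -(bop_sum _ _ _ bi) hc bop_0.
  by rewrite (bopZ _ _ bi) -(g0 _ (e0 k)).1.
exists (fun k => q (d k)); split.
  move=> y; have [c [x hx]] := dS (i y); exists c, (q x).
  rewrite -qg -hx (bopB _ _ bq) qi (bop_sum _ _ _ bq); congr (_ - _).
  by apply: eq_bigr => k _; rewrite (bopZ _ _ bq).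
move=> c x hx; set y := \sum_(k < p) c k *: d k.
have hy : q y = f' x.
  by rewrite -hx /y (bop_sum _ _ _ bq); apply: eq_bigr => k _; rewrite (bopZ _ _ bq).
have qa : q (i x + (y - i (q y))) = x.
  by rewrite (bopD _ _ bq) (bopB _ _ bq) !qi subrr addr0.
by apply: (dI c (i x + (y - i (q y)))); rewrite -/y /g qa -hy; vec_eq.
Qed.

End Shift.

(** ** The Sobolev space as a Banach space of sequences *)

Section SobolevSpace.
Context {R : realType}.
Local Notation C := R[i].
Local Notation T := (circle R).
Local Notation P := (fps R).
Variable Y0 : banachIdealSpace R.
Local Notation Y := (bis_carrier Y0).
Hypotheses (LooY : @Lp R +oo%E `<=` Y) (YL1 : Y `<=` @Lp R 1%E).
Variable n : nat.
Implicit Types (a b w : P) (r s B e : R) (z : T).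
Local Notation N := (bis_norm Y0).
Local Notation H := (hardyS YL1).
Local Notation J := (@icoef R).
Local Notation D := (@dcoef R).

Lemma iter_dcoef_lin j c a b : iter j D (c *: a + b) = c *: iter j D a + iter j D b.
Proof. by elim: j => //= j ->; rewrite dcoef_lin. Qed.

Lemma iter_icoef_lin j c a b : iter j J (c *: a + b) = c *: iter j J a + iter j J b.
Proof. by elim: j => //= j ->; rewrite icoef_lin. Qed.

Lemma iter_dcoef j a k : iter j D a k = a (k + j)%N * ((k + j) ^_ j)%:R.
Proof.
elim: j k => [|j IH] k; first by rewrite addn0 ffactn0 mulr1.
rewrite iterS /dcoef IH addSnnS ffactnSr -mulrA -natrM; congr (_ * _%:R).
by rewrite -addSnnS addnK.
Qed.

Lemma iter_dcoef0 j a : iter j D a 0%N = a j * (j`!)%:R.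
Proof. by rewrite iter_dcoef add0n ffactnn. Qed.

Lemma iter_dcoefK j a : iter j D (iter j J a) = a.
Proof. by elim: j => // j IH; rewrite iterSr iterS dcoefK. Qed.

Lemma iter_icoef_lt j a k : (k < j)%N -> iter j J a k = 0.
Proof.
elim: j k => //= j IH [|k] kj //; rewrite icoefS IH ?mul0r //.
Qed.

Lemma iter_icoef_ge j a k : iter j J a (k + j)%N = a k / ((k + j) ^_ j)%:R.
Proof.
have h : ((k + j) ^_ j)%:R != 0 :> C by rewrite pnatr_eq0 -lt0n ffact_gt0 leq_addl.
by rewrite -{2}(iter_dcoefK j a) iter_dcoef mulfK.
Qed.

Definition polys a : P := \sum_(k < n) a k *: mon k.

Lemma polysE a k : polys a k = if (k < n)%N then a k else 0.
Proof.
have -> : polys a k = \sum_(i < n) a i * (k == i)%:R.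
  rewrite /polys; elim: n => [|m IH]; first by rewrite !big_ord0.
  by rewrite !big_ord_recr /= fpsD IH.
case: ifP => kn; last first.
  rewrite big1 // => i _; case: eqP => [e|_]; last by rewrite mulr0.
  by have := ltn_ord i; rewrite -e kn.
rewrite (bigD1 (Ordinal kn)) //= eqxx mulr1 big1 ?addr0 // => i ik.
by rewrite -val_eqE /= eq_sym in ik; rewrite (negPf ik) mulr0.
Qed.

(** Taylor's formula at 0 with integral remainder. *)
Lemma taylor_decomp a : a = polys a + iter n J (iter n D a).
Proof.
apply/funext => k; rewrite fpsD polysE; case: ltnP => kn.
  by rewrite iter_icoef_lt ?addr0.
rewrite add0r -(subnK kn) iter_icoef_ge iter_dcoef mulfK //.
by rewrite pnatr_eq0 -lt0n ffact_gt0 leq_addl.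
Qed.

Definition sob a := hser Y0 (iter n D a).

Definition sob_norm a := \sum_(j < n) nm (iter j D a 0%N) + hser_norm Y0 (iter n D a).

Lemma disc_sob a : sob a -> disc_coef a.
Proof.
move=> /hser_disc; elim: n a => // m IH a; rewrite iterSr => /IH h.
have := disc_coefD (disc_coefZ (a 0%N) (mult_disc (mult_mon 0))) (disc_icoef h).
congr disc_coef.
by apply/funext => -[|k]; rewrite fpsD fpsZ icoefK /mon ?mulr1 ?addr0 //= mulr0 add0r.
Qed.

Let sob0 : sob 0.
Proof.
rewrite /sob (_ : iter n D 0 = 0); first exact: hser0.
by elim: n => //= m ->; apply/funext => k; rewrite /dcoef mul0r.
Qed.

Let sobL c a b : sob a -> sob b -> sob (c *: a + b).
Proof. by move=> ha hb; rewrite /sob iter_dcoef_lin; exact: (ssL (s := H)). Qed.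

Let sob_normD a b : sob a -> sob b -> sob_norm (a + b) <= sob_norm a + sob_norm b.
Proof.
move=> ha hb; rewrite /sob_norm addrACA; have l j := iter_dcoef_lin j 1 a b.
rewrite scale1r in l.
apply: lerD; last by rewrite l scale1r (hser_normD YL1).
by rewrite -big_split /=; apply: ler_sum => j _; rewrite l scale1r fpsD nmD.
Qed.

Let iterZ j c a : iter j D (c *: a) = c *: iter j D a.
Proof.
have := iter_dcoef_lin j c a 0; rewrite addr0 => ->.
suff -> : iter j D 0 = 0 by rewrite addr0.
by elim: j => //= m ->; apply/funext => k; rewrite /dcoef mul0r.
Qed.

Let sob_normZ c a : sob a -> sob_norm (c *: a) = nm c * sob_norm a.
Proof.
move=> ha; rewrite /sob_norm mulrDr iterZ (hser_normZ YL1) //; congr (_ + _).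
by rewrite mulr_sumr; apply: eq_bigr => j _; rewrite iterZ fpsZ nmM.
Qed.

Let sob_norm_eq0 a : sob a -> sob_norm a = 0 -> a = 0.
Proof.
move=> ha /eqP; have s0 : 0 <= \sum_(j < n) nm (iter j D a 0%N).
  by apply: sumr_ge0 => j _; exact: nm_ge0.
rewrite paddr_eq0 // ?(hser_norm_ge0 YL1) // psumr_eq0 => [|j _]; last exact: nm_ge0.
move=> /andP[/allP h0 /eqP /(hser_norm_eq0 YL1 ha) h1].
rewrite [a]taylor_decomp h1; apply/funext => k; rewrite fpsD polysE; case: ltnP => kn.
  have := h0 (Ordinal kn) (mem_index_enum _); rewrite /= nm_eq0 iter_dcoef0 mulf_eq0.
  rewrite pnatr_eq0 (gtn_eqF (fact_gt0 k)) orbF => /eqP ->; rewrite add0r iter_icoef_lt //.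
by rewrite add0r -(subnK kn) iter_icoef_ge mul0r.
Qed.

Let nm_le_sob a j : sob a -> (j < n)%N -> nm (iter j D a 0%N) <= sob_norm a.
Proof.
move=> ha jn; rewrite /sob_norm (bigD1 (Ordinal jn)) //= -addrA lerDl.
by rewrite addr_ge0 ?(hser_norm_ge0 YL1) // sumr_ge0 // => i _; exact: nm_ge0.
Qed.

Let hs_le_sob a : sob a -> hser_norm Y0 (iter n D a) <= sob_norm a.
Proof. by move=> ha; rewrite lerDr sumr_ge0 // => i _; exact: nm_ge0. Qed.

Let iterB j a b : iter j D (a - b) = iter j D a - iter j D b.
Proof. by rewrite addrC -scaleN1r iter_dcoef_lin scaleN1r addrC. Qed.

Let sobB a b : sob a -> sob b -> sob (a - b).
Proof. by move=> ha hb; rewrite addrC -scaleN1r; apply: sobL. Qed.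

(** The n-th derivatives converge in the Hardy space and the derivatives at 0 in C;
    the limit has these derivatives. *)
Let sob_complete (u : nat -> P) : (forall k, sob (u k)) ->
  (forall e, 0 < e -> exists M : nat, forall k m, (M <= k)%N -> (M <= m)%N ->
    sob_norm (u k - u m) < e) ->
  exists2 l, sob l & forall e, 0 < e -> exists M : nat, forall k, (M <= k)%N ->
    sob_norm (u k - l) < e.
Proof.
move=> hu hc.
have [b hb lb] : exists2 b, hser Y0 b & forall e, 0 < e -> exists M : nat, forall k,
    (M <= k)%N -> hser_norm Y0 (iter n D (u k) - b) < e.
  apply: (hser_complete YL1) => // e e0; have [M hM] := hc e e0; exists M => k m kM mM.
  by rewrite -iterB (le_lt_trans (hs_le_sob (sobB (hu k) (hu m)))) // hM.
have [l hl] : exists l : nat -> C, forall j, (j < n)%N -> tends (fun k => iter j D (u k) 0%N) (l j).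
  have [j|l hl] := @boolp.choice _ _
      (fun j l => (j < n)%N -> tends (fun k => iter j D (u k) 0%N) l) _.
    have [jn|jn] := ltnP j n; last by exists 0.
    have [l hl] : exists l, tends (fun k => iter j D (u k) 0%N) l.
      apply: complex_complete => e e0; have [M hM] := hc e e0; exists M => k m kM mM.
      have := nm_le_sob (sobB (hu k) (hu m)) jn; rewrite iterB fpsD fpsN => h.
      by rewrite (le_lt_trans h) // hM.
    by exists l.
  by exists l.
pose p : P := \sum_(k < n) (l k / (k`!)%:R) *: mon k.
have pE k : p k = if (k < n)%N then l k / (k`!)%:R else 0.
  by rewrite -(polysE (fun k => l k / (k`!)%:R)).
pose L := p + iter n J b.
have DL : iter n D L = b.
  apply/funext => k; rewrite iter_dcoef /L fpsD pE ltnNge leq_addl /= add0r iter_icoef_ge.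
  by rewrite divfK // pnatr_eq0 -lt0n ffact_gt0 leq_addl.
have DL0 j : (j < n)%N -> iter j D L 0%N = l j.
  move=> jn; have f0 : (j`!)%:R != 0 :> C by rewrite pnatr_eq0 gtn_eqF ?fact_gt0.
  by rewrite iter_dcoef0 /L fpsD pE jn iter_icoef_lt // addr0 divfK.
exists L; first by rewrite /sob DL.
have fin m : (m <= n)%N -> forall e, 0 < e -> exists M : nat, forall k, (M <= k)%N ->
    \sum_(j < m) nm (iter j D (u k - L) 0%N) < e.
  elim: m => [|m IH] mn e e0; first by exists 0%N => k _; rewrite big_ord0.
  have e2 : 0 < e / 2 by rewrite divr_gt0.
  have [M1 h1] := IH (ltnW mn) _ e2; have [M2 h2] := hl m mn _ e2.
  exists (maxn M1 M2) => k; rewrite geq_max => /andP[/h1 k1 /h2 k2].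
  by rewrite big_ord_recr /= iterB fpsD fpsN DL0 // (splitr e) ltrD.
move=> e e0; have e2 : 0 < e / 2 by rewrite divr_gt0.
have [M1 h1] := fin n (leqnn n) _ e2; have [M2 h2] := lb _ e2.
exists (maxn M1 M2) => k; rewrite geq_max => /andP[/h1 k1 /h2 k2].
by rewrite /sob_norm (splitr e) ltrD // iterB DL.
Qed.

Definition sobolevS : seqspace P :=
  @Seqspace R P sob sob_norm sob0 sobL sob_normD sob_normZ sob_norm_eq0 sob_complete.
Local Notation W := sobolevS.

Lemma sob_dcoef : ss_map W H (iter n D).
Proof.
split; first exact: iter_dcoef_lin.
by exists 1 => // a ha; rewrite mul1r; split=> //; exact: hs_le_sob.
Qed.

Lemma sob_icoef : ss_map H W (iter n J).
Proof.
split; first exact: iter_icoef_lin.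
exists 1 => // a ha; rewrite mul1r; split.
  by change (sob (iter n J a)); rewrite /sob iter_dcoefK.
change (sob_norm (iter n J a) <= hser_norm Y0 a); rewrite /sob_norm iter_dcoefK big1 ?add0r // => j _.
by rewrite iter_dcoef0 iter_icoef_lt // mul0r nm0.
Qed.

Lemma sob_mon k : sob (mon k).
Proof.
rewrite /sob; have [kn|kn] := ltnP k n.
  rewrite (_ : iter n D (mon k) = 0); first exact: hser0.
  apply/funext => m; rewrite iter_dcoef /mon; case: eqP => [e|_]; last by rewrite mul0r.
  by move: kn; rewrite -e ltnNge leq_addl.
rewrite (_ : iter n D (mon k) = (k ^_ n)%:R *: mon (k - n)%N).
  by apply: hserZ; exact: mult_monP.
apply/funext => m; rewrite fpsZ iter_dcoef /mon.
have -> : (m == k - n)%N = (m + n == k)%N by rewrite -(eqn_add2r n) subnK.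
by case: eqP => [->|_]; rewrite ?mulr1 ?mul1r // mulr0 mul0r.
Qed.

Lemma sob_coef k : exists2 K, 0 <= K & forall a, sob a -> nm (a k) <= K * sob_norm a.
Proof.
have [K K0 hK] := hser_coef YL1.
have [kn|kn] := ltnP k n.
  exists (k`!%:R^-1) => [|a ha]; first by rewrite invr_ge0.
  rewrite mulrC ler_pdivlMr ?ltr0n ?fact_gt0 // -nm_nat -nmM -iter_dcoef0.
  exact: nm_le_sob.
exists (K / (k ^_ n)%:R) => [|a ha]; first by rewrite divr_ge0.
rewrite mulrAC ler_pdivlMr ?ltr0n ?ffact_gt0 // -nm_nat -nmM.
have := hK _ (k - n)%N ha; rewrite iter_dcoef subnK // => /le_trans; apply.
by rewrite ler_wpM2l // hs_le_sob.
Qed.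

End SobolevSpace.

(** ** The weighted rotation on power series *)

Section SeriesAlgebra.
Context {R : realType}.
Local Notation C := R[i].
Local Notation P := (fps R).
Local Notation J := (@icoef R).
Local Notation D := (@dcoef R).
Variable c : C.
Implicit Types (a b w : P) (u l : C).

(** The coefficients of w(z) x(c z). *)
Definition rotw w a : P := w * dilc c a.

Lemma dilc_lin u a b l : dilc l (u *: a + b) = u *: dilc l a + dilc l b.
Proof.
by apply/funext => k; rewrite fpsD fpsZ /dilc fpsD fpsZ mulrDr mulrCA.
Qed.

Lemma rotw_lin w u a b : rotw w (u *: a + b) = u *: rotw w a + rotw w b.
Proof. by rewrite /rotw dilc_lin mulrDr fpsZr. Qed.

Lemma rotwD w a b : rotw w (a + b) = rotw w a + rotw w b.
Proof. by have := rotw_lin w 1 a b; rewrite !scale1r. Qed.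

Lemma rotw_0 w : rotw w 0 = 0.
Proof. by apply: (addrI (rotw w 0)); rewrite -rotwD !addr0. Qed.

Lemma rotwZ w u a : rotw w (u *: a) = u *: rotw w a.
Proof. by have := rotw_lin w u a 0; rewrite rotw_0 !addr0. Qed.

Lemma rotwZl u w a : rotw (u *: w) a = u *: rotw w a.
Proof. by rewrite /rotw fpsZl. Qed.

Lemma dcoef_dilc u a : D (dilc u a) = u *: dilc u (D a).
Proof. by apply/funext => k; rewrite fpsZ /dilc /dcoef exprS !mulrA. Qed.

Lemma dilc_icoef u a : dilc u (J a) = u *: J (dilc u a).
Proof.
apply/funext => -[|k]; first by rewrite fpsZ /dilc !mulr0.
by rewrite fpsZ icoefS /dilc icoefS exprS !mulrA.
Qed.

Lemma dcoef_rotw w a : D (rotw w a) = rotw (D w) a + c *: rotw w (D a).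
Proof. by rewrite /rotw dcoefM dcoef_dilc fpsZr. Qed.

Lemma icoef_dcoef a : a 0%N = 0 -> J (D a) = a.
Proof. by move=> a0; apply/funext => k; rewrite icoefK; case: eqP => [->|]. Qed.

Lemma rotw_coef w a k : rotw w a k = \sum_(i < k.+1) w i * (c ^+ (k - i) * a (k - i)%N).
Proof. by rewrite /rotw fpsM. Qed.

Lemma rotw0 w a m : (forall k, (k < m)%N -> a k = 0) -> forall k, (k < m)%N -> rotw w a k = 0.
Proof.
move=> h k km; rewrite rotw_coef big1 // => i _.
by rewrite h ?mulr0 // (leq_ltn_trans (leq_subr _ _)).
Qed.

Lemma icoefZ u a : J (u *: a) = u *: J a.
Proof. by apply/funext => -[|k]; rewrite fpsZ ?mulr0 // !icoefS fpsZ mulrA. Qed.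

Lemma icoefD a b : J (a + b) = J a + J b.
Proof. by have := icoef_lin 1 a b; rewrite !scale1r. Qed.

(** Integration by parts. *)
Lemma icoef_rotw w a : c *: J (rotw w a) = rotw w (J a) - J (rotw (D w) (J a)).
Proof.
have h := dcoef_rotw w (J a); rewrite dcoefK in h.
have r0 : rotw w (J a) 0%N = 0 by apply: (@rotw0 w (J a) 1) => // -[].
rewrite -[X in X - _](icoef_dcoef r0) h.
by rewrite icoefD icoefZ addrC addKr.
Qed.

Lemma rotw_mon1 w a : rotw w (mon 1 * a) = c *: (mon 1 * rotw w a).
Proof.
rewrite /rotw dilcM; have -> : dilc c (mon 1) = c *: mon 1.
  apply/funext => k; rewrite fpsZ /dilc /mon; case: eqP => [->|_]; first by rewrite expr1.
  by rewrite !mulr0.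
by rewrite fpsZl fpsZr mulrCA.
Qed.

Lemma dcoef_mon1 a : D (mon 1 * a) = a + mon 1 * D a.
Proof.
rewrite dcoefM; have -> : D (mon 1) = 1; last by rewrite mul1r.
apply/funext => -[|k]; first by rewrite /dcoef /mon mul1r.
by rewrite /dcoef /mon /= mul0r.
Qed.

Lemma icoef_mon1 a : J (mon 1 * a) = mon 1 * J a - J (J a).
Proof.
have h0 : (mon 1 * J a - J (J a)) 0%N = 0 by rewrite fpsD fpsN monM subr0.
rewrite -[RHS](icoef_dcoef h0); congr icoef.
have := dcoef_lin (-1) (J (J a)) (mon 1 * J a); rewrite !scaleN1r addrC => ->.
by rewrite dcoef_mon1 !dcoefK addrA addNr add0r.
Qed.

(** The operator that the n-th derivative intertwines with the weighted rotation. *)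
Definition derw n w a := iter n D (rotw w (iter n J a)).

(** Leibniz' rule for D (w(z) x(c z)), applied to the innermost primitive. *)
Lemma derwS n w a : derw n.+1 w a = c *: derw n w a + derw n (D w) (J a).
Proof.
rewrite /derw iterSr [iter n.+1 J a]iterS dcoef_rotw dcoefK -iterS iterSr addrC.
exact: iter_dcoef_lin.
Qed.

(** The derivatives of order less than n at 0 of the left side vanish. *)
Lemma rotw_iter_icoef n w a : rotw w (iter n J a) = iter n J (derw n w a).
Proof.
rewrite [LHS](taylor_decomp n) -[RHS]add0r; congr (_ + _).
apply/funext => k; rewrite polysE; case: ifP => // kn.
by apply: (@rotw0 _ _ n) => // i; exact: iter_icoef_lt.
Qed.

Lemma iter_dcoef_mon1 n a : iter n D (mon 1 * a) = mon 1 * iter n D a + n%:R *: iter n.-1 D a.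
Proof.
elim: n => [|n IH]; first by rewrite scale0r addr0.
rewrite !iterS IH addrC dcoef_lin dcoef_mon1 addrA addrC; congr (_ + _).
case: n {IH} => [|n]; first by rewrite scale0r add0r scale1r.
by rewrite -!pred_Sn -iterS -[X in _ + X]scale1r -scalerDl natr1.
Qed.

End SeriesAlgebra.

(** ** Stability of the classes of operators *)

(** What the comparison of the two operators uses about a class of operators. *)
Record stable_class (R : realType) (Phi : forall E : banach R, (E -> E) -> Prop) : Prop := {
  sc_ap : forall (E : banach R) (f g : E -> E), Phi E f -> ap (fun x => g x - f x) -> Phi E g;
  sc_perturb : forall (E : banach R) (m j u v : E -> E), bop m -> bop j -> bop u -> bop v ->
    ap (fun x => j (u x) - v (j x)) -> ap (fun x => j (m (j x))) ->
    Phi E u -> Phi E v -> Phi E (fun x => u x + m (j x));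
  sc_shift : forall (E E' : banach R) (i : E' -> E) (q : E -> E') (f : E -> E) (f' : E' -> E'),
    bop i -> bop q -> (forall x, q (i x) = x) -> frank (fun x => x - i (q x)) ->
    bop f -> bop f' -> ap (fun x => f (i x) - i (f' x)) -> Phi E' f' -> Phi E f;
  sc_unshift : forall (E E' : banach R) (i : E' -> E) (q : E -> E') (f : E -> E) (f' : E' -> E'),
    bop i -> bop q -> (forall x, q (i x) = x) -> frank (fun x => x - i (q x)) ->
    bop f -> bop f' -> ap (fun x => f (i x) - i (f' x)) -> thin f' -> Phi E f -> Phi E' f' }.

Lemma LF_stable (R : realType) : stable_class (fun E : banach R => @LF R E E).
Proof.
split.
- by move=> E f g; exact: LF_ap.
- by move=> E m j u v bm bj bu bv h1 h2; exact: (LF_perturb bm bj h1 h2).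
- by move=> E E' i q f f' bi bq qi fiq bf bf' h; exact: (LF_shift bi bq qi fiq bf bf' h).2.
by move=> E E' i q f f' bi bq qi fiq bf bf' h _; exact: (LF_shift bi bq qi fiq bf bf' h).1.
Qed.

Lemma FP_stable (R : realType) : stable_class (fun E : banach R => @FP R E).
Proof.
split.
- by move=> E f g; exact: FP_ap.
- by move=> E m j u v bm bj bu bv h1 h2; exact: (FP_perturb bm bj bu bv h1 h2).
- by move=> E E' i q f f' bi bq qi fiq bf bf' h; exact: (FP_shift bi bq qi fiq bf bf' h).2.
by move=> E E' i q f f' bi bq qi fiq bf bf' h _; exact: (FP_shift bi bq qi fiq bf bf' h).1.
Qed.

Lemma IF_stable (R : realType) : stable_class (fun E : banach R => @IF R E).
Proof.
split.
- by move=> E f g; exact: IF_ap.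
- by move=> E m j u v bm bj bu bv h1 h2; exact: (IF_perturb bm bj h1 h2).
- by move=> E E' i q f f' bi bq qi fiq bf bf' h; exact: (IF_shift bi bq qi fiq bf bf' h).
by move=> E E' i q f f' bi bq qi fiq bf bf' h; exact: (IF_unshift bi bq qi fiq bf bf' h).
Qed.

Section Division.
Context {R : realType}.
Local Notation C := R[i].
Local Notation T := (circle R).
Local Notation P := (fps R).
Variable Y0 : banachIdealSpace R.
Local Notation Y := (bis_carrier Y0).
Hypotheses (LooY : @Lp R +oo%E `<=` Y) (YL1 : Y `<=` @Lp R 1%E).
Implicit Types (a b : P) (f g : T -> C).
Local Notation H := (hardyS YL1).

(** Division by z, after removal of the constant term; it is a left inverse of the
    multiplication by z, whose range has codimension one. *)
Definition shl a : P := fun k => a k.+1.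

Lemma shl_mon1 a : shl (mon 1 * a) = a.
Proof. by apply/funext => k; rewrite /shl monM /= subSS subn0. Qed.

Lemma mon1_shl a : mon 1 * shl a = a - a 0%N *: mon 0.
Proof.
apply/funext => -[|k]; rewrite monM fpsD fpsN fpsZ /mon /=.
  by rewrite mulr1 subrr.
by rewrite mulr0 subr0 /shl subSS subn0.
Qed.

(** On the circle 1 / z is the conjugate of z. *)
Lemma bval_shl b h : bval b h -> b 0%N = 0 -> bval (shl b) (fun z => (pt z)^*%C * h z).
Proof.
move=> [ch h0 hb] b0.
have mc : cmeas (fun x : T => (pt x)^*%C) by exact/cmeas_conj/cmeas_id.
have n1 (x : T) : nm ((pt x)^*%C) <= 1 by rewrite nm_conj nm_circle.
split.
- by apply: cint_ext (cintM ch mc n1) => z; rewrite mulrC.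
- case=> // m _; rewrite (@cI_ext _ _ (fun x => h x * pt x ^+ m)) => [|x]; last first.
    by rewrite exprS mulrACA [_^*%C * _]mulrC circle_conj mul1r.
  case: m => [|m]; last by rewrite h0.
  rewrite -[RHS]b0 -hb; apply: cI_ext => x; by rewrite !expr0.
apply/funext => k; rewrite /shl -hb; apply: cI_ext => x.
by rewrite exprS [RHS]mulrCA mulrA.
Qed.

Lemma hardy_shl : ss_map H H shl.
Proof.
split; first by move=> u a b; apply/funext => k; rewrite /shl !(fpsD, fpsZ).
have [K K0 hK] := hser_coef YL1; have h1 := mult_monP LooY YL1 0.
have n0 := hser_norm_ge0 YL1 h1.
exists (1 + K * hser_norm Y0 (mon 0)) => [|a ha]; first by rewrite addr_ge0 ?mulr_ge0.
pose b := a - a 0%N *: mon 0; have hb : hser Y0 b by apply: hserB ha (hserZ _ h1).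
have -> : shl a = shl b.
  by apply/funext => k; rewrite /shl /b fpsD fpsN fpsZ /mon /= mulr0 subr0.
have b0 : b 0%N = 0 by rewrite /b fpsD fpsN fpsZ /mon /= mulr1 subrr.
have [h Yh bh] := hb; have hs := bval_shl bh b0.
have [cs _ _] := hs.
have [Ys Ns] : Y (fun z => (pt z)^*%C * h z) /\ bis_norm Y0 (fun z => (pt z)^*%C * h z) <= bis_norm Y0 h.
  apply: bis_ideal_nm => //; first exact: cs.1.
  have FF := ae_filter_ringOfSetsType (@circle_measure R).
  by apply: nearW => z; rewrite nmM nm_conj nm_circle mul1r.
split; first by exists (fun z => (pt z)^*%C * h z).
change (hser_norm Y0 (shl b) <= (1 + K * hser_norm Y0 (mon 0)) * hser_norm Y0 a).
rewrite (hser_normE YL1 Ys hs) (le_trans Ns) // -(hser_normE YL1 Yh bh) /b.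
have -> : a - a 0%N *: mon 0 = a + (- a 0%N) *: mon 0 by rewrite scaleNr.
rewrite (le_trans (hser_normD YL1 ha (hserZ _ h1))) // mulrDl mul1r lerD2l.
by rewrite (hser_normZ YL1) // nmN mulrAC ler_wpM2r // hK.
Qed.

End Division.

(** ** The weighted rotation on the two spaces *)

Section WeightedRotation.
Context {R : realType}.
Local Notation C := R[i].
Local Notation T := (circle R).
Local Notation P := (fps R).
Local Notation J := (@icoef R).
Local Notation D := (@dcoef R).
Variable Y0 : banachIdealSpace R.
Local Notation Y := (bis_carrier Y0).
Hypotheses (LooY : @Lp R +oo%E `<=` Y) (YL1 : Y `<=` @Lp R 1%E).
Hypothesis Yrot : rotation_invariant Y0.
Variable alpha : T.
Implicit Types (a b w : P) (u l : C).
Local Notation c := (pt alpha).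
Local Notation rotw := (rotw c).
Local Notation derw := (derw c).
Local Notation H := (hardyS YL1).
Local Notation W n := (sobolevS YL1 n).

Let c0 : c != 0. Proof. by rewrite -nm_eq0 nm_circle oner_neq0. Qed.

(** w and its first n derivatives are bounded multipliers. *)
Definition multn n w := forall j, (j <= n)%N -> exists B, mult (iter j D w) B.

Lemma multnS n w : multn n.+1 w -> multn n w /\ multn n (D w).
Proof.
move=> h; split=> j jn; first by apply: h; exact: leqW.
by rewrite -iterSr; apply: h.
Qed.

Lemma multn0 n w : multn n w -> exists B, mult w B. Proof. by move=> /(_ 0%N); exact. Qed.

Lemma hardy_dilc : ss_map H H (dilc c).
Proof.
split; first by move=> *; exact: dilc_lin.
exists 1 => // a ha; have [h1 h2] := hser_rot YL1 alpha Yrot ha.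
by split=> //; rewrite mul1r -[leRHS]h2.
Qed.

Lemma hardy_rotw w B : mult w B -> ss_map H H (rotw w).
Proof. by move=> hw; exact: (ss_map_comp (hardy_mult YL1 hw) hardy_dilc). Qed.

Lemma hardy_derw n w : multn n w -> ss_map H H (derw n w).
Proof.
elim: n w => [|n IH] w hw; first by have [B hB] := multn0 hw; exact: hardy_rotw hB.
have [h1 h2] := multnS hw.
have := ss_map_lin c (IH _ h1) (ss_map_comp (IH _ h2) (hardy_icoef LooY YL1)).
by apply: ss_map_ext => a; rewrite derwS.
Qed.

(** Approximable operators on the Hardy space, as maps of sequences. *)
Definition hap (F : P -> P) := ss_map H H F /\ ap (lift H H F).

Lemma hap_ext F G : F =1 G -> hap F -> hap G. Proof. by move=> /funext ->. Qed.

Lemma hapL u F G : hap F -> hap G -> hap (fun a => u *: F a + G a).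
Proof.
move=> [hF aF] [hG aG]; split; first exact: ss_map_lin.
by apply: ap_ext (apD (apZ u aF) aG) => x; rewrite lift_lin.
Qed.

Lemma hapD F G : hap F -> hap G -> hap (fun a => F a + G a).
Proof. by move=> hF hG; apply: hap_ext (hapL 1 hF hG) => a; rewrite scale1r. Qed.

Lemma hap_compl L F : ss_map H H L -> hap F -> hap (fun a => L (F a)).
Proof.
move=> hL [hF aF]; split; first exact: (ss_map_comp hL hF).
by apply: ap_ext (ap_compl (lift_bop hL) aF) => x; rewrite (lift_comp _ hL hF).
Qed.

Lemma hap_compr F L : hap F -> ss_map H H L -> hap (fun a => F (L a)).
Proof.
move=> [hF aF] hL; split; first exact: (ss_map_comp hF hL).
by apply: ap_ext (ap_compr (lift_bop hL) aF) => x; rewrite (lift_comp _ hF hL).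
Qed.

Lemma hapZ u F : hap F -> hap (fun a => u *: F a).
Proof. by move=> hF; apply: hap_compl hF; apply: ss_mapZ; exact: ss_map_id. Qed.

Let hJ := hardy_icoef LooY YL1.

(** Rotations commute with integration up to a scalar, so this reduces to the
    multiplication by w. *)
Lemma hap_icoef_rotw_icoef w B : mult w B -> hap (fun a => J (rotw w (J a))).
Proof.
move=> hw; have h : hap (fun a => J (w * J a)).
  split; last exact: icoef_mult_icoef_ap hw.
  exact: (ss_map_comp hJ (ss_map_comp (hardy_mult YL1 hw) hJ)).
apply: hap_ext (hapZ c (hap_compr h hardy_dilc)) => a.
by rewrite /rotw dilc_icoef fpsZr icoefZ.
Qed.

Lemma hap_icoef2 : hap (fun a => J (J a)).
Proof.
have h : hap (fun a => J (mon 0 * J a)).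
  split; last exact: icoef_mult_icoef_ap (mult_mon 0).
  exact: (ss_map_comp hJ (ss_map_comp (hardy_mult YL1 (mult_mon 0)) hJ)).
by apply: hap_ext h => a; rewrite mon0 mul1r.
Qed.

(** Of the Leibniz formula for the n-th derivative only the two leading terms matter,
    the other ones containing two integrations side by side. *)
Lemma derw_approx n w : multn n.+1 w -> hap (fun a => derw n.+1 w a -
  (c ^+ n.+1 *: rotw w a + (n.+1%:R * c ^+ n) *: rotw (D w) (J a))).
Proof.
elim: n w => [|n IH] w hw.
  have h0 := hapZ 0 hap_icoef2; apply: hap_ext h0 => a.
  by rewrite scale0r /derw /= dcoef_rotw dcoefK expr1 expr0 mulr1 scale1r [X in X - _]addrC subrr.
have [h1 h2] := multnS hw; have [h3 h4] := multnS h2.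
have [B hB] := multn0 h4; have [B' hB'] : exists B, mult (D (D w)) B.
  exact: (hw 2 isT).
have h5 := hap_compr (IH _ h2) hJ.
have h6 := hap_compl (hardy_rotw hB') hap_icoef2.
apply: hap_ext (hapD (hapL c (IH _ h1) h5) (hapZ (n.+1%:R * c ^+ n) h6)) => a.
rewrite [derw n.+2 w a]derwS.
move: (derw _ _ _) (derw _ _ _) (rotw w a) (rotw (D w) (J a)) (rotw _ (J (J a))) => x y z t v.
rewrite (exprS c n.+1) (exprS c n); move: (c ^+ n) => p.
rewrite [n.+2%:R]mulrS; move: (n.+1%:R) => N.
lmod_with R[i] (fps R).
Qed.

Lemma hser_of_dcoef a : hser Y0 (D a) -> hser Y0 a.
Proof.
move=> ha; have -> : a = a 0%N *: mon 0 + J (D a).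
  by apply/funext => -[|k]; rewrite fpsD fpsZ icoefK /mon ?mulr1 ?addr0 //= mulr0 add0r.
have [_ [M _ hM]] := hJ; apply: hserD; last exact: (hM _ ha).1.
by apply: hserZ; exact: mult_monP.
Qed.

Lemma sob_mon1 n a : sob Y0 n a -> sob Y0 n (mon 1 * a).
Proof.
move=> ha; rewrite /sob iter_dcoef_mon1; apply: hserD.
  exact: (mult_hser YL1 (mult_mon 1) ha).1.
case: n ha => [|n] ha; first by rewrite scale0r; exact: hser0.
by apply: hserZ; apply: hser_of_dcoef; exact: ha.
Qed.

Lemma monS k : mon k.+1 = mon 1 * mon k :> P.
Proof.
by apply/funext => -[|j]; rewrite monM //= subSS subn0 /mon eqSS.
Qed.

Lemma sob_mult_mon n w k : multn n w -> sob Y0 n (w * mon k).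
Proof.
move=> hw; elim: k => [|k IH]; last by rewrite monS mulrCA; exact: sob_mon1.
rewrite mon0 mulr1 /sob; have [B hB] := hw n (leqnn n).
exact: (mult_in_hser LooY YL1 hB).1.
Qed.

Lemma rotw_mon w k : rotw w (mon k) = c ^+ k *: (w * mon k).
Proof.
rewrite /rotw; have -> : dilc c (mon k) = c ^+ k *: mon k; last by rewrite fpsZr.
by apply/funext => j; rewrite fpsZ /dilc /mon; case: eqP => [->|_]; rewrite ?mulr0.
Qed.

Lemma sob_tensor n k v : sob Y0 n v -> ss_map (W n) (W n) (fun a => a k *: v).
Proof.
move=> hv; split=> [u a b|]; first by rewrite fpsD fpsZ scalerDl scalerA.
have [K K0 hK] := sob_coef YL1 n k; have v0 : 0 <= ss_norm (W n) v by exact: ss_norm_ge0.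
exists (K * ss_norm (W n) v) => [|a ha]; first exact: mulr_ge0.
have hv' : W n v by [].
split; first by rewrite -[_ *: _]addr0; apply: ssL => //; exact: ss0.
by rewrite (ss_normZ _ hv') mulrAC ler_wpM2r // hK.
Qed.

(** On the span of 1, z, ..., z^(n-1) only the values at the basis matter, and on the
    functions that vanish at 0 with order n it is conjugate to
    [derw n w]. *)
Lemma sob_rotw n w : multn n w -> ss_map (W n) (W n) (rotw w).
Proof.
move=> hw.
have h1 : ss_map (W n) (W n) (fun a => rotw w (polys n a)).
  have e a : rotw w (polys n a) = \sum_(k < n) a k *: (c ^+ k *: (w * mon k)).
    rewrite /polys; elim: n {hw} => [|m IH].
      by rewrite !big_ord0 rotw_0.
    by rewrite !big_ord_recr /= -IH rotwD rotwZ rotw_mon.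
  apply: (@ss_map_ext _ _ _ (W n) (W n) (fun a => \sum_(k < n) a k *: (c ^+ k *: (w * mon k)))).
    by move=> a; rewrite e.
  suff h m : ss_map (W n) (W n) (fun a => \sum_(k < m) a k *: (c ^+ k *: (w * mon k))) by [].
  elim: m => [|m IH].
    by apply: ss_map_ext (ss_map0 _ _) => a; rewrite big_ord0.
  have t : ss_map (W n) (W n) (fun a => a m *: (c ^+ m *: (w * mon m))).
    apply: sob_tensor; have h : W n (w * mon m) by exact: sob_mult_mon.
    have := @ssL _ _ (W n) (c ^+ m) _ _ h (ss0 (W n)); rewrite addr0; exact.
  apply: ss_map_ext (ss_map_lin 1 IH t) => a.
  by rewrite big_ord_recr /= scale1r.
have h2 := ss_map_comp (sob_icoef YL1 n) (ss_map_comp (hardy_derw hw) (sob_dcoef YL1 n)).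
apply: ss_map_ext (ss_map_lin 1 h1 h2) => a.
rewrite scale1r -rotw_iter_icoef [in RHS](taylor_decomp n a).
by rewrite rotwD.
Qed.

Definition op l (F : P -> P) a : P := l *: a - F a.

Lemma op_map (S : seqspace P) l F : ss_map S S F -> ss_map S S (op l F).
Proof.
move=> hF; have := ss_map_lin (-1) hF (ss_mapZ l (ss_map_id S)).
by apply: ss_map_ext => a; rewrite scaleN1r addrC.
Qed.

(** ** Comparison of the two operators *)

Lemma sob_polys_frank n :
  frank (fun x : ss_banach (W n) => x - lift H (W n) (iter n J) (lift (W n) H (iter n D) x)).
Proof.
have bc k : bop (fun x : ss_banach (W n) => ssv x k : scalars R).
  split=> [u x y|]; first by rewrite ssvL.
  by have [K K0 hK] := sob_coef YL1 n k; exists K => // x; exact: hK (ssv_mem x).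
have [e he] : exists e : nat -> ss_banach (W n), forall k, ssv (e k) = mon k.
  have [k|e he] := @boolp.choice _ _ (fun k (x : ss_banach (W n)) => ssv x = mon k) _.
    by apply: ssv_onto; exact: sob_mon.
  by exists e.
have h m : frank (fun x : ss_banach (W n) => \sum_(k < m) (ssv x k : scalars R) *: e k).
  elim: m => [|m IH].
    by apply: frank_ext (frank_zero _ _) => x; rewrite big_ord0.
  apply: frank_ext (frank_cons (e m) IH (bc m)) => x.
  by rewrite big_ord_recr.
apply: frank_ext (h n) => x; apply: ssv_inj.
rewrite ssvB (liftE _ (sob_icoef YL1 n)) (liftE _ (sob_dcoef YL1 n)).
rewrite [X in _ = X - _](taylor_decomp n) addrK /polys.
have ssv_sum m (F : nat -> ss_banach (W n)) : ssv (\sum_(k < m) F k) = \sum_(k < m) ssv (F k).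
  by elim: m => [|m IH]; rewrite ?big_ord0 // !big_ord_recr /= ssvD IH.
by rewrite (ssv_sum n (fun k => ssv x k *: e k)); apply: eq_bigr => k _; rewrite ssvZ he.
Qed.

Section Comparison.
Variables (Phi : forall E : banach R, (E -> E) -> Prop) (n : nat) (w : P) (l : C).
Hypotheses (stab : stable_class Phi) (hw : multn n w).
Arguments Phi {E} _.


Let hi := sob_icoef YL1 n.
Let hq := sob_dcoef YL1 n.

Let qi (x : ss_banach H) : lift (W n) H (iter n D) (lift H (W n) (iter n J) x) = x.
Proof. by apply: ssv_inj; rewrite (liftE _ hq) (liftE _ hi) iter_dcoefK. Qed.

Let fi : ap (fun x : ss_banach H =>
  lift (W n) (W n) (op l (rotw w)) (lift H (W n) (iter n J) x) -
  lift H (W n) (iter n J) (lift H H (op l (derw n w)) x)).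
Proof.
apply: ap_ext (frank_ap (frank_zero _ _)) => x; apply: ssv_inj; rewrite ssvB.
rewrite (liftE _ (op_map l (sob_rotw hw))) !(liftE _ hi) (liftE _ (op_map l (hardy_derw hw))).
rewrite /op rotw_iter_icoef.
have := iter_icoef_lin n (-1) (derw n w (ssv x)) (l *: ssv x).
have := iter_icoef_lin n l (ssv x) 0.
have -> : iter n J 0 = 0 by elim: n => //= m ->; rewrite -(scale0r 0) icoefZ !scale0r.
rewrite !addr0 => -> ; rewrite !scaleN1r addrC => ->.
by rewrite [X in _ - X]addrC subrr.
Qed.

Let bW := lift_bop (op_map l (sob_rotw hw)).
Let bA := lift_bop (op_map l (hardy_derw hw)).

(** The Sobolev operator is an extension of its derivative by a finite
    dimensional block. *)
Lemma sobolev_derw :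
  thin (lift H H (op l (derw n w))) ->
  (Phi (lift (W n) (W n) (op l (rotw w))) <-> Phi (lift H H (op l (derw n w)))).
Proof.
move=> hthin; have fr := sob_polys_frank n.
split; last exact: (sc_shift stab (lift_bop hi) (lift_bop hq) qi fr bW bA fi).
exact: (sc_unshift stab (lift_bop hi) (lift_bop hq) qi fr bW bA fi).
Qed.

End Comparison.

Section Chain.
Variables (Phi : forall E : banach R, (E -> E) -> Prop) (w : P) (l : C) (B : R).
Hypotheses (stab : stable_class Phi) (hw : mult w B).
Arguments Phi {E} _.

Let PhiH (F : P -> P) := Phi (lift H H (op l F)).

Let hm1 := hardy_mult YL1 (mult_mon 1).
Let hs := hardy_shl LooY YL1.

Let qi (x : ss_banach H) : lift H H (@shl R) (lift H H (fun a => mon 1 * a) x) = x.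
Proof. by apply: ssv_inj; rewrite (liftE _ hs) (liftE _ hm1) shl_mon1. Qed.

Let fr : frank (fun x : ss_banach H => x - lift H H (fun a => mon 1 * a) (lift H H (@shl R) x)).
Proof.
have [e he] := ssv_onto (mult_monP LooY YL1 0 : H (mon 0)).
apply: frank_ext (frank_tensor e (coef_bop YL1 0)) => x; apply: ssv_inj.
by rewrite ssvB ssvZ (liftE _ hm1) (liftE _ hs) mon1_shl he opprB addrC subrK.
Qed.

Let shift_ap (F F' : P -> P) : ss_map H H F -> ss_map H H F' ->
  hap (fun a => F (mon 1 * a) - mon 1 * F' a) ->
  ap (fun x => lift H H (op l F) (lift H H (fun a => mon 1 * a) x) -
    lift H H (fun a => mon 1 * a) (lift H H (op l F') x)).
Proof.
move=> hF hF' [h1 h2]; apply: ap_ext (apN h2) => x; apply: ssv_inj.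
rewrite ssvB -scaleN1r ssvZ (liftE _ h1) (liftE _ (op_map l hF)) !(liftE _ hm1).
rewrite (liftE _ (op_map l hF')) /op mulrBr -fpsZr scaleN1r.
by rewrite opprB [RHS]addrC opprB addrA subrK addrC.
Qed.

Lemma shift_down (F F' : P -> P) : ss_map H H F -> ss_map H H F' ->
  hap (fun a => F (mon 1 * a) - mon 1 * F' a) -> PhiH F' -> PhiH F.
Proof.
move=> hF hF' h; exact: (sc_shift stab (lift_bop hm1) (lift_bop hs) qi fr
  (lift_bop (op_map l hF)) (lift_bop (op_map l hF')) (shift_ap hF hF' h)).
Qed.

Lemma shift_up (F F' : P -> P) : ss_map H H F -> ss_map H H F' ->
  hap (fun a => F (mon 1 * a) - mon 1 * F' a) -> thin (lift H H (op l F')) -> PhiH F -> PhiH F'.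
Proof.
move=> hF hF' h; exact: (sc_unshift stab (lift_bop hm1) (lift_bop hs) qi fr
  (lift_bop (op_map l hF)) (lift_bop (op_map l hF')) (shift_ap hF hF' h)).
Qed.

(** The perturbation principle for j = J, stated for maps of sequences. *)
Lemma perturb_hardy (F1 F0 M G : P -> P) : ss_map H H F1 -> ss_map H H F0 ->
  ss_map H H M -> ss_map H H G -> hap (fun a => J (F1 a) - F0 (J a)) ->
  hap (fun a => J (M (J a))) -> hap (fun a => G a - (F1 a + M (J a))) ->
  PhiH F1 -> PhiH F0 -> PhiH G.
Proof.
move=> h1 h0 hM hG [a1 b1] [a2 b2] [a3 b3] p1 p0.
have hN := ss_mapZ (-1) hM.
have := sc_perturb stab (lift_bop hN) (lift_bop hJ) (lift_bop (op_map l h1))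
  (lift_bop (op_map l h0)) _ _ p1 p0 => h.
apply: (sc_ap stab (h _ _)).
- apply: ap_ext (apN b1) => x; apply: ssv_inj.
  rewrite ssvB -scaleN1r ssvZ (liftE _ a1) (liftE _ hJ) (liftE _ (op_map l h0)).
  rewrite (liftE _ hJ) (liftE _ (op_map l h1)) /op.
  have -> : J (l *: ssv x - F1 (ssv x)) = l *: J (ssv x) - J (F1 (ssv x)).
    by rewrite -scaleN1r icoefD !icoefZ scaleN1r.
  move: (icoef (F1 (ssv x))) (F0 (icoef (ssv x))) (icoef (ssv x)) => p q r.
  lmod_with R[i] (fps R).
- apply: ap_ext (apN b2) => x; apply: ssv_inj.
  rewrite -scaleN1r ssvZ (liftE _ a2) (liftE _ hJ) (liftE _ hN) (liftE _ hJ).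
  by rewrite icoefZ.
apply: ap_ext (apN b3) => x; apply: ssv_inj.
rewrite ssvB ssvD -scaleN1r ssvZ (liftE _ a3) (liftE _ (op_map l hG)) (liftE _ (op_map l h1)).
rewrite (liftE _ hN) (liftE _ hJ) /op scaleN1r.
move: (G (ssv x)) (F1 (ssv x)) (M (icoef (ssv x))) (ssv x) => p q r t.
lmod_with R[i] (fps R).
Qed.

Let hR k : ss_map H H (fun a => c ^+ k *: rotw w a).
Proof. by apply: ss_mapZ; exact: hardy_rotw hw. Qed.

Let hap0 : hap (fun=> 0).
Proof. by apply: hap_ext (hapZ 0 hap_icoef2) => a; rewrite scale0r. Qed.

Let rot_step k : hap (fun a => c ^+ k *: rotw w (mon 1 * a) - mon 1 * (c ^+ k.+1 *: rotw w a)).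
Proof.
by apply: hap_ext hap0 => a; rewrite rotw_mon1 scalerA -exprSr fpsZr subrr.
Qed.

(** Multiplication by z intertwines w(z) x(c z) with its multiple by c. *)
Lemma rot_down k : PhiH (fun a => c ^+ k *: rotw w a) -> PhiH (rotw w).
Proof.
elim: k => [|k IH] h.
  by move: h; rewrite (_ : (fun a => _) = rotw w) //; apply/funext => a; rewrite expr0 scale1r.
apply: IH; exact: (shift_down (hR k) (hR k.+1) (rot_step k) h).
Qed.

Lemma rot_up k : (forall k, thin (lift H H (op l (fun a => c ^+ k *: rotw w a)))) ->
  PhiH (rotw w) -> PhiH (fun a => c ^+ k *: rotw w a).
Proof.
move=> th h; elim: k => [|k IH].
  by rewrite (_ : (fun a => _) = rotw w) //; apply/funext => a; rewrite expr0 scale1r.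
exact: (shift_up (hR k) (hR k.+1) (rot_step k) (th _) IH).
Qed.

Section Derived.
Variable n : nat.
Hypothesis hn : multn n.+1 w.
Let N : C := n.+1%:R.
Let q : C := c ^+ n.
Let A := derw n.+1 w.
Let hA : ss_map H H A := hardy_derw hn.
Let hDw : exists B, mult (D w) B := multn0 (multnS hn).2.
Let K a := A a - (c ^+ n.+1 *: rotw w a + (N * q) *: rotw (D w) (J a)).
Let hK : hap K := derw_approx hn.
Let AE a : A a = K a + (c ^+ n.+1 *: rotw w a + (N * q) *: rotw (D w) (J a)).
Proof. by rewrite /K subrK. Qed.

(** The perturbation principle for u = l - c^(n+1) t and v = l - c^n t, where t is the
    weighted rotation: integration by parts shows that J u and v J differ by
    a multiple of J t' J, with t' the rotation weighted by the derivative of w. *)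
Lemma derw_of_rotw : (forall k, thin (lift H H (op l (fun a => c ^+ k *: rotw w a)))) ->
  PhiH (rotw w) -> PhiH A.
Proof.
move=> th h; have [B' hB'] := hDw; have hjj := hap_icoef_rotw_icoef hB'.
have hM : ss_map H H (fun a => (N * q) *: rotw (D w) a) := ss_mapZ (N * q) (hardy_rotw hB').
have g1 : hap (fun a => J (c ^+ n.+1 *: rotw w a) - c ^+ n *: rotw w (J a)).
  apply: hap_ext (hapZ (- q) hjj) => a.
  rewrite icoefZ -/q exprS -/q [c * q]mulrC -scalerA icoef_rotw scalerBr addrAC subrr add0r.
  by rewrite scaleNr.
have g2 : hap (fun a => J ((N * q) *: rotw (D w) (J a))).
  by apply: hap_ext (hapZ (N * q) hjj) => a; rewrite icoefZ.
exact: (perturb_hardy (hR n.+1) (hR n) hM hA g1 g2 hK (rot_up n.+1 th h) (rot_up n th h)).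
Qed.

(** The roles are exchanged: now u = l - A and v = l - A / c, for A the derived operator.
    That v inherits the properties of u follows from A z = c z A, which holds up
    to approximable operators. *)
Lemma rotw_of_derw : PhiH A -> PhiH (rotw w).
Proof.
move=> h; have [B' hB'] := hDw; have hjj := hap_icoef_rotw_icoef hB'.
have hrjj := hap_compl (hardy_rotw hB') hap_icoef2.
apply: (@rot_down n.+1).
have cK := mulVf c0.
have hA' : ss_map H H (fun a => c^-1 *: A a) by exact: ss_mapZ.
have AJ a : c^-1 *: A (J a) = c^-1 *: K (J a) + q *: rotw w (J a) +
    (N * q * c^-1) *: rotw (D w) (J (J a)).
  by rewrite AE !scalerDr !scalerA exprS mulrA cK mul1r -/q addrA [c^-1 * _]mulrC.
have Am a : c^-1 *: A (mon 1 * a) = c^-1 *: K (mon 1 * a) + c ^+ n.+1 *: (mon 1 * rotw w a) +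
    (N * q) *: (mon 1 * rotw (D w) (J a)) - (N * q * c^-1) *: rotw (D w) (J (J a)).
  rewrite AE icoef_mon1 -scaleN1r rotwD rotwZ !rotw_mon1 !scalerDr !scalerA -!addrA.
  have e1 : c^-1 * (c ^+ n.+1 * c) = c ^+ n.+1 by rewrite [c ^+ n.+1 * c]mulrC mulrA cK mul1r.
  have e2 : c^-1 * (N * q * c) = N * q by rewrite [N * q * c]mulrC mulrA cK mul1r.
  have e3 : c^-1 * (N * q * -1) = - (N * q * c^-1) by rewrite mulrN1 mulrN mulrC.
  by rewrite e1 e2 e3 scaleNr.
have g0 : hap (fun a => c^-1 *: A (mon 1 * a) - mon 1 * A a).
  have t1 := hapZ c^-1 (hap_compr hK hm1); have t2 := hap_compl hm1 hK.
  apply: hap_ext (hapD (hapL (-1) t2 t1) (hapZ (- (N * q * c^-1)) hrjj)) => a.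
  rewrite Am AE; move: (K a) (K (mon 1 * a)) => x y; rewrite !mulrDr !fpsZr.
  move: (rotw _ _) (rotw _ _) (rotw _ _) => p1 p2 p3.
  move: (mon 1 * x) (mon 1 * p1) (mon 1 * p2) (mon 1 * p3) => z t1' t2' t3'.
  move: (c^-1 *: y) => y'; move: (c ^+ n.+1) (N * q) (N * q * c^-1) => s1 s2 s3.
  lmod_with R[i] (fps R).
have shA : PhiH (fun a => c^-1 *: A a) := shift_down hA' hA g0 h.
have hM : ss_map H H (fun a => (- (N * q)) *: rotw (D w) a) := ss_mapZ _ (hardy_rotw hB').
have g1 : hap (fun a => J (A a) - c^-1 *: A (J a)).
  have t1 := hap_compl hJ hK; have t2 := hapZ (- c^-1) (hap_compr hK hJ).
  have t3 := hapL (N * q - q) hjj (hapZ (- (N * q * c^-1)) hrjj).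
  apply: hap_ext (hapD (hapD t1 t2) t3) => a.
  rewrite AJ AE; move: (K a) (K (icoef a)) => k1 k2; rewrite !icoefD !icoefZ.
  have e : c ^+ n.+1 *: J (rotw w a) = q *: rotw w (J a) - q *: J (rotw (D w) (J a)).
    by rewrite exprS -/q [c * q]mulrC -scalerA icoef_rotw scalerBr.
  rewrite e; move: (icoef k1) (icoef (rotw (D w) (icoef a))) (rotw w (icoef a)) => x z t.
  move: (rotw (D w) (icoef (icoef a))) (N * q * c^-1) c^-1 (N * q) q => v s0 s1 s2 s3.
  lmod_with R[i] (fps R).
have g2 : hap (fun a => J ((- (N * q)) *: rotw (D w) (J a))).
  by apply: hap_ext (hapZ (- (N * q)) hjj) => a; rewrite icoefZ.
have g3 : hap (fun a => c ^+ n.+1 *: rotw w a - (A a + (- (N * q)) *: rotw (D w) (J a))).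
  apply: hap_ext (hapZ (-1) hK) => a; rewrite AE.
  move: (K a) (c ^+ n.+1 *: rotw w a) (rotw (D w) (icoef a)) => x y z; move: (N * q) => s0.
  lmod_with R[i] (fps R).
exact: (perturb_hardy hA hA' hM (hR n.+1) g1 g2 g3 h shA).
Qed.

End Derived.
End Chain.

End WeightedRotation.

(** ** Kernels, eigenvalues and the comparison of the two operators *)

Section Triangular.
Context {R : realType}.
Local Notation C := R[i].
Local Notation P := (fps R).
Variable c : C.
Hypothesis c_neq0 : c != 0.
Hypothesis c_free : forall k, (0 < k)%N -> c ^+ k != 1.
Implicit Types (a b w y : P) (u l : C).
Local Notation rotw := (rotw c).

Let cX_neq0 k : c ^+ k != 0. Proof. by rewrite expf_neq0. Qed.

Let cX_inj j k : c ^+ j = c ^+ k -> j = k.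
Proof.
wlog jk : j k / (j <= k)%N => [h e|e].
  by have [/h|/ltnW/h h'] := leqP j k; [exact|rewrite h'].
apply/eqP; rewrite eqn_leq jk /= -subn_eq0 eqn0Ngt; apply/negP => /c_free/eqP; apply.
by apply: (mulIf (cX_neq0 j)); rewrite -exprD subnK // mul1r.
Qed.

Let rotw_tri w y k : (forall j, (j < k)%N -> y j = 0) -> rotw w y k = w 0%N * c ^+ k * y k.
Proof.
move=> h; rewrite rotw_coef big_ord_recl /= subn0 mulrA big1 ?addr0 // => i _.
by rewrite /bump leq0n add1n h ?mulr0 // ltn_subrL /= (leq_trans _ (ltn_ord i)).
Qed.

(** The operator is triangular in the Taylor coefficients, with the pairwise
    distinct diagonal entries w(0) c^k; hence a kernel element is determined by
    a single coefficient. *)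
Lemma op_kernel_coef w l : w != 0 \/ l != 0 -> exists k0, forall y,
  op l (rotw w) y = 0 -> y k0 = 0 -> y = 0.
Proof.
have eqk u y k : op u (rotw w) y = 0 -> u * y k = rotw w y k.
  by move=> /(congr1 (fun f : P => f k)); rewrite /op fpsD fpsN fpsZ => /eqP; rewrite subr_eq0 => /eqP.
have ind y (Q : forall k, (forall j, (j < k)%N -> y j = 0) -> y k = 0) : y = 0.
  apply/funext => k; elim/ltn_ind: k => k IH; exact: Q.
have [w0|w0] := eqVneq (w 0%N) 0; last first.
  move=> _; have [[k0 hk]|hk] := pselect (exists k0, l = w 0%N * c ^+ k0); last first.
    exists 0%N => y hy _; apply: ind => k IH; have := eqk _ y k hy; rewrite rotw_tri // => /eqP.
    rewrite -subr_eq0 -mulrBl mulf_eq0 => /orP[|/eqP//].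
    by rewrite subr_eq0 => /eqP e; exfalso; apply: hk; exists k.
  exists k0 => y hy y0; apply: ind => k IH; have := eqk _ y k hy; rewrite rotw_tri // => /eqP.
  rewrite -subr_eq0 -mulrBl mulf_eq0 => /orP[|/eqP//].
  by rewrite subr_eq0 hk => /eqP/(mulfI w0)/cX_inj <-.
have [->|l0 _] := eqVneq l 0; last first.
  exists 0%N => y hy _; apply: ind => k IH; have := eqk _ y k hy; rewrite rotw_tri // w0 !mul0r.
  by move/eqP; rewrite mulf_eq0 (negPf l0) => /eqP.
case=> [wn0|//].
have [m wm hm] : exists2 m, w m != 0 & forall j, (j < m)%N -> w j = 0.
  have [k wk] : exists k, w k != 0.
    apply: contrapT => h; move/eqP: wn0; apply; apply/funext => k.
    by apply: contrapT => /eqP wk; apply: h; exists k.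
  have ex : exists k, w k != 0 by exists k.
  exists (ex_minn ex); first by case: ex_minnP.
  by move=> j; case: ex_minnP => m _ hm jm; apply/eqP; apply: contraTT jm => /hm; rewrite -leqNgt.
exists 0%N => y hy _; apply: ind => k IH; have := eqk _ y (m + k)%N hy.
have mk : (m < (m + k).+1)%N by rewrite ltnS leq_addr.
rewrite mul0r rotw_coef (bigD1 (Ordinal mk)) //= addKn big1 ?addr0 => [|i].
  move/esym/eqP; rewrite !mulf_eq0 (negPf wm) (negPf (cX_neq0 k)) /= => /eqP; exact.
rewrite -val_eqE /= neq_ltn => /orP[/hm ->|mi]; first by rewrite mul0r.
rewrite IH ?mulr0 // -(ltn_add2r i) subnK; last by rewrite -ltnS.
by rewrite [X in (_ < X)%N]addnC ltn_add2r.
Qed.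

Variable S : seqspace P.
Hypothesis S_coef : forall k, exists2 K : R, 0 <= K & forall a, S a -> nm (a k) <= K * ss_norm S a.
Hypothesis S_mon : forall k, S (mon k).

Let S_bop k : bop (fun x : ss_banach S => ssv x k : scalars R).
Proof.
split=> [u x y|]; first by rewrite ssvL.
by have [K K0 hK] := S_coef k; exists K => // x; exact: hK (ssv_mem x).
Qed.

Lemma rotw_thin w l : ss_map S S (rotw w) -> w != 0 \/ l != 0 -> thin (lift S S (op l (rotw w))).
Proof.
move=> hw /op_kernel_coef[k0 hk]; exists (fun x => ssv x k0 : scalars R); first exact: S_bop.
move=> x hx h0; apply: ssv_inj; apply: hk h0.
by rewrite -(liftE _ (op_map l hw)) hx.
Qed.

(** The spectrum is determined by the operators of the form invertible plus finite
    rank together with the eigenvalues w(0) c^k. *)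
Lemma rotw_isom w l : ss_map S S (rotw w) ->
  (isom (lift S S (op l (rotw w))) <->
   IF (lift S S (op l (rotw w))) /\ forall k, l != w 0%N * c ^+ k).
Proof.
move=> hw; set f := lift _ _ _; have hop := op_map l hw; have bf : bop f := lift_bop hop.
have tri y k : (forall j, (j < k)%N -> y j = 0) -> op l (rotw w) y k = (l - w 0%N * c ^+ k) * y k.
  by move=> h; rewrite /op fpsD fpsN fpsZ rotw_tri // mulrBl.
split=> [hf|[hf hl]].
  split; first exact: isom_IF.
  have [_ [g [_ gf fg]]] := hf.
  suff h k : (forall j, (j < k)%N -> l != w 0%N * c ^+ j) -> l != w 0%N * c ^+ k.
    by move=> k; elim/ltn_ind: k => k IH; exact: h.
  move=> hj; apply/negP => /eqP lk.
  have [m hm] := ssv_onto (S_mon k).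
  have e j : op l (rotw w) (ssv (g m)) j = mon k j by rewrite -(liftE _ hop) -/f fg hm.
  have z j : (j < k)%N -> ssv (g m) j = 0.
    elim/ltn_ind: j => j IH jk; have := e j; rewrite tri => [|i ij]; last by rewrite IH // (ltn_trans ij).
    rewrite /mon (ltn_eqF jk) => /eqP; rewrite mulf_eq0 subr_eq0 (negPf (hj j jk)) /= => /eqP.
    exact.
  have := e k; rewrite tri // lk subrr mul0r /mon eqxx => /eqP.
  by rewrite eq_sym oner_eq0.
have inj x : f x = 0 -> x = 0.
  move=> hx; apply: ssv_inj; apply/funext => k; elim/ltn_ind: k => k IH.
  have : op l (rotw w) (ssv x) k = 0 by rewrite -(liftE _ hop) -/f hx.
  rewrite tri // => /eqP; rewrite mulf_eq0 subr_eq0 (negPf (hl k)) /= => /eqP; exact.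
have [p [[e [e0 _ eI]] [d [dS _]]]] := IF_dims hf.
apply: bijective_isom => // y.
case: p e e0 eI d dS => [|p] e e0 eI d dS.
  by have [u [x]] := dS y; rewrite big_ord0 subr0 => ->; exists x.
have := eI (fun i => (i == ord0)%:R); rewrite big1 => [|i _]; last by rewrite (inj _ (e0 i)) scaler0.
by move=> /(_ erefl ord0) /eqP; rewrite eqxx oner_eq0.
Qed.

End Triangular.

Section Comparison.
Context {R : realType}.
Local Notation C := R[i].
Local Notation T := (circle R).
Local Notation P := (fps R).
Variable Y0 : banachIdealSpace R.
Local Notation Y := (bis_carrier Y0).
Hypotheses (LooY : @Lp R +oo%E `<=` Y) (YL1 : Y `<=` @Lp R 1%E).
Hypothesis Yrot : rotation_invariant Y0.
Variable alpha : T.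
Local Notation c := (pt alpha).
Hypothesis c_free : forall k, (0 < k)%N -> c ^+ k != 1.
Implicit Types (a b w : P) (u l : C).
Local Notation rotw := (rotw c).
Local Notation derw := (derw c).
Local Notation H := (hardyS YL1).
Local Notation W n := (sobolevS YL1 n).

Let c0 : c != 0. Proof. by rewrite -nm_eq0 nm_circle oner_neq0. Qed.

Lemma hardy_rotw_thin w l B : mult w B -> w != 0 \/ l != 0 -> thin (lift H H (op l (rotw w))).
Proof.
move=> hw h; apply: (rotw_thin c0 c_free) h; last exact: hardy_rotw hw.
move=> k; have [K K0 hK] := hser_coef YL1; exists K => // a ha; exact: hK.
Qed.

Lemma sobolev_rotw_thin n w l : multn n w -> w != 0 \/ l != 0 ->
  thin (lift (W n) (W n) (op l (rotw w))).
Proof.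
move=> hw h; apply: (rotw_thin c0 c_free) h; last exact: sob_rotw hw.
exact: (sob_coef YL1 n).
Qed.

(** Integrating n times maps the kernel into that of the weighted rotation. *)
Lemma derw_thin n w l : multn n w -> w != 0 \/ l != 0 -> thin (lift H H (op l (derw n w))).
Proof.
move=> hw h; have [k0 hk] := op_kernel_coef c0 c_free h.
have hJ : ss_map H H (iter n (@icoef R)).
  elim: n {hw} => [|n IH]; first exact: ss_map_id.
  exact: (ss_map_comp (hardy_icoef LooY YL1) IH).
exists (fun x => ssv (lift H H (iter n (@icoef R)) x) k0 : scalars R).
  exact: (bop_comp (coef_bop YL1 k0) (lift_bop hJ)).
move=> x hx; rewrite (liftE _ hJ) => h0; apply: ssv_inj.
have e : op l (derw n w) (ssv x) = 0.
  by rewrite -(liftE _ (op_map l (hardy_derw LooY YL1 Yrot alpha hw))) hx.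
rewrite -[LHS](iter_dcoefK n) (hk _ _ h0); last first.
  move: e; rewrite /op rotw_iter_icoef => /eqP; rewrite subr_eq0 => /eqP <-.
  have i0 : iter n (@icoef R) 0 = 0.
    by elim: n {hw hJ hx h0} => //= m ->; rewrite -(scale0r 0) icoefZ !scale0r.
  by have := iter_icoef_lin n l (ssv x) 0; rewrite i0 !addr0 => ->; rewrite subrr.
by elim: n {hw hJ hx h0 e} => //= m ->; apply/funext => k; rewrite /dcoef mul0r.
Qed.

(** From the Sobolev space to the derived operator by extension, and from there to
    the Hardy space by perturbation. *)
Theorem sobolev_hardy (Phi : forall E : banach R, (E -> E) -> Prop) n w l :
  stable_class Phi -> multn n w -> w != 0 \/ l != 0 ->
  (Phi _ (lift (W n) (W n) (op l (rotw w))) <-> Phi _ (lift H H (op l (rotw w)))).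
Proof.
move=> stab hw nt; have [B hB] := multn0 hw.
rewrite (sobolev_derw LooY Yrot stab hw (derw_thin hw nt)).
case: n hw => [|n] hw; first by [].
split; first exact: (rotw_of_derw LooY Yrot stab hB hw).
apply: (derw_of_rotw LooY Yrot stab hB hw) => k.
have -> : (fun a => c ^+ k *: rotw w a) = rotw (c ^+ k *: w).
  by apply/funext => a; rewrite rotwZl.
have [B' hB'] : exists B', mult (c ^+ k *: w) B'.
  have [B' hB'] := mult_lin (c ^+ k) hB (mult_mon 0).
  have [B2 hB2] := mult_lin (-1) (mult_mon 0) hB'; exists B2.
  by move: hB2; rewrite scaleN1r [_ + mon 0]addrC addKr.
apply: hardy_rotw_thin hB' _; case: nt => [wn|]; [left|by right].
by apply: contraNneq wn => e; rewrite -[w](scalerK (expf_neq0 k c0)) e scaler0.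
Qed.

Lemma sobolev_hardy_isom n w l : multn n w ->
  (isom (lift (W n) (W n) (op l (rotw w))) <-> isom (lift H H (op l (rotw w)))).
Proof.
move=> hw; have [B hB] := multn0 hw.
rewrite (rotw_isom (S := W n) (sob_mon LooY YL1 n) l (sob_rotw LooY YL1 Yrot alpha hw)).
rewrite (rotw_isom (S := H) (mult_monP LooY YL1) l (hardy_rotw YL1 Yrot alpha hB)).
split=> -[h hk]; split=> //.
  apply/(sobolev_hardy (@IF_stable R) hw) => //.
  have [w0|/eqP w0] := pselect (w = 0); last by left.
  by right; have := hk 0%N; rewrite w0 mul0r.
apply/(sobolev_hardy (@IF_stable R) hw) => //.
have [w0|/eqP w0] := pselect (w = 0); last by left.
by right; have := hk 0%N; rewrite w0 mul0r.
Qed.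

End Comparison.

(** ** Operators on a normed space of vectors of an ambient module *)

(** A normed space given by its carrier in an ambient module is compared with a
    Banach space through a linear isometry onto the carrier; for an operator with
    a thin kernel the notions defined on the carrier become the classes above. *)
Section Bridge.
Context {R : realType} {V : lmodType R[i]} {E : banach R}.
Variables (X : normedSubspace V) (iota : E -> V).
Hypothesis iota_lin : forall (a : R[i]) x y, iota (a *: x + y) = a *: iota x + iota y.
Hypothesis iota_inj : injective iota.
Hypothesis iota_onto : forall v, X v <-> exists x, iota x = v.
Hypothesis iota_norm : forall x, ns_norm X (iota x) = bn x.
Implicit Types (x y : E) (v : V).

Let iota0 : iota 0 = 0.
Proof. by have := iota_lin (-1) 0 0; rewrite !scaleN1r oppr0 addr0 addNr. Qed.

Let iotaD x y : iota (x + y) = iota x + iota y.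
Proof. by have := iota_lin 1 x y; rewrite !scale1r. Qed.

Let iotaZ (a : R[i]) x : iota (a *: x) = a *: iota x.
Proof. by have := iota_lin a x 0; rewrite iota0 !addr0. Qed.

Let iotaB x y : iota (x - y) = iota x - iota y.
Proof. by rewrite -scaleN1r iotaD iotaZ scaleN1r. Qed.

Let iota_sum n (F : 'I_n -> E) : iota (\sum_(i < n) F i) = \sum_(i < n) iota (F i).
Proof.
elim: n F => [|n IH] F; first by rewrite !big_ord0 iota0.
by rewrite !big_ord_recr /= iotaD IH.
Qed.

Let iota_mem x : X (iota x). Proof. by apply/iota_onto; exists x. Qed.

Let iota_comb n (c : 'I_n -> R[i]) (e : 'I_n -> E) :
  iota (\sum_(i < n) c i *: e i) = \sum_(i < n) c i *: iota (e i).
Proof. by rewrite iota_sum; apply: eq_bigr => i _; rewrite iotaZ. Qed.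

Let lift_family n (e : 'I_n -> V) : (forall i, X (e i)) ->
  exists e' : 'I_n -> E, forall i, iota (e' i) = e i.
Proof.
move=> h; have [i|e' he] := @boolp.choice _ _ (fun i x => iota x = e i) _.
  exact/iota_onto.
by exists e'.
Qed.

Section Map.
Variables (f : E -> E) (T : V -> V).
Hypotheses (bf : bop f) (Tf : forall x, T (iota x) = iota (f x)).

Lemma bridge_bounded : bounded_operator X T.
Proof.
have [lf [M _ hM]] := bf; split.
- by move=> v /iota_onto[x <-]; rewrite Tf.
- move=> a v v' /iota_onto[x <-] /iota_onto[y <-].
  by rewrite -iota_lin !Tf lf iota_lin.
by exists M => v /iota_onto[x <-]; rewrite Tf !iota_norm.
Qed.

Let rangeP x : range_of X T (iota x) <-> exists y, f y = x.
Proof.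
split=> [[v /iota_onto[y <-]]|[y <-]]; first by rewrite Tf => /iota_inj; exists y.
by exists (iota y) => //; exact: Tf.
Qed.

Lemma bridge_closed : norm_closed X (range_of X T) <-> closed_range f.
Proof.
split=> [h y hy|h v /iota_onto[y <-] hy].
  apply/rangeP; apply: h => // e e0; have [x hx] := hy e e0.
  exists (iota (f x)); first by apply/rangeP; exists x.
  by rewrite -iotaB iota_norm bnC.
apply/rangeP; apply: h => e e0; have [u [v' /iota_onto[x <-] <-] hx] := hy e e0.
by exists x; move: hx; rewrite Tf -iotaB iota_norm bnC.
Qed.

Let kerP x : kernel_of X T (iota x) <-> f x = 0.
Proof.
split=> [[_]|fx]; last by split; [exact: iota_mem|rewrite /= Tf fx iota0].
by rewrite Tf -iota0 => /iota_inj.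
Qed.

Lemma bridge_kernel p : has_dim (kernel_of X T) p <-> kernel_dim f p.
Proof.
split=> [[e [e0 eS eI]]|[e [e0 eS eI]]].
  have [e' he] := lift_family (fun i => (e0 i).1).
  have heq c : \sum_(i < p) c i *: e i = iota (\sum_(i < p) c i *: e' i).
    by rewrite iota_comb; apply: eq_bigr => i _; rewrite he.
  exists e'; split.
  - by move=> i; apply/kerP; rewrite he.
  - move=> x /kerP/eS[c hc]; exists c; apply: iota_inj; rewrite hc; exact: heq.
  by move=> c hc; apply: eI; rewrite heq hc iota0.
exists (fun i => iota (e i)); split.
- by move=> i; apply/kerP.
- move=> v hv; have [x hx] := (iota_onto v).1 hv.1; rewrite -hx in hv *.
  have [c ->] := eS x ((kerP x).1 hv); exists c; exact: iota_comb.
by move=> c; rewrite -iota_comb -iota0 => /iota_inj/eI.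
Qed.

Lemma bridge_codim q : has_codim X (range_of X T) q <-> range_codim f q.
Proof.
split=> [[e [e0 eS eI]]|[e [eS eI]]].
  have [e' he] := lift_family e0.
  have heq c : \sum_(i < q) c i *: e i = iota (\sum_(i < q) c i *: e' i).
    by rewrite iota_comb; apply: eq_bigr => i _; rewrite he.
  exists e'; split.
    move=> y; have [c] := eS _ (iota_mem y); rewrite heq -iotaB => /rangeP[x hx].
    by exists c, x.
  by move=> c x hx; apply: eI; rewrite heq hx; apply/rangeP; exists x.
exists (fun i => iota (e i)); split=> //.
- move=> v /iota_onto[y <-]; have [c [x hx]] := eS y; exists c.
  by rewrite -iota_comb -iotaB hx; apply/rangeP; exists x.
by move=> c; rewrite -iota_comb => /rangeP[x hx]; apply: (eI c x).
Qed.

Lemma bridge_isom : (exists2 S, bounded_operator X S &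
  forall v, X v -> S (T v) = v /\ T (S v) = v) <-> isom f.
Proof.
split=> [[S [S1 S2 [M S3]] hS]|[_ [g [bg gf fg]]]].
  have [x|g hg] := @boolp.choice _ _ (fun x y => iota y = S (iota x)) _.
    by apply/iota_onto; exact: S1.
  split=> //; exists g; split.
  - split.
      by move=> a x y; apply: iota_inj; rewrite hg !iota_lin !hg S2.
    exists `|M| => // x; rewrite -!iota_norm hg (le_trans (S3 _ (iota_mem x))) //.
    by rewrite ler_wpM2r ?ler_norm // iota_norm bn_ge0.
  - by move=> x; apply: iota_inj; rewrite hg -Tf (hS _ (iota_mem x)).1.
  by move=> x; apply: iota_inj; rewrite -Tf hg (hS _ (iota_mem x)).2.
have [r hr] : exists r : V -> E, forall x, r (iota x) = x.
  have [v|r hr] := @boolp.choice _ _ (fun v y => X v -> iota y = v) _.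
    have [hv|hv] := pselect (X v); last by exists 0.
    by have [x hx] := (iota_onto v).1 hv; exists x.
  by exists r => x; apply: iota_inj; exact: hr.
have [lg [M M0 hM]] := bg.
exists (fun v => iota (g (r v))).
  split.
  - by move=> v _; exact: iota_mem.
  - by move=> a v v' /iota_onto[x <-] /iota_onto[y <-]; rewrite -iota_lin !hr lg iota_lin.
  by exists M => v /iota_onto[x <-]; rewrite hr !iota_norm.
by move=> v /iota_onto[x <-]; rewrite Tf !hr gf Tf fg.
Qed.

Hypothesis tf : thin f.

Let fin_ker : fin_dim_kernel X T.
Proof. by have [p hp] := thin_kernel_dim bf tf; exists p; exact/bridge_kernel. Qed.

(** The kernel being finite dimensional, only the closed range matters. *)
Lemma bridge_semi_fredholm : semi_fredholm X T <-> LF f.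
Proof.
split=> [[/bridge_closed hc _]|hf]; first exact: closed_range_LF bf tf hc.
by split; [apply/bridge_closed; exact: LF_closed_range|left].
Qed.

Lemma bridge_Phi_plus : Phi_plus X T <-> LF f.
Proof.
split=> [[/bridge_semi_fredholm]//|hf].
by split=> //; exact/bridge_semi_fredholm.
Qed.

Lemma bridge_fredholm : fredholm X T <-> FP f.
Proof.
split=> [[[[/bridge_closed hc _] _] [_ [q /bridge_codim hq]]]|hf].
  exact: fredholm_FP bf tf hc hq.
have hL := FP_LF hf; split; first exact/bridge_Phi_plus.
split; first exact/bridge_semi_fredholm.
by have [q hq] := FP_codim bf hf; exists q; exact/bridge_codim.
Qed.

Lemma bridge_weyl : weyl X T <-> IF f.
Proof.
split=> [[_ [p [q [/bridge_kernel hp /bridge_codim hq e]]]]|hf].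
  have pq : p = q by apply/eqP; rewrite -eqz_nat -subr_eq0 -e.
  by move: hq; rewrite -pq; exact: dims_IF.
split; first by apply/bridge_fredholm; exact: IF_FP.
have [p [hp hq]] := IF_dims hf; exists p, p.
by split; [exact/bridge_kernel|exact/bridge_codim|rewrite subrr].
Qed.

End Map.

(** The kernel is the whole space and the range is zero, so that neither the kernel
    has finite dimension nor the range finite codimension. *)
Lemma bridge_zero T : (forall n, exists e : 'I_n -> E, forall c : 'I_n -> R[i],
    \sum_(i < n) c i *: e i = 0 -> forall i, c i = 0) ->
  (forall v, X v -> T v = 0) -> ~ semi_fredholm X T.
Proof.
move=> inf T0.
have span q (d : 'I_q -> E) : ~ forall y, exists c : 'I_q -> R[i], y = \sum_(i < q) c i *: d i.
  move=> h; have [e he] := inf q.+1.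
  have [j|A hA] := @boolp.choice _ _ (fun j c => e j = \sum_(i < q) c i *: d i) _.
    exact: h.
  pose B := \matrix_(j < q.+1, i < q) A j i.
  have : kermx B != 0.
    by rewrite kermx_eq0 /row_free neq_ltn (leq_ltn_trans (rank_leq_col B)).
  case/rowV0Pn => u /sub_kermxP uB; apply/negP; rewrite negbK; apply/eqP/rowP => j.
  rewrite mxE; apply: (he (fun j => u 0 j)).
  rewrite (eq_bigr (fun j => \sum_(i < q) (u 0 j * A j i) *: d i)) => [|k _]; last first.
    by rewrite hA scaler_sumr; apply: eq_bigr => i _; rewrite scalerA.
  rewrite exchange_big big1 //= => i _; rewrite -scaler_suml.
  have := congr1 (fun M : 'rV_q => M 0 i) uB; rewrite !mxE => hi.
  by rewrite (eq_bigr (fun k => u 0 k * B k i)) ?hi ?scale0r // => k _; rewrite mxE.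
have Tz x : T (iota x) = iota ((fun=> 0) x) by rewrite T0 ?iota0.
move=> [_ [[p /(bridge_kernel (f := fun=> 0) Tz)[e [_ eS _]]]|[q /(bridge_codim (f := fun=> 0) Tz)[d [dS _]]]]].
  by apply: (span p e) => y; exact: eS.
apply: (span q d) => y; have [c [_ /eqP]] := dS y.
by rewrite subr_eq0 => /eqP ->; exists c.
Qed.

End Bridge.

(** ** The two spaces of functions on the disc *)

Section DiscSpaces.
Context {R : realType}.
Local Notation C := R[i].
Local Notation T := (circle R).
Local Notation P := (fps R).
Implicit Types (a b w : P) (u l : C) (v : disc R -> C).

Lemma psum_lin u a b : disc_coef a -> disc_coef b ->
  psum (u *: a + b) = u *: psum a + psum b.
Proof.
move=> ha hb; apply/funext => z; have hz := nm_disc z.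
by rewrite /psum pevD ?pevZ //; exact: disc_coefZ.
Qed.

Lemma psum0 : psum 0 = 0 :> (disc R -> C).
Proof.
have := psum_lin (-1) (@disc_coef0 R) (@disc_coef0 R).
by rewrite scaler0 addr0 scaleN1r addNr.
Qed.

Lemma pev0 a : pev a 0 = a 0%N.
Proof.
apply: pev_eq => e e0; exists 1%N => -[//|n] _.
rewrite big_ord_recl expr0 mulr1 big1 ?addr0 ?subrr ?nm0 // => i _.
by rewrite lift0 expr0n mulr0.
Qed.

Lemma analytic_psum v : analytic v -> exists2 a, disc_coef a & v = psum a.
Proof. by move=> /analytic_pseries[a ha h]; exists a => //; apply/funext. Qed.

Lemma weighted_rotation_psum w a (alpha : T) : disc_coef w -> disc_coef a ->
  weighted_rotation (psum w) alpha (psum a) = psum (rotw (pt alpha) w a).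
Proof.
move=> hw ha; apply/funext => z; have hz := nm_disc z.
have hd : disc_coef (dilc (pt alpha) a) by apply: disc_dilc => //; rewrite nm_circle.
change (pev w (val z) * pev a (pt alpha * val z) = pev (w * dilc (pt alpha) a) (val z)).
by rewrite (pevM hw hd hz) pev_dilc.
Qed.

Section Sequences.
Variable S : seqspace P.
Hypothesis S_disc : forall a, S a -> disc_coef a.

Definition disc_sum (x : ss_banach S) : disc R -> C := psum (ssv x).

Lemma disc_sum_lin u x y : disc_sum (u *: x + y) = u *: disc_sum x + disc_sum y.
Proof. by rewrite /disc_sum ssvL psum_lin //; apply: S_disc; exact: ssv_mem. Qed.

Lemma disc_sum_inj : injective disc_sum.
Proof.
move=> x y h; apply: ssv_inj; apply: psum_inj h; apply: S_disc; exact: ssv_mem.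
Qed.

Lemma infinite_dim : (forall k, S (mon k)) -> forall n, exists e : 'I_n -> ss_banach S,
  forall c : 'I_n -> C, \sum_(i < n) c i *: e i = 0 -> forall i, c i = 0.
Proof.
move=> hmon n; have [i|e he] := @boolp.choice _ _ (fun (i : 'I_n) (x : ss_banach S) => ssv x = mon i) _.
  by apply: ssv_onto; exact: hmon.
exists e => c /(congr1 (fun x => ssv x)); rewrite (big_morph _ (@ssvD _ _ S) (@ssv0 _ _ S)) ssv0.
move=> hc i; have := congr1 (fun f : P => f i) hc.
have fps_sum (F : 'I_n -> P) k : (\sum_(j < n) F j) k = \sum_(j < n) F j k.
  by apply: (@big_rec2 _ _ (fun (f : P) (z : C) => f k = z)) => // j z f _ <-.
rewrite fps_sum (bigD1 i) //= ssvZ he fpsZ /mon eqxx mulr1 big1 ?addr0 // => j ji.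
by rewrite ssvZ he fpsZ /mon (inj_eq val_inj) eq_sym (negPf ji) mulr0.
Qed.

Variables (w : P) (alpha : T).
Hypotheses (hw : disc_coef w) (mw : ss_map S S (rotw (pt alpha) w)).
Local Notation Tw := (weighted_rotation (psum w) alpha).

Lemma disc_sum_rotw x : Tw (disc_sum x) = disc_sum (lift S S (rotw (pt alpha) w) x).
Proof.
rewrite /disc_sum (liftE _ mw) weighted_rotation_psum //.
by apply: S_disc; exact: ssv_mem.
Qed.

Lemma disc_sum_op l x : lambdaI_sub l Tw (disc_sum x) =
  disc_sum (lift S S (op l (rotw (pt alpha) w)) x).
Proof.
rewrite /lambdaI_sub disc_sum_rotw /disc_sum (liftE _ (op_map l mw)) (liftE _ mw) /op.
have [hx hy] : disc_coef (ssv x) /\ disc_coef (rotw (pt alpha) w (ssv x)).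
  by split; apply: S_disc; [exact: ssv_mem|rewrite -(liftE _ mw); exact: ssv_mem].
have -> : l *: ssv x - rotw (pt alpha) w (ssv x) = (-1) *: rotw (pt alpha) w (ssv x) + l *: ssv x.
  by rewrite scaleN1r addrC.
rewrite psum_lin //; last exact: disc_coefZ.
have -> : psum (l *: ssv x) = l *: psum (ssv x).
  by rewrite -[l *: ssv x]addr0 psum_lin ?psum0 ?addr0 //; exact: disc_coef0.
by rewrite scaleN1r addrC.
Qed.

End Sequences.

Variable Y0 : banachIdealSpace R.
Local Notation Y := (bis_carrier Y0).
Hypotheses (LooY : @Lp R +oo%E `<=` Y) (YL1 : Y `<=` @Lp R 1%E).
Local Notation H := (hardyS YL1).
Local Notation W n := (sobolevS YL1 n).

Lemma hardy_onto v : hardySpace Y0 v <-> exists x, @disc_sum H x = v.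
Proof.
split=> [hv|[x <-]]; last first.
  have hx : hser Y0 (ssv x) := ssv_mem x.
  by apply/(hardy_cap_psum YL1 (hser_disc hx)).
have [a ha e] := analytic_psum hv.1.1; rewrite e in hv *.
have /(hardy_cap_psum YL1 ha) h := hv.
by have [x <-] := @ssv_onto _ _ H a h; exists x.
Qed.

Lemma hardy_sum_norm x : ns_norm (hardySpace Y0) (@disc_sum H x) = bn x.
Proof. by rewrite bn_ssv; exact: (hardy_norm_psum YL1 (ssv_mem x)). Qed.

Lemma sobolev_onto n v : sobolevSpace n Y0 v <-> exists x, @disc_sum (W n) x = v.
Proof.
split=> [[va hv]|[x <-]].
  have [a ha e] := analytic_psum va; rewrite e in hv *.
  move: hv; rewrite (dderive_psum n ha) => /(hardy_cap_psum YL1 (disc_dcoefn n ha)) h.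
  by have [x <-] := @ssv_onto _ _ (W n) a h; exists x.
have hx : sob Y0 n (ssv x) := ssv_mem x; have dx := disc_sob hx.
split; first exact: psum_analytic.
rewrite [dderive _ _](dderive_psum n dx).
by apply/(hardy_cap_psum YL1 (disc_dcoefn n dx)).
Qed.

Lemma sobolev_sum_norm n x : ns_norm (sobolevSpace n Y0) (@disc_sum (W n) x) = bn x.
Proof.
have hx : sob Y0 n (ssv x) := ssv_mem x; have dx := disc_sob hx.
rewrite bn_ssv [LHS]/(sobolev_norm n Y0 (psum (ssv x))) [RHS]/(sob_norm Y0 n (ssv x)).
rewrite /sobolev_norm /sob_norm (dderive_psum n dx) (hardy_norm_psum YL1 hx); congr (_ + _).
by apply: eq_bigr => j _; rewrite (dderive_psum j dx) /psum pev0.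
Qed.

(** The n-th derivative of w is bounded, hence so are the derivatives of lower order. *)
Lemma multn_sobolev n v : sobolev n (@Lp R +oo%E) v ->
  exists2 w, v = psum w & disc_coef w /\ multn n w.
Proof.
move=> [va hv]; have [w hw e] := analytic_psum va; rewrite e in hv.
exists w => //; split=> //; move: hv; rewrite (dderive_psum n hw).
have mL : @Lp R +oo%E `<=` [set f | cmeas f] by move=> f [].
move=> /(hardy_capP (disc_dcoefn n hw) mL)[f fL fb].
have [B hB] := bval_mult fb fL.
elim: n {fb} B hB => [|n IH] B hB j jn.
  by move: jn; rewrite leqn0 => /eqP ->; exists B.
move: jn; rewrite leq_eqVlt => /orP[/eqP ->|]; first by exists B.
by rewrite ltnS; have [B' hB'] := mult_dcoef hB; apply: IH hB' j.
Qed.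

End DiscSpaces.

Section SpectralComparison.
Context {R : realType}.
Local Notation C := R[i].
Local Notation P := (fps R).
Variable Y0 : banachIdealSpace R.
Hypotheses (LooY : @Lp R +oo%E `<=` bis_carrier Y0) (YL1 : bis_carrier Y0 `<=` @Lp R 1%E).
Hypothesis Yrot : rotation_invariant Y0.
Variable alpha : circle R.
Hypothesis alpha_free : forall k, (0 < k)%N -> pt alpha ^+ k != 1.
Variables (n : nat) (w : P).
Hypotheses (dw : disc_coef w) (hw : multn n w).
Local Notation H := (hardyS YL1).
Local Notation W := (sobolevS YL1 n).
Local Notation T := (weighted_rotation (psum w) alpha).
Local Notation XW := (sobolevSpace n Y0).
Local Notation XH := (hardySpace Y0).

Let mw : exists B, mult w B := multn0 hw.
Let mapH : ss_map H H (rotw (pt alpha) w).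
Proof. by have [B hB] := mw; exact: hardy_rotw hB. Qed.
Let mapW : ss_map W W (rotw (pt alpha) w) := sob_rotw LooY YL1 Yrot alpha hw.

Let discH a : H a -> disc_coef a := fun h => hser_disc h.
Let discW a : W a -> disc_coef a := fun h => disc_sob h.

Let linH := disc_sum_lin discH. Let linW := disc_sum_lin discW.
Let injH := disc_sum_inj discH. Let injW := disc_sum_inj discW.
Let ontoH := hardy_onto YL1. Let ontoW := sobolev_onto YL1 n.
Let normH := @hardy_sum_norm _ _ YL1. Let normW := @sobolev_sum_norm _ _ YL1 n.

Lemma sobolev_bounded : bounded_operator XW T.
Proof. exact: (bridge_bounded linW ontoW normW (lift_bop mapW) (disc_sum_rotw discW dw mapW)). Qed.

Lemma hardy_bounded : bounded_operator XH T.
Proof. exact: (bridge_bounded linH ontoH normH (lift_bop mapH) (disc_sum_rotw discH dw mapH)). Qed.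

Lemma resolvent_eq l : resolvent_set XW T l <-> resolvent_set XH T l.
Proof.
have h1 := bridge_isom linW injW ontoW normW (lift_bop (op_map l mapW))
  (disc_sum_op discW dw mapW l).
have h2 := bridge_isom linH injH ontoH normH (lift_bop (op_map l mapH))
  (disc_sum_op discH dw mapH l).
rewrite /resolvent_set /= h1 h2; exact: sobolev_hardy_isom.
Qed.

(** When w = 0 and l = 0 both operators vanish, on spaces of infinite dimension. *)
Lemma classes_eq l : [/\
  semi_fredholm XW (lambdaI_sub l T) <-> semi_fredholm XH (lambdaI_sub l T),
  Phi_plus XW (lambdaI_sub l T) <-> Phi_plus XH (lambdaI_sub l T),
  fredholm XW (lambdaI_sub l T) <-> fredholm XH (lambdaI_sub l T) &
  weyl XW (lambdaI_sub l T) <-> weyl XH (lambdaI_sub l T)].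
Proof.
have oW := disc_sum_op discW dw mapW l; have oH := disc_sum_op discH dw mapH l.
have [nt|tr] := pselect (w != 0 \/ l != 0).
  have [B hB] := mw.
  have tW := sobolev_rotw_thin LooY YL1 Yrot alpha_free hw nt.
  have tH := hardy_rotw_thin YL1 Yrot alpha_free hB nt.
  have bW := lift_bop (op_map l mapW); have bH := lift_bop (op_map l mapH).
  have eL := sobolev_hardy LooY YL1 Yrot alpha_free (@LF_stable R) hw nt.
  have eF := sobolev_hardy LooY YL1 Yrot alpha_free (@FP_stable R) hw nt.
  have eI := sobolev_hardy LooY YL1 Yrot alpha_free (@IF_stable R) hw nt.
  split.
  - rewrite (bridge_semi_fredholm linW injW ontoW normW bW oW tW).
    by rewrite (bridge_semi_fredholm linH injH ontoH normH bH oH tH).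
  - rewrite (bridge_Phi_plus linW injW ontoW normW bW oW tW).
    by rewrite (bridge_Phi_plus linH injH ontoH normH bH oH tH).
  - rewrite (bridge_fredholm linW injW ontoW normW bW oW tW).
    by rewrite (bridge_fredholm linH injH ontoH normH bH oH tH).
  rewrite (bridge_weyl linW injW ontoW normW bW oW tW).
  by rewrite (bridge_weyl linH injH ontoH normH bH oH tH).
have [w0 l0] : w = 0 /\ l = 0.
  by split; apply/eqP; apply: contrapT => h; apply: tr; [left|right]; apply/negP.
have op0 a : op l (rotw (pt alpha) w) a = 0.
  by rewrite /op w0 l0 scale0r /rotw mul0r subr0.
have zW v : XW v -> lambdaI_sub l T v = 0.
  move=> /ontoW[x <-]; rewrite oW /disc_sum (liftE _ (op_map l mapW)) op0; exact: psum0.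
have zH v : XH v -> lambdaI_sub l T v = 0.
  move=> /ontoH[x <-]; rewrite oH /disc_sum (liftE _ (op_map l mapH)) op0; exact: psum0.
have nW := bridge_zero linW injW ontoW (infinite_dim (S := W) (sob_mon LooY YL1 n)) zW.
have nH := bridge_zero linH injH ontoH (infinite_dim (S := H) (mult_monP LooY YL1)) zH.
have nPW : ~ Phi_plus XW (lambdaI_sub l T) by case.
have nPH : ~ Phi_plus XH (lambdaI_sub l T) by case.
have nFW : ~ fredholm XW (lambdaI_sub l T) by case.
have nFH : ~ fredholm XH (lambdaI_sub l T) by case.
have nWW : ~ weyl XW (lambdaI_sub l T) by case.
have nWH : ~ weyl XH (lambdaI_sub l T) by case.
by split; split.
Qed.

End SpectralComparison.

Unset Implicit Arguments.

Theorem theorem7p25 (R : realType) (n : nat) (Y : banachIdealSpace R)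
  (LooY : @Lp R +oo%E `<=` bis_carrier Y)
  (YL1 : bis_carrier Y `<=` @Lp R 1%E)
  (Yrot : rotation_invariant Y)
  (alpha : circle R)
  (alpha_free : forall k : nat, (0 < k)%N -> ~~ k.-unity_root (val alpha))
  (w : disc R -> R[i]) (hw : sobolev n (@Lp R +oo%E) w) :
  let T := weighted_rotation w alpha in
  let W := sobolevSpace n Y in
  let H := hardySpace Y in
  [/\ bounded_operator W T, bounded_operator H T,
      spectrum W T = spectrum H T &
      [/\ sigma1 W T = sigma1 H T, sigma2 W T = sigma2 H T,
          sigma3 W T = sigma3 H T, sigma4 W T = sigma4 H T &
          sigma5 W T = sigma5 H T]].
Proof.
have [a -> [da ha]] := multn_sobolev hw; move=> T W H.
have free k : (0 < k)%N -> pt alpha ^+ k != 1.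
  by move=> k0; rewrite -unity_rootE; exact: alpha_free.
have eR : resolvent_set W T = resolvent_set H T.
  by apply/funext => l; apply/propext; exact: (resolvent_eq LooY YL1 Yrot free da ha).
have eS : spectrum W T = spectrum H T by rewrite /spectrum eR.
have cl l := classes_eq LooY YL1 Yrot free da ha l.
have neg (P Q : Prop) : (P <-> Q) -> (~ P) = (~ Q) by move=> /propext ->.
have e1 : sigma1 W T = sigma1 H T by apply/funext => l; apply: neg; case: (cl l).
split.
- exact: (sobolev_bounded LooY YL1 Yrot alpha da ha).
- exact: (hardy_bounded YL1 Yrot alpha da ha).
- exact: eS.
split.
- exact: e1.
- by apply/funext => l; apply: neg; case: (cl l).
- by apply/funext => l; apply: neg; case: (cl l).
- by apply/funext => l; apply: neg; case: (cl l).
by rewrite /sigma5 eS e1 eR.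
Qed.
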